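(* Let $M:(0,\infty)\to(e,\infty)$ be a continuously differentiable decreasing function with $\lim_{t\to0^+}t\log\log M(t)<\infty$ and $\int_0^\infty\log\log M(t)\,dt<\infty$. Let $\Omega$ be a collection of bounded holomorphic functions on the open strip $S_1^\circ=\{z\in\mathbb C:|\Im z|<\rho\}$ such that $\inf_{F\in\Omega}\delta^+_\infty(F)=\inf_{F\in\Omega}\delta^-_\infty(F)=0$. Suppose $H$ is an entire function such that, for some non-negative integer $N$, $$|H(z)|\le(1+|z|)^N M(d(z,\partial S_1)),\quad z\in\mathbb C\setminus S_1,$$ $$|F(z)H(z)|\le(1+|z|)^N M(d(z,\partial S_1)),\quad z\in S_1^\circ,\ \text{for all } F\in\Omega.$$ Then $H$ is a polynomial.
   Context: $\rho>0$ is a fixed real number, $S_1=\{z\in\mathbb C:|\Im z|\le\rho\}$, and $d(z,\partial S_1)$ is the Euclidean distance from $z$ to the boundary of $S_1$. For a function $F$ defined on $\mathbb R$, $\delta_\infty^+(F)=-\limsup_{t\to\infty}e^{-\frac{\pi}{2\rho}t}\log|F(t)|$ and $\delta_\infty^-(F)=-\limsup_{t\to\infty}e^{-\frac{\pi}{2\rho}t}\log|F(-t)|$. *)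

(* Defs.v *)
From Stdlib Require Import Reals.
From Coquelicot Require Import Coquelicot.
Open Scope R_scope.

Definition C_differentiable (f : C -> C) (z : C) : Prop :=
  @ex_derive C_AbsRing C_NormedModule f z.

Definition entire (f : C -> C) : Prop := forall z : C, C_differentiable f z.

Definition in_closed_strip (rho : R) (z : C) : Prop := Rabs (Im z) <= rho.
Definition in_open_strip (rho : R) (z : C) : Prop := Rabs (Im z) < rho.

(* Euclidean distance from z to the boundary {Im w = rho} ∪ {Im w = -rho} of S_1 *)
Definition dist_boundary (rho : R) (z : C) : R := Rabs (Rabs (Im z) - rho).

(* e^{-pi t/(2 rho)} log|F(s t)| as an extended real (log 0 = -oo) *)
Definition wlog (rho : R) (F : C -> C) (s : R) (t : R) : Rbar :=
  if Req_EM_T (Cmod (F (RtoC (s * t)))) 0 then m_infty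
  else Finite (exp (- (PI / (2 * rho)) * t) * ln (Cmod (F (RtoC (s * t))))).

Definition limsup_pinfty (g : R -> Rbar) : Rbar :=
  Rbar_glb (fun y => exists T : R, y = Rbar_lub (fun v => exists t, T <= t /\ v = g t)).

Definition delta_plus (rho : R) (F : C -> C) : Rbar :=
  Rbar_opp (limsup_pinfty (wlog rho F 1)).
Definition delta_minus (rho : R) (F : C -> C) : Rbar :=
  Rbar_opp (limsup_pinfty (wlog rho F (-1))).

Definition inf_over (Omega : (C -> C) -> Prop) (d : (C -> C) -> Rbar) : Rbar :=
  Rbar_glb (fun y => exists F, Omega F /\ y = d F).

Definition horner (l : list C) (z : C) : C :=
  List.fold_right (fun a acc => (a + z * acc)%C) (RtoC 0) l.

Definition is_polynomial (H : C -> C) : Prop :=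
  exists l : list C, forall z, H z = horner l z.

(* Main.v *)
Require Import Defs.
From Stdlib Require Import Reals Lra Lia ClassicalEpsilon List.
From Coquelicot Require Import Coquelicot.
Open Scope R_scope.

(** Let [u] be the average of [log+ |H|] over horizontal segments of half-width [rho / 16];
    it is continuous and subharmonic. Outside the strip [u] is at most a multiple of
    [log (2 + |x|) + log M(d)]. Inside the strip, subharmonicity of [log |F|] bounds the mean
    of [- log |F|] over a segment near a real point [t] by a multiple of
    [log (sup |F|) - log |F t|]; since the infimum of [delta] is zero, for every [eps] there
    are arbitrarily large [t] around which [u <= eps * exp (beta t) * log M(d)], where
    [beta = PI / (2 rho)]. A log-log theorem of Levinson type removes the factor [log M(d)],
    because [log log M] is integrable.

    Next, [u] is compared on the region [|y| <= rho + s x] with [exp (a x) * cos (b x * y)],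
    where [b] increases to [beta], [a' ~ b] and [s] is proportional to [beta - b]. The levels
    of [log log M] let [s] decrease integrably while [log M (s x) <= exp (kap (x + 1))] still
    holds, so that [a x >= beta x - O(1)] and the windows above suffice at the right end. Hence
    [u = O(exp (kap x))] for a small [kap], the usual Phragmén-Lindelöf argument improves this
    to [u = O(log x)], and the same holds on the left. So [H] has polynomial growth, and
    Cauchy's formula shows that it is a polynomial. *)

(** The product bound controls [log |H|] inside the strip only up to [- log |F|], and [F] may
    vanish; [- log |F|] is controlled only in mean over segments, which forces the averages [u]. The
    function [exp (beta x) cos (beta y)] vanishes exactly on the lines [|y| = rho], where the bounds
    on [u] blow up, so it cannot be compared with [u] on the strip itself. Widening the region costs
    a frequency below [beta]; the resulting loss of growth is the integral of [beta - b], which is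
    bounded by a multiple of the sum of the level widths of [log log M], and this sum is finite by
    integrability. Subharmonicity is not expressed by derivatives, since [log max (c, |f|)] is not
    smooth: it is a lower bound [- K h^3] on five-point stencils, which survives averaging and is
    negligible against a strictly negative Laplacian of a comparison function. *)

(** * Riemann integrals of real functions and continuity in the plane *)

Ltac eqR := match goal with |- @eq _ ?x ?y => change (@eq R x y) end.

Lemma ex_RInt_cont (f : R -> R) (a b : R) :
  a <= b -> (forall x, a <= x <= b -> continuous f x) -> ex_RInt f a b.
Proof.
  intros ab H. apply (@ex_RInt_continuous R_CompleteNormedModule). intros z Hz.
  apply H. rewrite Rmin_left, Rmax_right in Hz; lra.
Qed.

(** The [R] variants restate facts on module-valued integrals with the operations of [R], so that
    rewriting matches them syntactically; [eqR] likewise brings an equation to [R] for [ring]. *)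
Lemma ex_RInt_addR (f g : R -> R) a b :
  ex_RInt f a b -> ex_RInt g a b -> ex_RInt (fun x => f x + g x) a b.
Proof. exact (ex_RInt_plus (V := R_NormedModule) f g a b). Qed.

Lemma ex_RInt_subR (f g : R -> R) a b :
  ex_RInt f a b -> ex_RInt g a b -> ex_RInt (fun x => f x - g x) a b.
Proof. exact (ex_RInt_minus (V := R_NormedModule) f g a b). Qed.

Lemma ex_RInt_mulR (k : R) (f : R -> R) a b :
  ex_RInt f a b -> ex_RInt (fun x => k * f x) a b.
Proof. exact (ex_RInt_scal (V := R_NormedModule) f a b k). Qed.

Lemma RInt_addR (f g : R -> R) a b : ex_RInt f a b -> ex_RInt g a b ->
  RInt (fun x => f x + g x) a b = RInt f a b + RInt g a b.
Proof. exact (RInt_plus (V := R_CompleteNormedModule) f g a b). Qed.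

Lemma RInt_subR (f g : R -> R) a b : ex_RInt f a b -> ex_RInt g a b ->
  RInt (fun x => f x - g x) a b = RInt f a b - RInt g a b.
Proof. exact (RInt_minus (V := R_CompleteNormedModule) f g a b). Qed.

Lemma RInt_mulR (k : R) (f : R -> R) a b : ex_RInt f a b ->
  RInt (fun x => k * f x) a b = k * RInt f a b.
Proof. exact (RInt_scal (V := R_CompleteNormedModule) f a b k). Qed.

Lemma RInt_constR (c a b : R) : RInt (fun _ => c) a b = (b - a) * c.
Proof. exact (RInt_const (V := R_CompleteNormedModule) a b c). Qed.

Lemma RInt_ChaslesR (f : R -> R) a b c : ex_RInt f a b -> ex_RInt f b c ->
  RInt f a b + RInt f b c = RInt f a c.
Proof. exact (RInt_Chasles (V := R_CompleteNormedModule) f a b c). Qed.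

Lemma continuity_2d_pt_l (f : R -> R -> R) (x y : R) :
  continuity_2d_pt f x y -> continuous (fun u => f u y) x.
Proof.
  intros H. apply continuity_pt_filterlim. intros eps Heps.
  destruct (H (mkposreal eps Heps)) as [d Hd].
  exists d; split; [apply cond_pos|]. intros u [_ Hu]. simpl in *. unfold Rdist in *.
  apply Hd; [exact Hu|]. rewrite Rminus_diag, Rabs_R0. apply cond_pos.
Qed.

Lemma continuity_2d_pt_r (f : R -> R -> R) (x y : R) :
  continuity_2d_pt f x y -> continuous (fun v => f x v) y.
Proof.
  intros H. apply continuity_pt_filterlim. intros eps Heps.
  destruct (H (mkposreal eps Heps)) as [d Hd].
  exists d; split; [apply cond_pos|]. intros u [_ Hu]. simpl in *. unfold Rdist in *.
  apply Hd; [|exact Hu]. rewrite Rminus_diag, Rabs_R0. apply cond_pos.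
Qed.

Lemma differentiable_pt_lim_continuity (f : R -> R -> R) (x y l1 l2 : R) :
  differentiable_pt_lim f x y l1 l2 -> continuity_2d_pt f x y.
Proof.
  intros H. apply differentiable_continuity_pt. exists l1, l2. exact H.
Qed.

(** * Goursat's theorem for closed forms [P dx + Q dy] on rectangles *)

Definition circ (P Q : R -> R -> R) (a b c d : R) : R :=
  RInt (fun x => P x c) a b + RInt (fun y => Q b y) c d
  - RInt (fun x => P x d) a b - RInt (fun y => Q a y) c d.

(** The shared [l2] is the closedness condition. Only differentiability at each point is asked,
    which is all that complex differentiability provides at this stage. *)
Definition closed_form (P Q : R -> R -> R) (a b c d : R) : Prop :=
  forall x y, a <= x <= b -> c <= y <= d ->
  exists l1 l2 l3, differentiable_pt_lim P x y l1 l2 /\ differentiable_pt_lim Q x y l2 l3.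

Lemma closed_form_sub P Q a b c d a' b' c' d' :
  closed_form P Q a b c d -> a <= a' -> b' <= b -> c <= c' -> d' <= d ->
  closed_form P Q a' b' c' d'.
Proof. intros H ? ? ? ? x y Hx Hy. apply H; lra. Qed.

Lemma closed_form_ex P Q a b c d : closed_form P Q a b c d -> 
  forall a' b' c' d', a <= a' <= b' -> b' <= b -> c <= c' <= d' -> d' <= d ->
  (forall y, c <= y <= d -> ex_RInt (fun x => P x y) a' b') /\
  (forall x, a <= x <= b -> ex_RInt (fun y => Q x y) c' d').
Proof.
  intros H a' b' c' d' Ha Hb Hc Hd. split; intros z Hz; apply ex_RInt_cont; try lra;
    intros t Ht.
  - destruct (H t z) as (l1 & l2 & l3 & HP & HQ); try lra.
    apply (continuity_2d_pt_l P). eapply differentiable_pt_lim_continuity, HP.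
  - destruct (H z t) as (l1 & l2 & l3 & HP & HQ); try lra.
    apply (continuity_2d_pt_r Q). eapply differentiable_pt_lim_continuity, HQ.
Qed.

Lemma circ_split P Q a m b c n d :
  closed_form P Q a b c d -> a <= m <= b -> c <= n <= d ->
  circ P Q a b c d =
  circ P Q a m c n + circ P Q m b c n + circ P Q a m n d + circ P Q m b n d.
Proof.
  intros H Hm Hn. unfold circ.
  assert (HP : forall y, c <= y <= d ->
    RInt (fun x => P x y) a b = RInt (fun x => P x y) a m + RInt (fun x => P x y) m b).
  { intros y Hy. symmetry. apply RInt_ChaslesR.
    - apply (closed_form_ex _ _ _ _ _ _ H a m c n); lra.
    - apply (closed_form_ex _ _ _ _ _ _ H m b c n); lra. }
  assert (HQ : forall x, a <= x <= b ->
    RInt (fun y => Q x y) c d = RInt (fun y => Q x y) c n + RInt (fun y => Q x y) n d).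
  { intros x Hx. symmetry. apply RInt_ChaslesR.
    - apply (closed_form_ex _ _ _ _ _ _ H a m c n); lra.
    - apply (closed_form_ex _ _ _ _ _ _ H a m n d); lra. }
  rewrite (HP c), (HP d), (HQ a), (HQ b) by lra. ring.
Qed.

(** The affine part of [P dx + Q dy] at [(x0, y0)] has no circulation: its contributions
    [l2 * h * w] from the two pairs of opposite sides cancel. The remainder is small of first order
    along a boundary of length [2 (w + h)]. *)
Lemma circ_local P Q a b c d x0 y0 :
  closed_form P Q a b c d -> a <= x0 <= b -> c <= y0 <= d ->
  forall eps, 0 < eps -> exists delta, 0 < delta /\
  forall a' c' w h, a <= a' <= x0 -> x0 <= a' + w <= b -> c <= c' <= y0 -> y0 <= c' + h <= d ->
  w < delta -> h < delta ->
  Rabs (circ P Q a' (a' + w) c' (c' + h)) <= eps * (w + h) * (w + h).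
Proof.
  intros H Hx Hy eps He.
  destruct (H x0 y0 Hx Hy) as (l1 & l2 & l3 & HP & HQ).
  assert (He4 : 0 < eps / 4) by lra.
  destruct (HP (mkposreal _ He4)) as [d1 Hd1].
  destruct (HQ (mkposreal _ He4)) as [d2 Hd2]. simpl in *.
  exists (Rmin d1 d2). split. { apply Rmin_case; apply cond_pos. }
  intros a' c' w h Ha' Hw Hc' Hh Hwd Hhd.
  pose proof (Rmin_l d1 d2). pose proof (Rmin_r d1 d2).
  destruct (closed_form_ex _ _ _ _ _ _ H a' (a'+w) c' (c'+h)) as [E1 E2]; try lra.
  assert (mx : forall u v, a' <= u <= a'+w -> c' <= v <= c'+h ->
            Rmax (Rabs (u - x0)) (Rabs (v - y0)) <= w + h).
  { intros u v Hu Hv. apply Rmax_lub; apply Rabs_le; lra. }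
  assert (A1 : Rabs (RInt (fun x => P x c' - P x (c'+h) + l2 * h) a' (a'+w)) <= (a'+w-a') * (eps / 2 * (w+h))).
  { apply abs_RInt_le_const; try lra.
    - apply ex_RInt_addR; [apply ex_RInt_subR; apply E1; lra| apply ex_RInt_const].
    - intros t Ht.
      pose proof (Hd1 t c') as B1. pose proof (Hd1 t (c'+h)) as B2.
      assert (C1 : Rabs (t - x0) < d1) by (apply Rabs_lt_between; lra).
      assert (C2 : Rabs (c' - y0) < d1) by (apply Rabs_lt_between; lra).
      assert (C3 : Rabs (c'+h - y0) < d1) by (apply Rabs_lt_between; lra).
      specialize (B1 C1 C2). specialize (B2 C1 C3).
      pose proof (mx t c' ltac:(lra) ltac:(lra)) as M1. pose proof (mx t (c'+h) ltac:(lra) ltac:(lra)) as M2.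
      apply Rabs_le_between in B1, B2. apply Rabs_le. nra. }
  assert (A2 : Rabs (RInt (fun y => Q (a'+w) y - Q a' y - l2 * w) c' (c'+h)) <= (c'+h-c') * (eps / 2 * (w+h))).
  { apply abs_RInt_le_const; try lra.
    - apply ex_RInt_subR; [apply ex_RInt_subR; apply E2; lra| apply ex_RInt_const].
    - intros t Ht.
      pose proof (Hd2 a' t) as B1. pose proof (Hd2 (a'+w) t) as B2.
      assert (C1 : Rabs (t - y0) < d2) by (apply Rabs_lt_between; lra).
      assert (C2 : Rabs (a' - x0) < d2) by (apply Rabs_lt_between; lra).
      assert (C3 : Rabs (a'+w - x0) < d2) by (apply Rabs_lt_between; lra).
      specialize (B1 C2 C1). specialize (B2 C3 C1).
      pose proof (mx a' t ltac:(lra) ltac:(lra)) as M1. pose proof (mx (a'+w) t ltac:(lra) ltac:(lra)) as M2.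
      apply Rabs_le_between in B1, B2. apply Rabs_le. nra. }
  assert (I1 : RInt (fun x => P x c' - P x (c'+h) + l2 * h) a' (a'+w)
     = RInt (fun x => P x c') a' (a'+w) - RInt (fun x => P x (c'+h)) a' (a'+w) + w * (l2 * h)).
  { rewrite (RInt_addR (fun x => P x c' - P x (c'+h)) (fun _ => l2*h)).
    - rewrite RInt_subR by (apply E1; lra). rewrite RInt_constR. eqR; ring.
    - apply ex_RInt_subR; apply E1; lra.
    - apply ex_RInt_const. }
  assert (I2 : RInt (fun y => Q (a'+w) y - Q a' y - l2 * w) c' (c'+h)
     = RInt (fun y => Q (a'+w) y) c' (c'+h) - RInt (fun y => Q a' y) c' (c'+h) - h * (l2 * w)).
  { rewrite (RInt_subR (fun y => Q (a'+w) y - Q a' y) (fun _ => l2*w)).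
    - rewrite (RInt_subR (fun y => Q (a'+w) y) (fun y => Q a' y)) by (apply E2; lra). rewrite RInt_constR. eqR; ring.
    - apply ex_RInt_subR; apply E2; lra.
    - apply ex_RInt_const. }
  rewrite I1 in A1. rewrite I2 in A2.
  unfold circ. apply Rabs_le_between in A1, A2. apply Rabs_le. nra.
Qed.

Section Bisection.
Variables (P Q : R -> R -> R).

(** A rectangle is stored as its corner [(a, c)] and its sides [(w, h)]. The first quarter with at
    least a fourth of the circulation is kept; the last one is taken without a test, since one of
    the four must qualify. *)
Definition bis_step (s : (R * R) * (R * R)) : (R * R) * (R * R) :=
  let '((a, c), (w, h)) := s in
  let w' := w / 2 in let h' := h / 2 in
  let k := Rabs (circ P Q a (a + w) c (c + h)) / 4 in
  let ok a c := Rle_dec k (Rabs (circ P Q a (a + w') c (c + h'))) in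
  ((if ok a c then (a, c) else if ok (a + w') c then (a + w', c)
    else if ok a (c + h') then (a, c + h') else (a + w', c + h')), (w', h')).

Fixpoint bis (a c w h : R) (n : nat) : (R * R) * (R * R) :=
  match n with O => ((a, c), (w, h)) | S n => bis_step (bis a c w h n) end.

Lemma bis_step_spec a c w h : 0 <= w -> 0 <= h -> closed_form P Q a (a + w) c (c + h) ->
  exists a' c', bis_step ((a, c), (w, h)) = ((a', c'), (w / 2, h / 2)) /\
  a <= a' /\ a' + w / 2 <= a + w /\ c <= c' /\ c' + h / 2 <= c + h /\
  Rabs (circ P Q a (a + w) c (c + h)) / 4 <= Rabs (circ P Q a' (a' + w/2) c' (c' + h/2)).
Proof.
  intros Hw Hh H.
  pose proof (circ_split P Q a (a + w/2) (a+w) c (c+h/2) (c+h) H ltac:(lra) ltac:(lra)) as E.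
  unfold bis_step.
  set (k := Rabs (circ P Q a (a + w) c (c + h)) / 4) in *.
  destruct (Rle_dec k (Rabs (circ P Q a (a + w/2) c (c + h/2)))).
  { exists a, c. repeat split; lra. }
  destruct (Rle_dec k (Rabs (circ P Q (a + w/2) (a + w/2 + w/2) c (c + h/2)))).
  { exists (a+w/2), c. repeat split; lra. }
  destruct (Rle_dec k (Rabs (circ P Q a (a + w/2) (c + h/2) (c + h/2 + h/2)))).
  { exists a, (c+h/2). repeat split; lra. }
  exists (a+w/2), (c+h/2). repeat split; try lra.
  replace (a + w/2 + w/2) with (a + w) in * by field.
  replace (c + h/2 + h/2) with (c + h) in * by field.
  assert (Rabs (circ P Q a (a + w) c (c + h)) <= 
     Rabs (circ P Q a (a + w/2) c (c + h/2)) + Rabs (circ P Q (a + w/2) (a + w) c (c + h/2)) + 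
     Rabs (circ P Q a (a + w/2) (c + h/2) (c + h)) + Rabs (circ P Q (a + w/2) (a + w) (c + h/2) (c + h))).
  { rewrite E. eapply Rle_trans; [apply Rabs_triang|]. apply Rplus_le_compat_r.
    eapply Rle_trans; [apply Rabs_triang|]. apply Rplus_le_compat_r. apply Rabs_triang. }
  unfold k in *. lra.
Qed.

Lemma bis_spec a c w h n : 0 <= w -> 0 <= h -> closed_form P Q a (a + w) c (c + h) ->
  let s := bis a c w h n in
  let a' := fst (fst s) in let c' := snd (fst s) in
  snd s = (w / 2 ^ n, h / 2 ^ n) /\
  a <= a' /\ a' + w / 2 ^ n <= a + w /\ c <= c' /\ c' + h / 2 ^ n <= c + h /\
  Rabs (circ P Q a (a + w) c (c + h)) / 4 ^ n
    <= Rabs (circ P Q a' (a' + w / 2 ^ n) c' (c' + h / 2 ^ n)) /\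
  (let s' := bis a c w h (S n) in 
   a' <= fst (fst s') /\ fst (fst s') + w / 2 ^ (S n) <= a' + w / 2 ^ n /\
   c' <= snd (fst s') /\ snd (fst s') + h / 2 ^ (S n) <= c' + h / 2 ^ n).
Proof.
  intros Hw Hh H.
  assert (hw : forall n, 0 <= w / 2 ^ n) by (intros; apply Rdiv_le_0_compat; [lra|apply pow_lt; lra]).
  assert (hh : forall n, 0 <= h / 2 ^ n) by (intros; apply Rdiv_le_0_compat; [lra|apply pow_lt; lra]).
  assert (p2 : forall n, 2 ^ n <> 0) by (intros; apply pow_nonzero; lra).
  assert (p4 : forall n, 4 ^ n <> 0) by (intros; apply pow_nonzero; lra).
  assert (W : forall z n, z / 2 ^ S n = z / 2 ^ n / 2).
  { intros. simpl. field. apply p2. }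
  assert (main : forall n, let s := bis a c w h n in
  let a' := fst (fst s) in let c' := snd (fst s) in
  snd s = (w / 2 ^ n, h / 2 ^ n) /\
  a <= a' /\ a' + w / 2 ^ n <= a + w /\ c <= c' /\ c' + h / 2 ^ n <= c + h /\
  Rabs (circ P Q a (a + w) c (c + h)) / 4 ^ n
    <= Rabs (circ P Q a' (a' + w / 2 ^ n) c' (c' + h / 2 ^ n))).
  { clear n. induction n as [|n IH].
    - simpl. rewrite !Rdiv_1_r. repeat split; lra.
    - cbv zeta in *. change (bis a c w h (S n)) with (bis_step (bis a c w h n)).
      destruct (bis a c w h n) as [[a1 c1] [w1 h1]]. cbn [fst snd] in IH.
      destruct IH as (I1 & I2 & I3 & I4 & I5 & I6). injection I1 as -> ->.
      destruct (bis_step_spec a1 c1 (w/2^n) (h/2^n) (hw n) (hh n)) as (a' & c' & E & J1 & J2 & J3 & J4 & J5).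
      { eapply closed_form_sub; eauto; lra. }
      rewrite E. cbn [fst snd]. rewrite !W.
      repeat split; try lra.
      eapply Rle_trans; [|apply J5]. 
      replace (Rabs (circ P Q a (a + w) c (c + h)) / 4 ^ S n) with (Rabs (circ P Q a (a + w) c (c + h)) / 4 ^ n / 4).
      lra. simpl. field. apply p4. }
  cbv zeta in *. pose proof (main n) as Mn.
  destruct Mn as (I1 & I2 & I3 & I4 & I5 & I6).
  do 6 (split; [assumption|]).
  change (bis a c w h (S n)) with (bis_step (bis a c w h n)).
  destruct (bis a c w h n) as [[a1 c1] [w1 h1]]. cbn [fst snd] in I1, I2, I3, I4, I5, I6.
  injection I1 as -> ->.
  destruct (bis_step_spec a1 c1 (w/2^n) (h/2^n) (hw n) (hh n)) as (a' & c' & E & J1 & J2 & J3 & J4 & J5).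
  { eapply closed_form_sub; eauto; lra. }
  rewrite E. cbn [fst snd]. rewrite !W. repeat split; lra.
Qed.

End Bisection.

Lemma nested_point (u : nat -> R) (w : R) : 0 <= w ->
  (forall n, u n <= u (S n) /\ u (S n) + w / 2 ^ (S n) <= u n + w / 2 ^ n) ->
  exists x, forall n, u n <= x <= u n + w / 2 ^ n.
Proof.
  intros Hw H.
  assert (hw : forall n, 0 <= w / 2 ^ n) by (intros; apply Rdiv_le_0_compat; [lra|apply pow_lt; lra]).
  assert (G : forall n k, u n <= u (n + k)%nat /\ u (n+k)%nat + w / 2 ^ (n+k) <= u n + w / 2 ^ n).
  { intros n k. induction k as [|k IH].
    - rewrite Nat.add_0_r. lra.
    - rewrite Nat.add_succ_r. specialize (H (n+k)%nat). lra. }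
  assert (UB : forall n m, u m <= u n + w / 2 ^ n).
  { intros n m. destruct (Nat.le_ge_cases n m) as [L|L].
    - replace m with (n + (m-n))%nat by lia. pose proof (G n (m-n)%nat). 
      pose proof (hw (n + (m-n))%nat). lra.
    - replace n with (m + (n-m))%nat by lia. pose proof (G m (n-m)%nat). 
      pose proof (hw (m + (n-m))%nat). lra. }
  destruct (completeness (fun z => exists n, z = u n)) as [x [X1 X2]].
  - exists (u O + w / 2 ^ 0). intros z [n ->]. apply UB.
  - exists (u O). exists O. reflexivity.
  - exists x. intros n. split.
    + apply X1. exists n; reflexivity.
    + apply X2. intros z [m ->]. apply UB.
Qed.

(** The nested quarters keep circulation at least [k / 4 ^ n], while [circ_local] at their common
    point bounds it by [eps * (w + h) ^ 2 / 4 ^ n]. *)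
Theorem goursat P Q a b c d : a <= b -> c <= d ->
  closed_form P Q a b c d -> circ P Q a b c d = 0.
Proof.
  intros ab cd H.
  destruct (Req_EM_T (circ P Q a b c d) 0) as [|N]; [assumption|exfalso].
  set (w := b - a). set (h := d - c).
  assert (Eb : b = a + w) by (unfold w; ring). assert (Ed : d = c + h) by (unfold h; ring).
  assert (Hw : 0 <= w) by (unfold w; lra). assert (Hh : 0 <= h) by (unfold h; lra).
  assert (H' : closed_form P Q a (a+w) c (c+h)) by (rewrite <- Eb, <- Ed; exact H).
  pose proof (bis_spec P Q a c w h) as B.
  set (s := bis P Q a c w h) in *.
  destruct (nested_point (fun n => fst (fst (s n))) w Hw) as [x Hx].
  { intros n. destruct (B n Hw Hh H') as (_&_&_&_&_&_&B7). simpl in B7. simpl. tauto. }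
  destruct (nested_point (fun n => snd (fst (s n))) h Hh) as [y Hy].
  { intros n. destruct (B n Hw Hh H') as (_&_&_&_&_&_&B7). simpl in B7. simpl. tauto. }
  assert (K : 0 < Rabs (circ P Q a b c d)) by (apply Rabs_pos_lt; exact N).
  set (k := Rabs (circ P Q a b c d)) in *.
  (* Makes [eps * (w + h) ^ 2] at most [k / 2]; the [+ 1] keeps the denominator positive for
     degenerate rectangles. *)
  set (eps := k / (2 * ((w + h) * (w + h) + 1))).
  assert (D : 0 < 2 * ((w + h) * (w + h) + 1)) by nra.
  assert (He : 0 < eps) by (apply Rdiv_lt_0_compat; lra).
  destruct (circ_local P Q a b c d x y H) with (eps := eps) as (delta & Hd & L); auto.
  { destruct (B O Hw Hh H') as (_&B2&B3&_). specialize (Hx O). simpl in *. lra. }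
  { destruct (B O Hw Hh H') as (_&_&_&B4&B5&_). specialize (Hy O). simpl in *. lra. }
  destruct (pow_lt_1_zero (/2) ltac:(rewrite Rabs_right; lra) (delta / (w + h + 1))) as [n Hn].
  { apply Rdiv_lt_0_compat; lra. }
  specialize (Hn n (le_n n)).
  assert (p2 : 0 < 2 ^ n) by (apply pow_lt; lra).
  rewrite pow_inv, Rabs_right in Hn by (left; apply Rinv_0_lt_compat; lra).
  assert (Q1 : (w + h + 1) / 2 ^ n < delta).
  { apply Rmult_lt_reg_r with (/ (w+h+1)). apply Rinv_0_lt_compat; lra.
    unfold Rdiv in *. replace ((w + h + 1) * / 2 ^ n * / (w + h + 1)) with (/ 2 ^ n); [exact Hn|].
    field. split; lra. }
  destruct (B n Hw Hh H') as (B1 & B2 & B3 & B4 & B5 & B6 & B7).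
  specialize (Hx n). specialize (Hy n). simpl in Hx, Hy.
  assert (i2 : 0 < / 2 ^ n) by (apply Rinv_0_lt_compat; lra).
  specialize (L (fst (fst (s n))) (snd (fst (s n))) (w / 2 ^ n) (h / 2 ^ n)).
  assert (L' : Rabs (circ P Q (fst (fst (s n))) (fst (fst (s n)) + w / 2 ^ n) (snd (fst (s n)))
        (snd (fst (s n)) + h / 2 ^ n)) <= eps * (w / 2 ^ n + h / 2 ^ n) * (w / 2 ^ n + h / 2 ^ n)).
  { apply L; unfold Rdiv in *; try nra. }
  pose proof (Rle_trans _ _ _ B6 L') as F.
  rewrite <- Eb, <- Ed in F. fold k in F.
  replace (4 ^ n) with (2 ^ n * 2 ^ n) in F by (rewrite <- Rpow_mult_distr; f_equal; lra).
  assert (F2 : k <= eps * ((w + h) * (w + h))).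
  { apply Rmult_le_reg_r with (/ (2 ^ n * 2 ^ n)). apply Rinv_0_lt_compat; nra.
    eapply Rle_trans; [exact F|]. right. field. lra. }
  assert (F3 : eps * ((w + h) * (w + h)) <= k / 2).
  { unfold eps. apply Rmult_le_reg_r with (2 * ((w + h) * (w + h) + 1)); [lra|].
    field_simplify; nra. }
  lra.
Qed.

(** * Complex derivatives and contour integrals *)

Ltac cparts := unfold Cminus, Cmult, Cplus, Copp, RtoC, Ci, Re, Im in *; cbn [fst snd] in *.

(** Division-free form: [w = z] needs no exclusion, and the errors add and multiply directly. *)
Definition cder (f : C -> C) (z l : C) : Prop :=
  forall eps, 0 < eps -> exists delta, 0 < delta /\
  forall w, Cmod (w - z) < delta -> Cmod (f w - f z - l * (w - z)) <= eps * Cmod (w - z).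

Definition cdiffble (f : C -> C) (z : C) : Prop := exists l, cder f z l.

Lemma C_differentiable_cdiffble f z : C_differentiable f z -> cdiffble f z.
Proof.
  intros [l [_ H]]. exists l. intros eps He.
  (* The derivative of Coquelicot quantifies over limits of the neighbourhood filter; [z] itself is
     one. *)
  destruct (H z (fun P HP => HP) (mkposreal eps He)) as [d Hd].
  exists d. split; [apply cond_pos|]. intros w Hw.
  specialize (Hd w Hw). simpl in Hd.
  replace (f w - f z - l * (w - z))%C with
    (minus (G := C_NormedModule) (minus (G := C_NormedModule) (f w) (f z))
      (scal (V := C_NormedModule) (minus (G := C_AbelianGroup) w z) l)).
  - exact Hd.
  - unfold minus, scal, plus, opp; simpl. unfold mult; simpl. ring.
Qed.

Lemma Cmod_le_abs (z : C) : Cmod z <= Rabs (Re z) + Rabs (Im z).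
Proof.
  destruct z as [x y]. unfold Cmod, Re, Im; simpl fst; simpl snd.
  apply Rsqr_incr_0_var; [|pose proof (Rabs_pos x); pose proof (Rabs_pos y); lra].
  rewrite Rsqr_sqrt by nra. unfold Rsqr.
  pose proof (Rabs_pos x); pose proof (Rabs_pos y).
  replace (x ^ 2) with (Rabs x * Rabs x) by (rewrite <- Rabs_mult, Rabs_right; [ring|nra]).
  replace (y ^ 2) with (Rabs y * Rabs y) by (rewrite <- Rabs_mult, Rabs_right; [ring|nra]).
  nra.
Qed.

Lemma Rabs_Im_le (z : C) : Rabs (Im z) <= Cmod z.
Proof. eapply Rle_trans; [apply Rmax_r|apply Rmax_Cmod]. Qed.

Lemma Ceq_parts (z w : C) : Re z = Re w -> Im z = Im w -> z = w.
Proof. destruct z, w; unfold Re, Im; simpl; intros; subst; reflexivity. Qed.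

(** Multiplication by [l] as a real matrix: here the Cauchy-Riemann equations enter, and with them
    the closedness of [f dz]. *)
Lemma cder_parts f x y l : cder f (x, y) l ->
  differentiable_pt_lim (fun u v => Re (f (u, v))) x y (Re l) (- Im l) /\
  differentiable_pt_lim (fun u v => Im (f (u, v))) x y (Im l) (Re l).
Proof.
  intros H.
  assert (K : forall eps : posreal, exists delta : posreal, forall u v,
     Rabs (u - x) < delta -> Rabs (v - y) < delta ->
     Cmod (f (u, v) - f (x, y) - l * ((u, v) - (x, y))) <= eps * Rmax (Rabs (u - x)) (Rabs (v - y))).
  { intros eps. assert (He : 0 < eps / 2) by (pose proof (cond_pos eps); lra).
    destruct (H _ He) as (d & Hd & L).
    assert (Hd2 : 0 < d / 2) by lra.
    exists (mkposreal _ Hd2). simpl. intros u v Hu Hv.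
    assert (B : Cmod ((u, v) - (x, y)) <= Rabs (u - x) + Rabs (v - y)).
    { eapply Rle_trans; [apply Cmod_le_abs|]. simpl. unfold Rminus. lra. }
    eapply Rle_trans; [apply L; lra|].
    pose proof (Rmax_l (Rabs (u-x)) (Rabs (v-y))). pose proof (Rmax_r (Rabs (u-x)) (Rabs (v-y))).
    nra. }
  split; intros eps; destruct (K eps) as [d Hd]; exists d; intros u v Hu Hv;
    (eapply Rle_trans; [|apply (Hd u v Hu Hv)]).
  - eapply Rle_trans; [|apply re_le_Cmod]. right. f_equal.
    destruct (f (u, v)), (f (x, y)), l. simpl. ring.
  - eapply Rle_trans; [|apply Rabs_Im_le]. right. f_equal.
    destruct (f (u, v)), (f (x, y)), l. simpl. ring.
Qed.

Lemma cder_const (c z : C) : cder (fun _ => c) z 0.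
Proof.
  intros eps He. exists 1. split; [lra|]. intros w _.
  replace (c - c - 0 * (w - z))%C with (RtoC 0) by ring. rewrite Cmod_0.
  pose proof (Cmod_ge_0 (w - z)). nra.
Qed.

Lemma cder_id (z : C) : cder (fun w => w) z 1.
Proof.
  intros eps He. exists 1. split; [lra|]. intros w _.
  replace (w - z - 1 * (w - z))%C with (RtoC 0) by ring. rewrite Cmod_0.
  pose proof (Cmod_ge_0 (w - z)). nra.
Qed.

Lemma cder_plus f g z l m : cder f z l -> cder g z m -> cder (fun w => f w + g w)%C z (l + m).
Proof.
  intros Hf Hg eps He.
  destruct (Hf (eps / 2)) as (d1 & P1 & L1); [lra|].
  destruct (Hg (eps / 2)) as (d2 & P2 & L2); [lra|].
  exists (Rmin d1 d2). split; [apply Rmin_case; auto|]. intros w Hw.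
  pose proof (Rmin_l d1 d2). pose proof (Rmin_r d1 d2).
  specialize (L1 w ltac:(lra)). specialize (L2 w ltac:(lra)).
  replace (f w + g w - (f z + g z) - (l + m) * (w - z))%C with
    ((f w - f z - l * (w - z)) + (g w - g z - m * (w - z)))%C by ring.
  eapply Rle_trans; [apply Cmod_triangle|]. lra.
Qed.

Lemma cder_bound f z l : cder f z l -> exists delta, 0 < delta /\
  forall w, Cmod (w - z) < delta -> Cmod (f w - f z) <= (Cmod l + 1) * Cmod (w - z).
Proof.
  intros H. destruct (H 1) as (d & Hd & L); [lra|]. exists d; split; auto.
  intros w Hw. specialize (L w Hw).
  replace (f w - f z)%C with ((f w - f z - l * (w - z)) + l * (w - z))%C by ring.
  eapply Rle_trans; [apply Cmod_triangle|]. rewrite Cmod_mult. lra.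
Qed.

Lemma cder_mult f g z l m : cder f z l -> cder g z m ->
  cder (fun w => f w * g w)%C z (l * g z + f z * m).
Proof.
  intros Hf Hg eps He.
  destruct (cder_bound _ _ _ Hg) as (d0 & P0 & L0).
  set (A := Cmod (f z)). set (B := Cmod (g z)). set (Kl := Cmod l). set (Km := Cmod m) in *.
  assert (HA : 0 <= A) by apply Cmod_ge_0. assert (HB : 0 <= B) by apply Cmod_ge_0.
  assert (Hl : 0 <= Kl) by apply Cmod_ge_0. assert (Hm : 0 <= Km) by apply Cmod_ge_0.
  (* [e] pays for the two first-order errors, [d3] keeps [|g w - g z| <= 1], and [d4] makes the
     cross term of the two increments at most [eps / 3 * t]. *)
  set (e := eps / (3 * (A + B + 2))).
  assert (e0 : 0 < e) by (apply Rdiv_lt_0_compat; lra).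
  assert (ee : e * (A + B + 2) = eps / 3) by (unfold e; field; lra).
  destruct (Hf e e0) as (d1 & P1 & L1). destruct (Hg e e0) as (d2 & P2 & L2).
  set (d3 := 1 / (Km + 1)). assert (P3 : 0 < d3) by (apply Rdiv_lt_0_compat; lra).
  assert (e3 : (Km + 1) * d3 = 1) by (unfold d3; field; lra).
  set (d4 := eps / 3 / ((Kl + 1) * (Km + 1))).
  assert (P4 : 0 < d4) by (apply Rdiv_lt_0_compat; [lra|nra]).
  assert (e4 : (Kl + 1) * (Km + 1) * d4 = eps / 3) by (unfold d4; field; lra).
  exists (Rmin (Rmin d0 d1) (Rmin d2 (Rmin d3 d4))).
  split. { repeat apply Rmin_case; auto. }
  intros w Hw.
  assert (W : Cmod (w - z) < d0 /\ Cmod (w - z) < d1 /\ Cmod (w - z) < d2 /\ Cmod (w - z) < d3 /\ Cmod (w - z) < d4).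
  { repeat split; eapply Rlt_le_trans; try exact Hw.
    - eapply Rle_trans; [apply Rmin_l|apply Rmin_l].
    - eapply Rle_trans; [apply Rmin_l|apply Rmin_r].
    - eapply Rle_trans; [apply Rmin_r|apply Rmin_l].
    - eapply Rle_trans; [apply Rmin_r|]. eapply Rle_trans; [apply Rmin_r|apply Rmin_l].
    - eapply Rle_trans; [apply Rmin_r|]. eapply Rle_trans; [apply Rmin_r|apply Rmin_r]. }
  destruct W as (W0 & W1 & W2 & W3 & W4).
  specialize (L0 w W0). specialize (L1 w W1). specialize (L2 w W2).
  set (t := Cmod (w - z)) in *. assert (t0 : 0 <= t) by apply Cmod_ge_0.
  replace (f w * g w - f z * g z - (l * g z + f z * m) * (w - z))%C with
    ((f w - f z - l * (w - z)) * g w + f z * (g w - g z - m * (w - z)) + l * (w - z) * (g w - g z))%C by ring.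
  assert (Gw : Cmod (g w) <= B + 1).
  { replace (g w) with ((g w - g z) + g z)%C by ring.
    eapply Rle_trans; [apply Cmod_triangle|]. fold B. fold Km in L0. nra. }
  eapply Rle_trans; [apply Cmod_triangle|].
  eapply Rle_trans; [apply Rplus_le_compat_r, Cmod_triangle|].
  rewrite !Cmod_mult. fold A Kl t.
  assert (T1 : Cmod (f w - f z - l * (w - z)) * Cmod (g w) <= e * t * (B + 1)).
  { apply Rmult_le_compat; auto; apply Cmod_ge_0. }
  assert (T2 : A * Cmod (g w - g z - m * (w - z)) <= A * (e * t)).
  { apply Rmult_le_compat_l; auto. }
  assert (T3 : Kl * t * Cmod (g w - g z) <= eps / 3 * t).
  { eapply Rle_trans; [apply Rmult_le_compat_l; [nra|exact L0]|]. fold Km.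
    rewrite <- e4. assert (Kl * (Km+1) * t <= (Kl+1) * (Km+1) * d4) by (apply Rmult_le_compat; nra).
    nra. }
  assert (T4 : e * t * (B + 1) + A * (e * t) <= eps / 3 * t) by (rewrite <- ee; nra).
  assert (0 <= eps * t) by nra. lra.
Qed.

Lemma cder_inv (z : C) : z <> 0%C -> cder Cinv z (- / (z * z))%C.
Proof.
  intros Hz eps He.
  set (r := Cmod z). assert (Hr : 0 < r) by (apply Cmod_gt_0; exact Hz).
  (* [r / 2] keeps [|w| >= r / 2]; the second bound turns the remainder [|w - z|^2 / (|w| |z|^2)]
     into [eps |w - z|]. *)
  set (d := Rmin (r / 2) (eps * r * r * r / 2)).
  assert (Hd : 0 < d) by (apply Rmin_case; [lra|assert (0 < eps * r) by nra; assert (0 < eps * r * r) by nra; nra]).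
  exists d. split; auto. intros w Hw.
  assert (W1 : Cmod (w - z) < r / 2) by (eapply Rlt_le_trans; [exact Hw|apply Rmin_l]).
  assert (W2 : Cmod (w - z) < eps * r * r * r / 2) by (eapply Rlt_le_trans; [exact Hw|apply Rmin_r]).
  assert (Rw : r / 2 <= Cmod w).
  { assert (r <= Cmod w + Cmod (w - z)).
    { unfold r. replace z with (w + - (w - z))%C at 1 by ring.
      eapply Rle_trans; [apply Cmod_triangle|]. rewrite Cmod_opp. lra. }
    lra. }
  assert (Nw : w <> 0%C) by (apply Cmod_gt_0; lra).
  replace (/ w - / z - - / (z * z) * (w - z))%C with ((w - z) * (w - z) * / (w * (z * z)))%C
    by (field; auto).
  rewrite !Cmod_mult, Cmod_inv, !Cmod_mult by (repeat apply Cmult_neq_0; auto).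
  fold r. set (t := Cmod (w - z)) in *. set (q := Cmod w) in *.
  assert (t0 : 0 <= t) by apply Cmod_ge_0.
  assert (Q : / (q * (r * r)) <= / (r / 2 * (r * r))).
  { apply Rinv_le_contravar; [|apply Rmult_le_compat_r; nra]. apply Rmult_lt_0_compat; nra. }
  eapply Rle_trans; [apply Rmult_le_compat_l; [nra|exact Q]|].
  rewrite Rmult_assoc. rewrite (Rmult_comm eps). apply Rmult_le_compat_l; auto.
  apply Rmult_le_reg_r with (r / 2 * (r * r)). apply Rmult_lt_0_compat; nra.
  rewrite Rmult_assoc, Rinv_l by (assert (0 < r / 2 * (r * r)) by (apply Rmult_lt_0_compat; nra); lra).
  nra.
Qed.

Lemma cder_comp f g z l m : cder g z m -> cder f (g z) l -> cder (fun w => f (g w)) z (l * m).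
Proof.
  intros Hg Hf eps He.
  destruct (cder_bound _ _ _ Hg) as (d0 & P0 & L0).
  set (Kl := Cmod l). set (Km := Cmod m) in *.
  assert (Hl : 0 <= Kl) by apply Cmod_ge_0. assert (Hm : 0 <= Km) by apply Cmod_ge_0.
  assert (p1 : 0 < eps / 2 / (Km + 1)) by (apply Rdiv_lt_0_compat; lra).
  assert (p2 : 0 < eps / 2 / (Kl + 1)) by (apply Rdiv_lt_0_compat; lra).
  assert (q1 : eps / 2 / (Km + 1) * (Km + 1) = eps / 2) by (field; lra).
  assert (q2 : eps / 2 / (Kl + 1) * (Kl + 1) = eps / 2) by (field; lra).
  set (e1 := eps / 2 / (Km + 1)) in *. set (e2 := eps / 2 / (Kl + 1)) in *.
  destruct (Hf e1 p1) as (d1 & P1 & L1). destruct (Hg e2 p2) as (d2 & P2 & L2).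
  assert (P3 : 0 < d1 / (Km + 1)) by (apply Rdiv_lt_0_compat; lra).
  assert (q3 : d1 / (Km + 1) * (Km + 1) = d1) by (field; lra).
  exists (Rmin d0 (Rmin d2 (d1 / (Km + 1)))). split; [repeat apply Rmin_case; auto|].
  intros w Hw.
  assert (W0 : Cmod (w - z) < d0) by (eapply Rlt_le_trans; [exact Hw|apply Rmin_l]).
  assert (W2 : Cmod (w - z) < d2) by (eapply Rlt_le_trans; [exact Hw|eapply Rle_trans; [apply Rmin_r|apply Rmin_l]]).
  assert (W3 : Cmod (w - z) < d1 / (Km + 1)) by (eapply Rlt_le_trans; [exact Hw|eapply Rle_trans; [apply Rmin_r|apply Rmin_r]]).
  specialize (L0 w W0). specialize (L2 w W2). fold Km in L0.
  specialize (L1 (g w)).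
  set (t := Cmod (w - z)) in *. assert (t0 : 0 <= t) by apply Cmod_ge_0.
  assert (L1' : Cmod (f (g w) - f (g z) - l * (g w - g z)) <= e1 * Cmod (g w - g z)) by (apply L1; nra).
  replace (f (g w) - f (g z) - l * m * (w - z))%C with
   ((f (g w) - f (g z) - l * (g w - g z)) + l * (g w - g z - m * (w - z)))%C by ring.
  eapply Rle_trans; [apply Cmod_triangle|]. rewrite Cmod_mult. fold Kl.
  assert (e1 * Cmod (g w - g z) <= e1 * ((Km + 1) * t)) by (apply Rmult_le_compat_l; lra).
  assert (Kl * Cmod (g w - g z - m * (w - z)) <= Kl * (e2 * t)) by (apply Rmult_le_compat_l; lra).
  nra.
Qed.

Lemma cdiffble_const c z : cdiffble (fun _ => c) z.
Proof. eexists; apply cder_const. Qed.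

Lemma cdiffble_id z : cdiffble (fun w => w) z.
Proof. eexists; apply cder_id. Qed.

Lemma cdiffble_plus f g z : cdiffble f z -> cdiffble g z -> cdiffble (fun w => f w + g w)%C z.
Proof. intros [l Hl] [m Hm]. eexists; eapply cder_plus; eauto. Qed.

Lemma cdiffble_mult f g z : cdiffble f z -> cdiffble g z -> cdiffble (fun w => f w * g w)%C z.
Proof. intros [l Hl] [m Hm]. eexists; eapply cder_mult; eauto. Qed.

Lemma cdiffble_comp f g z : cdiffble g z -> cdiffble f (g z) -> cdiffble (fun w => f (g w)) z.
Proof. intros [l Hl] [m Hm]. eexists; eapply cder_comp; eauto. Qed.

Lemma cdiffble_inv f z : cdiffble f z -> f z <> 0%C -> cdiffble (fun w => / f w)%C z.
Proof. intros Hf Hz. apply (cdiffble_comp Cinv f z Hf). eexists; apply cder_inv; auto. Qed.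

Lemma cdiffble_pow f z n : cdiffble f z -> cdiffble (fun w => f w ^ n)%C z.
Proof.
  intros Hf. induction n as [|n IH]; simpl.
  - apply cdiffble_const.
  - apply cdiffble_mult; auto.
Qed.

Lemma differentiable_pt_lim_plus f g x y a b c d :
  differentiable_pt_lim f x y a b -> differentiable_pt_lim g x y c d ->
  differentiable_pt_lim (fun u v => f u v + g u v) x y (a + c) (b + d).
Proof.
  intros Hf Hg. replace (a + c) with (1 * a + 1 * c) by ring. replace (b + d) with (1 * b + 1 * d) by ring.
  apply (differentiable_pt_lim_comp (fun u v => u + v)); auto.
  intros eps. exists eps. intros u v _ _.
  match goal with |- Rabs ?e <= _ => replace e with 0 by ring end. rewrite Rabs_R0.
  apply Rmult_le_pos; [left; apply cond_pos|]. eapply Rle_trans; [|apply Rmax_l]. apply Rabs_pos.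
Qed.

Lemma differentiable_pt_lim_mult f g x y a b c d :
  differentiable_pt_lim f x y a b -> differentiable_pt_lim g x y c d ->
  differentiable_pt_lim (fun u v => f u v * g u v) x y
    (g x y * a + f x y * c) (g x y * b + f x y * d).
Proof.
  intros Hf Hg. 
  apply (differentiable_pt_lim_comp (fun u v => u * v)); auto.
  set (p := f x y). set (q := g x y).
  intros eps. exists eps. intros u v Hu Hv.
  match goal with |- Rabs ?e <= _ => replace e with ((u - p) * (v - q)) by ring end.
  rewrite Rabs_mult. apply Rmult_le_compat; try apply Rabs_pos; [lra|]. apply Rmax_r.
Qed.

Lemma differentiable_pt_lim_opp f x y a b :
  differentiable_pt_lim f x y a b -> differentiable_pt_lim (fun u v => - f u v) x y (- a) (- b).
Proof.
  intros Hf eps. destruct (Hf eps) as [d Hd]. exists d. intros u v Hu Hv.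
  specialize (Hd u v Hu Hv). rewrite <- Rabs_Ropp.
  match goal with |- Rabs ?e <= _ => replace e with (f u v - f x y - (a * (u - x) + b * (v - y))) by ring end.
  exact Hd.
Qed.

(** The partial derivatives of real and imaginary part are collected in complex numbers, so that
    product and chain rule apply to maps of two real parameters that are not holomorphic. *)
Definition cdiff (F : R -> R -> C) (s t : R) (l1 l2 : C) : Prop :=
  differentiable_pt_lim (fun u v => Re (F u v)) s t (Re l1) (Re l2) /\
  differentiable_pt_lim (fun u v => Im (F u v)) s t (Im l1) (Im l2).

Lemma differentiable_pt_lim_ext' f g x y a b a' b' :
  (forall u v, f u v = g u v) -> a = a' -> b = b' ->
  differentiable_pt_lim f x y a b -> differentiable_pt_lim g x y a' b'.
Proof.
  intros E -> -> H eps. destruct (H eps) as [d Hd]. exists d. intros u v Hu Hv.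
  rewrite <- !E. auto.
Qed.

Lemma cdiff_plus F G s t a b c d : cdiff F s t a b -> cdiff G s t c d ->
  cdiff (fun u v => F u v + G u v)%C s t (a + c) (b + d).
Proof.
  intros [F1 F2] [G1 G2]. split.
  - eapply differentiable_pt_lim_ext'; [| | |apply (differentiable_pt_lim_plus _ _ _ _ _ _ _ _ F1 G1)]; reflexivity.
  - eapply differentiable_pt_lim_ext'; [| | |apply (differentiable_pt_lim_plus _ _ _ _ _ _ _ _ F2 G2)]; reflexivity.
Qed.

Lemma cdiff_mult F G s t a b c d : cdiff F s t a b -> cdiff G s t c d ->
  cdiff (fun u v => F u v * G u v)%C s t (a * G s t + F s t * c) (b * G s t + F s t * d).
Proof.
  intros [F1 F2] [G1 G2]. split.
  - eapply differentiable_pt_lim_ext'; [| | |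
      apply (differentiable_pt_lim_plus _ _ _ _ _ _ _ _ (differentiable_pt_lim_mult _ _ _ _ _ _ _ _ F1 G1)
        (differentiable_pt_lim_opp _ _ _ _ _ (differentiable_pt_lim_mult _ _ _ _ _ _ _ _ F2 G2)))];
    intros; cparts; ring.
  - eapply differentiable_pt_lim_ext'; [| | |
      apply (differentiable_pt_lim_plus _ _ _ _ _ _ _ _ (differentiable_pt_lim_mult _ _ _ _ _ _ _ _ F1 G2)
         (differentiable_pt_lim_mult _ _ _ _ _ _ _ _ F2 G1))];
    intros; cparts; ring.
Qed.

Lemma cdiff_comp f F s t l a b : cder f (F s t) l -> cdiff F s t a b ->
  cdiff (fun u v => f (F u v)) s t (l * a) (l * b).
Proof.
  intros Hf [F1 F2]. 
  assert (E : F s t = (Re (F s t), Im (F s t))) by (destruct (F s t); reflexivity).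
  rewrite E in Hf. apply cder_parts in Hf. destruct Hf as [U V]. split.
  - eapply differentiable_pt_lim_ext'; [| | |apply (differentiable_pt_lim_comp _ _ _ _ _ _ _ _ _ _ _ U F1 F2)];
    intros; [unfold Re, Im; cbv beta; rewrite <- surjective_pairing; reflexivity|cparts; ring|cparts; ring].
  - eapply differentiable_pt_lim_ext'; [| | |apply (differentiable_pt_lim_comp _ _ _ _ _ _ _ _ _ _ _ V F1 F2)];
    intros; [unfold Re, Im; cbv beta; rewrite <- surjective_pairing; reflexivity|cparts; ring|cparts; ring].
Qed.

Lemma cdiff_const c s t : cdiff (fun _ _ => c) s t 0 0.
Proof.
  split; intros eps; exists eps; intros u v _ _; simpl;
    match goal with |- Rabs ?e <= _ => replace e with 0 by ring end; rewrite Rabs_R0;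
    (apply Rmult_le_pos; [left; apply cond_pos|]); eapply Rle_trans; [|apply Rmax_l| |apply Rmax_l]; apply Rabs_pos.
Qed.

Lemma cdiff_fst s t : cdiff (fun u _ => RtoC u) s t 1 0.
Proof.
  split; intros eps; exists eps; intros u v _ _; simpl;
    match goal with |- Rabs ?e <= _ => replace e with 0 by ring end; rewrite Rabs_R0;
    (apply Rmult_le_pos; [left; apply cond_pos|]); eapply Rle_trans; [|apply Rmax_l| |apply Rmax_l]; apply Rabs_pos.
Qed.

Definition eit (t : R) : C := (cos t, sin t).

Lemma cdiff_eit s t : cdiff (fun _ v => eit v) s t 0 (Ci * eit t).
Proof.
  assert (P : forall f l, derivable_pt_lim f t l -> differentiable_pt_lim (fun _ v => f v) s t 0 l).
  { intros f l H eps. destruct (differentiable_pt_lim_proj1_0 f t s l H eps) as [d Hd].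
    exists d. intros u v Hu Hv. specialize (Hd v u Hv Hu). rewrite Rmax_comm.
    eapply Rle_trans; [|exact Hd]. right. f_equal. ring. }
  split; simpl.
  - replace (0 * cos t - 1 * sin t) with (- sin t) by ring. apply P. apply derivable_pt_lim_cos.
  - replace (0 * sin t + 1 * cos t) with (cos t) by ring. apply P. apply derivable_pt_lim_sin.
Qed.

Lemma Cmod_eit t : Cmod (eit t) = 1.
Proof.
  unfold Cmod, eit; simpl. rewrite !Rmult_1_r. rewrite Rplus_comm.
  change (sin t * sin t + cos t * cos t) with ((sin t)² + (cos t)²). rewrite sin2_cos2. apply sqrt_1.
Qed.

Lemma eit_neq0 t : eit t <> 0%C.
Proof. apply Cmod_gt_0. rewrite Cmod_eit. lra. Qed.

Lemma eit_2PI : eit (2 * PI) = eit 0.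
Proof. unfold eit. rewrite cos_2PI, sin_2PI, cos_0, sin_0. reflexivity. Qed.

Lemma eit_conj t : (eit t * Cconj (eit t) = 1)%C.
Proof. rewrite <- Cmod2_conj, Cmod_eit. apply f_equal. ring. Qed.

Definition CInt (f : R -> C) (a b : R) : C :=
  (RInt (fun t => Re (f t)) a b, RInt (fun t => Im (f t)) a b).

Definition ccont (f : R -> C) (t : R) : Prop :=
  continuous (fun t => Re (f t)) t /\ continuous (fun t => Im (f t)) t.

Lemma ccont_ex f a b : a <= b -> (forall t, a <= t <= b -> ccont f t) ->
  ex_RInt (fun t => Re (f t)) a b /\ ex_RInt (fun t => Im (f t)) a b.
Proof. intros ab H. split; apply ex_RInt_cont; auto; intros t Ht; apply (H t Ht). Qed.

Lemma CInt_ext f g a b : (forall t, f t = g t) -> CInt f a b = CInt g a b.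
Proof. intros E. unfold CInt. f_equal; apply RInt_ext; intros; rewrite E; reflexivity. Qed.

Lemma CInt_sub f g a b : a <= b ->
  (forall t, a <= t <= b -> ccont f t) -> (forall t, a <= t <= b -> ccont g t) ->
  CInt (fun t => f t - g t)%C a b = (CInt f a b - CInt g a b)%C.
Proof.
  intros ab Hf Hg. destruct (ccont_ex f a b ab Hf), (ccont_ex g a b ab Hg).
  apply Ceq_parts.
  - apply (RInt_subR (fun t => Re (f t)) (fun t => Re (g t))); auto.
  - apply (RInt_subR (fun t => Im (f t)) (fun t => Im (g t))); auto.
Qed.

Lemma CInt_add f g a b : a <= b ->
  (forall t, a <= t <= b -> ccont f t) -> (forall t, a <= t <= b -> ccont g t) ->
  CInt (fun t => f t + g t)%C a b = (CInt f a b + CInt g a b)%C.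
Proof.
  intros ab Hf Hg. destruct (ccont_ex f a b ab Hf), (ccont_ex g a b ab Hg).
  apply Ceq_parts.
  - apply (RInt_addR (fun t => Re (f t)) (fun t => Re (g t))); auto.
  - apply (RInt_addR (fun t => Im (f t)) (fun t => Im (g t))); auto.
Qed.

Lemma CInt_mul c f a b : a <= b -> (forall t, a <= t <= b -> ccont f t) ->
  CInt (fun t => c * f t)%C a b = (c * CInt f a b)%C.
Proof.
  intros ab Hf. destruct (ccont_ex f a b ab Hf) as [E1 E2]. destruct c as [p q].
  apply Ceq_parts.
  - transitivity (p * RInt (fun t => Re (f t)) a b - q * RInt (fun t => Im (f t)) a b); [|reflexivity].
    rewrite <- (RInt_mulR p (fun t => Re (f t))), <- (RInt_mulR q (fun t => Im (f t))) by auto.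
    rewrite <- (RInt_subR (fun t => p * Re (f t)) (fun t => q * Im (f t))) by (apply ex_RInt_mulR; auto).
    reflexivity.
  - transitivity (p * RInt (fun t => Im (f t)) a b + q * RInt (fun t => Re (f t)) a b); [|reflexivity].
    rewrite <- (RInt_mulR q (fun t => Re (f t))), <- (RInt_mulR p (fun t => Im (f t))) by auto.
    rewrite <- (RInt_addR (fun t => p * Im (f t)) (fun t => q * Re (f t))) by (apply ex_RInt_mulR; auto).
    reflexivity.
Qed.

(** Real and imaginary part are estimated separately, whence the factor 2. *)
Lemma CInt_bound f a b M : a <= b -> (forall t, a <= t <= b -> ccont f t) ->
  (forall t, a <= t <= b -> Cmod (f t) <= M) -> Cmod (CInt f a b) <= 2 * (b - a) * M.
Proof.
  intros ab Hf HM. destruct (ccont_ex f a b ab Hf) as [E1 E2].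
  eapply Rle_trans; [apply Cmod_le_abs|]. unfold CInt; cbn [Re Im fst snd].
  assert (Rabs (RInt (fun t => Re (f t)) a b) <= (b - a) * M).
  { apply abs_RInt_le_const; auto. intros t Ht. eapply Rle_trans; [apply re_le_Cmod|auto]. }
  assert (Rabs (RInt (fun t => Im (f t)) a b) <= (b - a) * M).
  { apply abs_RInt_le_const; auto. intros t Ht. eapply Rle_trans; [apply Rabs_Im_le|auto]. }
  unfold Re, Im in *. lra.
Qed.

Lemma CInt_const (c : C) (a b : R) : CInt (fun _ => c) a b = (RtoC (b - a) * c)%C.
Proof.
  unfold CInt. rewrite !RInt_constR. destruct c as [p q].
  unfold RtoC, Cmult, Re, Im; cbn [fst snd]. f_equal; ring.
Qed.

Lemma cdiff_ccont F s t a b : cdiff F s t a b -> ccont (fun v => F s v) t.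
Proof.
  intros [H1 H2]. split.
  - apply (continuity_2d_pt_r (fun u v => Re (F u v))). eapply differentiable_pt_lim_continuity, H1.
  - apply (continuity_2d_pt_r (fun u v => Im (F u v))). eapply differentiable_pt_lim_continuity, H2.
Qed.

Lemma cdiff_eq F s t (a b a' b' : C) : cdiff F s t a b -> a = a' -> b = b' -> cdiff F s t a' b'.
Proof. intros H -> ->. exact H. Qed.

(** * Contour integrals along dilated circles *)

Section Rays.
Variables (f : C -> C) (w eta : C) (r : R).
Hypothesis Hr : 0 < r.
Hypothesis Heta : Cmod eta < r.

(** Seen from [w], the circle of radius [r] about [w + eta]; [|eta| < r] puts [w] inside it. *)
Definition arc (t : R) : C := (eta + r * eit t)%C.
(** The logarithmic derivative of [arc]: along [w + s * arc], the form [f dz / (z - w)] is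
    [f * arc_dlog dt] for every scale [s]. *)
Definition arc_dlog (t : R) : C := (r * (Ci * eit t) * / arc t)%C.

Lemma arc_neq0 t : arc t <> 0%C.
Proof.
  intros E. assert (Cmod (r * eit t) = r).
  { rewrite Cmod_mult, Cmod_R, Cmod_eit, Rabs_right; lra. }
  assert (E2 : (r * eit t)%C = (- eta)%C).
  { unfold arc in E. replace (r * eit t)%C with (eta + r * eit t - eta)%C by ring. rewrite E. ring. }
  rewrite E2, Cmod_opp in H. lra.
Qed.

Lemma cdiff_arc s t : cdiff (fun _ v => arc v) s t 0 (r * (Ci * eit t)).
Proof.
  eapply cdiff_eq.
  - apply (cdiff_plus (fun _ _ => eta) (fun _ v => r * eit v)%C). apply cdiff_const.
    apply (cdiff_mult (fun _ _ => RtoC r) (fun _ v => eit v)). apply cdiff_const. apply cdiff_eit.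
  - ring.
  - ring.
Qed.

Lemma cdiff_ray (s t : R) : cdiff (fun u v => w + u * arc v)%C s t (arc t) (s * (r * (Ci * eit t))).
Proof.
  eapply cdiff_eq.
  - apply (cdiff_plus (fun _ _ => w) (fun u v => u * arc v)%C). apply cdiff_const.
    apply (cdiff_mult (fun u _ => RtoC u) (fun _ v => arc v)). apply cdiff_fst. apply cdiff_arc.
  - ring.
  - ring.
Qed.

Lemma cdiff_arc_dlog s t : exists l, cdiff (fun _ v => arc_dlog v) s t 0 l.
Proof.
  eexists. eapply cdiff_eq.
  - apply (cdiff_mult (fun _ v => r * (Ci * eit v))%C (fun _ v => / arc v)%C).
    + apply (cdiff_mult (fun _ _ => RtoC r) (fun _ v => Ci * eit v)%C). apply cdiff_const.
      apply (cdiff_mult (fun _ _ => Ci) (fun _ v => eit v)). apply cdiff_const. apply cdiff_eit.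
    + apply (cdiff_comp Cinv (fun _ v => arc v)). apply cder_inv, arc_neq0. apply cdiff_arc.
  - ring.
  - reflexivity.
Qed.

Lemma arc_2PI : arc (2 * PI) = arc 0.
Proof. unfold arc. rewrite eit_2PI. reflexivity. Qed.

Lemma ccont_arc_dlog t : ccont arc_dlog t.
Proof. destruct (cdiff_arc_dlog 0 t) as [l H]. exact (cdiff_ccont (fun _ v => arc_dlog v) 0 t _ _ H). Qed.

Lemma ccont_ray (s t : R) : cdiffble f (w + s * arc t) ->
  ccont (fun v => f (w + s * arc v) * arc_dlog v)%C t.
Proof.
  intros [m Hm]. destruct (cdiff_arc_dlog s t) as [l Hl].
  eapply (cdiff_ccont (fun u v => f (w + u * arc v) * arc_dlog v)%C s t).
  apply (cdiff_mult (fun u v => f (w + u * arc v))%C (fun _ v => arc_dlog v)).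
  - apply (cdiff_comp f (fun u v => w + u * arc v)%C); [exact Hm|apply cdiff_ray].
  - exact Hl.
Qed.

(** In the coordinates [(s, t)] one has [dz / (z - w) = ds / s + arc_dlog dt]; the common mixed
    derivative is [f'] times the derivative of [arc]. *)
Lemma ray_forms (s t : R) (m : C) : s <> 0 -> cder f (w + s * arc t) m -> exists l1 l2 l3,
  cdiff (fun u v => f (w + u * arc v) * / u)%C s t l1 l2 /\
  cdiff (fun u v => f (w + u * arc v) * arc_dlog v)%C s t l2 l3.
Proof.
  intros Hs Hm.
  assert (Cs : RtoC s <> 0%C) by (intros E; apply Hs; injection E; auto).
  pose proof (cdiff_comp f (fun u v => w + u * arc v)%C s t m _ _ Hm (cdiff_ray s t)) as D.
  destruct (cdiff_arc_dlog s t) as [l Hl].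
  eexists. exists (m * (r * (Ci * eit t)))%C. eexists. split.
  - eapply cdiff_eq.
    + apply (cdiff_mult (fun u v => f (w + u * arc v))%C (fun u _ => / u)%C). exact D.
      apply (cdiff_comp Cinv (fun u _ => RtoC u)). apply cder_inv; exact Cs. apply cdiff_fst.
    + reflexivity.
    + field. exact Cs.
  - eapply cdiff_eq.
    + apply (cdiff_mult (fun u v => f (w + u * arc v))%C (fun _ v => arc_dlog v)). exact D. exact Hl.
    + unfold arc_dlog. field. apply arc_neq0.
    + reflexivity.
Qed.

(* [f dz / (z - w)] pulled back along [z = w + s * arc t] is a closed form whose [ds] part
   is [2 PI]-periodic in [t]. *)
Lemma ray_invariance (s1 s2 : R) : 0 < s1 <= s2 ->
  (forall s t : R, s1 <= s <= s2 -> cdiffble f (w + s * arc t)) ->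
  CInt (fun t => f (w + s1 * arc t) * arc_dlog t)%C 0 (2 * PI) =
  CInt (fun t => f (w + s2 * arc t) * arc_dlog t)%C 0 (2 * PI).
Proof.
  intros Hs Hf. pose proof PI_RGT_0 as Hpi.
  assert (K : forall p : C -> R, p = Re \/ p = Im ->
    circ (fun u v => p (f (w + u * arc v) * / u)%C) (fun u v => p (f (w + u * arc v) * arc_dlog v)%C)
      s1 s2 0 (2 * PI) = 0).
  { intros p Hp. apply goursat; try lra. intros s t H1 H2.
    destruct (Hf s t H1) as [m Hm].
    destruct (ray_forms s t m ltac:(lra) Hm) as (l1 & l2 & l3 & [A1 A2] & [B1 B2]).
    exists (p l1), (p l2), (p l3). destruct Hp as [-> | ->]; auto. }
  unfold circ in K. rewrite arc_2PI in K.
  pose proof (K Re (or_introl eq_refl)) as K1. pose proof (K Im (or_intror eq_refl)) as K2.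
  unfold CInt. f_equal; lra.
Qed.

(** By invariance the integral may be taken over the circle shrunk by [s], on which [f] is within
    [O(s)] of [f w]. *)
Lemma ray_limit :
  (forall s t : R, 0 <= s <= 1 -> cdiffble f (w + s * arc t)) ->
  (f w * CInt arc_dlog 0 (2 * PI) = CInt (fun t => f (w + arc t) * arc_dlog t) 0 (2 * PI))%C.
Proof.
  intros Hf. pose proof PI_RGT_0 as Hpi.
  assert (Lb : exists M, 0 < M /\ forall t, Cmod (arc_dlog t) <= M).
  { exists (r / (r - Cmod eta)). split. { apply Rdiv_lt_0_compat; lra. }
    intros t. unfold arc_dlog. rewrite !Cmod_mult, Cmod_inv by apply arc_neq0.
    rewrite Cmod_R, Cmod_Ci, Cmod_eit, Rabs_right by lra. unfold Rdiv.
    rewrite !Rmult_1_r. apply Rmult_le_compat_l; [lra|]. apply Rinv_le_contravar; [lra|].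
    assert (r <= Cmod (arc t) + Cmod eta); [|lra].
    replace r with (Cmod (r * eit t)) at 1 by (rewrite Cmod_mult, Cmod_R, Cmod_eit, Rabs_right; lra).
    replace (r * eit t)%C with (arc t + - eta)%C by (unfold arc; ring).
    eapply Rle_trans; [apply Cmod_triangle|]. rewrite Cmod_opp. lra. }
  destruct Lb as (M & HM & Lb).
  set (I := CInt (fun t => f (w + arc t) * arc_dlog t)%C 0 (2 * PI)).
  destruct (Hf 0 0 ltac:(lra)) as [m Hm].
  replace (w + 0 * arc 0)%C with w in Hm by ring.
  destruct (cder_bound _ _ _ Hm) as (d & Hd & Lip).
  set (K := 2 * (2 * PI) * ((Cmod m + 1) * (2 * r) * M)).
  assert (HK : 0 < K).
  { unfold K. pose proof (Cmod_ge_0 m). 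
    assert (0 < (Cmod m + 1) * (2 * r)) by (apply Rmult_lt_0_compat; lra).
    assert (0 < (Cmod m + 1) * (2 * r) * M) by (apply Rmult_lt_0_compat; lra). nra. }
  assert (arcB : forall t, Cmod (arc t) <= 2 * r).
  { intros t. unfold arc. eapply Rle_trans; [apply Cmod_triangle|].
    rewrite Cmod_mult, Cmod_R, Cmod_eit, Rabs_right; lra. }
  assert (Main : forall s, 0 < s -> s < 1 -> s * (2 * r) < d ->
    Cmod (I - f w * CInt arc_dlog 0 (2 * PI)) <= s * K).
  { intros s S0 S1 Sd.
    assert (E1 : I = CInt (fun t => f (w + s * arc t) * arc_dlog t)%C 0 (2 * PI)).
    { rewrite (ray_invariance s 1) by (try lra; intros; apply Hf; lra).
      unfold I. apply CInt_ext. intros t. replace (1 * arc t)%C with (arc t) by ring. reflexivity. }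
    rewrite E1. rewrite <- CInt_mul by (try lra; intros; apply ccont_arc_dlog).
    rewrite <- CInt_sub; try lra.
    2:{ intros t _. apply ccont_ray, Hf; lra. }
    2:{ intros t _. destruct (cdiff_arc_dlog 0 t) as [l Hl].
        eapply (cdiff_ccont (fun _ v => f w * arc_dlog v)%C 0 t).
        apply (cdiff_mult (fun _ _ => f w) (fun _ v => arc_dlog v)); [apply cdiff_const|exact Hl]. }
    eapply Rle_trans; [apply (CInt_bound _ _ _ (s * ((Cmod m + 1) * (2 * r) * M)))|].
    - lra.
    - intros t _. destruct (Hf s t ltac:(lra)) as [m' Hm']. destruct (cdiff_arc_dlog s t) as [l Hl].
      eapply (cdiff_ccont (fun u v => f (w + u * arc v) * arc_dlog v - f w * arc_dlog v)%C s t).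
      apply (cdiff_plus (fun u v => f (w + u * arc v) * arc_dlog v)%C (fun _ v => - (f w * arc_dlog v))%C).
      + apply (cdiff_mult (fun u v => f (w + u * arc v))%C (fun _ v => arc_dlog v)).
        * apply (cdiff_comp f (fun u v => w + u * arc v)%C); [exact Hm'|apply cdiff_ray].
        * exact Hl.
      + apply (cdiff_comp Copp (fun _ v => f w * arc_dlog v)%C).
        * instantiate (1 := (-(1))%C). intros eps He. exists 1. split; [lra|]. intros z _.
          match goal with |- Cmod ?e <= _ => replace e with (RtoC 0) by ring end. rewrite Cmod_0.
          pose proof (Cmod_ge_0 (z - f w * arc_dlog t)). nra.
        * apply (cdiff_mult (fun _ _ => f w) (fun _ v => arc_dlog v)); [apply cdiff_const|exact Hl].
    - intros t _. 
      replace (f (w + s * arc t) * arc_dlog t - f w * arc_dlog t)%C with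
        ((f (w + s * arc t) - f w) * arc_dlog t)%C by ring.
      rewrite Cmod_mult.
      assert (N : Cmod (w + s * arc t - w) <= s * (2 * r)).
      { replace (w + s * arc t - w)%C with (s * arc t)%C by ring.
        rewrite Cmod_mult, Cmod_R, Rabs_right by lra. apply Rmult_le_compat_l; [lra|apply arcB]. }
      specialize (Lip (w + s * arc t)%C ltac:(lra)).
      pose proof (Cmod_ge_0 m).
      replace (s * ((Cmod m + 1) * (2 * r) * M)) with ((Cmod m + 1) * (s * (2 * r)) * M) by ring.
      apply Rmult_le_compat; try apply Cmod_ge_0; [|apply Lb].
      eapply Rle_trans; [exact Lip|]. apply Rmult_le_compat_l; lra.
    - unfold K. right. ring. }
  assert (Z : Cmod (I - f w * CInt arc_dlog 0 (2 * PI)) = 0).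
  { set (D := Cmod (I - f w * CInt arc_dlog 0 (2 * PI))) in *.
    assert (D0 : 0 <= D) by apply Cmod_ge_0.
    destruct (Rle_lt_dec D 0) as [|Dp]; [lra|exfalso].
    (* Small enough for [s * K <= D / 2], which contradicts [D <= s * K]. *)
    set (s := Rmin (1/2) (Rmin (d / (4 * r)) (D / (2 * K)))).
    assert (s0 : 0 < s) by (unfold s; repeat apply Rmin_case; try lra; apply Rdiv_lt_0_compat; lra).
    assert (s1 : s <= 1/2) by apply Rmin_l.
    assert (s2 : s <= d / (4 * r)) by (eapply Rle_trans; [apply Rmin_r|apply Rmin_l]).
    assert (s3 : s <= D / (2 * K)) by (eapply Rle_trans; [apply Rmin_r|apply Rmin_r]).
    assert (s2' : s * (4 * r) <= d).
    { replace d with (d / (4 * r) * (4 * r)) by (field; lra). apply Rmult_le_compat_r; lra. }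
    assert (s3' : s * (2 * K) <= D).
    { replace D with (D / (2 * K) * (2 * K)) by (field; lra). apply Rmult_le_compat_r; lra. }
    specialize (Main s s0 ltac:(lra) ltac:(nra)). nra. }
  apply Cmod_eq_0 in Z. symmetry. apply Ceq_minus. exact Z.
Qed.
End Rays.

(** The case [w = eta = 0], [r = 1] of [ray_limit], where [arc_dlog] is the constant [i]. It
    supplies the winding number of an off-centre circle without a complex logarithm. *)
Lemma mean_inv_linear (c : C) : Cmod c < 1 ->
  CInt (fun t => / (1 - c * eit t))%C 0 (2 * PI) = RtoC (2 * PI).
Proof.
  intros Hc. pose proof PI_RGT_0 as Hpi.
  assert (N : forall s t : R, 0 <= s <= 1 -> (1 - c * (0 + s * arc 0 1 t))%C <> 0%C).
  { intros s t Hs E. assert (E1 : (c * (s * eit t))%C = 1%C).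
    { unfold arc in E.
      transitivity (1 - (1 - c * (0 + s * (0 + 1 * eit t))))%C; [ring|]. rewrite E. ring. }
    assert (E2 : Cmod (c * (s * eit t)) = 1) by (rewrite E1; apply Cmod_1).
    rewrite !Cmod_mult, Cmod_R, Cmod_eit, Rabs_right in E2 by lra.
    pose proof (Cmod_ge_0 c). nra. }
  pose proof (ray_limit (fun z => / (1 - c * z))%C 0 0 1 ltac:(lra) ltac:(rewrite Cmod_0; lra)) as L.
  assert (D : forall t, arc_dlog 0 1 t = Ci).
  { intros t. unfold arc_dlog, arc. field. replace (0 + 1 * eit t)%C with (eit t) by ring. apply eit_neq0. }
  assert (H : forall s t : R, 0 <= s <= 1 -> cdiffble (fun z => / (1 - c * z))%C (0 + s * arc 0 1 t)).
  { intros s t Hs. apply (cdiffble_inv (fun z => 1 - c * z)%C); [|apply N; exact Hs].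
    apply (cdiffble_plus (fun _ => 1%C) (fun z => - (c * z))%C); [apply cdiffble_const|].
    destruct (cdiffble_mult (fun _ => (- c)%C) (fun z => z) (0 + s * arc 0 1 t)%C (cdiffble_const _ _) (cdiffble_id _)) as [l Hl].
    exists l. intros eps He. destruct (Hl eps He) as (d & Hd & K). exists d; split; auto.
    intros w Hw. specialize (K w Hw). eapply Rle_trans; [right|exact K]. f_equal. ring. }
  specialize (L H). rewrite (CInt_ext _ (fun _ => Ci) _ _ D) in L. rewrite CInt_const in L.
  rewrite (CInt_ext _ (fun t => Ci * / (1 - c * eit t))%C) in L.
  2:{ intros t. rewrite D. unfold arc. rewrite Cmult_comm. f_equal. f_equal. ring. }
  rewrite CInt_mul in L.
  - replace (CInt (fun t => / (1 - c * eit t))%C 0 (2 * PI)) with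
      (/ Ci * (Ci * CInt (fun t => / (1 - c * eit t)) 0 (2 * PI)))%C
      by (field; apply Ci_nz).
    rewrite <- L. replace (2 * PI - 0) with (2 * PI) by ring.
    replace (1 - c * 0)%C with (RtoC 1) by ring. field. apply Ci_nz.
  - lra.
  - intros t _. 
    assert (Q : ccont (fun v => / (1 - c * (0 + 1 * arc 0 1 v)) * arc_dlog 0 1 v)%C t).
    { apply (ccont_ray (fun z => / (1 - c * z))%C 0 0 1); try lra.
      rewrite Cmod_0; lra. apply H. lra. }
    assert (E : forall v, (/ (1 - c * (0 + 1 * arc 0 1 v)) * arc_dlog 0 1 v)%C = (Ci * / (1 - c * eit v))%C).
    { intros v. rewrite D. rewrite Cmult_comm. f_equal. f_equal. unfold arc. ring. }
    destruct Q as [Q1 Q2]. split.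
    + eapply continuous_ext; [|exact Q2]. intros v. cbv beta. rewrite E. eqR. cparts. ring.
    + assert (Q1' : continuous (fun t => - Re (/ (1 - c * (0 + 1 * arc 0 1 t)) * arc_dlog 0 1 t)%C) t)
        by (apply (continuous_opp (V := R_NormedModule)); exact Q1).
      eapply continuous_ext; [|exact Q1']. intros v. cbv beta. rewrite E. eqR. cparts. ring.
Qed.

Lemma ccont_mul f g t : ccont f t -> ccont g t -> ccont (fun v => f v * g v)%C t.
Proof.
  intros [F1 F2] [G1 G2]. split.
  - apply (continuous_minus (V := R_NormedModule) (fun v => Re (f v) * Re (g v)) (fun v => Im (f v) * Im (g v)));
      apply (continuous_mult (K := R_AbsRing)); auto.
  - apply (continuous_plus (V := R_NormedModule) (fun v => Re (f v) * Im (g v)) (fun v => Im (f v) * Re (g v)));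
      apply (continuous_mult (K := R_AbsRing)); auto.
Qed.

Lemma ccont_const (c : C) t : ccont (fun _ => c) t.
Proof. split; apply continuous_const. Qed.

Lemma ccont_ext f g t : (forall v, f v = g v) -> ccont f t -> ccont g t.
Proof.
  intros E [F1 F2]. split; [eapply continuous_ext; [|exact F1]|eapply continuous_ext; [|exact F2]];
  intros v; cbv beta; rewrite E; reflexivity.
Qed.

Lemma ccont_add f g t : ccont f t -> ccont g t -> ccont (fun v => f v + g v)%C t.
Proof.
  intros [F1 F2] [G1 G2]. split.
  - apply (continuous_plus (V := R_NormedModule) (fun v => Re (f v)) (fun v => Re (g v))); auto.
  - apply (continuous_plus (V := R_NormedModule) (fun v => Im (f v)) (fun v => Im (g v))); auto.
Qed.

Lemma ccont_conj f t : ccont f t -> ccont (fun v => Cconj (f v)) t.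
Proof.
  intros [F1 F2]. split; [exact F1|].
  apply (continuous_opp (V := R_NormedModule) (fun v => Im (f v))). exact F2.
Qed.

Lemma ccont_eit t : ccont eit t.
Proof. exact (cdiff_ccont (fun _ v => eit v) 0 t _ _ (cdiff_eit 0 t)). Qed.

Lemma ccont_comp_cdiffble f g s t l1 l2 : cdiffble f (g s t) -> cdiff g s t l1 l2 ->
  ccont (fun v => f (g s v)) t.
Proof.
  intros [m Hm] Hg. exact (cdiff_ccont _ _ _ _ _ (cdiff_comp f g s t m l1 l2 Hm Hg)).
Qed.

Lemma CInt_conj f a b : a <= b -> (forall t, a <= t <= b -> ccont f t) ->
  CInt (fun t => Cconj (f t)) a b = Cconj (CInt f a b).
Proof.
  intros ab Hf. destruct (ccont_ex f a b ab Hf) as [E1 E2].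
  unfold CInt, Cconj. cbn [fst snd Re Im]. f_equal.
  exact (RInt_opp (V := R_CompleteNormedModule) (fun t => Im (f t)) a b E2).
Qed.

Lemma CInt_stencil g1 g2 g3 g4 g0 a b : a <= b -> (forall t, ccont g1 t) -> (forall t, ccont g2 t) ->
  (forall t, ccont g3 t) -> (forall t, ccont g4 t) -> (forall t, ccont g0 t) ->
  CInt (fun t => g1 t + g2 t + g3 t + g4 t - 4 * g0 t)%C a b =
  (CInt g1 a b + CInt g2 a b + CInt g3 a b + CInt g4 a b - 4 * CInt g0 a b)%C.
Proof.
  intros ab H1 H2 H3 H4 H0.
  assert (A2 : forall t, ccont (fun t => g1 t + g2 t)%C t) by (intros; apply ccont_add; auto).
  assert (A3 : forall t, ccont (fun t => g1 t + g2 t + g3 t)%C t) by (intros; apply (ccont_add (fun t => g1 t + g2 t)%C); auto).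
  assert (A4 : forall t, ccont (fun t => g1 t + g2 t + g3 t + g4 t)%C t) by (intros; apply (ccont_add (fun t => g1 t + g2 t + g3 t)%C); auto).
  rewrite (CInt_sub (fun t => g1 t + g2 t + g3 t + g4 t)%C (fun t => 4 * g0 t)%C); auto.
  - rewrite (CInt_add (fun t => g1 t + g2 t + g3 t)%C g4), (CInt_add (fun t => g1 t + g2 t)%C g3), (CInt_add g1 g2), CInt_mul; auto.
  - intros. apply (ccont_mul (fun _ => RtoC 4)); auto. apply ccont_const.
Qed.

(** * Cauchy's integral formula and difference estimates in a disc *)

(** This is [r e^{it} / (r e^{it} - h)], the Cauchy kernel with respect to [dt]; the conjugate
    stands for the inverse of [e^{it}]. *)
Definition ckernel (r : R) (h : C) (t : R) : C := (/ (1 - h / r * Cconj (eit t)))%C.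

Section Cauchy.
Variables (f : C -> C) (z0 : C) (r : R).
Hypothesis Hr : 0 < r.
Hypothesis Hf : forall z, Cmod (z - z0) <= r -> cdiffble f z.

Let rC : RtoC r <> 0%C.
Proof. intros E. injection E. lra. Qed.

Lemma ckernel_small h : Cmod h < r -> forall t,
  Cmod (h / r * Cconj (eit t)) = Cmod h / r /\ (1 - h / r * Cconj (eit t))%C <> 0%C.
Proof.
  intros Hh t.
  assert (E : Cmod (h / r * Cconj (eit t)) = Cmod h / r).
  { rewrite Cmod_mult, Cmod_conj, Cmod_eit, Cmod_div, Cmod_R, Rabs_right by (auto; lra). lra. }
  split; [exact E|]. intros N.
  assert (N1 : (h / r * Cconj (eit t))%C = 1%C).
  { transitivity (1 - (1 - h / r * Cconj (eit t)))%C; [ring|]. rewrite N. ring. }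
  rewrite N1, Cmod_1 in E.
  assert (Cmod h / r < 1) by (apply Rmult_lt_reg_r with r; auto; unfold Rdiv; rewrite Rmult_assoc, Rinv_l; lra).
  lra.
Qed.

Lemma arc_dlog_ckernel h t : Cmod h < r -> arc_dlog (- h) r t = (Ci * ckernel r h t)%C.
Proof.
  intros Hh. pose proof (arc_neq0 (- h) r Hr ltac:(rewrite Cmod_opp; exact Hh) t) as N1.
  destruct (ckernel_small h Hh t) as [_ N2].
  unfold arc_dlog, ckernel, arc in *.
  assert (E : (- h + r * eit t = r * eit t * (1 - h / r * Cconj (eit t)))%C).
  { transitivity (r * eit t - h * (eit t * Cconj (eit t)))%C; [rewrite eit_conj; ring|]. field. auto. }
  rewrite E. generalize dependent (1 - h / r * Cconj (eit t))%C. intros D ND _. field.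
  repeat split; auto. apply eit_neq0.
Qed.

Lemma ccont_ckernel h t : Cmod h < r -> ccont (ckernel r h) t.
Proof.
  intros Hh. apply (ccont_ext (fun t => / Ci * arc_dlog (- h) r t)%C).
  - intros v. rewrite arc_dlog_ckernel by auto. field. apply Ci_nz.
  - apply ccont_mul; [apply ccont_const|apply ccont_arc_dlog; auto]. rewrite Cmod_opp; auto.
Qed.

(** Conjugation turns the kernel into the integrand of [mean_inv_linear]. *)
Lemma CInt_ckernel h : Cmod h < r -> CInt (ckernel r h) 0 (2 * PI) = RtoC (2 * PI).
Proof.
  intros Hh. pose proof PI_RGT_0.
  assert (M : Cmod (Cconj (h / r)) < 1).
  { rewrite Cmod_conj, Cmod_div, Cmod_R, Rabs_right by (auto; lra).
    apply Rmult_lt_reg_r with r; auto. unfold Rdiv; rewrite Rmult_assoc, Rinv_l; lra. }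
  rewrite (CInt_ext _ (fun t => Cconj (/ (1 - Cconj (h / r) * eit t)))%C).
  - rewrite CInt_conj.
    + rewrite mean_inv_linear by exact M. unfold Cconj, RtoC. simpl. f_equal. ring.
    + lra.
    + intros t _. apply (ccont_ext (fun t => Cconj (ckernel r h t))).
      * intros v. unfold ckernel. destruct (ckernel_small h Hh v) as [_ N].
        rewrite Cinv_conj by exact N. rewrite Cminus_conj, Cmult_conj, Cconj_conj. f_equal. f_equal.
        unfold Cconj, RtoC; simpl; f_equal; ring.
      * apply ccont_conj, ccont_ckernel, Hh.
  - intros t. unfold ckernel. destruct (ckernel_small h Hh t) as [_ N].
    assert (E : (1 - h / r * Cconj (eit t))%C = Cconj (1 - Cconj (h / r) * eit t)).
    { rewrite Cminus_conj, Cmult_conj, Cconj_conj. f_equal. unfold Cconj, RtoC; simpl; f_equal; ring. }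
    rewrite E. symmetry. apply Cinv_conj. intros Z. apply N. rewrite E, Z. unfold Cconj, RtoC; simpl; f_equal; ring.
Qed.

Lemma ccont_circle t : ccont (fun t => f (z0 + r * eit t)%C) t.
Proof.
  apply (ccont_comp_cdiffble f (fun _ v => z0 + r * eit v)%C 0 t (0 + (0 * eit t + r * 0)) (0 + (0 * eit t + r * (Ci * eit t)))).
  - apply Hf. replace (z0 + r * eit t - z0)%C with (r * eit t)%C by ring.
    rewrite Cmod_mult, Cmod_R, Cmod_eit, Rabs_right; lra.
  - apply (cdiff_plus (fun _ _ => z0) (fun _ v => r * eit v)%C). apply cdiff_const.
    apply (cdiff_mult (fun _ _ => RtoC r) (fun _ v => eit v)). apply cdiff_const. apply cdiff_eit.
Qed.

Theorem cauchy_formula h : Cmod h < r ->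
  (RtoC (2 * PI) * f (z0 + h) = CInt (fun t => f (z0 + r * eit t) * ckernel r h t) 0 (2 * PI))%C.
Proof.
  intros Hh. pose proof PI_RGT_0.
  (* Base point [z0 + h] with offset [- h]: at scale 1 the curve is the circle of radius [r] about
     [z0]. *)
  pose proof (ray_limit f (z0 + h) (- h) r Hr ltac:(rewrite Cmod_opp; exact Hh)) as L.
  assert (A : forall s t : R, 0 <= s <= 1 -> cdiffble f (z0 + h + s * arc (- h) r t)).
  { intros s t Hs. apply Hf. unfold arc.
    replace (z0 + h + s * (- h + r * eit t) - z0)%C with (RtoC (1 - s) * h + RtoC (s * r) * eit t)%C
      by (rewrite RtoC_minus, RtoC_mult; ring).
    eapply Rle_trans; [apply Cmod_triangle|]. rewrite !Cmod_mult, !Cmod_R, Cmod_eit.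
    rewrite !Rabs_right by nra. nra. }
  specialize (L A).
  rewrite (CInt_ext _ (fun t => Ci * ckernel r h t)%C) in L by (intros; apply arc_dlog_ckernel; auto).
  rewrite CInt_mul in L by (try lra; intros; apply ccont_ckernel; auto).
  rewrite CInt_ckernel in L by auto.
  rewrite (CInt_ext (fun t => f (z0 + h + arc (- h) r t) * arc_dlog (- h) r t)%C
    (fun t => Ci * (f (z0 + r * eit t) * ckernel r h t))%C) in L.
  2:{ intros t. rewrite arc_dlog_ckernel by auto. unfold arc.
      replace (z0 + h + (- h + r * eit t))%C with (z0 + r * eit t)%C by ring. ring. }
  rewrite CInt_mul in L by (first [lra|intros; apply ccont_mul; [apply ccont_circle|apply ccont_ckernel; auto]]).
  transitivity (/ Ci * (f (z0 + h) * (Ci * RtoC (2 * PI))))%C; [field; apply Ci_nz|].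
  rewrite L. field. apply Ci_nz.
Qed.

Variable B : R.
Hypothesis HB : forall z, Cmod (z - z0) <= r -> Cmod (f z) <= B.

Lemma circle_pairing_bound k M : (forall t, ccont k t) -> (forall t, Cmod (k t) <= M) ->
  Cmod (CInt (fun t => f (z0 + r * eit t) * k t)%C 0 (2 * PI)) <= 2 * (2 * PI) * (B * M).
Proof.
  intros Hk HM. pose proof PI_RGT_0. eapply Rle_trans.
  - apply (CInt_bound _ _ _ (B * M)); [lra|intros; apply ccont_mul; [apply ccont_circle|apply Hk]|].
    intros t _. rewrite Cmod_mult. apply Rmult_le_compat; try apply Cmod_ge_0; auto.
    apply HB. replace (z0 + r * eit t - z0)%C with (r * eit t)%C by ring.
    rewrite Cmod_mult, Cmod_R, Cmod_eit, Rabs_right; lra.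
  - right. ring.
Qed.

(** The kernels at [h] and at 0 differ by [q / (1 - q)] with [|q| <= 1 / 2], hence by at most
    [2 |q|]. *)
Lemma cauchy_lipschitz h : Cmod h <= r / 2 -> Cmod (f (z0 + h) - f z0) <= 4 * B * (Cmod h / r).
Proof.
  intros Hh. pose proof PI_RGT_0.
  pose proof (cauchy_formula h ltac:(lra)) as C1.
  pose proof (cauchy_formula 0 ltac:(rewrite Cmod_0; lra)) as C0.
  assert (c0 : forall h t, Cmod h <= r / 2 -> ccont (fun t => f (z0 + r * eit t) * ckernel r h t)%C t).
  { intros h' t H'. apply ccont_mul; [apply ccont_circle|apply ccont_ckernel; lra]. }
  assert (E : (RtoC (2 * PI) * (f (z0 + h) - f z0))%C = 
     CInt (fun t => f (z0 + r * eit t) * (ckernel r h t - 1))%C 0 (2 * PI)).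
  { rewrite (CInt_ext _ (fun t => f (z0 + r * eit t) * ckernel r h t - f (z0 + r * eit t) * ckernel r 0 t)%C).
    - rewrite CInt_sub; try lra; [|intros; apply c0; lra|intros; apply c0; rewrite Cmod_0; lra].
      rewrite <- C1, <- C0. replace (z0 + 0)%C with z0 by ring. ring.
    - intros t. replace (ckernel r 0 t) with (RtoC 1); [ring|].
      unfold ckernel. replace (1 - 0 / r * Cconj (eit t))%C with (RtoC 1) by (field; auto). field. }
  assert (Bd : forall t, Cmod (ckernel r h t - 1) <= 2 * (Cmod h / r)).
  { intros t. destruct (ckernel_small h ltac:(lra) t) as [E1 N]. unfold ckernel.
    set (q := (h / r * Cconj (eit t))%C) in *.
    replace (/ (1 - q) - 1)%C with (q * / (1 - q))%C by (field; auto).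
    rewrite Cmod_mult, Cmod_inv by auto. rewrite E1.
    assert (q1 : Cmod h / r <= 1 / 2).
    { apply Rmult_le_reg_r with r; auto. unfold Rdiv. rewrite Rmult_assoc, Rinv_l; lra. }
    assert (q2 : 1 / 2 <= Cmod (1 - q)).
    { assert (1 <= Cmod (1 - q) + Cmod q).
      { rewrite <- Cmod_1 at 1. replace (RtoC 1) with ((1 - q) + q)%C at 1 by ring. apply Cmod_triangle. }
      lra. }
    rewrite Rmult_comm. apply Rmult_le_compat_r; [rewrite <- E1; apply Cmod_ge_0|].
    replace 2 with (/ (1 / 2)) by lra. apply Rinv_le_contravar; lra. }
  assert (F : Cmod (RtoC (2 * PI) * (f (z0 + h) - f z0)) <= 2 * (2 * PI) * (B * (2 * (Cmod h / r)))).
  { rewrite E. apply circle_pairing_bound; auto. intros t.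
    apply (ccont_ext (fun t => ckernel r h t + (-(1)))%C); [intros; ring|].
    apply ccont_add; [apply ccont_ckernel; lra|apply ccont_const]. }
  rewrite Cmod_mult, Cmod_R, Rabs_right in F by lra.
  apply Rmult_le_reg_l with (2 * PI); [lra|]. eapply Rle_trans; [exact F|]. right. ring.
Qed.

(* The kernels of the four points [i^k h] sum up to [4 / (1 - q^4)]. *)
Lemma cauchy_stencil h : Cmod h <= r / 2 ->
  Cmod (f (z0 + h) + f (z0 - h) + f (z0 + Ci * h) + f (z0 - Ci * h) - 4 * f z0)
    <= 16 * B * (Cmod h / r) ^ 3.
Proof.
  intros Hh. pose proof PI_RGT_0.
  assert (mo : Cmod (- h) = Cmod h) by apply Cmod_opp.
  assert (mi : Cmod (Ci * h) = Cmod h) by (rewrite Cmod_mult, Cmod_Ci; ring).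
  assert (mio : Cmod (- (Ci * h)) = Cmod h) by (rewrite Cmod_opp; exact mi).
  assert (c0 : forall h t, Cmod h <= r / 2 -> ccont (fun t => f (z0 + r * eit t) * ckernel r h t)%C t).
  { intros h' t H'. apply ccont_mul; [apply ccont_circle|apply ccont_ckernel; lra]. }
  set (k := fun t => (ckernel r h t + ckernel r (- h) t + ckernel r (Ci * h) t + ckernel r (- (Ci * h)) t - 4)%C).
  assert (E : (RtoC (2 * PI) * (f (z0 + h) + f (z0 - h) + f (z0 + Ci * h) + f (z0 - Ci * h) - 4 * f z0))%C = 
     CInt (fun t => f (z0 + r * eit t) * k t)%C 0 (2 * PI)).
  { rewrite (CInt_ext _ (fun t => f (z0 + r * eit t) * ckernel r h t + f (z0 + r * eit t) * ckernel r (- h) t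
       + f (z0 + r * eit t) * ckernel r (Ci * h) t + f (z0 + r * eit t) * ckernel r (- (Ci * h)) t
       - 4 * (f (z0 + r * eit t) * ckernel r 0 t))%C).
    2:{ intros t. unfold k. replace (ckernel r 0 t) with (RtoC 1). ring.
        unfold ckernel. replace (1 - 0 / r * Cconj (eit t))%C with (RtoC 1) by (field; auto). field. }
    assert (z : Cmod 0 <= r / 2) by (rewrite Cmod_0; lra).
    rewrite (CInt_stencil (fun t => f (z0 + r * eit t) * ckernel r h t)%C
      (fun t => f (z0 + r * eit t) * ckernel r (- h) t)%C (fun t => f (z0 + r * eit t) * ckernel r (Ci * h) t)%C
      (fun t => f (z0 + r * eit t) * ckernel r (- (Ci * h)) t)%C (fun t => f (z0 + r * eit t) * ckernel r 0 t)%C);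
      [|lra|intros; apply c0; lra|intros; apply c0; lra|intros; apply c0; lra|intros; apply c0; lra|intros; apply c0; lra].
    rewrite <- !cauchy_formula by lra. replace (z0 + 0)%C with z0 by ring.
    unfold Cminus. ring. }
  assert (Bd : forall t, Cmod (k t) <= 8 * (Cmod h / r) ^ 3).
  { intros t. destruct (ckernel_small h ltac:(lra) t) as [E1 N1]. 
    destruct (ckernel_small (- h) ltac:(lra) t) as [_ N2].
    destruct (ckernel_small (Ci * h) ltac:(lra) t) as [_ N3].
    destruct (ckernel_small (- (Ci * h)) ltac:(lra) t) as [_ N4]. unfold k, ckernel.
    set (q := (h / r * Cconj (eit t))%C) in *.
    replace (- h / r * Cconj (eit t))%C with (- q)%C in * by (unfold q; field; auto).
    replace (Ci * h / r * Cconj (eit t))%C with (Ci * q)%C in * by (unfold q; field; auto).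
    replace (- (Ci * h) / r * Cconj (eit t))%C with (- (Ci * q))%C in * by (unfold q; field; auto).
    assert (q1 : Cmod h / r <= 1 / 2).
    { apply Rmult_le_reg_r with r; auto. unfold Rdiv. rewrite Rmult_assoc, Rinv_l; lra. }
    assert (q0 : 0 <= Cmod h / r) by (rewrite <- E1; apply Cmod_ge_0).
    assert (I2 : (Ci * Ci = - (1))%C) by (unfold Ci, Cmult, Copp, RtoC; cbn; f_equal; ring).
    assert (q2 : 1 / 2 <= Cmod (1 - q ^ 4)).
    { assert (1 <= Cmod (1 - q ^ 4) + Cmod (q ^ 4)).
      { rewrite <- Cmod_1 at 1. replace (RtoC 1) with ((1 - q ^ 4) + q ^ 4)%C at 1 by ring. apply Cmod_triangle. }
      rewrite Cmod_pow, E1 in H0. assert (P4 : (Cmod h / r) ^ 4 <= (1 / 2) ^ 4) by (apply pow_incr; lra).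
      lra. }
    assert (N : (1 - q ^ 4)%C <> 0%C) by (apply Cmod_gt_0; lra).
    assert (S1 : (/ (1 - q) + / (1 - - q))%C = (2 * / (1 - q * q))%C).
    { field. repeat split; auto; try (replace (1 - q * q)%C with ((1 - q) * (1 - - q))%C by ring; apply Cmult_neq_0; auto). }
    assert (S2 : (/ (1 - Ci * q) + / (1 - - (Ci * q)))%C = (2 * / (1 + q * q))%C).
    { assert (P : ((1 - Ci * q) * (1 - - (Ci * q)) = 1 + q * q)%C).
      { transitivity (1 - (Ci * Ci) * (q * q))%C; [ring|]. rewrite I2. ring. }
      rewrite <- P. field. repeat split; auto. }
    assert (M1 : (1 - q * q)%C <> 0%C).
    { intros Z. apply N. replace (1 - q ^ 4)%C with ((1 - q * q) * (1 + q * q))%C by (simpl; ring). rewrite Z; ring. }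
    assert (M2 : (1 + q * q)%C <> 0%C).
    { intros Z. apply N. replace (1 - q ^ 4)%C with ((1 - q * q) * (1 + q * q))%C by (simpl; ring). rewrite Z; ring. }
    replace (/ (1 - q) + / (1 - - q) + / (1 - Ci * q) + / (1 - - (Ci * q)) - 4)%C with
      ((/ (1 - q) + / (1 - - q)) + (/ (1 - Ci * q) + / (1 - - (Ci * q))) - 4)%C by ring.
    rewrite S1, S2.
    replace (2 * / (1 - q * q) + 2 * / (1 + q * q) - 4)%C with (4 * q ^ 4 * / (1 - q ^ 4))%C.
    2:{ replace (1 - q ^ 4)%C with ((1 - q * q) * (1 + q * q))%C by (simpl; ring). field. auto. }
    rewrite !Cmod_mult, Cmod_inv, Cmod_pow, E1, Cmod_R, Rabs_right by (auto; lra).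
    assert (I : / Cmod (1 - q ^ 4) <= 2).
    { replace 2 with (/ (1 / 2)) by lra. apply Rinv_le_contravar; lra. }
    set (x := Cmod h / r) in *.
    apply Rle_trans with (4 * x ^ 4 * 2).
    - apply Rmult_le_compat_l; auto. apply Rmult_le_pos; [lra|]. apply pow_le; auto.
    - assert (0 <= x ^ 3) by (apply pow_le; auto). replace (x ^ 4) with (x * x ^ 3) by ring. nra. }
  assert (F : Cmod (RtoC (2 * PI) * (f (z0 + h) + f (z0 - h) + f (z0 + Ci * h) + f (z0 - Ci * h) - 4 * f z0))
     <= 2 * (2 * PI) * (B * (8 * (Cmod h / r) ^ 3))).
  { rewrite E. apply circle_pairing_bound; auto. intros t.
    apply (ccont_ext (fun t => ckernel r h t + (ckernel r (- h) t + (ckernel r (Ci * h) t + (ckernel r (- (Ci * h)) t + (-(4))))))%C);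
      [intros; unfold k; ring|].
    apply ccont_add; [apply ccont_ckernel; lra|]. apply ccont_add; [apply ccont_ckernel; lra|].
    apply ccont_add; [apply ccont_ckernel; lra|]. apply ccont_add; [apply ccont_ckernel; lra|apply ccont_const]. }
  rewrite Cmod_mult, Cmod_R, Rabs_right in F by lra.
  apply Rmult_le_reg_l with (2 * PI); [lra|]. eapply Rle_trans; [exact F|]. right. ring.
Qed.
End Cauchy.

(** * Subharmonicity through the five-point stencil *)

(** The four neighbours are [z + e], [z - e], [z + i e], [z - i e] with [e = a + i b]. All
    orientations are included so that the class of functions below is invariant under rotations. *)
Definition stencil (U : R -> R -> R) (x y a b : R) : R :=
  U (x + a) (y + b) + U (x - a) (y - b) + U (x - b) (y + a) + U (x + b) (y - a) - 4 * U x y.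

(** A nonnegative Laplacian up to an error of third order, uniformly over [D]: such an error is
    negligible against [h ^ 2] and survives integration over a parameter. [D] restricts the centre
    of the stencil, not its neighbours. *)
Definition subh (U : R -> R -> R) (D : R -> R -> Prop) : Prop :=
  exists K delta, 0 <= K /\ 0 < delta /\ forall x y, D x y ->
  forall h a b, 0 < h < delta -> Rabs a <= h -> Rabs b <= h -> - (K * h ^ 3) <= stencil U x y a b.

Lemma ln1p_ge_cubic s : - (1/2) <= s <= 1/2 -> s - s ^ 2 / 2 - Rabs s ^ 3 <= ln (1 + s).
Proof.
  intros Hs. destruct (Rle_lt_dec 0 s) as [P|P].
  - assert (0 <= Rabs s ^ 3) by (apply pow_le, Rabs_pos).
    set (g := fun u => ln (1 + u) - u + u ^ 2 / 2).
    assert (g 0 <= g s).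
    { destruct (MVT_gen g 0 s (fun u => / (1 + u) - 1 + u)) as [c [Hc E]].
      - intros u Hu. rewrite Rmin_left, Rmax_right in Hu by lra. unfold g. auto_derive; [lra|]. field. lra.
      - intros u Hu. rewrite Rmin_left, Rmax_right in Hu by lra.
        apply continuity_pt_filterlim, (ex_derive_continuous (V := R_NormedModule)). unfold g. auto_derive. lra.
      - rewrite Rmin_left, Rmax_right in Hc by lra.
        assert (0 <= / (1 + c) - 1 + c).
        { replace (/ (1 + c) - 1 + c) with (c * c * / (1 + c)) by (field; lra).
          apply Rmult_le_pos; [nra|]. left. apply Rinv_0_lt_compat. lra. }
        nra. }
    unfold g in H0. rewrite Rplus_0_r, ln_1 in H0. lra.
  - rewrite (Rabs_left s) by lra.
    set (g := fun u => ln (1 + u) - u + u ^ 2 / 2 - u ^ 3).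
    assert (g 0 <= g s).
    { destruct (MVT_gen g s 0 (fun u => / (1 + u) - 1 + u - 3 * u ^ 2)) as [c [Hc E]].
      - intros u Hu. rewrite Rmin_left, Rmax_right in Hu by lra. unfold g. auto_derive; [lra|]. field. lra.
      - intros u Hu. rewrite Rmin_left, Rmax_right in Hu by lra.
        apply continuity_pt_filterlim, (ex_derive_continuous (V := R_NormedModule)). unfold g. auto_derive. lra.
      - rewrite Rmin_left, Rmax_right in Hc by lra.
        assert (/ (1 + c) - 1 + c - 3 * c ^ 2 <= 0).
        { replace (/ (1 + c) - 1 + c - 3 * c ^ 2) with (c * c * (/ (1 + c) - 3)) by (field; lra).
          assert (/ (1 + c) <= 2) by (replace 2 with (/ (1/2)) by lra; apply Rinv_le_contravar; lra).
          assert (0 <= c * c) by nra. nra. }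
        nra. }
    unfold g in H. rewrite Rplus_0_r, ln_1 in H. replace ((- s) ^ 3) with (- s ^ 3) by ring. lra.
Qed.

Lemma Cmod_sq (z : C) : Cmod z ^ 2 = Re z ^ 2 + Im z ^ 2.
Proof. apply Cmod2_alt. Qed.

(** Second-order expansion of [Re log (1 + d)], from [2 ln |1 + d| = ln (1 + s)] with
    [s = 2 Re d + |d|^2]. *)
Lemma ln_Cmod_1p (d : C) : Cmod d <= 1/8 ->
  0 < Cmod (1 + d) /\ Re d - Re (d * d) / 2 - 20 * Cmod d ^ 3 <= ln (Cmod (1 + d)).
Proof.
  intros Hd.
  assert (P : 0 < Cmod (1 + d)).
  { assert (1 <= Cmod (1 + d) + Cmod d).
    { rewrite <- Cmod_1 at 1. replace (RtoC 1) with ((1 + d) + - d)%C at 1 by ring.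
      eapply Rle_trans; [apply Cmod_triangle|]. rewrite Cmod_opp. lra. }
    lra. }
  split; auto.
  pose proof (Cmod_ge_0 d) as m0. pose proof (re_le_Cmod d) as mp.
  set (m := Cmod d) in *. set (p := Re d) in *.
  set (s := 2 * p + m ^ 2).
  assert (E : Cmod (1 + d) ^ 2 = 1 + s).
  { rewrite Cmod_sq. unfold s, m. rewrite Cmod_sq. unfold p. destruct d. cbn. ring. }
  assert (Rabs s <= 3 * m).
  { apply Rabs_le. apply Rabs_le_between in mp. unfold s. simpl. nra. }
  assert (S : - (1/2) <= s <= 1/2) by (apply Rabs_le_between in H; lra).
  pose proof (ln1p_ge_cubic s S) as L.
  assert (L2 : ln (1 + s) = 2 * ln (Cmod (1 + d))).
  { rewrite <- E. replace (Cmod (1 + d) ^ 2) with (Cmod (1 + d) * Cmod (1 + d)) by ring.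
    rewrite ln_mult by auto. ring. }
  assert (R2 : Re (d * d) = 2 * p ^ 2 - m ^ 2).
  { unfold m. rewrite Cmod_sq. unfold p. destruct d. cbn. ring. }
  assert (C3 : Rabs s ^ 3 <= 27 * m ^ 3).
  { replace (27 * m ^ 3) with ((3 * m) ^ 3) by ring. apply pow_incr. split; auto. apply Rabs_pos. }
  assert (M3 : 0 <= m ^ 3) by (apply pow_le; auto).
  assert (T : s ^ 2 <= 4 * p ^ 2 + 5 * m ^ 3).
  { unfold s. apply Rabs_le_between in mp.
    replace ((2 * p + m ^ 2) ^ 2) with (4 * p ^ 2 + 4 * p * m ^ 2 + m * m ^ 3) by ring.
    assert (4 * p * m ^ 2 <= 4 * m ^ 3). { replace (4 * m ^ 3) with (4 * m * m ^ 2) by ring. apply Rmult_le_compat_r; [apply pow_le; auto|lra]. }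
    nra. }
  rewrite R2. unfold s in *. lra.
Qed.

(** The truncation at [c] keeps the function finite and continuous at the zeros of [f]; the maximum
    of a subharmonic function and a constant stays subharmonic. *)
Definition lnmax (c : R) (f : C -> C) (x y : R) : R := ln (Rmax c (Cmod (f (x, y)))).

Lemma lnmax_ge c f x y : 0 < c -> ln c <= lnmax c f x y.
Proof. intros Hc. apply ln_le; auto. apply Rmax_l. Qed.

(** Where [|f| <= c], the value at the centre is the minimal one. Elsewhere
    [f (z0 + w) = f0 (1 + d w)], and the sums of [d] and of [d^2] over the four neighbours are
    stencils of the holomorphic functions [f / f0] and [(f - f0)^2 / f0^2], hence of third order. *)
Lemma lnmax_subh (f : C -> C) (c r B : R) (D : R -> R -> Prop) : 0 < c -> 0 < r ->
  (forall x y, D x y -> forall z, Cmod (z - (x, y)) <= r -> cdiffble f z /\ Cmod (f z) <= B) ->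
  subh (lnmax c f) D.
Proof.
  intros Hc Hr H.
  set (B' := Rmax B c).
  assert (B0 : 0 < B') by (eapply Rlt_le_trans; [exact Hc|apply Rmax_r]).
  set (A := 4 * B' / (c * r)).
  assert (A0 : 0 < A) by (unfold A; apply Rdiv_lt_0_compat; nra).
  (* The summands stem from the stencil of [f], from half the stencil of [(f - f0)^2], and from the
     four cubic errors [20 (2 A h)^3]; [A] bounds [|d w| / |w|]. *)
  set (K := 8 * (16 * B' / (c * r ^ 3) + (64 * B' ^ 2) / (c ^ 2 * r ^ 3) / 2 + 80 * A ^ 3)).
  assert (r3 : 0 < r ^ 3) by (apply pow_lt; auto).
  assert (c2 : 0 < c ^ 2) by (apply pow_lt; auto).
  assert (T1 : 0 < 16 * B' / (c * r ^ 3)) by (apply Rdiv_lt_0_compat; nra).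
  assert (T2 : 0 < (64 * B' ^ 2) / (c ^ 2 * r ^ 3)) by (apply Rdiv_lt_0_compat; [assert (0 < B' ^ 2) by (apply pow_lt; auto); lra|nra]).
  assert (T3 : 0 < A ^ 3) by (apply pow_lt; auto).
  exists K, (Rmin (r / 4) (1 / (16 * A))).
  split; [unfold K; lra|]. split. { apply Rmin_case; [lra|apply Rdiv_lt_0_compat; lra]. }
  intros x y Dxy h a b [h0 hd] Ha Hb.
  assert (h1 : h < r / 4) by (eapply Rlt_le_trans; [exact hd|apply Rmin_l]).
  assert (h2 : h < 1 / (16 * A)) by (eapply Rlt_le_trans; [exact hd|apply Rmin_r]).
  assert (h2' : A * (2 * h) <= 1 / 8).
  { assert (h * (16 * A) <= 1 / (16 * A) * (16 * A)) by (apply Rmult_le_compat_r; lra).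
    replace (1 / (16 * A) * (16 * A)) with 1 in H0 by (field; lra). lra. }
  assert (h3 : 0 < h ^ 3) by (apply pow_lt; auto).
  specialize (H x y Dxy). set (z0 := (x, y) : C) in *.
  set (e := (a, b) : C).
  assert (He : Cmod e <= 2 * h).
  { eapply Rle_trans; [apply Cmod_le_abs|]. unfold e; cbn. lra. }
  assert (E1 : (x + a, y + b) = (z0 + e)%C) by reflexivity.
  assert (E2 : (x - a, y - b) = (z0 - e)%C) by reflexivity.
  assert (E3 : (x - b, y + a) = (z0 + Ci * e)%C).
  { unfold z0, e. cparts. f_equal; ring. }
  assert (E4 : (x + b, y - a) = (z0 - Ci * e)%C).
  { unfold z0, e. cparts. f_equal; ring. }
  unfold stencil, lnmax. rewrite E1, E2, E3, E4. fold z0.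
  destruct (Rle_lt_dec (Cmod (f z0)) c) as [L|L].
  { rewrite (Rmax_left c (Cmod (f z0))) by exact L.
    assert (Q : forall z, ln c <= ln (Rmax c (Cmod (f z)))) by (intros; apply ln_le; auto; apply Rmax_l).
    pose proof (Q (z0 + e)%C). pose proof (Q (z0 - e)%C). pose proof (Q (z0 + Ci * e)%C). pose proof (Q (z0 - Ci * e)%C).
    assert (0 <= K * h ^ 3) by (apply Rmult_le_pos; [unfold K; lra|lra]). lra. }
  rewrite (Rmax_right c (Cmod (f z0))) by lra.
  set (f0 := f z0) in *. assert (N0 : f0 <> 0%C) by (apply Cmod_gt_0; lra).
  assert (Hd : forall z, Cmod (z - z0) <= r -> cdiffble f z) by (intros; apply H; auto).
  assert (Hb' : forall z, Cmod (z - z0) <= r -> Cmod (f z) <= B').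
  { intros z Hz. eapply Rle_trans; [apply H; auto|apply Rmax_l]. }
  set (d := fun w : C => ((f (z0 + w) - f0) / f0)%C).
  assert (cinv : / Cmod f0 <= / c) by (apply Rinv_le_contravar; lra).
  assert (ic : 0 < / c) by (apply Rinv_0_lt_compat; auto).
  assert (if0 : 0 < / Cmod f0) by (apply Rinv_0_lt_compat; lra).
  assert (dB : forall w, Cmod w <= 2 * h -> Cmod (d w) <= A * (2 * h)).
  { intros w Hw. unfold d. rewrite Cmod_div by auto.
    pose proof (cauchy_lipschitz f z0 r Hr Hd B' Hb' w ltac:(lra)) as Lp. fold f0 in Lp.
    replace (A * (2 * h)) with ((4 * B' * ((2 * h) / r)) * / c) by (unfold A; field; lra).
    apply Rmult_le_compat; try apply Cmod_ge_0; auto; [left; auto|].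
    eapply Rle_trans; [exact Lp|]. apply Rmult_le_compat_l; [lra|].
    apply Rmult_le_compat_r; [left; apply Rinv_0_lt_compat; auto|auto]. }
  assert (Lw : forall w, Cmod w <= 2 * h ->
     ln (Cmod f0) + (Re (d w) - Re (d w * d w) / 2 - 20 * (A * (2 * h)) ^ 3) <= ln (Rmax c (Cmod (f (z0 + w)%C)))).
  { intros w Hw. pose proof (dB w Hw) as Bw.
    destruct (ln_Cmod_1p (d w) ltac:(lra)) as [P1 P2].
    assert (Ef : f (z0 + w)%C = (f0 * (1 + d w))%C) by (unfold d; field; auto).
    assert (Cmod (d w) ^ 3 <= (A * (2 * h)) ^ 3) by (apply pow_incr; split; [apply Cmod_ge_0|auto]).
    apply Rle_trans with (ln (Cmod (f (z0 + w)%C))).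
    - rewrite Ef, Cmod_mult, ln_mult; auto; lra.
    - apply ln_le; [|apply Rmax_r]. rewrite Ef, Cmod_mult. apply Rmult_lt_0_compat; auto. lra. }
  assert (M1 : Cmod (- e) <= 2 * h) by (rewrite Cmod_opp; auto).
  assert (M2 : Cmod (Ci * e) <= 2 * h) by (rewrite Cmod_mult, Cmod_Ci; lra).
  assert (M3 : Cmod (- (Ci * e)) <= 2 * h) by (rewrite Cmod_opp; auto).
  pose proof (Lw e He) as W1. pose proof (Lw (- e)%C M1) as W2.
  pose proof (Lw (Ci * e)%C M2) as W3. pose proof (Lw (- (Ci * e))%C M3) as W4.
  fold (Cminus z0 e) in W2. fold (Cminus z0 (Ci * e)) in W4.
  assert (eb : (Cmod e / r) ^ 3 <= 8 * h ^ 3 / r ^ 3).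
  { replace (8 * h ^ 3 / r ^ 3) with ((2 * h / r) ^ 3) by (field; lra). apply pow_incr. split.
    - apply Rdiv_le_0_compat; auto. apply Cmod_ge_0.
    - apply Rmult_le_compat_r; [left; apply Rinv_0_lt_compat; auto|auto]. }
  assert (S1 : Rabs (Re (d e) + Re (d (- e)%C) + Re (d (Ci * e)%C) + Re (d (- (Ci * e))%C)) <= 16 * B' / (c * r ^ 3) * (8 * h ^ 3)).
  { pose proof (cauchy_stencil f z0 r Hr Hd B' Hb' e ltac:(lra)) as St. fold f0 in St.
    assert (Es : (d e + d (- e) + d (Ci * e) + d (- (Ci * e)))%C =
       ((f (z0 + e) + f (z0 - e) + f (z0 + Ci * e) + f (z0 - Ci * e) - 4 * f0) / f0)%C).
    { unfold d. fold (Cminus z0 e). fold (Cminus z0 (Ci * e)). field. auto. }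
    replace (Re (d e) + Re (d (- e)%C) + Re (d (Ci * e)%C) + Re (d (- (Ci * e))%C)) with
      (Re (d e + d (- e) + d (Ci * e) + d (- (Ci * e)))%C) by reflexivity.
    eapply Rle_trans; [apply re_le_Cmod|]. rewrite Es, Cmod_div by auto.
    replace (16 * B' / (c * r ^ 3) * (8 * h ^ 3)) with ((16 * B' * (8 * h ^ 3 / r ^ 3)) * / c) by (field; lra).
    apply Rmult_le_compat; try apply Cmod_ge_0; auto; [left; auto|].
    eapply Rle_trans; [exact St|]. apply Rmult_le_compat_l; [lra|auto]. }
  assert (S2 : Rabs (Re (d e * d e)%C + Re (d (- e) * d (- e))%C + Re (d (Ci * e) * d (Ci * e))%C + Re (d (- (Ci * e)) * d (- (Ci * e)))%C)
      <= (64 * B' ^ 2) / (c ^ 2 * r ^ 3) * (8 * h ^ 3)).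
  { set (g := fun z => ((f z + - f0) * (f z + - f0))%C).
    assert (Gd : forall z, Cmod (z - z0) <= r -> cdiffble g z).
    { intros z Hz. apply (cdiffble_mult (fun z => f z + - f0)%C (fun z => f z + - f0)%C);
      (apply (cdiffble_plus f (fun _ => - f0)%C); [auto|apply cdiffble_const]). }
    assert (Gb : forall z, Cmod (z - z0) <= r -> Cmod (g z) <= 4 * B' ^ 2).
    { intros z Hz. unfold g. rewrite Cmod_mult.
      assert (Q : Cmod (f z + - f0) <= 2 * B').
      { eapply Rle_trans; [apply Cmod_triangle|]. rewrite Cmod_opp. pose proof (Hb' z Hz).
        assert (Cmod f0 <= B'). { apply Hb'. replace (z0 - z0)%C with (RtoC 0) by ring. rewrite Cmod_0. lra. }
        lra. }
      replace (4 * B' ^ 2) with ((2 * B') * (2 * B')) by ring.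
      apply Rmult_le_compat; auto; apply Cmod_ge_0. }
    pose proof (cauchy_stencil g z0 r Hr Gd (4 * B' ^ 2) Gb e ltac:(lra)) as St.
    assert (Es : (d e * d e + d (- e) * d (- e) + d (Ci * e) * d (Ci * e) + d (- (Ci * e)) * d (- (Ci * e)))%C =
       ((g (z0 + e) + g (z0 - e) + g (z0 + Ci * e) + g (z0 - Ci * e) - 4 * g z0) / (f0 * f0))%C).
    { unfold d, g. fold f0. fold (Cminus z0 e). fold (Cminus z0 (Ci * e)). field. auto. }
    match goal with |- Rabs ?q <= _ => replace q with
      (Re (d e * d e + d (- e) * d (- e) + d (Ci * e) * d (Ci * e) + d (- (Ci * e)) * d (- (Ci * e)))%C) by reflexivity end.
    eapply Rle_trans; [apply re_le_Cmod|]. rewrite Es, Cmod_div, (Cmod_mult f0 f0) by (apply Cmult_neq_0; auto).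
    replace ((64 * B' ^ 2) / (c ^ 2 * r ^ 3) * (8 * h ^ 3)) with ((16 * (4 * B' ^ 2) * (8 * h ^ 3 / r ^ 3)) * / (c * c)) by (field; lra).
    apply Rmult_le_compat; try apply Cmod_ge_0.
    - left. apply Rinv_0_lt_compat. nra.
    - eapply Rle_trans; [exact St|]. apply Rmult_le_compat_l; [|auto]. assert (0 < B' ^ 2) by (apply pow_lt; auto). lra.
    - apply Rinv_le_contravar; nra. }
  apply Rabs_le_between in S1, S2.
  replace (K * h ^ 3) with (16 * B' / (c * r ^ 3) * (8 * h ^ 3) + (64 * B' ^ 2) / (c ^ 2 * r ^ 3) * (8 * h ^ 3) / 2 + 80 * (A * (2 * h)) ^ 3)
    by (unfold K; field; lra).
  lra.
Qed.

(** * Maximum principle *)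

Definition cont2 (f : R -> R -> R) : Prop := forall x y, continuity_2d_pt f x y.

(** Compactness of the rectangle as a positive lower bound on locally chosen radii.
    [compactness_value_2d] yields its point only under a double negation. *)
Lemma gauge_cover (a b c d : R) (Pr : R -> R -> R -> Prop) :
  (forall u v, a <= u <= b -> c <= v <= d -> exists e, 0 < e /\ Pr u v e) ->
  exists e0, 0 < e0 /\ forall x y, a <= x <= b -> c <= y <= d ->
  exists u v e, a <= u <= b /\ c <= v <= d /\ Pr u v e /\ Rabs (x - u) < e /\ Rabs (y - v) < e /\ e0 <= e.
Proof.
  intros H.
  assert (G : forall u v, exists e : posreal, (a <= u <= b /\ c <= v <= d) -> Pr u v e).
  { intros u v. destruct (excluded_middle_informative (a <= u <= b /\ c <= v <= d)) as [[I1 I2]|N].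
    - destruct (H u v I1 I2) as (e & He & P). exists (mkposreal e He). auto.
    - exists (mkposreal 1 Rlt_0_1). tauto. }
  set (g := fun u v => proj1_sig (constructive_indefinite_description _ (G u v))).
  assert (gP : forall u v, a <= u <= b /\ c <= v <= d -> Pr u v (g u v)).
  { intros u v. unfold g. destruct constructive_indefinite_description; auto. }
  destruct (compactness_value_2d a b c d g) as [e0 He0].
  exists e0. split; [apply cond_pos|]. intros x y Hx Hy.
  destruct (Classical_Prop.NNPP _ (He0 x y Hx Hy)) as (u & v & U & V & X & Y & E).
  exists u, v, (g u v). repeat split; auto; try tauto.
Qed.

(** The local bound is encoded as [/ e], so that the uniform radius [e0] gives the bound [/ e0]. *)
Lemma cont_bounded (f : R -> R -> R) a b c d :
  (forall x y, a <= x <= b -> c <= y <= d -> continuity_2d_pt f x y) ->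
  exists M, 0 < M /\ forall x y, a <= x <= b -> c <= y <= d -> Rabs (f x y) <= M.
Proof.
  intros H.
  destruct (gauge_cover a b c d (fun u v e => 
     (forall x y, Rabs (x - u) < e -> Rabs (y - v) < e -> Rabs (f x y) <= / e))) as (e0 & E0 & G).
  - intros u v Hu Hv. destruct (H u v Hu Hv (mkposreal 1 Rlt_0_1)) as [e He]. simpl in He.
    assert (P : 0 < / (Rabs (f u v) + 1)) by (apply Rinv_0_lt_compat; pose proof (Rabs_pos (f u v)); lra).
    exists (Rmin e (/ (Rabs (f u v) + 1))). split; [apply Rmin_case; auto; apply cond_pos|].
    intros x y Hx Hy. pose proof (Rmin_l e (/ (Rabs (f u v) + 1))). pose proof (Rmin_r e (/ (Rabs (f u v) + 1))).
    specialize (He x y ltac:(lra) ltac:(lra)).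
    apply Rle_trans with (Rabs (f u v) + 1).
    + pose proof (Rabs_triang_inv (f x y) (f u v)). lra.
    + apply Rle_trans with (/ / (Rabs (f u v) + 1)); [rewrite Rinv_inv; lra|].
      apply Rinv_le_contravar; auto. apply Rmin_case; auto; apply cond_pos.
  - exists (/ e0). split; [apply Rinv_0_lt_compat; auto|]. intros x y Hx Hy.
    destruct (G x y Hx Hy) as (u & v & e & _ & _ & P & X & Y & E).
    eapply Rle_trans; [apply P; auto|]. apply Rinv_le_contravar; auto.
Qed.

(** [k <= 0] carves a closed region out of the rectangle. If the supremum [m] were not attained, [f]
    would be at most [m - e] on the region near every point, with [e] uniform by compactness. *)
Lemma evt2 (k f : R -> R -> R) a b c d x0 y0 :
  (forall x y, a <= x <= b -> c <= y <= d -> continuity_2d_pt f x y) ->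
  (forall x y, a <= x <= b -> c <= y <= d -> continuity_2d_pt k x y) ->
  a <= x0 <= b -> c <= y0 <= d -> k x0 y0 <= 0 ->
  exists xm ym, a <= xm <= b /\ c <= ym <= d /\ k xm ym <= 0 /\
  forall x y, a <= x <= b -> c <= y <= d -> k x y <= 0 -> f x y <= f xm ym.
Proof.
  intros Hf Hk X0 Y0 K0.
  destruct (cont_bounded f a b c d Hf) as (M & HM & BM).
  destruct (completeness (fun z => exists x y, a <= x <= b /\ c <= y <= d /\ k x y <= 0 /\ z = f x y)) as [m [m1 m2]].
  { exists M. intros z (x & y & Hx & Hy & _ & ->). pose proof (BM x y Hx Hy) as Q. apply Rabs_le_between in Q. lra. }
  { exists (f x0 y0), x0, y0. auto. }
  apply Classical_Prop.NNPP. intros N.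
  assert (S : forall x y, a <= x <= b -> c <= y <= d -> k x y <= 0 -> f x y < m).
  { intros x y Hx Hy Hk'. destruct (Rle_lt_or_eq_dec (f x y) m) as [|E]; auto.
    - apply m1. exists x, y. auto.
    - exfalso. apply N. exists x, y. repeat split; auto; try tauto. intros x' y' ? ? ?. rewrite E. apply m1.
      exists x', y'. auto. }
  destruct (gauge_cover a b c d (fun u v e => forall x y, Rabs (x - u) < e -> Rabs (y - v) < e ->
     k x y <= 0 -> f x y <= m - e)) as (e0 & E0 & G).
  - intros u v Hu Hv. destruct (Rle_lt_dec (k u v) 0) as [Q|Q].
    + specialize (S u v Hu Hv Q).
      assert (P : 0 < (m - f u v) / 2) by lra.
      destruct (Hf u v Hu Hv (mkposreal _ P)) as [e He]. simpl in He.
      exists (Rmin e ((m - f u v) / 2)). split; [apply Rmin_case; auto; apply cond_pos|].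
      intros x y Hx Hy _. pose proof (Rmin_l e ((m - f u v) / 2)). pose proof (Rmin_r e ((m - f u v) / 2)).
      specialize (He x y ltac:(lra) ltac:(lra)). apply Rabs_lt_between in He. lra.
    + destruct (Hk u v Hu Hv (mkposreal _ Q)) as [e He]. simpl in He.
      exists e. split; [apply cond_pos|]. intros x y Hx Hy Z. specialize (He x y Hx Hy).
      apply Rabs_lt_between in He. lra.
  - assert (m <= m - e0); [|lra]. apply m2. intros z (x & y & Hx & Hy & Hk' & ->).
    destruct (G x y Hx Hy) as (u & v & e & _ & _ & P & X & Y & E).
    specialize (P x y X Y Hk'). lra.
Qed.

(** The Laplacian at a point as the limit of axis-parallel stencils: this is what gets compared at a
    maximum of a difference. *)
Definition Lap (W : R -> R -> R) (x y L : R) : Prop :=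
  forall eps, 0 < eps -> exists delta, 0 < delta /\
  forall h, 0 < h < delta -> Rabs (stencil W x y h 0 - L * h ^ 2) <= eps * h ^ 2.

(** The mean value theorem for [g (x + t) + g (x - t) - L t^2]; its derivative is [o(t)] as soon as
    [g'] is differentiable at [x]. *)
Lemma second_difference (g g' : R -> R) x L :
  locally x (fun u => is_derive g u (g' u)) -> is_derive g' x L ->
  forall eps, 0 < eps -> exists delta, 0 < delta /\
  forall h, 0 < h < delta -> Rabs (g (x + h) + g (x - h) - 2 * g x - L * h ^ 2) <= eps * h ^ 2.
Proof.
  intros [d0 H0] H1 eps He.
  apply is_derive_Reals in H1. destruct (H1 (eps / 2) ltac:(lra)) as [d1 H2].
  exists (Rmin d0 d1). split; [apply Rmin_case; apply cond_pos|].
  intros h [h0 hd]. pose proof (Rmin_l d0 d1). pose proof (Rmin_r d0 d1).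
  set (phi := fun t => g (x + t) + g (x - t) - L * t ^ 2).
  destruct (MVT_gen phi 0 h (fun t => g' (x + t) - g' (x - t) - 2 * L * t)) as [t [Ht E]].
  - intros t Ht. rewrite Rmin_left, Rmax_right in Ht by lra. unfold phi.
    assert (D1 : is_derive g (x + t) (g' (x + t))).
    { apply H0. change (Rabs (x + t - x) < d0). replace (x + t - x) with t by ring. rewrite Rabs_right; lra. }
    assert (D2 : is_derive g (x - t) (g' (x - t))).
    { apply H0. change (Rabs (x - t - x) < d0). replace (x - t - x) with (- t) by ring. rewrite Rabs_left; lra. }
    auto_derive.
    + split; [|split; [|auto]]; [exists (g' (x + t)); auto|exists (g' (x - t)); auto].
    + replace (Derive (fun x0 : R => g x0) (x + t)) with (g' (x + t)) by (symmetry; apply is_derive_unique; auto).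
      replace (Derive (fun x0 : R => g x0) (x + - t)) with (g' (x - t)) by (symmetry; apply is_derive_unique; auto).
      ring.
  - intros t Ht. rewrite Rmin_left, Rmax_right in Ht by lra. 
    apply continuity_pt_filterlim, (ex_derive_continuous (V := R_NormedModule)). unfold phi.
    auto_derive. split; [|split; [|auto]].
    + exists (g' (x + t)). apply H0. change (Rabs (x + t - x) < d0). replace (x + t - x) with t by ring. rewrite Rabs_right; lra.
    + exists (g' (x - t)). apply H0. change (Rabs (x - t - x) < d0). replace (x - t - x) with (- t) by ring. rewrite Rabs_left1; lra.
  - rewrite Rmin_left, Rmax_right in Ht by lra.
    assert (T : Rabs (g' (x + t) - g' (x - t) - 2 * L * t) <= eps * h).
    { destruct (Req_EM_T t 0) as [->|Nt].
      - rewrite Rplus_0_r, Rminus_0_r. replace (g' x - g' x - 2 * L * 0) with 0 by ring. rewrite Rabs_R0. nra.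
      - assert (A1 : Rabs (g' (x + t) - g' x - L * t) <= eps / 2 * t).
        { specialize (H2 t Nt). rewrite Rabs_right in H2 by lra. specialize (H2 ltac:(lra)).
          replace (g' (x + t) - g' x - L * t) with (((g' (x + t) - g' x) / t - L) * t) by (field; auto).
          rewrite Rabs_mult, (Rabs_right t) by lra. apply Rmult_le_compat_r; lra. }
        assert (A2 : Rabs (g' (x - t) - g' x + L * t) <= eps / 2 * t).
        { specialize (H2 (- t) ltac:(lra)). rewrite Rabs_Ropp, Rabs_right in H2 by lra. specialize (H2 ltac:(lra)).
          fold (Rminus x t) in H2.
          replace (g' (x - t) - g' x + L * t) with (- (((g' (x - t) - g' x) / - t - L) * t)) by (field; lra).
          rewrite Rabs_Ropp, Rabs_mult, (Rabs_right t) by lra. apply Rmult_le_compat_r; lra. }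
        apply Rabs_le_between in A1, A2. apply Rabs_le. nra. }
    unfold phi in E. rewrite Rplus_0_r, !Rminus_0_r in E.
    replace (g (x + h) + g (x - h) - 2 * g x - L * h ^ 2) with ((g' (x + t) - g' (x - t) - 2 * L * t) * h)
      by (rewrite <- E; ring).
    rewrite Rabs_mult, (Rabs_right h) by lra. replace (eps * h ^ 2) with (eps * h * h) by ring.
    apply Rmult_le_compat_r; lra.
Qed.

Lemma Lap_intro (W : R -> R -> R) (Wx Wy : R -> R) x y Lx Ly :
  locally x (fun u => is_derive (fun u => W u y) u (Wx u)) -> is_derive Wx x Lx ->
  locally y (fun v => is_derive (fun v => W x v) v (Wy v)) -> is_derive Wy y Ly ->
  Lap W x y (Lx + Ly).
Proof.
  intros A1 A2 B1 B2 eps He.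
  destruct (second_difference _ _ _ _ A1 A2 (eps / 2) ltac:(lra)) as (d1 & P1 & Q1).
  destruct (second_difference _ _ _ _ B1 B2 (eps / 2) ltac:(lra)) as (d2 & P2 & Q2).
  exists (Rmin d1 d2). split; [apply Rmin_case; auto|]. intros h [h0 hd].
  pose proof (Rmin_l d1 d2). pose proof (Rmin_r d1 d2).
  specialize (Q1 h ltac:(lra)). specialize (Q2 h ltac:(lra)). cbv beta in *.
  unfold stencil. rewrite !Rplus_0_r, !Rminus_0_r.
  apply Rabs_le_between in Q1, Q2. apply Rabs_le. lra.
Qed.

Lemma Lap_plus W1 W2 x y L1 L2 : Lap W1 x y L1 -> Lap W2 x y L2 ->
  Lap (fun u v => W1 u v + W2 u v) x y (L1 + L2).
Proof.
  intros A B eps He.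
  destruct (A (eps / 2) ltac:(lra)) as (d1 & P1 & Q1). destruct (B (eps / 2) ltac:(lra)) as (d2 & P2 & Q2).
  exists (Rmin d1 d2). split; [apply Rmin_case; auto|]. intros h [h0 hd].
  pose proof (Rmin_l d1 d2). pose proof (Rmin_r d1 d2).
  specialize (Q1 h ltac:(lra)). specialize (Q2 h ltac:(lra)). 
  unfold stencil in *. apply Rabs_le_between in Q1, Q2. apply Rabs_le. lra.
Qed.

Lemma Lap_scal W x y L k : Lap W x y L -> Lap (fun u v => k * W u v) x y (k * L).
Proof.
  intros A eps He.
  assert (K : 0 < Rabs k + 1) by (pose proof (Rabs_pos k); lra).
  destruct (A (eps / (Rabs k + 1))) as (d1 & P1 & Q1); [apply Rdiv_lt_0_compat; lra|].
  exists d1. split; auto. intros h hd. specialize (Q1 h hd).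
  replace (stencil (fun u v => k * W u v) x y h 0 - k * L * h ^ 2) with (k * (stencil W x y h 0 - L * h ^ 2))
    by (unfold stencil; ring).
  rewrite Rabs_mult.
  assert (0 <= h ^ 2) by (apply pow2_ge_0).
  apply Rle_trans with ((Rabs k + 1) * (eps / (Rabs k + 1) * h ^ 2)).
  - apply Rmult_le_compat; try apply Rabs_pos; auto. lra.
  - right. field. lra.
Qed.

(** At an interior maximum of [U - W] the stencil of [U] is at most that of [W]; the former is at
    least [- K h^3], the latter at most [L / 2 * h^2] with [L < 0]. *)
Theorem max_principle (k U W : R -> R -> R) a b c d :
  (forall x y, a <= x <= b -> c <= y <= d -> continuity_2d_pt U x y) ->
  (forall x y, a <= x <= b -> c <= y <= d -> continuity_2d_pt W x y) ->
  (forall x y, a <= x <= b -> c <= y <= d -> continuity_2d_pt k x y) ->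
  subh U (fun x y => a < x < b /\ c < y < d /\ k x y < 0) ->
  (forall x y, a < x < b -> c < y < d -> k x y < 0 -> exists L, L < 0 /\ Lap W x y L) ->
  (forall x y, a <= x <= b -> c <= y <= d -> k x y <= 0 ->
     x = a \/ x = b \/ y = c \/ y = d \/ k x y = 0 -> U x y <= W x y) ->
  forall x y, a <= x <= b -> c <= y <= d -> k x y <= 0 -> U x y <= W x y.
Proof.
  intros CU CW Ck (K & d0 & K0 & D0 & HU) HL HB x y Hx Hy Hk.
  destruct (evt2 k (fun x y => U x y - W x y) a b c d x y) as (p & q & Hp & Hq & Hkp & Max); auto.
  { intros. apply continuity_2d_pt_minus; auto. }
  specialize (Max x y Hx Hy Hk) as Mx. simpl in Mx.
  assert (Z : U p q - W p q <= 0); [|lra].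
  destruct (Req_EM_T p a) as [E|Na]; [enough (U p q <= W p q) by lra; apply HB; tauto|].
  destruct (Req_EM_T p b) as [E|Nb]; [enough (U p q <= W p q) by lra; apply HB; tauto|].
  destruct (Req_EM_T q c) as [E|Nc]; [enough (U p q <= W p q) by lra; apply HB; tauto|].
  destruct (Req_EM_T q d) as [E|Nd]; [enough (U p q <= W p q) by lra; apply HB; tauto|].
  destruct (Req_EM_T (k p q) 0) as [E|Nk]; [enough (U p q <= W p q) by lra; apply HB; tauto|].
  exfalso.
  assert (kn : 0 < - k p q) by lra.
  destruct (HL p q ltac:(lra) ltac:(lra) ltac:(lra)) as (L & HL0 & HLap).
  destruct (HLap (- L / 2) ltac:(lra)) as (d1 & D1 & Q1).
  destruct (Ck p q Hp Hq (mkposreal _ kn)) as [d2 Q2]. simpl in Q2.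
  (* Below this radius [K * h < - L / 2], so the cubic error cannot compensate the Laplacian. *)
  set (d3 := - L / (2 * (K + 1))).
  assert (D3 : 0 < d3) by (apply Rdiv_lt_0_compat; lra).
  set (m := Rmin (Rmin (Rmin d0 d1) (Rmin d2 d3)) (Rmin (Rmin (p - a) (b - p)) (Rmin (q - c) (d - q)))).
  assert (M : m <= d0 /\ m <= d1 /\ m <= d2 /\ m <= d3 /\ m <= p - a /\ m <= b - p /\ m <= q - c /\ m <= d - q /\ 0 < m).
  { unfold m. pose proof (cond_pos d2).
    repeat split.
    - eapply Rle_trans; [apply Rmin_l|]. eapply Rle_trans; [apply Rmin_l|apply Rmin_l].
    - eapply Rle_trans; [apply Rmin_l|]. eapply Rle_trans; [apply Rmin_l|apply Rmin_r].
    - eapply Rle_trans; [apply Rmin_l|]. eapply Rle_trans; [apply Rmin_r|apply Rmin_l].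
    - eapply Rle_trans; [apply Rmin_l|]. eapply Rle_trans; [apply Rmin_r|apply Rmin_r].
    - eapply Rle_trans; [apply Rmin_r|]. eapply Rle_trans; [apply Rmin_l|apply Rmin_l].
    - eapply Rle_trans; [apply Rmin_r|]. eapply Rle_trans; [apply Rmin_l|apply Rmin_r].
    - eapply Rle_trans; [apply Rmin_r|]. eapply Rle_trans; [apply Rmin_r|apply Rmin_l].
    - eapply Rle_trans; [apply Rmin_r|]. eapply Rle_trans; [apply Rmin_r|apply Rmin_r].
    - repeat apply Rmin_case; lra. }
  destruct M as (m0 & m1 & m2 & m3 & m4 & m5 & m6 & m7 & m8).
  set (h := m / 2). assert (h0 : 0 < h < m) by (unfold h; lra).
  specialize (Q1 h ltac:(lra)).
  specialize (HU p q ltac:(lra) h h 0 ltac:(lra) ltac:(rewrite Rabs_right; lra) ltac:(rewrite Rabs_R0; lra)).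
  assert (NB : forall u v, Rabs (u - p) <= h -> Rabs (v - q) <= h -> U u v - W u v <= U p q - W p q).
  { intros u v Hu Hv. specialize (Q2 u v ltac:(lra) ltac:(lra)). apply Rabs_lt_between in Q2.
    apply Rabs_le_between in Hu, Hv. apply Max; lra. }
  assert (S : stencil U p q h 0 <= stencil W p q h 0).
  { unfold stencil. rewrite !Rplus_0_r, !Rminus_0_r.
    pose proof (NB (p + h) q ltac:(apply Rabs_le; lra) ltac:(apply Rabs_le; lra)).
    pose proof (NB (p - h) q ltac:(apply Rabs_le; lra) ltac:(apply Rabs_le; lra)).
    pose proof (NB p (q + h) ltac:(apply Rabs_le; lra) ltac:(apply Rabs_le; lra)).
    pose proof (NB p (q - h) ltac:(apply Rabs_le; lra) ltac:(apply Rabs_le; lra)). lra. }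
  apply Rabs_le_between in Q1.
  assert (F : - (K * h ^ 3) <= L / 2 * h ^ 2) by lra.
  assert (h2 : 0 < h ^ 2) by (apply pow_lt; lra).
  assert (F2 : - L / 2 <= K * h).
  { apply Rmult_le_reg_r with (h ^ 2); auto. replace (K * h * h ^ 2) with (K * h ^ 3) by ring. lra. }
  assert (h3 : h < d3) by lra.
  assert (F3 : (K + 1) * h < - L / 2).
  { replace (- L / 2) with ((K + 1) * d3) by (unfold d3; field; lra). apply Rmult_lt_compat_l; lra. }
  lra.
Qed.

(** * Averages of subharmonic functions *)

Lemma cont2_unif U r eps : cont2 U -> 0 < eps -> exists delta, 0 < delta /\
  forall x y u v, Rabs x <= r -> Rabs y <= r -> Rabs u <= r -> Rabs v <= r ->
  Rabs (u - x) < delta -> Rabs (v - y) < delta -> Rabs (U u v - U x y) < eps.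
Proof.
  intros H He.
  destruct (uniform_continuity_2d U (- r) r (- r) r (fun x y _ _ => H x y) (mkposreal eps He)) as [d Hd].
  exists d. split; [apply cond_pos|]. intros x y u v X Y U' V A B.
  apply Rabs_le_between in X, Y, U', V. apply Hd; auto.
Qed.

Lemma avg_cont (G : R -> R -> R -> R) a b : a <= b ->
  (forall x y t, a <= t <= b -> continuous (fun t => G t x y) t) ->
  (forall x y eps, 0 < eps -> exists delta, 0 < delta /\ forall u v, Rabs (u - x) < delta -> Rabs (v - y) < delta ->
     forall t, a <= t <= b -> Rabs (G t u v - G t x y) <= eps) ->
  cont2 (fun x y => RInt (fun t => G t x y) a b).
Proof.
  intros ab HC HU x y eps.
  assert (P : 0 < eps / (2 * (b - a + 1))) by (apply Rdiv_lt_0_compat; [apply cond_pos|lra]).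
  destruct (HU x y _ P) as (d & Hd & K). exists (mkposreal d Hd). intros u v Hu Hv. simpl in Hu, Hv.
  assert (E : forall x y, ex_RInt (fun t => G t x y) a b) by (intros; apply ex_RInt_cont; auto).
  rewrite <- RInt_subR by auto.
  eapply Rle_lt_trans.
  - apply (abs_RInt_le_const (fun t => G t u v - G t x y) a b (eps / (2 * (b - a + 1)))); auto.
    apply ex_RInt_subR; auto.
  - apply Rle_lt_trans with (eps / 2 * ((b - a) / (b - a + 1))).
    + right. field. lra.
    + pose proof (cond_pos eps).
      assert ((b - a) / (b - a + 1) <= 1).
      { apply Rmult_le_reg_r with (b - a + 1); [lra|]. unfold Rdiv. rewrite Rmult_assoc, Rinv_l; lra. }
      nra.
Qed.

Lemma RInt_stencil (f1 f2 f3 f4 f0 : R -> R) a b : ex_RInt f1 a b -> ex_RInt f2 a b -> ex_RInt f3 a b ->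
  ex_RInt f4 a b -> ex_RInt f0 a b ->
  ex_RInt (fun t => f1 t + f2 t + f3 t + f4 t - 4 * f0 t) a b /\
  RInt (fun t => f1 t + f2 t + f3 t + f4 t - 4 * f0 t) a b =
  RInt f1 a b + RInt f2 a b + RInt f3 a b + RInt f4 a b - 4 * RInt f0 a b.
Proof.
  intros H1 H2 H3 H4 H0.
  assert (A2 : ex_RInt (fun t => f1 t + f2 t) a b) by (apply ex_RInt_addR; auto).
  assert (A3 : ex_RInt (fun t => f1 t + f2 t + f3 t) a b) by (apply (ex_RInt_addR (fun t => f1 t + f2 t)); auto).
  assert (A4 : ex_RInt (fun t => f1 t + f2 t + f3 t + f4 t) a b) by (apply (ex_RInt_addR (fun t => f1 t + f2 t + f3 t)); auto).
  assert (A0 : ex_RInt (fun t => 4 * f0 t) a b) by (apply ex_RInt_mulR; auto).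
  split; [apply (ex_RInt_subR (fun t => f1 t + f2 t + f3 t + f4 t)); auto|].
  rewrite (RInt_subR (fun t => f1 t + f2 t + f3 t + f4 t) (fun t => 4 * f0 t)) by auto.
  rewrite (RInt_addR (fun t => f1 t + f2 t + f3 t) f4), (RInt_addR (fun t => f1 t + f2 t) f3), (RInt_addR f1 f2), RInt_mulR by auto.
  reflexivity.
Qed.

Lemma avg_subh (G : R -> R -> R -> R) a b (D : R -> R -> Prop) K d : a <= b -> 0 <= K -> 0 < d ->
  (forall x y t, a <= t <= b -> continuous (fun t => G t x y) t) ->
  (forall t x y, a <= t <= b -> D x y -> forall h p q, 0 < h < d -> Rabs p <= h -> Rabs q <= h ->
     - (K * h ^ 3) <= stencil (G t) x y p q) ->
  subh (fun x y => RInt (fun t => G t x y) a b) D.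
Proof.
  intros ab K0 d0 HC HG. exists ((b - a) * K), d.
  split; [apply Rmult_le_pos; lra|]. split; auto.
  intros x y Dxy h p q Hh Hp Hq.
  assert (E : forall x y, ex_RInt (fun t => G t x y) a b) by (intros; apply ex_RInt_cont; auto).
  unfold stencil.
  destruct (RInt_stencil (fun t => G t (x + p) (y + q)) (fun t => G t (x - p) (y - q)) (fun t => G t (x - q) (y + p))
    (fun t => G t (x + q) (y - p)) (fun t => G t x y) a b) as [Ex <-]; auto.
  replace (- ((b - a) * K * h ^ 3)) with (RInt (fun _ => - (K * h ^ 3)) a b) by (rewrite RInt_constR; eqR; ring).
  apply RInt_le; auto.
  - apply ex_RInt_const.
  - intros t Ht. apply HG; auto; lra.
Qed.

Lemma cont2_comp U (X Y : R -> R) t : cont2 U -> continuous X t -> continuous Y t ->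
  continuous (fun t => U (X t) (Y t)) t.
Proof.
  intros HU HX HY. apply continuity_pt_filterlim. intros eps He.
  destruct (HU (X t) (Y t) (mkposreal eps He)) as [d Hd]. simpl in Hd.
  apply continuity_pt_filterlim in HX, HY.
  destruct (HX d (cond_pos d)) as (e1 & P1 & Q1). destruct (HY d (cond_pos d)) as (e2 & P2 & Q2).
  exists (Rmin e1 e2). split; [apply Rmin_case; auto|].
  intros u [_ Hu]. simpl in *. unfold Rdist in *.
  destruct (Req_EM_T u t) as [->|N]; [rewrite Rminus_diag, Rabs_R0; auto|].
  apply Hd; [apply Q1|apply Q2]; (split; [split; [exact I|auto]|]); eapply Rlt_le_trans; try exact Hu; [apply Rmin_l|apply Rmin_r].
Qed.

(** Not divided by the length [2 p]; [rotavg] is not normalised either. *)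
Definition havg (p : R) (U : R -> R -> R) (x y : R) : R := RInt (fun t => U (x + t) y) (- p) p.

Lemma havg_integrand_cont U x y t : cont2 U -> continuous (fun t => U (x + t) y) t.
Proof.
  intros H. apply (cont2_comp U (fun t => x + t) (fun _ => y)); auto.
  - apply (continuous_plus (V := R_NormedModule)); [apply continuous_const|apply continuous_id].
  - apply continuous_const.
Qed.

Lemma havg_ex U p q x y : cont2 U -> p <= q -> ex_RInt (fun t => U (x + t) y) p q.
Proof. intros H pq. apply ex_RInt_cont; auto. intros; apply havg_integrand_cont; auto. Qed.

Lemma havg_cont p U : 0 <= p -> cont2 U -> cont2 (havg p U).
Proof.
  intros Hp H. apply (avg_cont (fun t x y => U (x + t) y)); try lra.
  - intros; apply havg_integrand_cont; auto.
  - intros x y eps He. destruct (cont2_unif U (Rabs x + Rabs y + p + 1) eps H He) as (d & Hd & K).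
    exists (Rmin d 1). split; [apply Rmin_case; lra|]. intros u v Hu Hv t Ht.
    pose proof (Rmin_l d 1). pose proof (Rmin_r d 1).
    pose proof (Rabs_pos x). pose proof (Rabs_pos y).
    pose proof (Rabs_triang_inv u x). pose proof (Rabs_triang_inv v y).
    assert (Rabs t <= p) by (apply Rabs_le; lra).
    pose proof (Rabs_triang x t). pose proof (Rabs_triang u t).
    left. apply K; try lra. replace (u + t - (x + t)) with (u - x) by ring. lra.
Qed.

Lemma havg_subh p U (D D' : R -> R -> Prop) : 0 <= p -> cont2 U -> subh U D ->
  (forall x y t, D' x y -> - p <= t <= p -> D (x + t) y) -> subh (havg p U) D'.
Proof.
  intros Hp H (K & d & K0 & d0 & HK) HD.
  apply (avg_subh (fun t x y => U (x + t) y) (- p) p D' K d); auto; try lra.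
  - intros; apply havg_integrand_cont; auto.
  - intros t x y Ht Dxy h a b Hh Ha Hb. specialize (HK (x + t) y (HD x y t Dxy Ht) h a b Hh Ha Hb).
    unfold stencil in *.
    replace (x + a + t) with (x + t + a) by ring. replace (x - a + t) with (x + t - a) by ring.
    replace (x - b + t) with (x + t - b) by ring. replace (x + b + t) with (x + t + b) by ring. exact HK.
Qed.

Lemma RInt_periodic (g : R -> R) T a : 0 <= T -> (forall t, continuous g t) -> (forall t, g (t + T) = g t) ->
  RInt g a (a + T) = RInt g 0 T.
Proof.
  intros HT HC HP.
  assert (E : forall p q, ex_RInt g p q).
  { intros. apply (@ex_RInt_continuous R_CompleteNormedModule). auto. }
  rewrite <- (RInt_ChaslesR g a 0 (a + T)) by auto.
  rewrite <- (RInt_ChaslesR g 0 T (a + T)) by auto.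
  assert (S : RInt g T (a + T) = RInt g 0 a).
  { pose proof (RInt_comp_lin (V := R_CompleteNormedModule) g 1 T 0 a) as L.
    replace (1 * 0 + T) with T in L by ring. replace (1 * a + T) with (a + T) in L by ring.
    rewrite <- L by auto. apply RInt_ext. intros t _. transitivity (1 * g (1 * t + T)); [reflexivity|].
    rewrite !Rmult_1_l, HP. reflexivity. }
  assert (O : RInt g a 0 + RInt g 0 a = 0).
  { rewrite RInt_ChaslesR by auto. exact (RInt_point (V := R_CompleteNormedModule) a g). }
  rewrite S. eqR. lra.
Qed.

Lemma unit_circle_angle x y r : 0 <= r -> x ^ 2 + y ^ 2 = r ^ 2 -> exists t, x = r * cos t /\ y = r * sin t.
Proof.
  intros Hr E. destruct (Req_EM_T r 0) as [->|N].
  - exists 0. split; nra.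
  - assert (r0 : 0 < r) by lra.
    assert (e : (x / r) ^ 2 + (y / r) ^ 2 = 1).
    { replace ((x / r) ^ 2 + (y / r) ^ 2) with ((x ^ 2 + y ^ 2) / r ^ 2) by (field; lra).
      rewrite E. field. lra. }
    set (p := x / r) in *. set (q := y / r) in *.
    assert (Ex : x = r * p) by (unfold p; field; lra). assert (Ey : y = r * q) by (unfold q; field; lra).
    assert (P : -1 <= p <= 1) by nra.
    assert (Sq : sqrt (1 - p²) = Rabs q).
    { rewrite <- sqrt_Rsqr_abs. f_equal. unfold Rsqr. nra. }
    destruct (Rle_lt_dec 0 q) as [Q|Q].
    + exists (acos p). rewrite cos_acos, sin_acos by auto. rewrite Sq, Rabs_right by lra. auto.
    + exists (- acos p). rewrite cos_neg, sin_neg, cos_acos, sin_acos by auto. rewrite Sq, Rabs_left by lra.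
      rewrite Ropp_involutive. auto.
Qed.

Definition rotavg (U : R -> R -> R) (c c' x y : R) : R :=
  RInt (fun t => U (c + (x * cos t - y * sin t)) (c' + (x * sin t + y * cos t))) 0 (2 * PI).

Lemma rot_integrand_cont U c c' x y t : cont2 U ->
  continuous (fun t => U (c + (x * cos t - y * sin t)) (c' + (x * sin t + y * cos t))) t.
Proof.
  intros H. apply (cont2_comp U (fun t => c + (x * cos t - y * sin t)) (fun t => c' + (x * sin t + y * cos t))); auto;
  apply (ex_derive_continuous (V := R_NormedModule)); auto_derive; auto.
Qed.

Lemma rotavg_cont U c c' : cont2 U -> cont2 (rotavg U c c').
Proof.
  intros H. pose proof PI_RGT_0.
  apply (avg_cont (fun t x y => U (c + (x * cos t - y * sin t)) (c' + (x * sin t + y * cos t)))); try lra.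
  - intros; apply rot_integrand_cont; auto.
  - intros x y eps He.
    destruct (cont2_unif U (Rabs c + Rabs c' + Rabs x + Rabs y + 2) eps H He) as (d & Hd & K).
    exists (Rmin (d / 2) 1). split; [apply Rmin_case; lra|]. intros u v Hu Hv t _.
    pose proof (Rmin_l (d / 2) 1). pose proof (Rmin_r (d / 2) 1).
    pose proof (Rabs_pos c). pose proof (Rabs_pos c').
    assert (T : forall p q, Rabs (p * cos t - q * sin t) <= Rabs p + Rabs q /\ Rabs (p * sin t + q * cos t) <= Rabs p + Rabs q).
    { intros p q. pose proof (COS_bound t) as HC. pose proof (SIN_bound t) as HS.
      assert (M : forall a b, -1 <= b <= 1 -> Rabs (a * b) <= Rabs a).
      { intros a b Hb. rewrite Rabs_mult. rewrite <- (Rmult_1_r (Rabs a)) at 2.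
        apply Rmult_le_compat_l; [apply Rabs_pos|apply Rabs_le; auto]. }
      pose proof (M p (cos t) HC). pose proof (M q (sin t) HS). pose proof (M p (sin t) HS). pose proof (M q (cos t) HC).
      split.
      - unfold Rminus. eapply Rle_trans; [apply Rabs_triang|]. rewrite Rabs_Ropp. lra.
      - eapply Rle_trans; [apply Rabs_triang|]. lra. }
    pose proof (T x y) as [T1 T2]. pose proof (T u v) as [T3 T4]. pose proof (T (u - x) (v - y)) as [T5 T6].
    pose proof (Rabs_triang_inv u x). pose proof (Rabs_triang_inv v y).
    pose proof (Rabs_triang c (x * cos t - y * sin t)). pose proof (Rabs_triang c' (x * sin t + y * cos t)).
    pose proof (Rabs_triang c (u * cos t - v * sin t)). pose proof (Rabs_triang c' (u * sin t + v * cos t)).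
    left. apply K; try lra.
    + replace (c + (u * cos t - v * sin t) - (c + (x * cos t - y * sin t))) with ((u - x) * cos t - (v - y) * sin t) by ring. lra.
    + replace (c' + (u * sin t + v * cos t) - (c' + (x * sin t + y * cos t))) with ((u - x) * sin t + (v - y) * cos t) by ring. lra.
Qed.

(** A rotated stencil is a stencil with rotated [(a, b)], whose entries are at most [2 h]; hence
    [8 K] and [d / 2]. *)
Lemma rotavg_subh U c c' r : cont2 U -> 
  subh U (fun x y => (x - c) ^ 2 + (y - c') ^ 2 <= r ^ 2) ->
  subh (rotavg U c c') (fun x y => x ^ 2 + y ^ 2 <= r ^ 2).
Proof.
  intros H (K & d & K0 & d0 & HK). pose proof PI_RGT_0.
  apply (avg_subh (fun t x y => U (c + (x * cos t - y * sin t)) (c' + (x * sin t + y * cos t))) 0 (2 * PI) _ (8 * K) (d / 2)); try lra.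
  - intros; apply rot_integrand_cont; auto.
  - intros t x y _ Dxy h a b Hh Ha Hb.
    pose proof (COS_bound t) as HC. pose proof (SIN_bound t) as HS. pose proof (sin2_cos2 t) as SC. unfold Rsqr in SC.
    assert (M : forall a b, -1 <= b <= 1 -> Rabs (a * b) <= Rabs a).
      { intros a' b' Hb'. rewrite Rabs_mult. rewrite <- (Rmult_1_r (Rabs a')) at 2.
        apply Rmult_le_compat_l; [apply Rabs_pos|apply Rabs_le; auto]. }
    specialize (HK (c + (x * cos t - y * sin t)) (c' + (x * sin t + y * cos t))).
    assert (Q : (c + (x * cos t - y * sin t) - c) ^ 2 + (c' + (x * sin t + y * cos t) - c') ^ 2 <= r ^ 2).
    { eapply Rle_trans; [|exact Dxy]. right.
      replace ((c + (x * cos t - y * sin t) - c) ^ 2 + (c' + (x * sin t + y * cos t) - c') ^ 2)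
        with ((x ^ 2 + y ^ 2) * (sin t * sin t + cos t * cos t)) by ring. rewrite SC. ring. }
    specialize (HK Q (2 * h) (a * cos t - b * sin t) (a * sin t + b * cos t) ltac:(lra)).
    replace (8 * K * h ^ 3) with (K * (2 * h) ^ 3) by ring.
    eapply Rle_trans; [apply HK|right].
    + unfold Rminus. eapply Rle_trans; [apply Rabs_triang|]. rewrite Rabs_Ropp.
      pose proof (M a (cos t) HC). pose proof (M b (sin t) HS). lra.
    + eapply Rle_trans; [apply Rabs_triang|].
      pose proof (M a (sin t) HS). pose proof (M b (cos t) HC). lra.
    + unfold stencil. apply (f_equal2 Rminus); [|reflexivity].
      repeat apply (f_equal2 Rplus); apply (f_equal2 U); ring.
Qed.

(* The rotation average is radial, so the maximum principle compares its value at the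
   centre with its value on the circle. *)
Theorem circle_mean U c c' r : cont2 U -> 0 <= r ->
  subh U (fun x y => (x - c) ^ 2 + (y - c') ^ 2 <= r ^ 2) ->
  2 * PI * U c c' <= RInt (fun t => U (c + r * cos t) (c' + r * sin t)) 0 (2 * PI).
Proof.
  intros HU Hr HS. pose proof PI_RGT_0.
  assert (E0 : rotavg U c c' 0 0 = 2 * PI * U c c').
  { unfold rotavg. rewrite (RInt_ext _ (fun _ => U c c')).
    - rewrite RInt_constR. eqR; ring.
    - intros t _. f_equal; ring. }
  set (m := RInt (fun t => U (c + r * cos t) (c' + r * sin t)) 0 (2 * PI)).
  assert (E1 : forall x y, x ^ 2 + y ^ 2 = r ^ 2 -> rotavg U c c' x y = m).
  { intros x y E. destruct (unit_circle_angle x y r Hr E) as (s & -> & ->).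
    set (g := fun t => U (c + r * cos t) (c' + r * sin t)).
    assert (gc : forall t, continuous g t).
    { intros t. apply (cont2_comp U (fun t => c + r * cos t) (fun t => c' + r * sin t)); auto;
      apply (ex_derive_continuous (V := R_NormedModule)); auto_derive; auto. }
    unfold m. fold g. rewrite <- (RInt_periodic g (2 * PI) s); auto; try lra.
    2:{ intros t. unfold g. rewrite cos_plus, sin_plus, cos_2PI, sin_2PI.
        f_equal; ring. }
    pose proof (RInt_comp_lin (V := R_CompleteNormedModule) g 1 s 0 (2 * PI)) as L.
    replace (1 * 0 + s) with s in L by ring. replace (1 * (2 * PI) + s) with (s + 2 * PI) in L by ring.
    rewrite <- L.
    - unfold rotavg. apply RInt_ext. intros t _. transitivity (1 * g (1 * t + s)); [|reflexivity].
      rewrite !Rmult_1_l. unfold g. rewrite cos_plus, sin_plus. f_equal; ring.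
    - apply (@ex_RInt_continuous R_CompleteNormedModule). auto. }
  rewrite <- E0. 
  (* The term [e * (r ^ 2 - x ^ 2 - y ^ 2)] gives the comparison function the strictly negative
     Laplacian [- 4 e] and vanishes on the circle; then [e] tends to 0. *)
  assert (Main : forall e, 0 < e -> rotavg U c c' 0 0 <= m + e * r ^ 2).
  { intros e He.
    pose proof (max_principle (fun x y => x ^ 2 + y ^ 2 - r ^ 2) (rotavg U c c')
      (fun x y => m + e * (r ^ 2 - (x * x + y * y))) (- r) r (- r) r) as MP.
    assert (MP' : rotavg U c c' 0 0 <= m + e * (r ^ 2 - (0 * 0 + 0 * 0))).
    { apply MP; clear MP; try lra.
      - intros; apply rotavg_cont; auto.
      - intros. apply continuity_2d_pt_plus; [apply continuity_2d_pt_const|].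
        apply continuity_2d_pt_mult; [apply continuity_2d_pt_const|].
        apply continuity_2d_pt_minus; [apply continuity_2d_pt_const|].
        apply continuity_2d_pt_plus; apply continuity_2d_pt_mult;
          first [apply continuity_2d_pt_id1|apply continuity_2d_pt_id2].
      - intros. apply (continuity_2d_pt_ext (fun x y => x * x + y * y - r ^ 2)); [intros; ring|].
        apply continuity_2d_pt_minus; [|apply continuity_2d_pt_const].
        apply continuity_2d_pt_plus; apply continuity_2d_pt_mult;
          first [apply continuity_2d_pt_id1|apply continuity_2d_pt_id2].
      - destruct (rotavg_subh U c c' r HU HS) as (K & d & K0 & d0 & HK).
        exists K, d. split; auto. split; auto. intros x y (_ & _ & Hk). apply HK. lra.
      - intros x y _ _ _. exists (- (2 * e) + - (2 * e)). split; [lra|].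
        apply (Lap_intro _ (fun u => - (2 * e * u)) (fun v => - (2 * e * v))).
        + apply filter_forall. intros u. auto_derive; auto. ring.
        + auto_derive; auto. ring.
        + apply filter_forall. intros u. auto_derive; auto. ring.
        + auto_derive; auto. ring.
      - intros x y Hx Hy Hk HB.
        assert (Z : x ^ 2 + y ^ 2 = r ^ 2).
        { pose proof (pow2_ge_0 x). pose proof (pow2_ge_0 y).
          destruct HB as [->|[->|[->|[->|HB]]]]; try lra. }
        rewrite (E1 x y Z). replace (x * x + y * y) with (x ^ 2 + y ^ 2) by ring. rewrite Z. lra.
      - nra. }
    lra. }
  apply le_epsilon. intros e He.
  assert (P : 0 < e / (r ^ 2 + 1)) by (apply Rdiv_lt_0_compat; [lra|pose proof (pow2_ge_0 r); lra]).
  eapply Rle_trans; [apply (Main _ P)|]. apply Rplus_le_compat_l.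
  pose proof (pow2_ge_0 r).
  replace e with (e / (r ^ 2 + 1) * (r ^ 2 + 1)) at 2 by (field; lra).
  apply Rmult_le_compat_l; lra.
Qed.

(** * Iterated integrals over sectors *)

Lemma cont2_RInt_param (f : R -> R -> R) a b : a <= b -> cont2 f ->
  forall x, continuous (fun x => RInt (fun t => f x t) a b) x.
Proof.
  intros ab H x.
  apply (continuity_2d_pt_l (fun x _ => RInt (fun t => f x t) a b) x 0).
  apply (avg_cont (fun t x _ => f x t)); auto.
  - intros. apply (continuity_2d_pt_r f). apply H.
  - intros u y eps He. destruct (cont2_unif f (Rabs u + Rabs a + Rabs b + 1) eps H He) as (d & Hd & K).
    exists (Rmin d 1). split; [apply Rmin_case; lra|]. intros u' v Hu _ t Ht.
    pose proof (Rmin_l d 1). pose proof (Rmin_r d 1).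
    pose proof (Rabs_pos u). pose proof (Rabs_triang_inv u' u).
    assert (Rabs t <= Rabs a + Rabs b).
    { unfold Rabs. repeat destruct Rcase_abs; lra. }
    pose proof (Rabs_pos a). pose proof (Rabs_pos b). left. apply K; try lra. rewrite Rminus_diag, Rabs_R0. lra.
Qed.

Lemma cont2_swap f : cont2 f -> cont2 (fun x y => f y x).
Proof. intros H x y eps. destruct (H y x eps) as [d Hd]. exists d. intros; apply Hd; auto. Qed.

Lemma cont2_RInt_upper (f : R -> R -> R) a : cont2 f ->
  forall x t, is_derive (fun x => RInt (fun s => f s t) a x) x (f x t).
Proof.
  intros H x t. apply (is_derive_RInt (V := R_NormedModule) (fun s => f s t) (fun x => RInt (fun s => f s t) a x) a x).
  - apply filter_forall. intros y. apply (RInt_correct (V := R_CompleteNormedModule)).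
    apply (@ex_RInt_continuous R_CompleteNormedModule). intros z _. apply (continuity_2d_pt_l f). apply H.
  - apply (continuity_2d_pt_l f). apply H.
Qed.

(** The right-hand side as a function [F] of the upper limit in [x] vanishes at [a], and
    differentiation under the integral sign gives the integrand of the left-hand side. *)
Theorem fubini (f : R -> R -> R) a b c d : a <= b -> c <= d -> cont2 f ->
  RInt (fun x => RInt (fun y => f x y) c d) a b = RInt (fun y => RInt (fun x => f x y) a b) c d.
Proof.
  intros ab cd H.
  set (F := fun x => RInt (fun y => RInt (fun s => f s y) a x) c d).
  assert (HF : forall x, is_derive F x (RInt (fun y => f x y) c d)).
  { intros x.
    assert (E : RInt (fun y => f x y) c d = RInt (fun y => Derive (fun u => RInt (fun s => f s y) a u) x) c d).
    { apply RInt_ext. intros y _. symmetry. apply is_derive_unique. apply cont2_RInt_upper; auto. }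
    rewrite E. apply (is_derive_RInt_param (fun u y => RInt (fun s => f s y) a u)).
    - apply filter_forall. intros u y _. eexists. apply cont2_RInt_upper; auto.
    - intros y _. apply (continuity_2d_pt_ext f); [|apply H].
      intros u v. symmetry. apply is_derive_unique. apply cont2_RInt_upper; auto.
    - apply filter_forall. intros u. apply ex_RInt_cont; auto. intros y _.
      destruct (Rle_lt_dec a u) as [L|L].
      + apply (cont2_RInt_param (fun y s => f s y)); auto. apply (cont2_swap f); auto.
      + assert (K : continuous (fun y => RInt (fun s => f s y) u a) y).
        { apply (cont2_RInt_param (fun y s => f s y)); [lra|]. apply (cont2_swap f); auto. }
        apply (continuous_ext (fun y => - RInt (fun s => f s y) u a)).
        * intros z. apply (opp_RInt_swap (V := R_CompleteNormedModule) (fun s => f s z) u a). apply (@ex_RInt_continuous R_CompleteNormedModule). intros q _. apply (continuity_2d_pt_l f). apply H.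
        * apply (continuous_opp (V := R_NormedModule)). exact K. }
  assert (I : is_RInt (fun x => RInt (fun y => f x y) c d) a b (minus (F b) (F a))).
  { apply (is_RInt_derive (V := R_CompleteNormedModule) F).
    - intros; apply HF.
    - intros x _. apply cont2_RInt_param; auto. }
  apply is_RInt_unique in I. rewrite I.
  assert (Fa : F a = 0).
  { unfold F. rewrite (RInt_ext _ (fun _ => 0)).
    - rewrite RInt_constR. eqR; ring.
    - intros y _. exact (RInt_point (V := R_CompleteNormedModule) a (fun s => f s y)). }
  unfold minus, plus, opp; simpl. rewrite Fa. unfold F. ring.
Qed.

Lemma cont2_comp2 U X Y : cont2 U -> cont2 X -> cont2 Y -> cont2 (fun x y => U (X x y) (Y x y)).
Proof.
  intros HU HX HY x y eps. destruct (HU (X x y) (Y x y) eps) as [d Hd].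
  destruct (HX x y d) as [d1 H1]. destruct (HY x y d) as [d2 H2].
  assert (P : 0 < Rmin d1 d2) by (apply Rmin_case; apply cond_pos).
  exists (mkposreal _ P). simpl. intros u v Hu Hv.
  pose proof (Rmin_l d1 d2). pose proof (Rmin_r d1 d2).
  apply Hd; [apply H1|apply H2]; lra.
Qed.

Lemma cont2_fst : cont2 (fun x _ => x).
Proof. intros x y. apply continuity_2d_pt_id1. Qed.
Lemma cont2_snd : cont2 (fun _ y => y).
Proof. intros x y. apply continuity_2d_pt_id2. Qed.
Lemma cont2_const c : cont2 (fun _ _ => c).
Proof. intros x y. apply continuity_2d_pt_const. Qed.
Lemma cont2_add f g : cont2 f -> cont2 g -> cont2 (fun x y => f x y + g x y).
Proof. intros F G x y. apply continuity_2d_pt_plus; auto. Qed.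
Lemma cont2_sub f g : cont2 f -> cont2 g -> cont2 (fun x y => f x y - g x y).
Proof. intros F G x y. apply continuity_2d_pt_minus; auto. Qed.
Lemma cont2_mul f g : cont2 f -> cont2 g -> cont2 (fun x y => f x y * g x y).
Proof. intros F G x y. apply continuity_2d_pt_mult; auto. Qed.
Lemma cont2_1d g f : (forall t, continuous g t) -> cont2 f -> cont2 (fun x y => g (f x y)).
Proof.
  intros G F x y. apply continuity_1d_2d_pt_comp; [|apply F]. apply continuity_pt_filterlim. apply G.
Qed.

Lemma cos_pi4_range u : - (PI / 4) <= u <= PI / 4 -> 1 / sqrt 2 <= cos u /\ cos u <= 1.
Proof.
  intros Hu. split; [|apply COS_bound]. rewrite <- cos_PI4. pose proof PI_RGT_0.
  destruct (Rle_lt_dec 0 u).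
  - apply cos_decr_1; lra.
  - rewrite <- (cos_neg u). apply cos_decr_1; lra.
Qed.

(** Polar coordinates on the trapezoid [|x| <= y], [y1 <= y <= y2], with the angle measured from the
    [y] axis. They are composed of one-dimensional substitutions: [x = u y], exchange of the
    integrals, [u] as a tangent, and [y = r cos]. *)
Theorem sector_integral (f : R -> R -> R) y1 y2 : cont2 f -> 0 <= y1 <= y2 ->
  ex_RInt (fun u => RInt (fun r => r * f (r * sin u) (r * cos u)) (y1 / cos u) (y2 / cos u)) (- (PI / 4)) (PI / 4) /\
  RInt (fun y => RInt (fun x => f x y) (- y) y) y1 y2 =
  RInt (fun u => RInt (fun r => r * f (r * sin u) (r * cos u)) (y1 / cos u) (y2 / cos u)) (- (PI / 4)) (PI / 4).
Proof.
  intros H Hy. pose proof PI_RGT_0 as Hpi.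
  set (g := fun u y => y * f (u * y) y).
  assert (Hg : cont2 g).
  { apply cont2_mul; [apply cont2_snd|]. apply (cont2_comp2 f (fun u y => u * y) (fun _ y => y)); auto;
    [apply cont2_mul; [apply cont2_fst|apply cont2_snd]|apply cont2_snd]. }
  set (K := fun u => RInt (fun y => g u y) y1 y2).
  assert (KC : forall u, continuous K u) by (apply cont2_RInt_param; auto; lra).
  assert (CT : forall u, - (PI / 4) <= u <= PI / 4 -> 0 < cos u) by (intros u Hu; apply cos_gt_0; lra).
  assert (EJ : forall u, - (PI / 4) < u < PI / 4 -> (tan u ^ 2 + 1) * K (tan u) =
     RInt (fun r => r * f (r * sin u) (r * cos u)) (y1 / cos u) (y2 / cos u)).
  { intros u Hu.
    assert (Cu : 0 < cos u) by (apply CT; lra).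
    pose proof (RInt_comp_lin (V := R_CompleteNormedModule) (fun y => (tan u ^ 2 + 1) * g (tan u) y) (cos u) 0 (y1 / cos u) (y2 / cos u)) as L.
    replace (cos u * (y1 / cos u) + 0) with y1 in L by (field; lra).
    replace (cos u * (y2 / cos u) + 0) with y2 in L by (field; lra).
    assert (Eg : ex_RInt (fun y => g (tan u) y) y1 y2).
    { apply ex_RInt_cont; [lra|]. intros z _. apply (continuity_2d_pt_r g). apply Hg. }
    rewrite (RInt_mulR (tan u ^ 2 + 1) (fun y => g (tan u) y)) in L by auto.
    unfold K. rewrite <- L; [|apply ex_RInt_mulR; auto].
    apply RInt_ext. intros r _. unfold g.
    transitivity (cos u * ((tan u ^ 2 + 1) * ((cos u * r + 0) * f (tan u * (cos u * r + 0)) (cos u * r + 0)))); [reflexivity|].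
    rewrite Rplus_0_r. replace (tan u * (cos u * r)) with (r * sin u) by (unfold tan; field; lra).
    rewrite (Rmult_comm (cos u) r).
    assert (S : cos u * (tan u ^ 2 + 1) * cos u = 1).
    { unfold tan. pose proof (sin2_cos2 u) as SC. unfold Rsqr in SC.
      replace (cos u * ((sin u / cos u) ^ 2 + 1) * cos u) with (sin u * sin u + cos u * cos u) by (field; lra). exact SC. }
    transitivity ((cos u * (tan u ^ 2 + 1) * cos u) * (r * f (r * sin u) (r * cos u))); [eqR; ring|].
    rewrite S. eqR; ring. }
  pose proof (is_RInt_comp (V := R_CompleteNormedModule) K tan (fun u => tan u ^ 2 + 1) (- (PI / 4)) (PI / 4)) as LC.
  rewrite tan_neg, tan_PI4 in LC. replace (- (1)) with (-1) in LC by ring.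
  assert (I : is_RInt (fun u => RInt (fun r => r * f (r * sin u) (r * cos u)) (y1 / cos u) (y2 / cos u))
     (- (PI / 4)) (PI / 4) (RInt K (-1) 1)).
  { eapply is_RInt_ext; [|apply LC].
    - intros u Hu. rewrite Rmin_left, Rmax_right in Hu by lra. apply (EJ u Hu).
    - intros; apply KC.
    - intros u Hu. rewrite Rmin_left, Rmax_right in Hu by lra. specialize (CT u Hu).
      assert (Nc : cos u <> 0) by lra.
      split.
      + unfold tan. auto_derive; [auto|]. field. auto.
      + unfold tan. apply (ex_derive_continuous (V := R_NormedModule)). auto_derive. auto. }
  split; [eexists; exact I|].
  rewrite (is_RInt_unique _ _ _ _ I).
  transitivity (RInt (fun y => RInt (fun u => g u y) (-1) 1) y1 y2).
  { apply RInt_ext. intros y Hy'. rewrite Rmin_left, Rmax_right in Hy' by lra.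
    pose proof (RInt_comp_lin (V := R_CompleteNormedModule) (fun x => f x y) y 0 (-1) 1) as L.
    replace (y * -1 + 0) with (- y) in L by ring. replace (y * 1 + 0) with y in L by ring.
    rewrite <- L.
    - apply RInt_ext. intros u _. unfold g. transitivity (y * f (y * u + 0) y); [reflexivity|].
      rewrite Rplus_0_r, (Rmult_comm y u). reflexivity.
    - apply (@ex_RInt_continuous R_CompleteNormedModule). intros q _. apply (continuity_2d_pt_l f). apply H. }
  rewrite <- (fubini g) by (auto; lra). reflexivity.
Qed.

Lemma RInt_le_sub (f : R -> R) a b c d : (forall x, continuous f x) -> (forall x, a <= x <= d -> 0 <= f x) ->
  a <= b -> b <= c -> c <= d -> RInt f b c <= RInt f a d.
Proof.
  intros Hf H0 ab bc cd.
  assert (E : forall p q, ex_RInt f p q) by (intros; apply (@ex_RInt_continuous R_CompleteNormedModule); auto).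
  rewrite <- (RInt_ChaslesR f a b d), <- (RInt_ChaslesR f b c d) by auto.
  assert (0 <= RInt f a b) by (apply RInt_ge_0; auto; intros; apply H0; lra).
  assert (0 <= RInt f c d) by (apply RInt_ge_0; auto; intros; apply H0; lra).
  lra.
Qed.

Lemma polar_cont2 (f : R -> R -> R) : cont2 f -> cont2 (fun r u => r * f (r * sin u) (r * cos u)).
Proof.
  intros H. apply cont2_mul; [apply cont2_fst|].
  apply (cont2_comp2 f (fun r u => r * sin u) (fun r u => r * cos u)); auto;
  (apply cont2_mul; [apply cont2_fst|]); apply (cont2_1d _ (fun _ y => y)); try apply cont2_snd; intros t;
  apply (ex_derive_continuous (V := R_NormedModule)); auto_derive; auto.
Qed.

(** The quarter circle about the positive [y] axis, integrated in the angle without the factor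
    [r]. *)
Definition arc_int (f : R -> R -> R) (r : R) : R :=
  RInt (fun u => f (r * sin u) (r * cos u)) (- (PI / 4)) (PI / 4).

Lemma arc_integrand_cont f r u : cont2 f -> continuous (fun u => f (r * sin u) (r * cos u)) u.
Proof.
  intros H. apply (cont2_comp f (fun u => r * sin u) (fun u => r * cos u)); auto;
  apply (ex_derive_continuous (V := R_NormedModule)); auto_derive; auto.
Qed.

Lemma polar_swap f a b : cont2 f -> a <= b ->
  RInt (fun u => RInt (fun r => r * f (r * sin u) (r * cos u)) a b) (- (PI / 4)) (PI / 4) =
  RInt (fun r => r * arc_int f r) a b.
Proof.
  intros H ab. pose proof PI_RGT_0.
  rewrite <- (fubini (fun r u => r * f (r * sin u) (r * cos u)) a b (- (PI / 4)) (PI / 4)) by (try lra; apply polar_cont2; auto).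
  apply RInt_ext. intros r _. unfold arc_int.
  apply (RInt_mulR r (fun u => f (r * sin u) (r * cos u))).
  apply ex_RInt_cont; [lra|]. intros; apply arc_integrand_cont; auto.
Qed.

Lemma sqrt2_bounds : 1 < sqrt 2 < 2 /\ sqrt 2 * sqrt 2 = 2.
Proof.
  assert (E : sqrt 2 * sqrt 2 = 2) by (apply sqrt_sqrt; lra).
  pose proof (sqrt_pos 2). split; auto. split; nra.
Qed.

(** For angles up to [PI / 4] from the axis, [y2 / cos u <= sqrt 2 * y2]. *)
Lemma sector_le_disc f y1 y2 r0 : cont2 f -> (forall x y, 0 <= f x y) -> 0 <= y1 <= y2 -> sqrt 2 * y2 <= r0 ->
  RInt (fun y => RInt (fun x => f x y) (- y) y) y1 y2 <= RInt (fun r => r * arc_int f r) 0 r0.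
Proof.
  intros H P Hy Hr. pose proof PI_RGT_0. destruct sqrt2_bounds as [S1 S2].
  destruct (sector_integral f y1 y2 H Hy) as [E ->]. rewrite <- polar_swap by (auto; nra).
  assert (PC : forall u r, continuous (fun r => r * f (r * sin u) (r * cos u)) r).
  { intros u r. apply (continuity_2d_pt_l (fun r u => r * f (r * sin u) (r * cos u))). apply polar_cont2; auto. }
  apply RInt_le; auto; try lra.
  - apply ex_RInt_cont; [lra|]. intros u _.
    apply (cont2_RInt_param (fun u r => r * f (r * sin u) (r * cos u)) 0 r0); [nra|].
    apply (cont2_swap (fun r u => r * f (r * sin u) (r * cos u))). apply polar_cont2; auto.
  - intros u Hu. destruct (cos_pi4_range u ltac:(lra)) as [C1 C2].
    assert (i2 : 0 < 1 / sqrt 2) by (apply Rdiv_lt_0_compat; lra).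
    assert (ic : / cos u <= sqrt 2).
    { replace (sqrt 2) with (/ (1 / sqrt 2)) by (field; lra). apply Rinv_le_contravar; auto. }
    assert (ip : 0 < / cos u) by (apply Rinv_0_lt_compat; lra).
    apply RInt_le_sub; unfold Rdiv; try nra.
    + intros; apply PC.
    + intros r Hr'. apply Rmult_le_pos; [lra|auto].
Qed.

(** For [sqrt 2 * s <= r <= 2 * s] and angles up to [PI / 4], the height [r cos u] stays in
    [[s, 2 s]]. *)
Lemma annulus_le_sector f s : cont2 f -> (forall x y, 0 <= f x y) -> 0 <= s ->
  RInt (fun r => r * arc_int f r) (sqrt 2 * s) (2 * s) <= RInt (fun y => RInt (fun x => f x y) (- y) y) s (2 * s).
Proof.
  intros H P Hs. pose proof PI_RGT_0. destruct sqrt2_bounds as [S1 S2].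
  destruct (sector_integral f s (2 * s) H ltac:(lra)) as [E ->]. rewrite <- polar_swap by (auto; nra).
  assert (PC : forall u r, continuous (fun r => r * f (r * sin u) (r * cos u)) r).
  { intros u r. apply (continuity_2d_pt_l (fun r u => r * f (r * sin u) (r * cos u))). apply polar_cont2; auto. }
  apply RInt_le; auto; try lra.
  - apply ex_RInt_cont; [lra|]. intros u _.
    apply (cont2_RInt_param (fun u r => r * f (r * sin u) (r * cos u))); [nra|].
    apply (cont2_swap (fun r u => r * f (r * sin u) (r * cos u))). apply polar_cont2; auto.
  - intros u Hu. destruct (cos_pi4_range u ltac:(lra)) as [C1 C2].
    assert (i2 : 0 < 1 / sqrt 2) by (apply Rdiv_lt_0_compat; lra).
    assert (ic : / cos u <= sqrt 2).
    { replace (sqrt 2) with (/ (1 / sqrt 2)) by (field; lra). apply Rinv_le_contravar; auto. }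
    assert (ip : 1 <= / cos u) by (rewrite <- Rinv_1; apply Rinv_le_contravar; lra).
    apply RInt_le_sub; unfold Rdiv; try nra.
    + intros; apply PC.
    + intros r Hr'. apply Rmult_le_pos; [nra|auto].
Qed.

Lemma RInt_exists_le (g : R -> R) a b m : a < b -> (forall x, continuous g x) -> RInt g a b <= (b - a) * m ->
  exists x, a <= x <= b /\ g x <= m.
Proof.
  intros ab Hg H. apply Classical_Prop.NNPP. intros N.
  assert (L : forall x, a <= x <= b -> m < g x).
  { intros x Hx. destruct (Rlt_le_dec m (g x)); auto. exfalso. apply N. exists x; auto. }
  assert (RInt (fun _ => m) a b < RInt g a b).
  { apply RInt_lt; auto. - intros; apply continuous_const. - intros; apply L; lra. }
  rewrite RInt_constR in H0. lra.
Qed.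

Lemma arc_int_cont f r : cont2 f -> continuous (arc_int f) r.
Proof.
  intros H. pose proof PI_RGT_0. apply (cont2_RInt_param (fun r u => f (r * sin u) (r * cos u))); [lra|].
  apply (cont2_comp2 f (fun r u => r * sin u) (fun r u => r * cos u)); auto;
  (apply cont2_mul; [apply cont2_fst|]); apply (cont2_1d _ (fun _ y => y)); try apply cont2_snd; intros t;
  apply (ex_derive_continuous (V := R_NormedModule)); auto_derive; auto.
Qed.

Lemma RInt_id a b : RInt (fun r => r) a b = (b ^ 2 - a ^ 2) / 2.
Proof.
  apply is_RInt_unique. replace ((b ^ 2 - a ^ 2) / 2) with (minus (b ^ 2 / 2) (a ^ 2 / 2)) by (unfold minus, plus, opp; simpl; field).
  apply (is_RInt_derive (V := R_CompleteNormedModule) (fun x => x ^ 2 / 2)).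
  - intros x _. auto_derive; auto. field.
  - intros x _. apply continuous_id.
Qed.

(** [k] is the linear map from coordinates about the [y] axis to the displacement from the centre;
    it shifts the angle by [s]. *)
Lemma arc_int_shift U c c' r k (s : R) : cont2 U ->
  (forall u, cos (u + s) = fst (k (sin u, cos u)) /\ sin (u + s) = snd (k (sin u, cos u))) ->
  (forall x y, fst (k (r * x, r * y)) = r * fst (k (x, y)) /\ snd (k (r * x, r * y)) = r * snd (k (x, y))) ->
  arc_int (fun x y => U (c + fst (k (x, y))) (c' + snd (k (x, y)))) r =
  RInt (fun t => U (c + r * cos t) (c' + r * sin t)) (- (PI / 4) + s) (PI / 4 + s).
Proof.
  intros H Hk Hl.
  set (g := fun t => U (c + r * cos t) (c' + r * sin t)).
  assert (gc : forall t, continuous g t).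
  { intros t. apply (cont2_comp U (fun t => c + r * cos t) (fun t => c' + r * sin t)); auto;
    apply (ex_derive_continuous (V := R_NormedModule)); auto_derive; auto. }
  pose proof (RInt_comp_lin (V := R_CompleteNormedModule) g 1 s (- (PI / 4)) (PI / 4)) as L.
  rewrite !Rmult_1_l in L. rewrite <- L.
  - apply RInt_ext. intros u _. transitivity (1 * g (1 * u + s)); [|reflexivity].
    rewrite !Rmult_1_l. unfold g. destruct (Hk u) as [-> ->].
    destruct (Hl (sin u) (cos u)) as [-> ->]. reflexivity.
  - apply (@ex_RInt_continuous R_CompleteNormedModule). auto.
Qed.

Lemma circle_four_arcs U c c' r : cont2 U ->
  RInt (fun t => U (c + r * cos t) (c' + r * sin t)) 0 (2 * PI) =
  arc_int (fun x y => U (c + y) (c' + x)) r + arc_int (fun x y => U (c - x) (c' + y)) r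
  + arc_int (fun x y => U (c - y) (c' - x)) r + arc_int (fun x y => U (c + x) (c' - y)) r.
Proof.
  intros H. pose proof PI_RGT_0.
  set (g := fun t => U (c + r * cos t) (c' + r * sin t)).
  assert (gc : forall t, continuous g t).
  { intros t. apply (cont2_comp U (fun t => c + r * cos t) (fun t => c' + r * sin t)); auto;
    apply (ex_derive_continuous (V := R_NormedModule)); auto_derive; auto. }
  assert (E : forall p q, ex_RInt g p q) by (intros; apply (@ex_RInt_continuous R_CompleteNormedModule); auto).
  rewrite <- (RInt_periodic g (2 * PI) (- (PI / 4))); auto; try lra.
  2:{ intros t. unfold g. rewrite cos_plus, sin_plus, cos_2PI, sin_2PI. f_equal; ring. }
  rewrite <- (RInt_ChaslesR g (- (PI / 4)) (PI / 4)) by auto.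
  rewrite <- (RInt_ChaslesR g (PI / 4) (PI / 4 + PI / 2)) by auto.
  rewrite <- (RInt_ChaslesR g (PI / 4 + PI / 2) (PI / 4 + PI)) by auto.
  assert (A0 : arc_int (fun x y => U (c + y) (c' + x)) r = RInt g (- (PI / 4)) (PI / 4)).
  { transitivity (RInt g (- (PI / 4) + 0) (PI / 4 + 0)); [|rewrite !Rplus_0_r; reflexivity].
    refine (arc_int_shift U c c' r (fun z => (snd z, fst z)) 0 H _ _); auto. intros u. rewrite Rplus_0_r. auto. }
  assert (A1 : arc_int (fun x y => U (c - x) (c' + y)) r = RInt g (PI / 4) (PI / 4 + PI / 2)).
  { replace (PI / 4) with (- (PI / 4) + PI / 2) at 1 by field.
    refine (arc_int_shift U c c' r (fun z => (- fst z, snd z)) (PI / 2) H _ _); auto.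
    - intros u. rewrite cos_plus, sin_plus, cos_PI2, sin_PI2. simpl. split; ring.
    - intros x y. simpl. split; ring. }
  assert (A2 : arc_int (fun x y => U (c - y) (c' - x)) r = RInt g (PI / 4 + PI / 2) (PI / 4 + PI)).
  { replace (PI / 4 + PI / 2) with (- (PI / 4) + PI) by field.
    refine (arc_int_shift U c c' r (fun z => (- snd z, - fst z)) PI H _ _); auto.
    - intros u. rewrite cos_plus, sin_plus, cos_PI, sin_PI. simpl. split; ring.
    - intros x y. simpl. split; ring. }
  assert (A3 : arc_int (fun x y => U (c + x) (c' - y)) r = RInt g (PI / 4 + PI) (- (PI / 4) + 2 * PI)).
  { replace (PI / 4 + PI) with (- (PI / 4) + 3 * (PI / 2)) by field.
    replace (- (PI / 4) + 2 * PI) with (PI / 4 + 3 * (PI / 2)) by field.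
    refine (arc_int_shift U c c' r (fun z => (fst z, - snd z)) (3 * (PI / 2)) H _ _); auto.
    - intros u. rewrite cos_plus, sin_plus, cos_3PI2, sin_3PI2. simpl. split; ring.
    - intros x y. simpl. split; ring. }
  rewrite A0, A1, A2, A3. eqR; ring.
Qed.

Lemma cont2_affine U (c c' a b a' b' : R) : cont2 U -> cont2 (fun x y => U (c + a * x + b * y) (c' + a' * x + b' * y)).
Proof.
  intros H. apply (cont2_comp2 U); auto;
  repeat apply cont2_add; try apply cont2_const; apply cont2_mul; try apply cont2_const; first [apply cont2_fst|apply cont2_snd].
Qed.

Lemma cont2_ext f g : (forall x y, f x y = g x y) -> cont2 f -> cont2 g.
Proof. intros E H x y. eapply continuity_2d_pt_ext; [apply E|apply H]. Qed.

Lemma arc_int_ge0 f r : cont2 f -> (forall x y, 0 <= f x y) -> 0 <= arc_int f r.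
Proof.
  intros H P. pose proof PI_RGT_0. apply RInt_ge_0; auto; try lra.
  apply ex_RInt_cont; [lra|]. intros; apply arc_integrand_cont; auto.
Qed.

(* From the circle means to one horizontal segment: the sector above the centre is
   exhausted by horizontal segments. *)
Lemma point_to_line v c rho V : cont2 v -> (forall x y, 0 <= v x y) -> 0 < rho ->
  (forall r, 0 <= r <= 3 / 4 * rho -> RInt (fun t => v (c + r * cos t) (r * sin t)) 0 (2 * PI) <= 2 * PI * V) ->
  exists y0, rho / 4 <= y0 <= rho / 2 /\ RInt (fun x => v (c + x) y0) (- (rho / 4)) (rho / 4) <= 10 * rho * V.
Proof.
  intros H P Hrho HV. pose proof PI_RGT_0. destruct sqrt2_bounds as [S1 S2].
  assert (V0 : 0 <= V).
  { specialize (HV 0 ltac:(lra)).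
    rewrite (RInt_ext _ (fun _ => v c 0)) in HV by (intros; f_equal; ring).
    rewrite RInt_constR in HV. specialize (P c 0). nra. }
  assert (E1 : forall U, cont2 U -> cont2 (fun x y => U (c + x) (0 + y))).
  { intros U HU. apply (cont2_ext (fun x y => U (c + 1 * x + 0 * y) (0 + 0 * x + 1 * y))); [intros; f_equal; ring|].
    apply cont2_affine; auto. }
  (* In [circle_four_arcs] the upper quarter appears with [x] reversed. *)
  set (f := fun x y => v (c - x) (0 + y)).
  assert (Hf : cont2 f).
  { apply (cont2_ext (fun x y => v (c + (-1) * x + 0 * y) (0 + 0 * x + 1 * y))); [intros; unfold f; f_equal; ring|].
    apply cont2_affine; auto. }
  assert (Pf : forall x y, 0 <= f x y) by (intros; apply P).
  assert (A : forall r, 0 <= r <= 3/4 * rho -> arc_int f r <= 2 * PI * V).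
  { intros r Hr. specialize (HV r Hr).
    rewrite (RInt_ext _ (fun t => v (c + r * cos t) (0 + r * sin t))) in HV by (intros; rewrite Rplus_0_l; reflexivity).
    rewrite (circle_four_arcs v c 0 r H) in HV. fold f in HV.
    assert (0 <= arc_int (fun x y => v (c + y) (0 + x)) r).
    { apply arc_int_ge0; auto. apply (cont2_ext (fun x y => v (c + 0 * x + 1 * y) (0 + 1 * x + 0 * y))); [intros; f_equal; ring|apply cont2_affine; auto]. }
    assert (0 <= arc_int (fun x y => v (c - y) (0 - x)) r).
    { apply arc_int_ge0; auto. apply (cont2_ext (fun x y => v (c + 0 * x + (-1) * y) (0 + (-1) * x + 0 * y))); [intros; f_equal; ring|apply cont2_affine; auto]. }
    assert (0 <= arc_int (fun x y => v (c + x) (0 - y)) r).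
    { apply arc_int_ge0; auto. apply (cont2_ext (fun x y => v (c + 1 * x + 0 * y) (0 + 0 * x + (-1) * y))); [intros; f_equal; ring|apply cont2_affine; auto]. }
    lra. }
  (* [3 / 4] exceeds [sqrt 2 / 2], so the disc contains the sector. *)
  pose proof (sector_le_disc f (rho / 4) (rho / 2) (3 / 4 * rho) Hf Pf ltac:(lra) ltac:(nra)) as S.
  assert (S' : RInt (fun r => r * arc_int f r) 0 (3 / 4 * rho) <= RInt (fun r => 2 * PI * V * r) 0 (3 / 4 * rho)).
  { apply RInt_le; [lra| | |].
    - apply ex_RInt_cont; [lra|]. intros r _. apply (continuous_mult (K := R_AbsRing)); [apply continuous_id|apply arc_int_cont; auto].
    - apply ex_RInt_mulR. apply ex_RInt_cont; [lra|]. intros; apply continuous_id.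
    - intros r Hr. rewrite (Rmult_comm r). apply Rmult_le_compat_r; [lra|apply A; lra]. }
  rewrite RInt_mulR in S' by (apply ex_RInt_cont; [lra|]; intros; apply continuous_id).
  rewrite RInt_id in S'.
  assert (seg : forall y, - y <= y -> RInt (fun x => f x y) (- y) y = RInt (fun x => v (c + x) y) (- y) y).
  { intros y Hy. pose proof (RInt_comp_lin (V := R_CompleteNormedModule) (fun x => v (c + x) y) (-1) 0 y (- y)) as L.
    replace (-1 * y + 0) with (- y) in L by ring. replace (-1 * - y + 0) with y in L by ring.
    assert (Ev : forall p q, ex_RInt (fun x => v (c + x) y) p q).
    { intros. apply (@ex_RInt_continuous R_CompleteNormedModule). intros; apply havg_integrand_cont; auto. }
    rewrite <- L by auto.
    transitivity (- RInt (fun x => f x y) y (- y)).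
    - symmetry. apply (opp_RInt_swap (V := R_CompleteNormedModule)). apply (@ex_RInt_continuous R_CompleteNormedModule).
      intros; apply (continuity_2d_pt_l f); apply Hf.
    - eqR. transitivity (-1 * RInt (fun x => f x y) y (- y)); [ring|].
      rewrite <- (RInt_mulR (-1) (fun x => f x y)).
      + apply RInt_ext. intros x _. unfold f.
        transitivity (-1 * v (c + (-1 * x + 0)) y); [|reflexivity]. f_equal. f_equal; ring.
      + apply (@ex_RInt_continuous R_CompleteNormedModule). intros; apply (continuity_2d_pt_l f); apply Hf. }
  set (g := fun y => RInt (fun x => v (c + x) y) (- (rho / 4)) (rho / 4)).
  assert (gc : forall y, continuous g y).
  { apply (cont2_RInt_param (fun y x => v (c + x) y)); [lra|].
    apply (cont2_swap (fun x y => v (c + x) y)).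
    apply (cont2_ext (fun x y => v (c + 1 * x + 0 * y) (0 + 0 * x + 1 * y))); [intros; f_equal; ring|apply cont2_affine; auto]. }
  (* The disc integral is at most [9 PI / 16 * rho ^ 2 * V], which is below the length [rho / 4] of
     the range of heights times [10 * rho * V]. *)
  destruct (RInt_exists_le g (rho / 4) (rho / 2) (10 * rho * V)) as (y0 & Hy0 & L0); auto; try lra.
  - apply Rle_trans with (RInt (fun y => RInt (fun x => f x y) (- y) y) (rho / 4) (rho / 2)).
    + apply RInt_le; [lra| | |].
      * apply ex_RInt_cont; [lra|]; auto.
      * apply (ex_RInt_ext (fun y => RInt (fun u => y * f (u * y) y) (-1) 1)).
        { intros y Hy. rewrite Rmin_left, Rmax_right in Hy by lra.
          pose proof (RInt_comp_lin (V := R_CompleteNormedModule) (fun x => f x y) y 0 (-1) 1) as L.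
          replace (y * -1 + 0) with (- y) in L by ring. replace (y * 1 + 0) with y in L by ring.
          rewrite <- L.
          - apply RInt_ext. intros u _. transitivity (y * f (y * u + 0) y); [|reflexivity].
            rewrite Rplus_0_r, (Rmult_comm y u). reflexivity.
          - apply (@ex_RInt_continuous R_CompleteNormedModule). intros q _. apply (continuity_2d_pt_l f). apply Hf. }
        apply ex_RInt_cont; [lra|]. intros y _.
        apply (cont2_RInt_param (fun y u => y * f (u * y) y)); [lra|].
        apply cont2_mul; [apply cont2_fst|]. apply (cont2_comp2 f (fun y u => u * y) (fun y _ => y)); auto;
        [apply cont2_mul; [apply cont2_snd|apply cont2_fst]|apply cont2_fst].
      * intros y Hy. rewrite seg by lra. unfold g. apply RInt_le_sub; try lra.
        intros; apply havg_integrand_cont; auto. intros; apply P.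
    + eapply Rle_trans; [exact S|]. eapply Rle_trans; [exact S'|].
      pose proof PI_4. assert (q0 : 0 <= V * (rho * rho)) by (apply Rmult_le_pos; nra).
      assert (PI * (V * (rho * rho)) <= 4 * (V * (rho * rho))) by (apply Rmult_le_compat_r; lra). lra.
  - exists y0. split; auto.
Qed.

(** The circle means over [sqrt 2 * s <= r <= 2 * s], of total weight [s^2], are split into four
    quarters, each covered by a trapezoid. The upper and lower ones contribute [s A] each; in the
    left and right ones the integrals are exchanged, at a cost of [4 s A] each. Then [PI >= 3] gives
    the constant. *)
Lemma line_to_point U c c' s A : cont2 U -> (forall x y, 0 <= U x y) -> 0 < s ->
  subh U (fun x y => (x - c) ^ 2 + (y - c') ^ 2 <= (2 * s) ^ 2) ->
  (forall y, Rabs (y - c') <= 2 * s -> RInt (fun x => U (c + x) y) (- (2 * s)) (2 * s) <= A) ->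
  U c c' <= 2 * A / s.
Proof.
  intros H P Hs HS HA. pose proof PI_RGT_0. destruct sqrt2_bounds as [S1 S2].
  set (f0 := fun x y => U (c + y) (c' + x)). set (f1 := fun x y => U (c - x) (c' + y)).
  set (f2 := fun x y => U (c - y) (c' - x)). set (f3 := fun x y => U (c + x) (c' - y)).
  assert (C0 : cont2 f0) by (apply (cont2_ext (fun x y => U (c + 0 * x + 1 * y) (c' + 1 * x + 0 * y))); [intros; unfold f0; f_equal; ring|apply cont2_affine; auto]).
  assert (C1 : cont2 f1) by (apply (cont2_ext (fun x y => U (c + (-1) * x + 0 * y) (c' + 0 * x + 1 * y))); [intros; unfold f1; f_equal; ring|apply cont2_affine; auto]).
  assert (C2 : cont2 f2) by (apply (cont2_ext (fun x y => U (c + 0 * x + (-1) * y) (c' + (-1) * x + 0 * y))); [intros; unfold f2; f_equal; ring|apply cont2_affine; auto]).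
  assert (C3 : cont2 f3) by (apply (cont2_ext (fun x y => U (c + 1 * x + 0 * y) (c' + 0 * x + (-1) * y))); [intros; unfold f3; f_equal; ring|apply cont2_affine; auto]).
  assert (EU : forall y p q, ex_RInt (fun x => U (c + x) y) p q).
  { intros. apply (@ex_RInt_continuous R_CompleteNormedModule). intros; apply havg_integrand_cont; auto. }
  assert (flip : forall y p q, RInt (fun x => U (c - x) y) p q = RInt (fun x => U (c + x) y) (- q) (- p)).
  { intros y p q. 
    pose proof (RInt_comp_lin (V := R_CompleteNormedModule) (fun x => U (c + x) y) (-1) 0 p q (EU _ _ _)) as L.
    replace (-1 * p + 0) with (- p) in L by ring. replace (-1 * q + 0) with (- q) in L by ring.
    rewrite <- (opp_RInt_swap (V := R_CompleteNormedModule) (fun x => U (c + x) y) (- p) (- q) (EU _ _ _)).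
    rewrite <- L. 
    assert (X : forall z : R, z = - (-1 * z)) by (intros; ring).
    transitivity (- (-1 * RInt (fun x => U (c - x) y) p q)); [apply X|].
    rewrite <- (RInt_mulR (-1) (fun x => U (c - x) y)).
    - transitivity (- RInt (fun x => scal (-1) (U (c + (-1 * x + 0)) y)) p q); [|reflexivity].
      f_equal. apply RInt_ext. intros x _.
      transitivity (-1 * U (c + (-1 * x + 0)) y); [|reflexivity]. f_equal. f_equal; ring.
    - apply (@ex_RInt_continuous R_CompleteNormedModule). intros z _. apply (continuity_2d_pt_l (fun x y => U (c - x) y)).
      apply (cont2_ext (fun x y => U (c + (-1) * x + 0 * y) (0 + 0 * x + 1 * y))); [intros; f_equal; ring|apply cont2_affine; auto]. }
  assert (A0 : 0 <= A).
  { eapply Rle_trans; [|apply (HA c')]. apply RInt_ge_0; auto; lra.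
    rewrite Rminus_diag, Rabs_R0. lra. }
  assert (B1 : forall f, cont2 f -> (forall x y, 0 <= f x y) ->
     RInt (fun r => r * arc_int f r) (sqrt 2 * s) (2 * s) <= RInt (fun y => RInt (fun x => f x y) (- (2 * s)) (2 * s)) s (2 * s)).
  { intros f Cf Pf. eapply Rle_trans; [apply annulus_le_sector; auto; lra|].
    apply RInt_le; [lra| | |].
    - apply (ex_RInt_ext (fun y => RInt (fun u => y * f (u * y) y) (-1) 1)).
        { intros y Hy. rewrite Rmin_left, Rmax_right in Hy by lra.
          pose proof (RInt_comp_lin (V := R_CompleteNormedModule) (fun x => f x y) y 0 (-1) 1) as L.
          replace (y * -1 + 0) with (- y) in L by ring. replace (y * 1 + 0) with y in L by ring.
          rewrite <- L.
          - apply RInt_ext. intros u _. transitivity (y * f (y * u + 0) y); [|reflexivity].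
            rewrite Rplus_0_r, (Rmult_comm y u). reflexivity.
          - apply (@ex_RInt_continuous R_CompleteNormedModule). intros q _. apply (continuity_2d_pt_l f). apply Cf. }
        apply ex_RInt_cont; [lra|]. intros y _.
        apply (cont2_RInt_param (fun y u => y * f (u * y) y)); [lra|].
        apply cont2_mul; [apply cont2_fst|]. apply (cont2_comp2 f (fun y u => u * y) (fun y _ => y)); auto;
        [apply cont2_mul; [apply cont2_snd|apply cont2_fst]|apply cont2_fst].
    - apply ex_RInt_cont; [lra|]. intros y _. apply (cont2_RInt_param (fun y x => f x y)); [lra|]. apply cont2_swap; auto.
    - intros y Hy. apply RInt_le_sub; try lra; auto. intros; apply (continuity_2d_pt_l f); apply Cf. }
  assert (cst : forall a b m, RInt (fun _ : R => m) a b = (b - a) * m) by (intros; apply RInt_constR).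
  assert (H1 : forall f, cont2 f -> (forall y, s <= y <= 2 * s -> RInt (fun x => f x y) (- (2 * s)) (2 * s) <= A) ->
     RInt (fun y => RInt (fun x => f x y) (- (2 * s)) (2 * s)) s (2 * s) <= s * A).
  { intros f Cf Hf. replace (s * A) with ((2 * s - s) * A) by ring. rewrite <- cst. apply RInt_le; [lra| | |].
    - apply ex_RInt_cont; [lra|]. intros y _. apply (cont2_RInt_param (fun y x => f x y)); [lra|]. apply cont2_swap; auto.
    - apply ex_RInt_const.
    - intros y Hy. apply Hf. lra. }
  assert (H2 : forall f, cont2 f -> (forall x, - (2 * s) <= x <= 2 * s -> RInt (fun y => f x y) s (2 * s) <= A) ->
     RInt (fun y => RInt (fun x => f x y) (- (2 * s)) (2 * s)) s (2 * s) <= 4 * s * A).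
  { intros f Cf Hf. rewrite <- fubini by (auto; lra).
    replace (4 * s * A) with ((2 * s - - (2 * s)) * A) by ring. rewrite <- cst. apply RInt_le; [lra| | |].
    - apply ex_RInt_cont; [lra|]. intros y _. apply (cont2_RInt_param f); auto; lra.
    - apply ex_RInt_const.
    - intros x Hx. apply Hf. lra. }
  pose proof (B1 f0 C0 ltac:(intros; apply P)) as D0. pose proof (B1 f1 C1 ltac:(intros; apply P)) as D1.
  pose proof (B1 f2 C2 ltac:(intros; apply P)) as D2. pose proof (B1 f3 C3 ltac:(intros; apply P)) as D3.
  assert (G0 : RInt (fun y => RInt (fun x => f0 x y) (- (2 * s)) (2 * s)) s (2 * s) <= 4 * s * A).
  { apply H2; auto. intros x Hx. unfold f0. 
    eapply Rle_trans; [|apply (HA (c' + x))]; [|replace (c' + x - c') with x by ring; apply Rabs_le; lra].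
    apply RInt_le_sub; try lra; [intros; apply havg_integrand_cont; auto|intros; apply P]. }
  assert (G2 : RInt (fun y => RInt (fun x => f2 x y) (- (2 * s)) (2 * s)) s (2 * s) <= 4 * s * A).
  { apply H2; auto. intros x Hx. unfold f2. rewrite flip.
    eapply Rle_trans; [|apply (HA (c' - x))]; [|replace (c' - x - c') with (- x) by ring; apply Rabs_le; lra].
    apply RInt_le_sub; try lra; [intros; apply havg_integrand_cont; auto|intros; apply P]. }
  assert (G1 : RInt (fun y => RInt (fun x => f1 x y) (- (2 * s)) (2 * s)) s (2 * s) <= s * A).
  { apply H1; auto. intros y Hy. unfold f1. rewrite flip, Ropp_involutive.
    apply HA. replace (c' + y - c') with y by ring. apply Rabs_le; lra. }
  assert (G3 : RInt (fun y => RInt (fun x => f3 x y) (- (2 * s)) (2 * s)) s (2 * s) <= s * A).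
  { apply H1; auto. intros y Hy. unfold f3. 
    apply HA. replace (c' - y - c') with (- y) by ring. apply Rabs_le; lra. }
  assert (Ea : forall f, cont2 f -> ex_RInt (fun r => r * arc_int f r) (sqrt 2 * s) (2 * s)).
  { intros f Cf. apply ex_RInt_cont; [nra|]. intros r _. apply (continuous_mult (K := R_AbsRing)); [apply continuous_id|apply arc_int_cont; auto]. }
  assert (M : RInt (fun r => 2 * PI * U c c' * r) (sqrt 2 * s) (2 * s) <=
     RInt (fun r => r * arc_int f0 r + r * arc_int f1 r + r * arc_int f2 r + r * arc_int f3 r) (sqrt 2 * s) (2 * s)).
  { apply RInt_le; [nra| | |].
    - apply ex_RInt_mulR. apply ex_RInt_cont; [nra|]. intros; apply continuous_id.
    - apply ex_RInt_addR; [apply ex_RInt_addR; [apply ex_RInt_addR|]|]; auto.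
    - intros r Hr. assert (r0 : 0 <= r <= 2 * s) by nra.
      pose proof (circle_mean U c c' r H ltac:(lra)) as CM.
      rewrite (circle_four_arcs U c c' r H) in CM. fold f0 f1 f2 f3 in CM.
      replace (r * arc_int f0 r + r * arc_int f1 r + r * arc_int f2 r + r * arc_int f3 r) with
        ((arc_int f0 r + arc_int f1 r + arc_int f2 r + arc_int f3 r) * r) by ring.
      apply Rmult_le_compat_r; [lra|]. apply CM.
      destruct HS as (K & d & K0 & d0 & HK). exists K, d. split; auto. split; auto.
      intros x y Hxy. apply HK. eapply Rle_trans; [exact Hxy|]. apply pow_incr; lra. }
  rewrite RInt_mulR in M by (apply ex_RInt_cont; [nra|]; intros; apply continuous_id).
  rewrite RInt_id in M.
  rewrite (RInt_addR (fun r => r * arc_int f0 r + r * arc_int f1 r + r * arc_int f2 r) (fun r => r * arc_int f3 r)) in M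
    by (first [solve [auto]|apply ex_RInt_addR; [apply ex_RInt_addR|]; auto]).
  rewrite (RInt_addR (fun r => r * arc_int f0 r + r * arc_int f1 r) (fun r => r * arc_int f2 r)) in M
    by (first [solve [auto]|apply ex_RInt_addR; auto]).
  rewrite (RInt_addR (fun r => r * arc_int f0 r) (fun r => r * arc_int f1 r)) in M by auto.
  replace (((2 * s) ^ 2 - (sqrt 2 * s) ^ 2) / 2) with (s * s) in M
    by (replace ((sqrt 2 * s) ^ 2) with (sqrt 2 * sqrt 2 * (s * s)) by ring; rewrite S2; field).
  assert (F : 2 * PI * U c c' * s <= 10 * A).
  { apply Rmult_le_reg_r with s; auto. lra. }
  assert (F2 : U c c' * s <= 2 * A).
  { assert (3 <= PI) by (pose proof PI2_3_2; lra). specialize (P c c'). nra. }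
  apply Rmult_le_reg_r with s; auto. unfold Rdiv. rewrite Rmult_assoc, Rinv_l; lra.
Qed.

(** * Positive superharmonic functions in a strip *)

Lemma lipschitz_continuous (g : R -> R) x : (forall a b, Rabs (g a - g b) <= Rabs (a - b)) -> continuous g x.
Proof.
  intros H. apply continuity_pt_filterlim. intros eps He. exists eps. split; auto.
  intros u [_ Hu]. simpl in *. unfold Rdist in *. specialize (H u x). lra.
Qed.

(** From [exp u - exp (- u) >= u] with [u = k e / 2]. The crude factor [1 / 4] is compensated by the
    exponent [4 c] in [supersolution_growth]. *)
Lemma exp_second_difference k y e : 0 < k -> 0 < e ->
  exp (k * y) * (k * e) ^ 2 / 4 <= exp (k * (y + e)) + exp (k * (y - e)) - 2 * exp (k * y).
Proof.
  intros Hk He. set (u := k * e / 2). assert (u0 : 0 < u) by (unfold u; nra).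
  assert (E1 : exp (k * (y + e)) = exp (k * y) * (exp u * exp u)).
  { rewrite <- !exp_plus. f_equal. unfold u. field. }
  assert (E2 : exp (k * (y - e)) = exp (k * y) * (exp (- u) * exp (- u))).
  { rewrite <- !exp_plus. f_equal. unfold u. field. }
  assert (E3 : exp u * exp (- u) = 1) by (rewrite <- exp_plus; replace (u + - u) with 0 by ring; apply exp_0).
  pose proof (exp_pos (k * y)) as P. pose proof (exp_pos u) as P1. pose proof (exp_pos (- u)) as P2.
  assert (G : 1 + u < exp u) by (apply exp_ineq1; lra).
  assert (L : u <= exp u - exp (- u)) by nra.
  assert (S : u * u <= (exp u - exp (- u)) * (exp u - exp (- u))) by nra.
  rewrite E1, E2.
  replace (exp (k * y) * (exp u * exp u) + exp (k * y) * (exp (- u) * exp (- u)) - 2 * exp (k * y)) with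
    (exp (k * y) * ((exp u - exp (- u)) * (exp u - exp (- u)))).
  - replace (exp (k * y) * (k * e) ^ 2 / 4) with (exp (k * y) * (u * u)) by (unfold u; field).
    apply Rmult_le_compat_l; lra.
  - replace ((exp u - exp (- u)) * (exp u - exp (- u))) with (exp u * exp u + exp (- u) * exp (- u) - 2 * (exp u * exp (- u))) by ring.
    rewrite E3. ring.
Qed.

(** A discrete form of [m'' <= c^2 m] with [m >= 0]. Let [q] be the exponential minus 1, and [l]
    chosen for equality at [y1]. At a negative interior minimum of [m - l q], [m] would be smaller
    than [l exp (4 c y)] and so bend upward less than [l q], which a minimum excludes. *)
Lemma supersolution_growth (m : R -> R) c y0 y1 K d : 0 < c -> 0 < y0 <= y1 -> 0 <= K -> 0 < d ->
  (forall y, continuous m y) -> (forall y, 0 <= y <= y1 -> 0 <= m y) ->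
  (forall y e, 0 < y < y1 -> 0 < e < d -> m (y + e) + m (y - e) - 2 * m y <= c ^ 2 * e ^ 2 * m y + K * e ^ 3) ->
  m y1 * (exp (4 * c * y0) - 1) <= m y0 * (exp (4 * c * y1) - 1).
Proof.
  intros Hc Hy K0 d0 HC P HD.
  set (k := 4 * c). assert (Hk : 0 < k) by (unfold k; lra).
  set (q := fun y => exp (k * y) - 1).
  assert (q0 : forall y, 0 < y -> 0 < q y).
  { intros y Hy0. unfold q. rewrite <- exp_0. apply Rlt_0_minus, exp_increasing. nra. }
  assert (q1 : 0 < q y1) by (apply q0; lra).
  set (l := m y1 / q y1).
  assert (El : l * q y1 = m y1) by (unfold l; field; lra).
  assert (l0 : 0 <= l) by (apply Rdiv_le_0_compat; auto; apply P; lra).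
  set (g := fun y => m y - l * q y).
  destruct (continuity_ab_min g 0 y1 ltac:(lra)) as (ys & Hmin & Hys).
  { intros y _. apply continuity_pt_filterlim, (continuous_minus (V := R_NormedModule) m (fun y => l * q y)).
    - apply HC.
    - apply (ex_derive_continuous (V := R_NormedModule)). unfold q. auto_derive. auto. }
  assert (G : 0 <= g ys).
  { destruct (Rle_lt_dec 0 (g ys)) as [|N]; auto. exfalso.
    assert (N0 : ys <> 0).
    { intros ->. unfold g, q in N. rewrite Rmult_0_r, exp_0 in N. specialize (P 0 ltac:(lra)). lra. }
    assert (N1 : ys <> y1) by (intros ->; unfold g in N; lra).
    assert (I : 0 < ys < y1) by lra.
    set (E := exp (k * ys)). assert (E0 : 0 < E) by apply exp_pos.
    assert (Lm : m ys < l * E) by (unfold g, q in N; fold E in N; nra).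
    assert (lE : 0 < l * E) by (specialize (P ys ltac:(lra)); lra).
    (* Keeps [ys - e] and [ys + e] inside the interval and makes [K e^3] at most [c^2 e^2 l E]. *)
    set (e := Rmin (Rmin (d / 2) (ys / 2)) (Rmin ((y1 - ys) / 2) (c ^ 2 * (l * E) / (K + 1)))).
    assert (c2 : 0 < c ^ 2) by (apply pow_lt; auto).
    assert (e0 : 0 < e).
    { unfold e. repeat apply Rmin_case; try lra. apply Rdiv_lt_0_compat; [|lra]. apply Rmult_lt_0_compat; auto. }
    assert (e1 : e <= d / 2) by (eapply Rle_trans; [apply Rmin_l|apply Rmin_l]).
    assert (e2 : e <= ys / 2) by (eapply Rle_trans; [apply Rmin_l|apply Rmin_r]).
    assert (e3 : e <= (y1 - ys) / 2) by (eapply Rle_trans; [apply Rmin_r|apply Rmin_l]).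
    assert (e4 : e * (K + 1) <= c ^ 2 * (l * E)).
    { replace (c ^ 2 * (l * E)) with (c ^ 2 * (l * E) / (K + 1) * (K + 1)) by (field; lra).
      apply Rmult_le_compat_r; [lra|]. eapply Rle_trans; [apply Rmin_r|apply Rmin_r]. }
    pose proof (Hmin (ys + e) ltac:(lra)) as M1. pose proof (Hmin (ys - e) ltac:(lra)) as M2. unfold g, q in M1, M2.
    specialize (HD ys e I ltac:(lra)).
    pose proof (exp_second_difference k ys e Hk e0) as X. fold E in X, M1, M2.
    replace (E * (k * e) ^ 2 / 4) with (4 * c ^ 2 * e ^ 2 * E) in X by (unfold k; field).
    assert (ee : 0 < e ^ 2) by (apply pow_lt; auto).
    assert (l * (4 * c ^ 2 * e ^ 2 * E) <= l * (exp (k * (ys + e)) + exp (k * (ys - e)) - 2 * E)) by (apply Rmult_le_compat_l; auto).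
    assert (c ^ 2 * e ^ 2 * m ys <= c ^ 2 * e ^ 2 * (l * E)) by (apply Rmult_le_compat_l; nra).
    assert (K * e ^ 3 <= e ^ 2 * (c ^ 2 * (l * E))).
    { replace (K * e ^ 3) with (e ^ 2 * (e * K)) by ring. apply Rmult_le_compat_l; lra. }
    assert (0 < c ^ 2 * e ^ 2 * (l * E)) by (apply Rmult_lt_0_compat; [nra|lra]).
    nra. }
  pose proof (Hmin y0 ltac:(lra)) as M. unfold g at 2 in M.
  assert (l * q y0 <= m y0) by lra.
  change (exp (k * y0) - 1) with (q y0). change (exp (k * y1) - 1) with (q y1).
  rewrite <- El. replace (l * q y1 * q y0) with (l * q y0 * q y1) by ring. apply Rmult_le_compat_r; lra.
Qed.

Section Line.
Variables (v : R -> R -> R) (t rho rho' : R).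
Hypothesis Hrho : 0 < rho.
Hypothesis Cv : cont2 v.
Hypothesis Pv : forall x y, 0 <= v x y.
Hypothesis Sv : subh (fun x y => - v x y) (fun x y => Rabs (x - t) <= rho /\ Rabs y < rho').

Let h := rho / 4.
Let c := PI / (2 * h).
(** The first Dirichlet eigenfunction of [[- h, h]], extended by zero: its second derivative is at
    least [- c^2 alpha] in the sense of second differences. The formula gives zero for
    [h <= |x| <= 3 h], which leaves room for shifts within [[- 2 h, 2 h]]. *)
Let alpha x := Rmax 0 (cos (c * x)).
Definition weighted (y : R) : R := RInt (fun x => alpha x * v (t + x) y) (- (2 * h)) (2 * h).

Let h0 : 0 < h.
Proof. unfold h. lra. Qed.

Let c0 : 0 < c.
Proof. unfold c. pose proof PI_RGT_0. apply Rdiv_lt_0_compat; lra. Qed.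

Let ch : c * h = PI / 2.
Proof. unfold c. field. lra. Qed.

Lemma alpha_cont x : continuous alpha x.
Proof.
  apply (continuous_comp (fun x => cos (c * x)) (Rmax 0)).
  - apply (ex_derive_continuous (V := R_NormedModule)). auto_derive. auto.
  - apply lipschitz_continuous. intros a b. unfold Rmax. destruct Rle_dec, Rle_dec; unfold Rabs; repeat destruct Rcase_abs; lra.
Qed.

Lemma alpha_range x : 0 <= alpha x <= 1.
Proof. unfold alpha. split; [apply Rmax_l|]. apply Rmax_lub; [lra|apply COS_bound]. Qed.

Lemma alpha_zero x : h <= Rabs x <= 3 * h -> alpha x = 0.
Proof.
  intros Hx. unfold alpha. apply Rmax_left.
  assert (E : cos (c * x) = cos (c * Rabs x)).
  { unfold Rabs. destruct Rcase_abs; auto. rewrite <- cos_neg. f_equal. ring. }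
  rewrite E. pose proof PI_RGT_0. apply cos_le_0; nra.
Qed.

Lemma weighted_integrand_cont a y x : continuous (fun x => alpha (x + a) * v (t + x) y) x.
Proof.
  apply (continuous_mult (K := R_AbsRing)).
  - apply (continuous_comp (fun x => x + a) alpha); [|apply alpha_cont].
    apply (continuous_plus (V := R_NormedModule)); [apply continuous_id|apply continuous_const].
  - apply havg_integrand_cont; auto.
Qed.

Lemma weighted_ex a y p q : ex_RInt (fun x => alpha (x + a) * v (t + x) y) p q.
Proof. apply (@ex_RInt_continuous R_CompleteNormedModule). intros; apply weighted_integrand_cont. Qed.

Lemma weighted_narrow y : weighted y = RInt (fun x => alpha (x + 0) * v (t + x) y) (- h) h.
Proof.
  unfold weighted.
  rewrite (RInt_ext _ (fun x => alpha (x + 0) * v (t + x) y)) by (intros; rewrite Rplus_0_r; reflexivity).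
  rewrite <- (RInt_ChaslesR _ (- (2 * h)) (- h) (2 * h)), <- (RInt_ChaslesR _ (- h) h (2 * h)) by apply weighted_ex.
  assert (Z : forall p q, h <= p <= q -> q <= 2 * h -> RInt (fun x => alpha (x + 0) * v (t + x) y) p q = 0).
  { intros p q Hp Hq. rewrite (RInt_ext _ (fun _ => 0)); [rewrite RInt_constR; eqR; ring|].
    intros x Hx. rewrite Rmin_left, Rmax_right in Hx by lra. rewrite alpha_zero; [eqR; ring|]. rewrite Rplus_0_r, Rabs_right; lra. }
  assert (Z' : RInt (fun x => alpha (x + 0) * v (t + x) y) (- (2 * h)) (- h) = 0).
  { rewrite (RInt_ext _ (fun _ => 0)); [rewrite RInt_constR; eqR; ring|].
    intros x Hx. rewrite Rmin_left, Rmax_right in Hx by lra. rewrite alpha_zero; [eqR; ring|]. rewrite Rplus_0_r, Rabs_left; lra. }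
  rewrite Z', (Z h (2 * h)) by lra. eqR; ring.
Qed.

Lemma weighted_shift e y : Rabs e < h ->
  RInt (fun x => alpha (x + e) * v (t + x) y) (- h) h <= RInt (fun x => alpha x * v (t + x - e) y) (- (2 * h)) (2 * h).
Proof.
  intros He. apply Rabs_lt_between in He.
  pose proof (RInt_comp_lin (V := R_CompleteNormedModule) (fun x => alpha (x + e) * v (t + x) y) 1 (- e) (- (2 * h)) (2 * h)) as L.
  rewrite !Rmult_1_l in L.
  assert (E : RInt (fun x => alpha x * v (t + x - e) y) (- (2 * h)) (2 * h) =
     RInt (fun x => alpha (x + e) * v (t + x) y) (- (2 * h) + - e) (2 * h + - e)).
  { rewrite <- L by apply weighted_ex. apply RInt_ext. intros x _.
    transitivity (1 * (alpha (1 * x + - e + e) * v (t + (1 * x + - e)) y)); [|reflexivity].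
    rewrite !Rmult_1_l. f_equal; f_equal; ring. }
  rewrite E. apply RInt_le_sub; try lra.
  - intros; apply weighted_integrand_cont.
  - intros. apply Rmult_le_pos; [apply alpha_range|apply Pv].
Qed.

(** Superharmonicity replaces the vertical neighbours of [v] by horizontal ones, a shift moves these
    onto [alpha], and [alpha (x + e) + alpha (x - e) >= 2 cos (c e) alpha x] on [[- h, h]]. *)
Lemma weighted_supersolution : exists K d, 0 <= K /\ 0 < d /\ forall y e, Rabs y < rho' -> 0 < e < d ->
  weighted (y + e) + weighted (y - e) - 2 * weighted y <= c ^ 2 * e ^ 2 * weighted y + K * e ^ 3.
Proof.
  destruct Sv as (K & d & K0 & d0 & HK).
  exists (4 * h * K), (Rmin d (Rmin h (1 / c))). split; [nra|].
  assert (ic : 0 < 1 / c) by (apply Rdiv_lt_0_compat; lra).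
  split. { repeat apply Rmin_case; auto. }
  intros y e Hy He.
  assert (e1 : e < d) by (eapply Rlt_le_trans; [apply He|apply Rmin_l]).
  assert (e2 : e < h) by (eapply Rlt_le_trans; [apply He|eapply Rle_trans; [apply Rmin_r|apply Rmin_l]]).
  assert (e3 : c * e < 1).
  { assert (X : e < 1 / c) by (eapply Rlt_le_trans; [apply He|eapply Rle_trans; [apply Rmin_r|apply Rmin_r]]).
    apply (Rmult_lt_compat_l c) in X; auto. replace (c * (1 / c)) with 1 in X by (field; lra). exact X. }
  assert (Ex : forall z, ex_RInt (fun x => alpha x * v (t + x) z) (- (2 * h)) (2 * h)).
  { intros z. apply (ex_RInt_ext (fun x => alpha (x + 0) * v (t + x) z)); [intros; rewrite Rplus_0_r; reflexivity|apply weighted_ex]. }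
  assert (Exs : forall s, ex_RInt (fun x => alpha x * v (t + x - s) y) (- (2 * h)) (2 * h)).
  { intros s. apply (@ex_RInt_continuous R_CompleteNormedModule). intros x _. 
    apply (continuous_mult (K := R_AbsRing)); [apply alpha_cont|].
    apply (continuous_ext (fun x => v (t - s + x) y)); [intros; f_equal; ring|]. apply havg_integrand_cont; auto. }
  pose proof (weighted_shift e y ltac:(apply Rabs_lt_between; lra)) as W1.
  pose proof (weighted_shift (- e) y ltac:(apply Rabs_lt_between; lra)) as W2.
  assert (A : 2 * cos (c * e) * weighted y <=
     RInt (fun x => alpha (x + e) * v (t + x) y) (- h) h + RInt (fun x => alpha (x + - e) * v (t + x) y) (- h) h).
  { rewrite weighted_narrow, <- RInt_mulR by apply weighted_ex.
    rewrite <- RInt_addR by apply weighted_ex. apply RInt_le; [lra| | |].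
    - apply ex_RInt_mulR, weighted_ex.
    - apply ex_RInt_addR; apply weighted_ex.
    - intros x Hx. rewrite <- Rmult_plus_distr_r, <- Rmult_assoc. apply Rmult_le_compat_r; [apply Pv|].
      rewrite Rplus_0_r.
      assert (P : 0 <= cos (c * x)) by (pose proof PI_RGT_0; apply cos_ge_0; nra).
      unfold alpha at 1. rewrite Rmax_right by exact P.
      replace (2 * cos (c * e) * cos (c * x)) with (cos (c * (x + e)) + cos (c * (x + - e))).
      + apply Rplus_le_compat; apply Rmax_r.
      + replace (c * (x + e)) with (c * x + c * e) by ring. replace (c * (x + - e)) with (c * x - c * e) by ring.
        rewrite cos_plus, cos_minus. ring. }
  assert (B : weighted (y + e) + weighted (y - e) <=
     4 * weighted y - (RInt (fun x => alpha x * v (t + x - e) y) (- (2 * h)) (2 * h)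
        + RInt (fun x => alpha x * v (t + x - - e) y) (- (2 * h)) (2 * h)) + 4 * h * K * e ^ 3).
  { assert (L : RInt (fun x => alpha x * v (t + x) (y + e) + alpha x * v (t + x) (y - e)) (- (2 * h)) (2 * h) <=
      RInt (fun x => 4 * (alpha x * v (t + x) y) - (alpha x * v (t + x - e) y + alpha x * v (t + x - - e) y) + K * e ^ 3) (- (2 * h)) (2 * h)).
    { apply RInt_le; [lra| | |].
      - apply ex_RInt_addR; auto.
      - apply (ex_RInt_addR (fun x => 4 * (alpha x * v (t + x) y) - (alpha x * v (t + x - e) y + alpha x * v (t + x - - e) y))); [|apply ex_RInt_const].
        apply ex_RInt_subR; [apply ex_RInt_mulR; auto|apply ex_RInt_addR; auto].
      - intros x Hx. assert (D : Rabs (t + x - t) <= rho /\ Rabs y < rho').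
        { split; auto. replace (t + x - t) with x by ring. apply Rabs_le. unfold h in *. lra. }
        specialize (HK (t + x) y D e e 0 ltac:(lra) ltac:(rewrite Rabs_right; lra) ltac:(rewrite Rabs_R0; lra)).
        unfold stencil in HK. rewrite !Rplus_0_r, !Rminus_0_r in HK.
        replace (t + x - - e) with (t + x + e) by ring.
        destruct (alpha_range x) as [R1 R2].
        assert (K * e ^ 3 * alpha x <= K * e ^ 3).
        { rewrite <- (Rmult_1_r (K * e ^ 3)) at 2. apply Rmult_le_compat_l; auto. apply Rmult_le_pos; auto. apply pow_le; lra. }
        nra. }
    rewrite RInt_addR in L by auto.
    rewrite (RInt_addR (fun x => 4 * (alpha x * v (t + x) y) - (alpha x * v (t + x - e) y + alpha x * v (t + x - - e) y)) (fun _ => K * e ^ 3)) in L.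
    - rewrite (RInt_subR (fun x => 4 * (alpha x * v (t + x) y)) (fun x => alpha x * v (t + x - e) y + alpha x * v (t + x - - e) y)) in L;
        [|apply ex_RInt_mulR; auto|apply ex_RInt_addR; auto].
      rewrite RInt_mulR in L by auto. rewrite (RInt_addR (fun x => alpha x * v (t + x - e) y)) in L by auto.
      rewrite RInt_constR in L. unfold weighted. lra.
    - apply ex_RInt_subR; [apply ex_RInt_mulR; auto|apply ex_RInt_addR; auto].
    - apply ex_RInt_const. }
  assert (W0 : 0 <= weighted y).
  { unfold weighted. apply RInt_ge_0; auto; [lra|]. intros. apply Rmult_le_pos; [apply alpha_range|apply Pv]. }
  assert (Cs : 2 - 2 * cos (c * e) <= c ^ 2 * e ^ 2).
  { assert (X : 1 - (c * e) ^ 2 / 2 <= cos (c * e)).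
    { replace (c * e) with (2 * (c * e / 2)) at 2 by field. rewrite cos_2a_sin.
      assert (S : 0 <= sin (c * e / 2) <= c * e / 2).
      { assert (0 < c * e) by nra. split; [apply sin_ge_0; pose proof PI_RGT_0; pose proof PI2_1; lra|].
        left. apply sin_lt_x. lra. }
      nra. }
    replace (c ^ 2 * e ^ 2) with ((c * e) ^ 2) by ring. lra. }
  assert ((2 - 2 * cos (c * e)) * weighted y <= c ^ 2 * e ^ 2 * weighted y) by (apply Rmult_le_compat_r; auto).
  lra.
Qed.
End Line.

(** A Harnack-type estimate, uniform up to the edge of the strip: circle means bound one segment at
    a height [y0] between [rho / 4] and [rho / 2], and [supersolution_growth] carries the bound to
    every height. The constant does not involve [rho']. *)
Theorem strip_line_bound (v : R -> R -> R) (t rho rho' : R) : 0 < rho -> 3 / 4 * rho < rho' <= rho ->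
  cont2 v -> (forall x y, 0 <= v x y) ->
  subh (fun x y => - v x y) (fun x y => Rabs (x - t) <= rho /\ Rabs y < rho') ->
  forall y, Rabs y < rho' -> RInt (fun x => v (t + x) y) (- (rho / 8)) (rho / 8) <= 20 * exp (16 * PI) * rho * v t 0.
Proof.
  intros Hrho Hrho' Cv Pv Sv y1 Hy1. pose proof PI_RGT_0 as Hpi.
  set (h := rho / 4) in *. set (c := PI / (2 * h)).
  set (alpha := fun x => Rmax 0 (cos (c * x))).
  assert (h0 : 0 < h) by (unfold h; lra).
  assert (Ec : c = 2 * PI / rho) by (unfold c, h; field; lra).
  assert (c0 : 0 < c) by (rewrite Ec; apply Rdiv_lt_0_compat; lra).
  assert (cr : c * rho = 2 * PI) by (rewrite Ec; field; lra).
  set (m := weighted v t rho).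
  assert (ac : forall x, continuous alpha x) by (intros; apply alpha_cont).
  assert (mc : forall y, continuous m y).
  { unfold m, weighted. fold h c.
    apply (cont2_RInt_param (fun y x => alpha x * v (t + x) y)); [lra|].
    apply (cont2_swap (fun x y => alpha x * v (t + x) y)). apply cont2_mul.
    - apply (cont2_1d alpha (fun x _ => x)); auto. apply cont2_fst.
    - apply (cont2_ext (fun x y => v (t + 1 * x + 0 * y) (0 + 0 * x + 1 * y))); [intros; f_equal; ring|apply cont2_affine; auto]. }
  assert (alr : forall x, 0 <= alpha x <= 1) by (intros; apply alpha_range).
  assert (Ea : forall y p q, ex_RInt (fun x => alpha x * v (t + x) y) p q).
  { intros. apply (@ex_RInt_continuous R_CompleteNormedModule). intros. apply (continuous_mult (K := R_AbsRing)); auto.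
    apply havg_integrand_cont; auto. }
  assert (Ev : forall y p q, ex_RInt (fun x => v (t + x) y) p q).
  { intros. apply (@ex_RInt_continuous R_CompleteNormedModule). intros; apply havg_integrand_cont; auto. }
  assert (mp : forall y, 0 <= m y).
  { intros y. unfold m, weighted. apply RInt_ge_0; [fold h; lra|apply Ea|]. intros x _. apply Rmult_le_pos; [apply alr|auto]. }
  destruct (point_to_line v t rho (v t 0)) as (y0 & Hy0 & L0); auto.
  { intros r Hr.
    assert (CM : 2 * PI * - v t 0 <= RInt (fun s => - v (t + r * cos s) (0 + r * sin s)) 0 (2 * PI)).
    { apply (circle_mean (fun x y => - v x y) t 0 r); [|lra|].
      - intros x y. apply continuity_2d_pt_opp. apply Cv.
      - destruct Sv as (K & d & K0 & d0 & HK). exists K, d. split; auto. split; auto.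
        intros x y Hxy. apply HK. pose proof (pow2_ge_0 (x - t)). pose proof (pow2_ge_0 (y - 0)).
        assert (Rabs (x - t) <= r) by (apply Rabs_le; nra).
        rewrite Rminus_0_r in *.
        assert (Rabs y <= r) by (apply Rabs_le; nra).
        lra. }
    rewrite (RInt_ext _ (fun s => -1 * v (t + r * cos s) (r * sin s))) in CM
      by (intros; rewrite Rplus_0_l; eqR; ring).
    rewrite RInt_mulR in CM; [lra|].
    apply (@ex_RInt_continuous R_CompleteNormedModule). intros s _.
    apply (cont2_comp v (fun s => t + r * cos s) (fun s => r * sin s)); auto;
    apply (ex_derive_continuous (V := R_NormedModule)); auto_derive; auto. }
  fold h in L0, Hy0.
  assert (M0 : m y0 <= 10 * rho * v t 0).
  { unfold m. rewrite weighted_narrow by auto. fold h. eapply Rle_trans; [|exact L0].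
    apply RInt_le; [lra| | |].
    - fold c. fold alpha. apply (ex_RInt_ext (fun x => alpha x * v (t + x) y0)); [intros; unfold alpha; rewrite Rplus_0_r; reflexivity|apply Ea].
    - apply Ev.
    - intros x _. specialize (alr (x + 0)). unfold alpha, c in alr. unfold h in *. specialize (Pv (t + x) y0).
      cbv beta. nra. }
  destruct (weighted_supersolution v t rho rho' Hrho Cv Pv Sv) as (K & d & K0 & d0 & HK).
  fold h c m in HK.
  assert (E1 : 1 <= exp (2 * PI) - 1).
  { pose proof (exp_ineq1 (2 * PI) ltac:(lra)). pose proof PI2_1. lra. }
  (* Since [c rho = 2 PI], the exponents that occur lie between [2 PI] on the left and [16 PI] on
     the right. *)
  assert (X : forall a b, 2 * PI <= a -> b <= 16 * PI -> m y1 * (exp a - 1) <= m y0 * (exp b - 1) ->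
     m y1 <= exp (16 * PI) * m y0).
  { intros a b Ha Hb I.
    assert (exp (2 * PI) <= exp a) by (destruct Ha as [Ha|<-]; [left; apply exp_increasing; auto|lra]).
    assert (exp b <= exp (16 * PI)) by (destruct Hb as [Hb| ->]; [left; apply exp_increasing; auto|lra]).
    pose proof (mp y1). pose proof (mp y0).
    assert (m y1 * 1 <= m y1 * (exp a - 1)) by (apply Rmult_le_compat_l; lra).
    assert (m y0 * (exp b - 1) <= m y0 * exp (16 * PI)) by (apply Rmult_le_compat_l; lra). lra. }
  apply Rabs_lt_between in Hy1.
  assert (M1 : m y1 <= exp (16 * PI) * m y0).
  { destruct (Rle_lt_dec y0 y1) as [Le|Lt].
    - apply (X (4 * c * y0) (4 * c * y1)).
      + unfold h in *. nra.
      + nra.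
      + apply (supersolution_growth m c y0 y1 K d); auto; try lra.
        intros y e Hy He. apply HK; auto. apply Rabs_lt_between; lra.
    (* Downward from [y0], the growth lemma is applied to the reflected function [m (Y - y)]. *)
    - set (Y := 3 / 4 * rho).
      apply (X (4 * c * (Y - y0)) (4 * c * (Y - y1))).
      + unfold Y, h in *. nra.
      + unfold Y. nra.
      + pose proof (supersolution_growth (fun y => m (Y - y)) c (Y - y0) (Y - y1) K d) as S. cbv beta in S.
        replace (Y - (Y - y1)) with y1 in S by ring. replace (Y - (Y - y0)) with y0 in S by ring.
        apply S; auto; try (unfold Y, h in *; lra).
        * intros y. apply (continuous_comp (fun y => Y - y) m); auto.
          apply (continuous_minus (V := R_NormedModule)); [apply continuous_const|apply continuous_id].
        * intros y e Hy He. replace (Y - (y + e)) with (Y - y - e) by ring. replace (Y - (y - e)) with (Y - y + e) by ring.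
          specialize (HK (Y - y) e). rewrite (Rplus_comm (m (Y - y - e))). apply HK; auto.
          apply Rabs_lt_between. unfold Y, h in *. lra. }
  assert (N : RInt (fun x => v (t + x) y1) (- (rho / 8)) (rho / 8) <= 2 * m y1).
  { apply Rle_trans with (RInt (fun x => 2 * (alpha x * v (t + x) y1)) (- (rho / 8)) (rho / 8)).
    - apply RInt_le; [lra|apply Ev|apply ex_RInt_mulR; apply Ea|]. intros x Hx.
      (* [|x| <= rho / 8] means [|c x| <= PI / 4]. *)
      assert (A : 1 / 2 <= alpha x).
      { unfold alpha. eapply Rle_trans; [|apply Rmax_r].
        destruct (cos_pi4_range (c * x)) as [Q _]; [nra|]. eapply Rle_trans; [|exact Q].
        destruct sqrt2_bounds as [S1 S2]. apply Rmult_le_reg_r with (sqrt 2); [lra|].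
        unfold Rdiv at 2. rewrite Rmult_assoc, Rinv_l; lra. }
      specialize (Pv (t + x) y1). nra.
    - rewrite RInt_mulR by apply Ea. apply Rmult_le_compat_l; [lra|].
      unfold m, weighted. fold h c alpha.
      change (RInt (fun x => alpha x * v (t + x) y1) (- (rho / 8)) (rho / 8) <= RInt (fun x => alpha x * v (t + x) y1) (- (2 * h)) (2 * h)).
      apply RInt_le_sub; try (unfold h; lra).
      + intros x. apply (continuous_mult (K := R_AbsRing)); auto. apply havg_integrand_cont; auto.
      + intros x _. apply Rmult_le_pos; [apply alr|auto]. }
  pose proof (exp_pos (16 * PI)).
  assert (exp (16 * PI) * m y0 <= exp (16 * PI) * (10 * rho * v t 0)) by (apply Rmult_le_compat_l; lra).
  lra.
Qed.

(** * Segment means of the truncated [log |H|] near a real point *)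

Lemma Cmod_triangle_inv (a b : C) : Rabs (Cmod a - Cmod b) <= Cmod (a - b).
Proof.
  assert (A : Cmod a <= Cmod (a - b) + Cmod b).
  { replace a with ((a - b) + b)%C at 1 by ring. apply Cmod_triangle. }
  assert (B : Cmod b <= Cmod (a - b) + Cmod a).
  { replace b with (- (a - b) + a)%C at 1 by ring. eapply Rle_trans; [apply Cmod_triangle|]. rewrite Cmod_opp. lra. }
  apply Rabs_le. lra.
Qed.

Lemma Rmax_lipschitz c a b : Rabs (Rmax c a - Rmax c b) <= Rabs (a - b).
Proof. unfold Rmax. destruct Rle_dec, Rle_dec; unfold Rabs; repeat destruct Rcase_abs; lra. Qed.

Lemma Cmod_cont2 f x y : cdiffble f (x, y) -> continuity_2d_pt (fun x y => Cmod (f (x, y))) x y.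
Proof.
  intros [l Hl] eps. destruct (cder_bound _ _ _ Hl) as (d & Hd & L).
  set (K := Cmod l + 1). assert (K0 : 0 < K) by (unfold K; pose proof (Cmod_ge_0 l); lra).
  assert (P : 0 < Rmin (d / 2) (eps / (2 * K))).
  { apply Rmin_case; [lra|]. apply Rdiv_lt_0_compat; [apply cond_pos|lra]. }
  exists (mkposreal _ P). simpl. intros u v Hu Hv.
  pose proof (Rmin_l (d / 2) (eps / (2 * K))). pose proof (Rmin_r (d / 2) (eps / (2 * K))).
  assert (B : Cmod ((u, v) - (x, y)) <= Rabs (u - x) + Rabs (v - y)).
  { eapply Rle_trans; [apply Cmod_le_abs|]. simpl. unfold Rminus. lra. }
  eapply Rle_lt_trans; [apply Cmod_triangle_inv|].
  eapply Rle_lt_trans; [apply L; lra|]. fold K.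
  apply Rle_lt_trans with (K * (Rabs (u - x) + Rabs (v - y))); [apply Rmult_le_compat_l; lra|].
  replace (pos eps) with (K * (2 * (eps / (2 * K)))) by (field; lra). apply Rmult_lt_compat_l; lra.
Qed.

Lemma lnmax_cont c f x y : 0 < c -> cdiffble f (x, y) -> continuity_2d_pt (lnmax c f) x y.
Proof.
  intros Hc Hf. unfold lnmax.
  apply (continuity_1d_2d_pt_comp ln (fun x y => Rmax c (Cmod (f (x, y))))).
  - apply derivable_continuous_pt. exists (/ Rmax c (Cmod (f (x, y)))). apply derivable_pt_lim_ln.
    eapply Rlt_le_trans; [exact Hc|apply Rmax_l].
  - apply (continuity_1d_2d_pt_comp (Rmax c) (fun x y => Cmod (f (x, y)))).
    + apply continuity_pt_filterlim, lipschitz_continuous, Rmax_lipschitz.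
    + apply Cmod_cont2; auto.
Qed.

Lemma lnmax_entire_subh c f X : 0 < c -> (forall z, cdiffble f z) ->
  subh (lnmax c f) (fun x y => Rabs x <= X /\ Rabs y <= X).
Proof.
  intros Hc Hf.
  destruct (cont_bounded (fun x y => Cmod (f (x, y))) (- (X + 1)) (X + 1) (- (X + 1)) (X + 1)) as (B & HB & L).
  { intros. apply Cmod_cont2; auto. }
  apply (lnmax_subh f c 1 B); auto; try lra.
  intros x y [Hx Hy] z Hz. split; auto. destruct z as [u v].
  pose proof (re_le_Cmod ((u, v) - (x, y))%C) as R1. pose proof (Rabs_Im_le ((u, v) - (x, y))%C) as R2. simpl in R1, R2.
  apply Rabs_le_between in Hx, Hy.
  assert (-1 <= u - x <= 1) by (apply Rabs_le_between; unfold Rminus; lra).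
  assert (-1 <= v - y <= 1) by (apply Rabs_le_between; unfold Rminus; lra).
  specialize (L u v ltac:(lra) ltac:(lra)). rewrite Rabs_right in L; auto. apply Rle_ge, Cmod_ge_0.
Qed.

Lemma ln_ge_0 x : 1 <= x -> 0 <= ln x.
Proof. intros H. rewrite <- ln_1. apply ln_le; lra. Qed.

(** The default value of [ln]; it disposes of the zeros of [H]. *)
Lemma ln_nonpos x : x <= 0 -> ln x = 0.
Proof. intros H. unfold ln. destruct (Rlt_dec 0 x); [exfalso; lra|reflexivity]. Qed.

Lemma ln_growth_bound (a m : R) (N : nat) Z : 1 <= a -> a <= Z -> 1 <= m ->
  0 < a ^ N * m /\ ln (a ^ N * m) <= INR N * ln Z + ln m.
Proof.
  intros Ha HZ Hm. assert (P : 0 < a ^ N) by (apply pow_lt; lra).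
  split; [apply Rmult_lt_0_compat; lra|].
  rewrite ln_mult by lra. apply Rplus_le_compat_r. rewrite ln_pow by lra.
  apply Rmult_le_compat_l; [apply pos_INR|apply ln_le; lra].
Qed.

Section Window.
Variables (rho : R) (M : R -> R) (H : C -> C) (N : nat).
Hypothesis Hrho : 0 < rho.
Hypothesis HM : forall t, 0 < t -> exp 1 < M t.
Hypothesis HH : forall z, cdiffble H z.
Hypothesis Hout : forall x y, rho < Rabs y -> Cmod (H (x, y)) <= (1 + Cmod (x, y)) ^ N * M (Rabs y - rho).

Definition logH : R -> R -> R := lnmax 1 H.

Lemma logH_cont : cont2 logH.
Proof. intros x y. apply lnmax_cont; auto; lra. Qed.

Lemma logH_ge0 x y : 0 <= logH x y.
Proof. unfold logH. rewrite <- ln_1. apply lnmax_ge. lra. Qed.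

Lemma M_gt1 t : 0 < t -> 1 < M t.
Proof. intros Ht. specialize (HM t Ht). pose proof (exp_ineq1 1 ltac:(lra)). lra. Qed.

Lemma logH_outside x y Z : rho < Rabs y -> 1 + Rabs x + Rabs y <= Z ->
  logH x y <= INR N * ln Z + ln (M (Rabs y - rho)).
Proof.
  intros Hy HZ. pose proof (M_gt1 (Rabs y - rho) ltac:(lra)) as M1.
  assert (Z0 : 1 <= Z) by (pose proof (Rabs_pos x); pose proof (Rabs_pos y); lra).
  assert (P : 0 <= INR N * ln Z + ln (M (Rabs y - rho))).
  { apply Rplus_le_le_0_compat; [apply Rmult_le_pos; [apply pos_INR|apply ln_ge_0; auto]|apply ln_ge_0; lra]. }
  pose proof (Cmod_ge_0 (x, y)).
  assert (Q : 1 + Cmod (x, y) <= Z) by (pose proof (Cmod_le_abs (x, y)); simpl in *; lra).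
  destruct (ln_growth_bound (1 + Cmod (x, y)) (M (Rabs y - rho)) N Z ltac:(lra) Q ltac:(lra)) as [G1 G2].
  unfold logH, lnmax. apply Rmax_case; [rewrite ln_1; auto|].
  destruct (Rle_lt_dec (Cmod (H (x, y))) 0) as [L|L].
  - rewrite (ln_nonpos (Cmod _)); auto.
  - eapply Rle_trans; [apply ln_le; [auto|apply Hout; auto]|]. auto.
Qed.

(** Two such half-widths add up to [rho / 8], the half-width in [strip_line_bound]: a segment about
    a point near [t] is then covered by the one about [t]. *)
Definition hw : R := rho / 16.
Definition avgH : R -> R -> R := havg hw logH.

Lemma avgH_cont : cont2 avgH.
Proof. apply havg_cont; [unfold hw; lra|apply logH_cont]. Qed.

Lemma avgH_subh X : subh avgH (fun x y => Rabs x <= X /\ Rabs y <= X).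
Proof.
  apply (havg_subh hw logH (fun x y => Rabs x <= X + hw /\ Rabs y <= X + hw)).
  - unfold hw; lra.
  - apply logH_cont.
  - apply lnmax_entire_subh; auto; lra.
  - intros x y t [Hx Hy] Ht. split; [|unfold hw; lra].
    eapply Rle_trans; [apply Rabs_triang|]. assert (Rabs t <= hw) by (apply Rabs_le; lra). lra.
Qed.

Lemma avgH_le_const x y L : (forall t, - hw <= t <= hw -> logH (x + t) y <= L) -> avgH x y <= 2 * hw * L.
Proof.
  intros HL. unfold avgH, havg. replace (2 * hw * L) with ((hw - - hw) * L) by ring.
  rewrite <- (RInt_constR L (- hw) hw). apply RInt_le; [unfold hw; lra| |apply ex_RInt_const|].
  - apply havg_ex; [apply logH_cont|unfold hw; lra].
  - intros t Ht. apply HL. lra.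
Qed.

Lemma avgH_outside x y Z : rho < Rabs y -> 1 + Rabs x + hw + Rabs y <= Z ->
  avgH x y <= 2 * hw * (INR N * ln Z + ln (M (Rabs y - rho))).
Proof.
  intros Hy HZ. apply avgH_le_const. intros t Ht. apply logH_outside; auto.
  pose proof (Rabs_triang x t). assert (Rabs t <= hw) by (apply Rabs_le; lra). lra.
Qed.

Section Inside.
Variables (F : C -> C) (B : R).
Hypothesis HF : forall x y, Rabs y < rho -> cdiffble F (x, y).
Hypothesis HB : forall x y, Rabs y < rho -> Cmod (F (x, y)) <= B.
Hypothesis HB1 : 1 <= B.
Hypothesis HFH : forall x y, Rabs y < rho -> Cmod (F (x, y) * H (x, y)) <= (1 + Cmod (x, y)) ^ N * M (rho - Rabs y).

(** [strip_line_bound] is applied to [ln B - ln |F|], whose value at [(t, 0)] is known. Two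
    modifications make this function continuous on the whole plane: [|F|] is truncated at [kap], and
    [y] is clamped to [|y| <= rho1 < rho]. *)
Lemma avgH_inside t x y Z : 0 < Cmod (F (t, 0)) -> Rabs (x - t) <= hw -> Rabs y < rho ->
  1 + Rabs t + 2 * rho <= Z ->
  avgH x y <= 20 * exp (16 * PI) * rho * (ln B - ln (Cmod (F (t, 0)))) + 2 * hw * (INR N * ln Z + ln (M (rho - Rabs y))).
Proof.
  intros Ft Hx Hy HZ.
  (* Lies strictly between [|y|] and [rho] and exceeds [3 / 4 * rho]; the final constant is
     independent of it. *)
  set (rho' := (Rmax (Rabs y) (7 / 8 * rho) + rho) / 2).
  set (rho1 := (rho' + rho) / 2).
  assert (r1 : Rabs y < rho' /\ 7 / 8 * rho < rho' < rho).
  { unfold rho'. pose proof (Rmax_l (Rabs y) (7 / 8 * rho)). pose proof (Rmax_r (Rabs y) (7 / 8 * rho)).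
    assert (Rmax (Rabs y) (7 / 8 * rho) < rho) by (apply Rmax_lub_lt; lra). lra. }
  assert (r2 : rho' < rho1 < rho) by (unfold rho1; lra).
  set (cl := fun y => Rmax (- rho1) (Rmin rho1 y)).
  assert (clr : forall y, Rabs (cl y) <= rho1).
  { intros z. apply Rabs_le. unfold cl. split; [apply Rmax_l|apply Rmax_lub; [lra|apply Rmin_l]]. }
  assert (cli : forall y, Rabs y <= rho1 -> cl y = y).
  { intros z Hz. apply Rabs_le_between in Hz. unfold cl. rewrite Rmin_right, Rmax_right; lra. }
  assert (clc : forall y, continuous cl y).
  { intros z. apply lipschitz_continuous. intros a b. unfold cl. eapply Rle_trans; [apply Rmax_lipschitz|].
    unfold Rmin. destruct Rle_dec, Rle_dec; unfold Rabs; repeat destruct Rcase_abs; lra. }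
  destruct (cont_bounded logH (t - rho) (t + rho) (- rho) rho (fun x y _ _ => logH_cont x y)) as (K & K0 & HK).
  (* At most [exp (- K)], so that [v >= K >= logH] where the truncation is active; at most
     [|F (t, 0)|], so that it does not alter the value at [(t, 0)]. *)
  set (kap := Rmin (Cmod (F (t, 0))) (exp (- K))).
  assert (k0 : 0 < kap) by (unfold kap; apply Rmin_case; auto; apply exp_pos).
  assert (k1 : kap <= Cmod (F (t, 0))) by apply Rmin_l.
  assert (k2 : kap <= exp (- K)) by apply Rmin_r.
  set (w := fun x y => lnmax kap F x (cl y)).
  set (v := fun x y => ln B - w x y).
  assert (kB : kap <= B). { eapply Rle_trans; [exact k1|]. apply HB. rewrite Rabs_R0; auto. }
  assert (Cw : cont2 w).
  { intros a b. unfold w. intros eps.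
    assert (Fd : cdiffble F (a, cl b)) by (apply HF; specialize (clr b); lra).
    destruct (lnmax_cont kap F a (cl b) k0 Fd eps) as [d Hd].
    pose proof (clc b) as cb. apply continuity_pt_filterlim in cb. destruct (cb d (cond_pos d)) as (e & He & G).
    assert (P : 0 < Rmin d e) by (apply Rmin_case; auto; apply cond_pos).
    exists (mkposreal _ P). simpl. intros u z Hu Hz. pose proof (Rmin_l d e). pose proof (Rmin_r d e).
    apply Hd; [lra|]. destruct (Req_EM_T z b) as [->|Nz]; [rewrite Rminus_diag, Rabs_R0; apply cond_pos|].
    apply G. split; [split; [exact I|auto]|]. simpl. unfold Rdist. lra. }
  assert (Cv : cont2 v) by (apply (cont2_sub (fun _ _ => ln B)); [apply cont2_const|auto]).
  assert (Pv : forall x y, 0 <= v x y).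
  { intros a b. unfold v, w, lnmax. assert (Rmax kap (Cmod (F (a, cl b))) <= B).
    { apply Rmax_lub; auto. apply HB. specialize (clr b). lra. }
    assert (ln (Rmax kap (Cmod (F (a, cl b)))) <= ln B); [|lra]. apply ln_le; auto.
    eapply Rlt_le_trans; [exact k0|apply Rmax_l]. }
  assert (Sv : subh (fun x y => - v x y) (fun x y => Rabs (x - t) <= rho /\ Rabs y < rho')).
  { destruct (lnmax_subh F kap (rho1 - rho') B (fun x y => Rabs (x - t) <= rho /\ Rabs y < rho')) as (L & d & L0 & d0 & G); auto; try lra.
    - intros a b [_ Hb] [z1 z2] Hz.
      pose proof (Rabs_Im_le ((z1, z2) - (a, b))%C) as R2. simpl in R2.
      assert (Rabs z2 < rho).
      { replace z2 with (z2 + - b + b) by ring. eapply Rle_lt_trans; [apply Rabs_triang|]. lra. }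
      split; [apply HF|apply HB]; auto.
    (* Such small stencils stay where the clamp is the identity. *)
    - exists L, (Rmin d (rho1 - rho')). split; auto. split; [apply Rmin_case; lra|].
      intros a b [Ha Hb] h p q Hh Hp Hq. 
      pose proof (Rmin_l d (rho1 - rho')). pose proof (Rmin_r d (rho1 - rho')).
      specialize (G a b (conj Ha Hb) h p q ltac:(lra) Hp Hq). eapply Rle_trans; [exact G|]. right.
      assert (T : forall s, Rabs s <= h -> cl (b + s) = b + s).
      { intros s Hs. apply cli. eapply Rle_trans; [apply Rabs_triang|]. lra. }
      assert (T0 : cl b = b) by (apply cli; lra).
      assert (T1 : forall s, Rabs s <= h -> cl (b - s) = b - s).
      { intros s Hs. unfold Rminus. apply T. rewrite Rabs_Ropp; auto. }
      unfold stencil, v, w. rewrite T0, !T, !T1 by auto. ring. }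
  assert (Vt : v t 0 = ln B - ln (Cmod (F (t, 0)))).
  { unfold v, w, lnmax. rewrite cli by (rewrite Rabs_R0; lra). rewrite Rmax_right; auto. }
  pose proof (strip_line_bound v t rho rho' Hrho ltac:(lra) Cv Pv Sv y ltac:(lra)) as LB. rewrite Vt in LB.
  set (L := INR N * ln Z + ln (M (rho - Rabs y))).
  pose proof (M_gt1 (rho - Rabs y) ltac:(lra)) as M1.
  assert (Z1 : 1 <= Z) by (pose proof (Rabs_pos t); lra).
  assert (L0 : 0 <= L).
  { apply Rplus_le_le_0_compat; [apply Rmult_le_pos; [apply pos_INR|apply ln_ge_0; auto]|apply ln_ge_0; lra]. }
  apply Rabs_le_between in Hx.
  assert (hw0 : 0 < hw) by (unfold hw; lra).
  assert (PW : forall s, Rabs (s - t) <= rho / 8 -> logH s y <= v s y + L).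
  { intros s Hs. assert (Ey : cl y = y) by (apply cli; lra).
    assert (S8 : - (rho / 8) <= s - t <= rho / 8) by (apply Rabs_le_between; auto).
    destruct (Rle_lt_dec kap (Cmod (F (s, y)))) as [G|G].
    - pose proof (Pv s y) as Pvs. assert (Evs : v s y = ln B - ln (Cmod (F (s, y)))).
      { unfold v, w, lnmax. rewrite Ey, Rmax_right; auto. }
      unfold logH, lnmax. apply Rmax_case; [rewrite ln_1; lra|].
      destruct (Rle_lt_dec (Cmod (H (s, y))) 0) as [Q|Q].
      + rewrite (ln_nonpos (Cmod (H (s, y)))); lra.
      + assert (As : Rabs s <= Rabs t + rho / 8).
        { replace s with (t + (s - t)) by ring. eapply Rle_trans; [apply Rabs_triang|]. lra. }
        pose proof (Cmod_ge_0 (s, y)).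
        assert (Q1 : 1 + Cmod (s, y) <= Z) by (pose proof (Cmod_le_abs (s, y)) as CA; simpl in CA; lra).
        destruct (ln_growth_bound (1 + Cmod (s, y)) (M (rho - Rabs y)) N Z ltac:(lra) Q1 ltac:(lra)) as [G1 G2].
        specialize (HFH s y Hy). rewrite Cmod_mult in HFH.
        assert (ln (Cmod (F (s, y))) + ln (Cmod (H (s, y))) <= L).
        { rewrite <- ln_mult by lra. eapply Rle_trans; [apply ln_le; [|exact HFH]|exact G2]. apply Rmult_lt_0_compat; lra. }
        rewrite Evs. assert (0 <= ln B) by (apply ln_ge_0; auto). lra.
    - assert (Evs : v s y = ln B - ln kap).
      { unfold v, w, lnmax. rewrite Ey, Rmax_left; auto. lra. }
      assert (ln kap <= - K). { rewrite <- (ln_exp (- K)). apply ln_le; auto. }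
      assert (0 <= ln B) by (apply ln_ge_0; auto).
      apply Rabs_lt_between in Hy.
      specialize (HK s y ltac:(lra) ltac:(lra)). apply Rabs_le_between in HK. lra. }
  assert (Ev : forall p q, ex_RInt (fun s => v (x + s) y) p q).
  { intros. apply (@ex_RInt_continuous R_CompleteNormedModule). intros; apply havg_integrand_cont; auto. }
  assert (A1 : avgH x y <= RInt (fun s => v (x + s) y + L) (- hw) hw).
  { unfold avgH, havg. apply RInt_le; [lra| | |].
    - apply havg_ex; [apply logH_cont|lra].
    - apply ex_RInt_addR; [apply Ev|apply ex_RInt_const].
    - intros s Hs. apply PW. apply Rabs_le. unfold hw in *. lra. }
  rewrite RInt_addR in A1 by (first [apply Ev|apply ex_RInt_const]). rewrite RInt_constR in A1.
  assert (A2 : RInt (fun s => v (x + s) y) (- hw) hw <= RInt (fun s => v (t + s) y) (- (rho / 8)) (rho / 8)).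
  { pose proof (RInt_comp_lin (V := R_CompleteNormedModule) (fun s => v (t + s) y) 1 (x - t) (- hw) hw) as CL.
    rewrite !Rmult_1_l in CL.
    assert (E : RInt (fun s => v (x + s) y) (- hw) hw = RInt (fun s => v (t + s) y) (- hw + (x - t)) (hw + (x - t))).
    { rewrite <- CL.
      - apply RInt_ext. intros s _. transitivity (1 * v (t + (1 * s + (x - t))) y); [|reflexivity]. rewrite !Rmult_1_l. f_equal. ring.
      - apply (@ex_RInt_continuous R_CompleteNormedModule). intros; apply havg_integrand_cont; auto. }
    rewrite E. apply RInt_le_sub; try (unfold hw in *; lra); auto. intros; apply havg_integrand_cont; auto. }
  fold L. lra.
Qed.
End Inside.
End Window.

(** * Level widths of a decreasing integrable function *)

Fixpoint psum (u : nat -> R) (n : nat) : R :=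
  match n with O => 0 | S n => psum u n + u n end.

Lemma psum_tail (u : nat -> R) B : (forall j, 0 <= u j) -> (forall n, psum u n <= B) ->
  forall eps, 0 < eps -> exists k0, forall k, (k0 <= k)%nat -> psum u k - psum u k0 <= eps.
Proof.
  intros P HB eps He.
  destruct (completeness (fun z => exists n, z = psum u n)) as [s [s1 s2]].
  - exists B. intros z [n ->]. auto.
  - exists 0. exists O. reflexivity.
  - assert (X : exists k0, s - eps < psum u k0).
    { apply Classical_Prop.NNPP. intros Nx. assert (s <= s - eps); [|lra]. apply s2. intros z [n ->].
      destruct (Rlt_le_dec (s - eps) (psum u n)); auto. exfalso. apply Nx. exists n; auto. }
    destruct X as [k0 Hk]. exists k0. intros k _. assert (psum u k <= s) by (apply s1; exists k; auto). lra.
Qed.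

Lemma psum_plus u v n : psum (fun j => u j + v j) n = psum u n + psum v n.
Proof. induction n as [|n IH]; simpl; [lra|rewrite IH; ring]. Qed.

Lemma psum_half n : psum (fun j => (1/2) ^ j) n <= 2.
Proof.
  assert (E : psum (fun j => (1/2) ^ j) n = 2 - 2 * (1/2) ^ n).
  { induction n as [|n IH]; simpl; [lra|rewrite IH; field]. }
  rewrite E. assert (0 < (1/2) ^ n) by (apply pow_lt; lra). lra.
Qed.

(** Let [l j] be the length of the set where [psi] exceeds [kap (j + 1)]; by layers, [kap] times the
    sum of the [l j] is at most the integral of [psi]. Adding [(1/2)^j] makes the widths positive
    and the estimate valid at [t = lam j] itself. *)
Lemma level_widths (psi : R -> R) (kap I : R) : 0 < kap ->
  (forall t, 0 < t -> 0 < psi t) -> (forall s t, 0 < s -> s <= t -> psi t <= psi s) ->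
  (forall t, 0 < t -> continuous psi t) -> (forall a b, 0 < a <= b -> RInt psi a b <= I) ->
  exists lam : nat -> R, exists B, (forall j, 0 < lam j) /\ (forall j, lam (S j) <= lam j) /\
  (forall j t, lam j <= t -> psi t <= kap * (INR j + 1)) /\ (forall n, psum lam n <= B).
Proof.
  intros Hk P Dec Cont HI.
  assert (Ex : forall a b, 0 < a -> a <= b -> ex_RInt psi a b).
  { intros a b Ha Hb. apply ex_RInt_cont; auto. intros; apply Cont; lra. }
  assert (LB : forall a c m, 0 < a -> a <= c -> (forall t, a < t < c -> m <= psi t) -> (c - a) * m <= RInt psi a c).
  { intros a c m Ha Hc Hm. rewrite <- (RInt_constR m a c). apply RInt_le; auto. apply ex_RInt_const. }
  assert (tB : forall t, 0 < t -> t * psi t <= 2 * I).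
  { intros t Ht. assert ((t - t / 2) * psi t <= RInt psi (t / 2) t) by (apply LB; try lra; intros; apply Dec; lra).
    specialize (HI (t / 2) t ltac:(lra)). lra. }
  (* The point 0 keeps the set nonempty when [psi] never exceeds the level. *)
  set (E := fun j t => t = 0 \/ (0 < t /\ kap * (INR j + 1) < psi t)).
  assert (pos : forall j, 0 < INR j + 1) by (intros; pose proof (pos_INR j); lra).
  assert (Lub : forall j, exists l, is_lub (E j) l).
  { intros j. destruct (completeness (E j)) as [l Hl].
    - exists (2 * I / (kap * (INR j + 1))). intros t Ht.
      assert (I0 : 0 <= I) by (specialize (tB 1 ltac:(lra)); specialize (P 1 ltac:(lra)); lra).
      assert (kj : 0 < kap * (INR j + 1)) by (apply Rmult_lt_0_compat; auto).
      destruct Ht as [->|[T1 T2]]; [apply Rdiv_le_0_compat; lra|].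
      apply Rmult_le_reg_r with (kap * (INR j + 1)); auto.
      unfold Rdiv. rewrite Rmult_assoc, Rinv_l by lra. specialize (tB t T1). nra.
    - exists 0. left; auto.
    - exists l; auto. }
  set (l := fun j => proj1_sig (constructive_indefinite_description _ (Lub j))).
  assert (Hl : forall j, is_lub (E j) (l j)) by (intros; unfold l; destruct constructive_indefinite_description; auto).
  assert (l0 : forall j, 0 <= l j) by (intros; apply Hl; left; auto).
  assert (lup : forall j t, 0 < t -> l j < t -> psi t <= kap * (INR j + 1)).
  { intros j t Ht Hlt. destruct (Rle_lt_dec (psi t) (kap * (INR j + 1))) as [|G]; auto.
    exfalso. assert (t <= l j) by (apply Hl; right; auto). lra. }
  assert (llow : forall j t, 0 < t -> t < l j -> kap * (INR j + 1) <= psi t).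
  { intros j t Ht Hlt. destruct (Rle_lt_dec (kap * (INR j + 1)) (psi t)) as [|G]; auto.
    exfalso. assert (l j <= t); [|lra]. apply Hl. intros s [->|[S1 S2]]; [lra|].
    destruct (Rle_lt_dec s t) as [|Q]; auto. specialize (Dec t s Ht ltac:(lra)). lra. }
  assert (ldec : forall j, l (S j) <= l j).
  { intros j. apply Hl. intros s [->|[S1 S2]]; [auto|]. apply Hl. right. split; auto.
    rewrite S_INR in S2. nra. }
  assert (lle : forall j, l j <= l O).
  { intros j. induction j as [|j IH]; [lra|]. specialize (ldec j). lra. }
  (* The lower limit [a > 0] avoids the singularity of [psi] at 0. In the induction the interval is
     split at [l (S n)]: left of it [psi] is above the new level. *)
  assert (Key : forall b, l O <= b -> forall n a, 0 < a <= b ->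
     kap * (psum l (S n) - INR (S n) * a) <= RInt psi a b).
  { intros b Hb n. induction n as [|n IH]; intros a Ha.
    - simpl. destruct (Rle_lt_dec (l O) a) as [G|G].
      + assert (0 <= RInt psi a b) by (apply RInt_ge_0; [lra|apply Ex; lra|intros; left; apply P; lra]). nra.
      + rewrite <- (RInt_ChaslesR psi a (l O) b) by (apply Ex; lra).
        assert (0 <= RInt psi (l O) b) by (apply RInt_ge_0; [lra|apply Ex; lra|intros; left; apply P; lra]).
        assert ((l O - a) * (kap * (INR 0 + 1)) <= RInt psi a (l O)) by (apply LB; try lra; intros; apply llow; lra).
        simpl in H0. lra.
    - change (psum l (S (S n))) with (psum l (S n) + l (S n)). rewrite (S_INR (S n)).
      destruct (Rle_lt_dec (l (S n)) a) as [G|G].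
      + specialize (IH a Ha). nra.
      + specialize (IH (l (S n)) ltac:(specialize (lle (S n)); lra)).
        specialize (lle (S n)).
        rewrite <- (RInt_ChaslesR psi a (l (S n)) b) by (apply Ex; lra).
        assert ((l (S n) - a) * (kap * (INR (S n) + 1)) <= RInt psi a (l (S n))) by (apply LB; try lra; intros; apply llow; lra).
        lra. }
  assert (SB : forall n, psum l (S n) <= I / kap).
  { intros n. apply le_epsilon. intros e He.
    set (b := l O + 1). assert (b0 : 1 <= b) by (unfold b; specialize (l0 O); lra).
    assert (q : 0 < INR (S n)) by (apply lt_0_INR; lia).
    set (a := Rmin 1 (e / INR (S n))).
    assert (a0 : 0 < a) by (apply Rmin_case; [lra|apply Rdiv_lt_0_compat; lra]).
    assert (a1 : a <= 1) by apply Rmin_l.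
    assert (a2 : INR (S n) * a <= e).
    { replace e with (INR (S n) * (e / INR (S n))) by (field; lra). apply Rmult_le_compat_l; [lra|apply Rmin_r]. }
    pose proof (Key b ltac:(unfold b; lra) n a ltac:(lra)) as K. specialize (HI a b ltac:(lra)).
    assert (X : psum l (S n) - INR (S n) * a <= I / kap).
    { apply Rmult_le_reg_l with kap; auto. replace (kap * (I / kap)) with I by (field; lra). lra. }
    lra. }
  exists (fun j => l j + (1/2) ^ j), (I / kap + 2).
  assert (hp : forall j, 0 < (1/2) ^ j) by (intros; apply pow_lt; lra).
  repeat split.
  - intros j. specialize (hp j). specialize (l0 j). lra.
  - intros j. specialize (ldec j). specialize (hp j). simpl. lra.
  - intros j t Ht. specialize (hp j). specialize (l0 j). apply lup; lra.
  - intros n. rewrite (psum_plus l (fun j => (1/2) ^ j) n). pose proof (psum_half n).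
    destruct n as [|n]; [|specialize (SB n); lra].
    specialize (SB O). cbn [psum] in *. specialize (l0 O). lra.
Qed.

(** * A log-log theorem of Levinson type *)

(* One step of the descent: in the window of half-width [4 * lam] around [x0] the quadratic
   polynomial below dominates [Phi]; its value on the axis [x = x0] is at most [4 ^ k]. *)
Lemma loglog_step (Phi : R -> R -> R) (x0 y0 lam a b : R) : 0 < lam -> 0 <= a ->
  cont2 Phi -> subh Phi (fun x y => Rabs (x - x0) <= 4 * lam /\ Rabs (y - y0) <= lam) ->
  (forall x y, Rabs (x - x0) <= 4 * lam -> Rabs (y - y0) <= lam -> Phi x y <= b) ->
  (forall x y, Rabs (x - x0) <= 4 * lam -> Rabs (y - y0) = lam -> Phi x y <= a) ->
  0 < b -> forall y, Rabs (y - y0) <= lam -> Phi x0 y <= a + b / 8.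
Proof.
  intros Hl Ha HC HS Hb HE b0 y Hy.
  (* Its Laplacian is [- b / (8 lam^2)]; it is at least [a + b] on the sides [|x - x0| = 4 lam], at
     least [a] on the horizontal edges, and at most [a + b / 8] on [x = x0]. *)
  set (W := fun x y => a + b * (((x - x0) * (x - x0) + 2 * (lam * lam - (y - y0) * (y - y0))) / (16 * (lam * lam)))).
  assert (l2 : 0 < 16 * (lam * lam)) by nra.
  assert (I : 0 < / (16 * (lam * lam))) by (apply Rinv_0_lt_compat; lra).
  assert (MP : Phi x0 y <= W x0 y).
  { apply Rabs_le_between in Hy.
    apply (max_principle (fun _ _ => -1) Phi W (x0 - 4 * lam) (x0 + 4 * lam) (y0 - lam) (y0 + lam)); try lra.
    - intros; apply HC.
    - intros u v _ _. unfold W. apply (cont2_add (fun _ _ => a)); [apply cont2_const|].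
      apply (cont2_mul (fun _ _ => b)); [apply cont2_const|].
      apply (cont2_mul _ (fun _ _ => / (16 * (lam * lam)))); [|apply cont2_const].
      apply (cont2_add (fun x y => (x - x0) * (x - x0))).
      + apply cont2_mul; apply (cont2_sub (fun x _ => x)); first [apply cont2_fst|apply cont2_const].
      + apply (cont2_mul (fun _ _ => 2)); [apply cont2_const|]. apply (cont2_sub (fun _ _ => lam * lam)); [apply cont2_const|].
        apply cont2_mul; apply (cont2_sub (fun _ y => y)); first [apply cont2_snd|apply cont2_const].
    - intros; apply continuity_2d_pt_const.
    - destruct HS as (K & d & K0 & d0 & G). exists K, d. split; auto. split; auto.
      intros u v (Hu & Hv & _). apply G. split; apply Rabs_le; lra.
    - intros u v _ _ _.
      exists (b * (2 * / (16 * (lam * lam))) + - (b * (4 * / (16 * (lam * lam))))). split.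
      + assert (0 < b * / (16 * (lam * lam))) by (apply Rmult_lt_0_compat; auto). lra.
      + apply (Lap_intro _ (fun u => b * (2 * (u - x0) * / (16 * (lam * lam)))) (fun v => - (b * (4 * (v - y0) * / (16 * (lam * lam)))))).
        * apply filter_forall. intros z. unfold W. auto_derive; auto. field. lra.
        * auto_derive; auto. field. lra.
        * apply filter_forall. intros z. unfold W. auto_derive; auto. field. lra.
        * auto_derive; auto. field. lra.
    - intros u v Hu Hv _ HB. cbv beta in HB.
      assert (Au : Rabs (u - x0) <= 4 * lam) by (apply Rabs_le; lra).
      assert (Av : Rabs (v - y0) <= lam) by (apply Rabs_le; lra).
      assert (Q : 0 <= 2 * (lam * lam - (v - y0) * (v - y0))) by nra.
      destruct (Req_EM_T (Rabs (v - y0)) lam) as [Ev|Nv].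
      + eapply Rle_trans; [apply HE; auto|]. unfold W.
        assert (0 <= b * (((u - x0) * (u - x0) + 2 * (lam * lam - (v - y0) * (v - y0))) / (16 * (lam * lam)))); [|lra].
        pose proof (Rle_0_sqr (u - x0)) as Sq. unfold Rsqr in Sq.
        apply Rmult_le_pos; [lra|]. apply Rmult_le_pos; lra.
      + assert (Eu : (u - x0) * (u - x0) = 16 * (lam * lam)).
        { destruct HB as [->|[->|[->|[->|HB]]]]; try ring; try lra.
          - exfalso. apply Nv. replace (y0 - lam - y0) with (- lam) by ring. rewrite Rabs_Ropp, Rabs_right; lra.
          - exfalso. apply Nv. replace (y0 + lam - y0) with lam by ring. rewrite Rabs_right; lra. }
        eapply Rle_trans; [apply Hb; auto|]. unfold W. rewrite Eu.
        replace ((16 * (lam * lam) + 2 * (lam * lam - (v - y0) * (v - y0))) / (16 * (lam * lam))) with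
          (1 + 2 * (lam * lam - (v - y0) * (v - y0)) * / (16 * (lam * lam))) by (field; lra).
        assert (0 <= b * (2 * (lam * lam - (v - y0) * (v - y0)) * / (16 * (lam * lam)))) by (apply Rmult_le_pos; [lra|apply Rmult_le_pos; lra]).
        lra. }
  eapply Rle_trans; [exact MP|]. unfold W. apply Rplus_le_compat_l.
  replace (b / 8) with (b * (2 * (lam * lam) / (16 * (lam * lam)))) by (field; lra).
  apply Rmult_le_compat_l; [lra|]. apply Rmult_le_compat_r; [lra|]. pose proof (Rle_0_sqr (y - y0)) as Sq. unfold Rsqr in Sq. rewrite Rminus_diag. lra.
Qed.

(** Downward induction on the level [k]: continuity gives the bound for some large [k], and each
    step shrinks the window by [4 lam k] and improves [4 ^ (k + 3)] to [4 ^ (k + 1) + 4 ^ (k + 3) /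
    8 = 3 * 4 ^ (k + 1)]. The final bound is independent of the size of [Phi]. *)
Theorem loglog_bound (Phi : R -> R -> R) (psi : R -> R) (lam : nat -> R) (k0 : nat) (t y0 p c0 : R) :
  0 < p -> cont2 Phi ->
  subh Phi (fun x y => Rabs (x - t) <= p /\ Rabs (y - y0) <= c0) ->
  (forall j, 0 < lam j) -> (forall j s, lam j <= s -> psi s <= ln 4 * (INR j + 1)) ->
  (forall j, (k0 <= j)%nat -> lam j <= c0) ->
  (forall k, (k0 <= k)%nat -> psum lam k - psum lam k0 <= p / 8) ->
  (forall x y, Rabs (x - t) <= p -> 0 < Rabs (y - y0) <= c0 -> Phi x y <= exp (psi (Rabs (y - y0)))) ->
  forall x y, Rabs (x - t) <= p / 2 -> Rabs (y - y0) <= c0 -> Phi x y <= 4 ^ (k0 + 2).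
Proof.
  intros Hp HC HS Lp Lpsi Lc Lsum HPhi.
  assert (P4 : forall n, 0 < 4 ^ n) by (intros; apply pow_lt; lra).
  assert (ln4 : forall n s, lam n <= s -> exp (psi s) <= 4 ^ (n + 1)).
  { intros n s Hs. specialize (Lpsi n s Hs).
    replace (4 ^ (n + 1)) with (exp (ln 4 * (INR n + 1))).
    - destruct Lpsi as [L|E]; [left; apply exp_increasing; auto|rewrite E; lra].
    - replace (INR n + 1) with (INR (n + 1)) by (rewrite plus_INR; simpl; ring).
      rewrite <- (exp_ln (4 ^ (n + 1))) by auto. rewrite ln_pow by lra. f_equal. ring. }
  assert (mono : forall m k, (m <= k)%nat -> psum lam m <= psum lam k).
  { intros m k Hmk. induction Hmk as [|k Hmk IH]; [lra|]. simpl. specialize (Lp k). lra. }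
  destruct (cont_bounded Phi (t - p) (t + p) (y0 - c0) (y0 + c0) (fun x y _ _ => HC x y)) as (B & B0 & HB).
  destruct (Pow_x_infinity 4 ltac:(rewrite Rabs_right; lra) B) as [K HK].
  (* Half-width of the window at level [k]; the tail bound [p / 8] keeps it at most [p]. *)
  set (X := fun k => p / 2 + 4 * (psum lam k - psum lam k0)).
  assert (Main : forall m k, (k + m = k0 + K)%nat -> (k0 <= k)%nat ->
     forall x y, Rabs (x - t) <= X k -> Rabs (y - y0) <= c0 -> Phi x y <= 4 ^ (k + 2)).
  { induction m as [|m IH]; intros k Ekm Hk x y Hx Hy.
    - assert (Xk : X k <= p) by (unfold X; specialize (Lsum k Hk); lra).
      assert (x1 : - p <= x - t <= p) by (apply Rabs_le_between; lra).
      apply Rabs_le_between in Hy. specialize (HB x y ltac:(lra) ltac:(lra)). apply Rabs_le_between in HB.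
      specialize (HK (k + 2)%nat ltac:(lia)). rewrite Rabs_right in HK by (apply Rle_ge; left; auto). lra.
    - assert (Xk : X (S k) <= p) by (unfold X; specialize (Lsum (S k) ltac:(lia)); lra).
      assert (XS : X (S k) = X k + 4 * lam k) by (unfold X; simpl; ring).
      pose proof (Lp k) as lk. pose proof (Lc k Hk) as lc.
      assert (Hout : forall x y, Rabs (x - t) <= p -> lam k <= Rabs (y - y0) <= c0 -> Phi x y <= 4 ^ (k + 1)).
      { intros x' y' Hx' Hy'. eapply Rle_trans; [apply HPhi; auto; lra|]. apply ln4. lra. }
      assert (E2 : 4 ^ (k + 2) = 4 * 4 ^ (k + 1)) by (replace (k + 2)%nat with (S (k + 1)) by lia; simpl; ring).
      assert (E3 : 4 ^ (S k + 2) = 16 * 4 ^ (k + 1)) by (replace (S k + 2)%nat with (S (S (k + 1))) by lia; simpl; ring).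
      specialize (P4 (k + 1)%nat).
      destruct (Rle_lt_dec (lam k) (Rabs (y - y0))) as [G|G].
      + eapply Rle_trans; [apply Hout; [lra|lra]|]. lra.
      + assert (step : Phi x y <= 4 ^ (k + 1) + 4 ^ (S k + 2) / 8); [|lra].
        assert (tr : forall x', Rabs (x' - x) <= 4 * lam k -> Rabs (x' - t) <= X (S k)).
        { intros x' Hx'. replace (x' - t) with ((x' - x) + (x - t)) by ring. eapply Rle_trans; [apply Rabs_triang|]. lra. }
        apply (loglog_step Phi x y0 (lam k)); auto; try lra.
        * destruct HS as (K1 & d & K0 & d0 & HG). exists K1, d. split; auto. split; auto.
          intros u v [Hu Hv]. apply HG. specialize (tr u Hu). split; lra.
        * intros x' y' Hx' Hy'. apply (IH (S k)); [lia|lia|auto|lra].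
        * intros x' y' Hx' Hy'. apply Hout; [specialize (tr x' Hx'); lra|lra]. }
  intros x y Hx Hy. apply (Main K k0); auto.
  unfold X. lra.
Qed.

(** * Comparison functions for the Phragmén-Lindelöf argument *)

(** A quadratic barrier with Laplacian [- 2 A / q^2], at least [A] on three sides and at least [E]
    on the top. The excess over [E] decays linearly towards the top, which matches the linear
    vanishing of a cosine. *)
Lemma boundary_layer (u : R -> R -> R) (t q Y A E : R) : 0 < q -> 0 < Y -> 0 < A -> 0 <= E ->
  cont2 u -> subh u (fun x y => Rabs (x - t) <= q /\ 0 <= y <= Y) ->
  (forall x y, Rabs (x - t) <= q -> 0 <= y <= Y -> u x y <= A) ->
  (forall x, Rabs (x - t) <= q -> u x Y <= E) ->
  forall y, 0 <= y <= Y -> u t y <= E + A * (2 * Y / (q * q) + 1 / Y) * (Y - y).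
Proof.
  intros Hq HY HA HE HC HS Hb Ht y Hy.
  set (k := / (q * q)). assert (k0 : 0 < k) by (apply Rinv_0_lt_compat; nra).
  assert (kq : k * (q * q) = 1) by (unfold k; apply Rinv_l; nra).
  set (l := 1 / Y). assert (l0 : 0 < l) by (apply Rdiv_lt_0_compat; lra).
  assert (lY : l * Y = 1) by (unfold l; field; lra).
  set (W := fun x y => E + A * (k * ((x - t) * (x - t)) + (Y - y) * ((2 * Y * k + l) - 2 * k * (Y - y)))).
  assert (MP : u t y <= W t y).
  { apply (max_principle (fun _ _ => -1) u W (t - q) (t + q) 0 Y); try lra.
    - intros; apply HC.
    - intros a b _ _. unfold W. apply (cont2_add (fun _ _ => E)); [apply cont2_const|].
      apply (cont2_mul (fun _ _ => A)); [apply cont2_const|].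
      apply (cont2_add (fun x y => k * ((x - t) * (x - t)))).
      + apply (cont2_mul (fun _ _ => k)); [apply cont2_const|].
        apply cont2_mul; apply (cont2_sub (fun x _ => x)); first [apply cont2_fst|apply cont2_const].
      + apply (cont2_mul (fun _ y => Y - y)).
        * apply (cont2_sub (fun _ _ => Y)); [apply cont2_const|apply cont2_snd].
        * apply (cont2_sub (fun _ _ => 2 * Y * k + l)); [apply cont2_const|].
          apply (cont2_mul (fun _ _ => 2 * k)); [apply cont2_const|].
          apply (cont2_sub (fun _ _ => Y)); [apply cont2_const|apply cont2_snd].
    - intros; apply continuity_2d_pt_const.
    - destruct HS as (K & d & K0 & d0 & G). exists K, d. split; auto. split; auto.
      intros a b (Ha & Hb' & _). apply G. split; [apply Rabs_le; lra|lra].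
    - intros a b _ _ _. exists (2 * k * A + - (4 * k * A)). split; [assert (0 < k * A) by (apply Rmult_lt_0_compat; auto); lra|].
      apply (Lap_intro _ (fun x => 2 * k * A * (x - t)) (fun v => A * (4 * k * (Y - v) - (2 * Y * k + l)))).
      + apply filter_forall. intros z. unfold W. auto_derive; auto. ring.
      + auto_derive; auto. ring.
      + apply filter_forall. intros z. unfold W. auto_derive; auto. ring.
      + auto_derive; auto. ring.
    - intros a b Ha Hb' _ HB. cbv beta in HB. unfold W.
      assert (S0 : 0 <= (a - t) * (a - t)) by (apply Rle_0_sqr).
      assert (S1 : 0 <= k * ((a - t) * (a - t))) by (apply Rmult_le_pos; lra).
      assert (S2 : l * (Y - b) <= (Y - b) * ((2 * Y * k + l) - 2 * k * (Y - b))).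
      { rewrite Rmult_comm. apply Rmult_le_compat_l; [lra|]. assert (0 <= k * b) by (apply Rmult_le_pos; lra). lra. }
      assert (S3 : 0 <= l * (Y - b)) by (apply Rmult_le_pos; lra).
      assert (Aa : Rabs (a - t) <= q) by (apply Rabs_le; lra).
      assert (Side : (1 <= k * ((a - t) * (a - t)) + (Y - b) * ((2 * Y * k + l) - 2 * k * (Y - b))) \/ b = Y).
      { destruct HB as [->|[->|[->|[->|HB]]]]; lra. }
      destruct Side as [Sd| ->].
      + eapply Rle_trans; [apply Hb; auto|]. apply (Rmult_le_compat_l A) in Sd; lra.
      + eapply Rle_trans; [apply Ht; auto|].
        assert (0 <= A * (k * ((a - t) * (a - t)) + (Y - Y) * (2 * Y * k + l - 2 * k * (Y - Y)))); [|lra].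
        apply Rmult_le_pos; lra. }
  eapply Rle_trans; [exact MP|]. unfold W. apply Rplus_le_compat_l.
  replace (A * (2 * Y / (q * q) + l) * (Y - y)) with (A * ((2 * Y * k + l) * (Y - y))) by (unfold k; field; lra).
  apply Rmult_le_compat_l; [lra|].
  rewrite Rminus_diag. rewrite (Rmult_comm (2 * Y * k + l)).
  assert ((Y - y) * (2 * Y * k + l - 2 * k * (Y - y)) <= (Y - y) * (2 * Y * k + l)); [|lra].
  apply Rmult_le_compat_l; [lra|]. assert (0 <= k * (Y - y)) by (apply Rmult_le_pos; lra). lra.
Qed.

Lemma is_derive_psum (f : nat -> R -> R) (f' : nat -> R) x n :
  (forall i, is_derive (f i) x (f' i)) -> is_derive (fun x => psum (fun i => f i x) n) x (psum f' n).
Proof.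
  intros H. induction n as [|n IH]; simpl.
  - apply (is_derive_const (V := R_NormedModule)).
  - apply (is_derive_plus (V := R_NormedModule) (fun x => psum (fun i => f i x) n) (f n)); auto.
Qed.

Lemma psum_le u v n : (forall i, u i <= v i) -> psum u n <= psum v n.
Proof. intros H. induction n as [|n IH]; simpl; [lra|]. specialize (H n). lra. Qed.

Lemma psum_ge0 u n : (forall i, 0 <= u i) -> 0 <= psum u n.
Proof. intros H. induction n as [|n IH]; simpl; [lra|]. specialize (H n). lra. Qed.

Lemma psum_scal k u n : psum (fun i => k * u i) n = k * psum u n.
Proof. induction n as [|n IH]; simpl; [ring|rewrite IH; ring]. Qed.

Lemma psum_ext u v n : (forall i, (i < n)%nat -> u i = v i) -> psum u n = psum v n.
Proof. intros H. induction n as [|n IH]; simpl; [auto|]. rewrite IH, H; auto. Qed.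

Lemma psum_telescope u n : psum (fun i => u i - u (S i)) n = u O - u n.
Proof. induction n as [|n IH]; simpl; [ring|rewrite IH; ring]. Qed.

Lemma psum_abel u n : psum (fun i => (u i - u (S i)) * (INR i + 1)) n = psum u n - INR n * u n.
Proof. induction n as [|n IH]; [simpl; ring|]. cbn [psum]. rewrite IH, S_INR. ring. Qed.

Lemma exp_cos_Lap (a b a1 b1 : R -> R) x y a2 b2 :
  (forall u, is_derive a u (a1 u)) -> is_derive a1 x a2 -> (forall u, is_derive b u (b1 u)) -> is_derive b1 x b2 ->
  Lap (fun x y => exp (a x) * cos (b x * y)) x y
    (exp (a x) * ((a2 + a1 x ^ 2 - b1 x ^ 2 * y ^ 2) * cos (b x * y) - (2 * a1 x * b1 x + b2) * (y * sin (b x * y)))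
     + - (b x ^ 2 * (exp (a x) * cos (b x * y)))).
Proof.
  intros A1 A2 B1 B2.
  assert (Ea : forall u, ex_derive a u) by (intros u; exists (a1 u); auto).
  assert (Eb : forall u, ex_derive b u) by (intros u; exists (b1 u); auto).
  assert (Da : forall u, Derive (fun z => a z) u = a1 u) by (intros; apply is_derive_unique; auto).
  assert (Db : forall u, Derive (fun z => b z) u = b1 u) by (intros; apply is_derive_unique; auto).
  assert (Ea1 : ex_derive a1 x) by (exists a2; auto). assert (Eb1 : ex_derive b1 x) by (exists b2; auto).
  assert (Da1 : Derive (fun z => a1 z) x = a2) by (apply is_derive_unique; auto).
  assert (Db1 : Derive (fun z => b1 z) x = b2) by (apply is_derive_unique; auto).
  apply (Lap_intro _ (fun u => exp (a u) * (a1 u * cos (b u * y) - b1 u * y * sin (b u * y))) (fun v => - (b x * (exp (a x) * sin (b x * v))))).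
  - apply filter_forall. intros u. auto_derive; [repeat split; auto|]. rewrite Da, Db. ring.
  - auto_derive; [repeat split; auto|]. rewrite Da, Db, Da1, Db1. ring.
  - apply filter_forall. intros u. auto_derive; auto. ring.
  - auto_derive; auto. ring.
Qed.

(** * The superharmonic function [exp (a x) * cos (b x * y)] with increasing frequency *)

Section Comparator.
Variables (beta c x0 : R) (L : nat -> R) (n : nat).
Hypothesis Hbeta : 0 < beta.
Hypothesis Hc : 0 < c.
Hypothesis Lpos : forall j, 0 < L j.
Hypothesis Ldec : forall j, L (S j) <= L j.
Hypothesis Lsmall : c * L O <= beta / 8.
Hypothesis Hn : (0 < n)%nat.

(** A steepness small against [beta]: second derivatives of the frequency are at most [gam] times
    its first derivative. *)
Let gam := beta / 4.
(** Only the levels up to the right end of the region matter; cutting [L] off at [n] makes the sums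
    finite and lets the increments telescope to [c * L 0]. *)
Let L' (i : nat) := if Nat.ltb i n then L i else 0.
Let mu (i : nat) := c * (L' i - L' (S i)).
(** A smoothed step, decreasing from 1 to 0, with value [1 / 2] at 0. *)
Let g (x : R) := / (1 + exp (gam * x)).
Let arg (i : nat) (x : R) := x - x0 - INR i - 1.

(** The future [beta - b]: a smooth substitute for the step function with value [c * L j] between
    [x0 + j] and [x0 + j + 1]. *)
Definition bump_sum (x : R) : R := psum (fun i => mu i * g (arg i x)) n.
Definition bump_sum1 (x : R) : R := psum (fun i => mu i * (- gam * g (arg i x) * (1 - g (arg i x)))) n.
Definition bump_sum2 (x : R) : R :=
  psum (fun i => mu i * (gam ^ 2 * g (arg i x) * (1 - g (arg i x)) * (1 - 2 * g (arg i x)))) n.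
(** The antiderivative of [bump_sum] that vanishes at plus infinity. *)
Definition bump_prim (x : R) : R := psum (fun i => mu i * (- / gam * ln (1 + exp (- gam * arg i x)))) n.

Let gam0 : 0 < gam.
Proof. unfold gam; lra. Qed.

Let g01 x : 0 < g x < 1.
Proof.
  unfold g. pose proof (exp_pos (gam * x)). split; [apply Rinv_0_lt_compat; lra|].
  rewrite <- Rinv_1 at 2. apply Rinv_lt_contravar; lra.
Qed.

Let L'0 : L' O = L O.
Proof. unfold L'. destruct (Nat.ltb_spec 0 n); [auto|lia]. Qed.

Let L'n : L' n = 0.
Proof. unfold L'. rewrite Nat.ltb_irrefl. auto. Qed.

Let L'dec i : L' (S i) <= L' i.
Proof.
  unfold L'. destruct (Nat.ltb_spec (S i) n), (Nat.ltb_spec i n); try lia; auto; try lra. left; auto.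
Qed.

Let mu0 i : 0 <= mu i.
Proof. unfold mu. apply Rmult_le_pos; [lra|]. specialize (L'dec i). lra. Qed.

Let mu_total : psum mu n = c * L O.
Proof.
  unfold mu. rewrite psum_scal, psum_telescope, L'0, L'n. ring.
Qed.

Let is_derive_g x : is_derive g x (- gam * g x * (1 - g x)).
Proof.
  unfold g. pose proof (exp_pos (gam * x)). auto_derive; [lra|]. field. lra.
Qed.

Let is_derive_arg i x : is_derive (arg i) x 1.
Proof. unfold arg. auto_derive; auto. Qed.

Let is_derive_comp_arg (f : R -> R) l i x : is_derive f (arg i x) l -> is_derive (fun x => mu i * f (arg i x)) x (mu i * l).
Proof.
  intros Hf. apply (is_derive_scal (fun x => f (arg i x))).
  replace l with (scal 1 l) by (exact (scal_one (V := R_NormedModule) l)).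
  apply (is_derive_comp (V := R_NormedModule) f (arg i)); auto.
Qed.

Lemma bump_sum_derive x : is_derive bump_sum x (bump_sum1 x).
Proof. apply is_derive_psum. intros i. apply is_derive_comp_arg. apply is_derive_g. Qed.

Lemma bump_sum1_derive x : is_derive bump_sum1 x (bump_sum2 x).
Proof.
  apply is_derive_psum. intros i. apply (is_derive_comp_arg (fun z => - gam * g z * (1 - g z))).
  pose proof (is_derive_g (arg i x)) as D.
  assert (E : ex_derive g (arg i x)) by (eexists; exact D).
  auto_derive; [auto|]. replace (Derive (fun z => g z) (arg i x)) with (- gam * g (arg i x) * (1 - g (arg i x))) by (symmetry; apply is_derive_unique; auto).
  ring.
Qed.

Lemma bump_prim_derive x : is_derive bump_prim x (bump_sum x).
Proof.
  apply is_derive_psum. intros i. apply (is_derive_comp_arg (fun z => - / gam * ln (1 + exp (- gam * z)))).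
  set (z := arg i x). pose proof (exp_pos (- gam * z)). auto_derive; [lra|].
  assert (E : exp (gam * z) = / exp (- gam * z)) by (rewrite <- exp_Ropp; f_equal; ring).
  unfold g. rewrite E. field. repeat split; lra.
Qed.

Lemma bump_sum_range x : 0 <= bump_sum x <= beta / 8.
Proof.
  split.
  - apply psum_ge0. intros i. apply Rmult_le_pos; auto. left; apply g01.
  - rewrite <- mu_total in Lsmall. eapply Rle_trans; [|exact Lsmall]. apply psum_le. intros i.
    rewrite <- (Rmult_1_r (mu i)) at 2. apply Rmult_le_compat_l; auto. left; apply g01.
Qed.

Lemma bump_sum1_range x : - (gam * (beta / 8)) <= bump_sum1 x <= 0.
Proof.
  assert (E : bump_sum1 x = - psum (fun i => mu i * (gam * g (arg i x) * (1 - g (arg i x)))) n).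
  { unfold bump_sum1. rewrite <- (Rmult_1_l (psum _ _)) at 1.
    replace (- psum (fun i => mu i * (gam * g (arg i x) * (1 - g (arg i x)))) n) with (-1 * psum (fun i => mu i * (gam * g (arg i x) * (1 - g (arg i x)))) n) by ring.
    rewrite Rmult_1_l, <- psum_scal. apply psum_ext. intros; ring. }
  rewrite E. assert (0 <= psum (fun i => mu i * (gam * g (arg i x) * (1 - g (arg i x)))) n <= gam * (beta / 8)); [|lra].
  split.
  - apply psum_ge0. intros i. apply Rmult_le_pos; auto. specialize (g01 (arg i x)). apply Rmult_le_pos; [apply Rmult_le_pos; lra|lra].
  - apply Rle_trans with (gam * (c * L O)); [|apply Rmult_le_compat_l; lra].
    rewrite <- mu_total, <- psum_scal. apply psum_le. intros i. rewrite (Rmult_comm gam (mu i)). apply Rmult_le_compat_l; auto.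
    specialize (g01 (arg i x)). rewrite <- (Rmult_1_r gam) at 2. rewrite Rmult_assoc. apply Rmult_le_compat_l; [lra|].
    rewrite <- (Rmult_1_r 1). apply Rmult_le_compat; lra.
Qed.

Lemma bump_sum2_le x : bump_sum2 x <= - (gam * bump_sum1 x).
Proof.
  replace (- (gam * bump_sum1 x)) with (- gam * bump_sum1 x) by ring.
  unfold bump_sum1, bump_sum2. rewrite <- psum_scal. apply psum_le. intros i.
  specialize (g01 (arg i x)). set (z := g (arg i x)) in *. specialize (mu0 i).
  replace (- gam * (mu i * (- gam * z * (1 - z)))) with (mu i * (gam ^ 2 * z * (1 - z) * 1)) by ring.
  apply Rmult_le_compat_l; auto. apply Rmult_le_compat_l; [|lra].
  apply Rmult_le_pos; [apply Rmult_le_pos; [apply pow2_ge_0|lra]|lra].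
Qed.

(** For [i >= j] the smoothed steps are still at least [1 / 2], and their heights telescope to
    [c * L j]. *)
Lemma bump_sum_lower j x : (j < n)%nat -> x <= x0 + INR j + 1 -> c / 2 * L j <= bump_sum x.
Proof.
  intros Hj Hx.
  assert (G : forall m, (j <= m)%nat -> c / 2 * (L' j - L' m) <= psum (fun i => mu i * g (arg i x)) m).
  { intros m Hm. induction Hm as [|m Hm IH].
    - rewrite Rminus_diag, Rmult_0_r. apply psum_ge0. intros i. apply Rmult_le_pos; auto. left; apply g01.
    - simpl. assert (c / 2 * (L' m - L' (S m)) <= mu m * g (arg m x)); [|lra].
      assert (1 / 2 <= g (arg m x)).
      { unfold g. replace (1 / 2) with (/ 2) by lra. apply Rinv_le_contravar; [pose proof (exp_pos (gam * arg m x)); lra|].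
        assert (exp (gam * arg m x) <= exp 0); [|rewrite exp_0 in *; lra].
        assert (arg m x <= 0). { unfold arg. apply le_INR in Hm. lra. }
        assert (gam * arg m x <= 0) by nra. destruct H0 as [H0|H0]; [left; apply exp_increasing; auto|rewrite H0; lra]. }
      replace (c / 2 * (L' m - L' (S m))) with (mu m * (1 / 2)) by (unfold mu; field).
      apply Rmult_le_compat_l; auto. }
  specialize (G n ltac:(lia)). rewrite L'n in G.
  assert (E : L' j = L j) by (unfold L'; destruct (Nat.ltb_spec j n); [auto|lia]).
  rewrite E in G. unfold bump_sum. lra.
Qed.

Definition cmp_b (x : R) : R := beta - bump_sum x.
(** Thus [a' = b - (8 / beta) b']: the correction makes [a'^2 - b^2] negative enough to absorb
    [a'']. *)
Definition cmp_a (x : R) : R := beta * x - (bump_prim x - bump_prim x0) - 8 / beta * cmp_b x.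

Lemma cmp_b_range x : 7 / 8 * beta <= cmp_b x <= beta.
Proof. unfold cmp_b. pose proof (bump_sum_range x). lra. Qed.

Lemma cmp_b_gap j x : (j < n)%nat -> x <= x0 + INR j + 1 -> c / 2 * L j <= beta - cmp_b x.
Proof. intros Hj Hx. unfold cmp_b. pose proof (bump_sum_lower j x Hj Hx). lra. Qed.

Lemma cmp_b_derive x : is_derive cmp_b x (- bump_sum1 x).
Proof.
  unfold cmp_b. replace (- bump_sum1 x) with (0 - bump_sum1 x) by ring.
  apply (is_derive_minus (V := R_NormedModule) (fun _ => beta) bump_sum).
  - apply (is_derive_const (V := R_NormedModule)).
  - apply bump_sum_derive.
Qed.

Lemma cmp_a_derive x : is_derive cmp_a x (cmp_b x + 8 / beta * bump_sum1 x).
Proof.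
  pose proof (bump_prim_derive x) as D1. pose proof (cmp_b_derive x) as D2.
  assert (E1 : ex_derive bump_prim x) by (eexists; exact D1). assert (E2 : ex_derive cmp_b x) by (eexists; exact D2).
  unfold cmp_a. auto_derive; [auto|].
  replace (Derive (fun z => bump_prim z) x) with (bump_sum x) by (symmetry; apply is_derive_unique; auto).
  replace (Derive (fun z => cmp_b z) x) with (- bump_sum1 x) by (symmetry; apply is_derive_unique; auto).
  unfold cmp_b. field. lra.
Qed.

Lemma bump_prim_le0 x : bump_prim x <= 0.
Proof.
  unfold bump_prim. rewrite <- (Rmult_0_r 1). 
  assert (0 <= psum (fun i => mu i * (/ gam * ln (1 + exp (- gam * arg i x)))) n).
  { apply psum_ge0. intros i. apply Rmult_le_pos; auto. apply Rmult_le_pos; [left; apply Rinv_0_lt_compat; auto|].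
    apply ln_ge_0. pose proof (exp_pos (- gam * arg i x)). lra. }
  replace (psum (fun i => mu i * (- / gam * ln (1 + exp (- gam * arg i x)))) n) with
    (-1 * psum (fun i => mu i * (/ gam * ln (1 + exp (- gam * arg i x)))) n); [lra|].
  rewrite <- psum_scal. apply psum_ext. intros; ring.
Qed.

(** The left side is the integral of [beta - b] from [x0] to infinity, the total loss of growth. The
    bound [ln (1 + exp z) <= z + ln 2] and summation by parts turn it into [c] times the sum of the
    widths. *)
Lemma bump_prim_start : - bump_prim x0 <= c * psum L n + 1.
Proof.
  assert (Sm : - bump_prim x0 <= psum (fun i => mu i * (INR i + 1) + mu i * (/ gam * ln 2)) n).
  { unfold bump_prim. replace (- psum (fun i => mu i * (- / gam * ln (1 + exp (- gam * arg i x0)))) n) with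
      (-1 * psum (fun i => mu i * (- / gam * ln (1 + exp (- gam * arg i x0)))) n) by ring.
    rewrite <- psum_scal. apply psum_le. intros i.
    replace (-1 * (mu i * (- / gam * ln (1 + exp (- gam * arg i x0))))) with (mu i * (/ gam * ln (1 + exp (- gam * arg i x0)))) by ring.
    rewrite <- Rmult_plus_distr_l. apply Rmult_le_compat_l; auto.
    replace (- gam * arg i x0) with (gam * (INR i + 1)) by (unfold arg; ring).
    assert (P : 0 <= gam * (INR i + 1)) by (pose proof (pos_INR i); apply Rmult_le_pos; lra).
    assert (Q : ln (1 + exp (gam * (INR i + 1))) <= gam * (INR i + 1) + ln 2).
    { rewrite <- (ln_exp (gam * (INR i + 1))) at 2. rewrite <- ln_mult; [|apply exp_pos|lra].
      pose proof (exp_pos (gam * (INR i + 1))). apply ln_le; [lra|].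
      assert (exp 0 <= exp (gam * (INR i + 1))) by (destruct P as [P|P]; [left; apply exp_increasing; auto|rewrite <- P; lra]).
      rewrite exp_0 in *. lra. }
    apply (Rmult_le_compat_l (/ gam)) in Q; [|left; apply Rinv_0_lt_compat; auto].
    replace (/ gam * (gam * (INR i + 1) + ln 2)) with (INR i + 1 + / gam * ln 2) in Q by (field; lra). lra. }
  rewrite psum_plus in Sm.
  assert (E1 : psum (fun i => mu i * (INR i + 1)) n = c * psum L n).
  { rewrite (psum_ext _ (fun i => c * ((L' i - L' (S i)) * (INR i + 1)))) by (intros; unfold mu; ring).
    rewrite psum_scal, psum_abel, L'n, Rmult_0_r, Rminus_0_r. f_equal. apply psum_ext. intros i Hi. unfold L'.
    destruct (Nat.ltb_spec i n); [auto|lia]. }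
  assert (E2 : psum (fun i => mu i * (/ gam * ln 2)) n <= 1).
  { rewrite (psum_ext _ (fun i => (/ gam * ln 2) * mu i)) by (intros; ring). rewrite psum_scal, mu_total.
    assert (l2 : ln 2 <= 1).
    { rewrite <- (ln_exp 1). apply ln_le; [lra|]. pose proof (exp_ineq1 1 ltac:(lra)). lra. }
    assert (l0 : 0 <= ln 2) by (apply ln_ge_0; lra).
    assert (ig : 0 < / gam) by (apply Rinv_0_lt_compat; auto).
    apply Rle_trans with (/ gam * 1 * (beta / 8)).
    - apply Rmult_le_compat; auto; [apply Rmult_le_pos; lra|apply Rmult_le_pos; [lra|left; auto]|apply Rmult_le_compat_l; lra].
    - replace (/ gam * 1 * (beta / 8)) with (1 / 2) by (unfold gam; field; lra). lra. }
  lra.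
Qed.

Lemma cmp_a_upper x : x0 <= x -> cmp_a x <= beta * x.
Proof.
  intros Hx. unfold cmp_a.
  assert (bump_prim x0 <= bump_prim x).
  { destruct Hx as [Hx|Hx]; [|rewrite Hx; lra].
    destruct (MVT_gen bump_prim x0 x bump_sum) as [z [Hz E]].
    - intros; apply bump_prim_derive.
    - intros z _. apply continuity_pt_filterlim, (ex_derive_continuous (V := R_NormedModule)). eexists; apply bump_prim_derive.
    - pose proof (bump_sum_range z). nra. }
  pose proof (cmp_b_range x). assert (0 <= 8 / beta * cmp_b x) by (apply Rmult_le_pos; [left; apply Rdiv_lt_0_compat; lra|lra]). lra.
Qed.

Lemma cmp_a_lower x : beta * x - (9 + c * psum L n) <= cmp_a x.
Proof.
  unfold cmp_a. pose proof (bump_prim_le0 x). pose proof bump_prim_start. pose proof (cmp_b_range x) as [_ Q].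
  apply (Rmult_le_compat_l (8 / beta)) in Q; [|left; apply Rdiv_lt_0_compat; lra].
  replace (8 / beta * beta) with 8 in Q by (field; lra). lra.
Qed.

(** With [d = b' >= 0] the sine terms have the good sign. In the coefficient of the cosine, [a''] is
    at most [3 d] while [a'^2 - b^2] is at most [- 10 d]. *)
Lemma cmp_superharmonic x y : cmp_b x * Rabs y <= PI / 2 ->
  exists l, l <= 0 /\ Lap (fun x y => exp (cmp_a x) * cos (cmp_b x * y)) x y l.
Proof.
  intros Hy. pose proof PI_RGT_0 as Hpi.
  pose proof (cmp_b_range x) as Rb. pose proof (bump_sum1_range x) as R1. pose proof (bump_sum2_le x) as R2.
  eexists. split; [|apply (exp_cos_Lap cmp_a cmp_b (fun x => cmp_b x + 8 / beta * bump_sum1 x) (fun x => - bump_sum1 x) x y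
    (- bump_sum1 x + 8 / beta * bump_sum2 x) (- bump_sum2 x))].
  - set (s1 := bump_sum1 x) in *. set (s2 := bump_sum2 x) in *. set (b := cmp_b x) in *. cbv beta.
    assert (By : - (PI / 2) <= b * y <= PI / 2).
    { apply Rabs_le_between. rewrite Rabs_mult, (Rabs_right b) by lra. auto. }
    assert (C0 : 0 <= cos (b * y)) by (apply cos_ge_0; lra).
    assert (S0 : 0 <= y * sin (b * y)).
    { destruct (Rle_lt_dec 0 y) as [G|G].
      - apply Rmult_le_pos; auto. apply sin_ge_0; [apply Rmult_le_pos; lra|lra].
      - replace (y * sin (b * y)) with ((- y) * sin (b * (- y))).
        + apply Rmult_le_pos; [lra|]. apply sin_ge_0; [apply Rmult_le_pos; lra|lra].
        + replace (b * - y) with (- (b * y)) by ring. rewrite sin_neg. ring. }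
    set (d := - s1) in *. assert (d0 : 0 <= d <= gam * (beta / 8)) by (unfold d; lra).
    assert (k0 : 0 < 8 / beta) by (apply Rdiv_lt_0_compat; lra).
    assert (kd : 8 / beta * d <= beta / 4).
    { apply Rle_trans with (8 / beta * (gam * (beta / 8))); [apply Rmult_le_compat_l; lra|]. right. unfold gam. field. lra. }
    assert (ks2 : 8 / beta * s2 <= 2 * d).
    { apply Rle_trans with (8 / beta * (gam * d)); [apply Rmult_le_compat_l; [lra|unfold d; lra]|]. right. unfold gam. field. lra. }
    set (k := 8 / beta) in *. set (a1 := b + k * s1).
    assert (Ea1 : a1 = b - k * d) by (unfold a1, d; ring).
    assert (kb : 6 <= k * b). { replace 6 with (k * (6 / 8 * beta)) by (unfold k; field; lra). apply Rmult_le_compat_l; lra. }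
    assert (Q1 : (d + k * s2) + a1 ^ 2 - b ^ 2 <= 0).
    { rewrite Ea1. replace (d + k * s2 + (b - k * d) ^ 2 - b ^ 2) with (d + k * s2 - d * (2 * (k * b) - k * (k * d))) by ring.
      assert (k * (k * d) <= 2) by (replace 2 with (k * (beta / 4)) by (unfold k; field; lra); apply Rmult_le_compat_l; lra).
      assert (d * 10 <= d * (2 * (k * b) - k * (k * d))) by (apply Rmult_le_compat_l; lra). lra. }
    assert (Q2 : 0 <= 2 * a1 * d - s2).
    { assert (beta / 2 <= a1) by lra. assert (2 * (beta / 2) * d <= 2 * a1 * d) by (apply Rmult_le_compat_r; lra).
      assert (s2 <= gam * d) by (unfold d; lra). assert (gam * d <= beta * d) by (apply Rmult_le_compat_r; unfold gam; lra). lra. }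
    pose proof (exp_pos (cmp_a x)) as Ep. set (e := exp (cmp_a x)) in *. set (C := cos (b * y)) in *. set (Sn := y * sin (b * y)) in *.
    replace (e * ((d + k * s2 + a1 ^ 2 - d ^ 2 * y ^ 2) * C - (2 * a1 * d + - s2) * Sn) + - (b ^ 2 * (e * C))) with
      (e * ((d + k * s2 + a1 ^ 2 - b ^ 2) * C - (d * y) ^ 2 * C - (2 * a1 * d - s2) * Sn)) by ring.
    assert ((d + k * s2 + a1 ^ 2 - b ^ 2) * C <= 0) by nra.
    assert (0 <= (d * y) ^ 2 * C) by (apply Rmult_le_pos; [apply pow2_ge_0|auto]).
    assert (0 <= (2 * a1 * d - s2) * Sn) by (apply Rmult_le_pos; auto).
    nra.
  - intros; apply cmp_a_derive.
  - pose proof (cmp_b_derive x) as D1. pose proof (bump_sum1_derive x) as D2.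
    assert (E1 : ex_derive cmp_b x) by (eexists; exact D1). assert (E2 : ex_derive bump_sum1 x) by (eexists; exact D2).
    auto_derive; [auto|]. replace (Derive (fun z => cmp_b z) x) with (- bump_sum1 x) by (symmetry; apply is_derive_unique; auto).
    replace (Derive (fun z => bump_sum1 z) x) with (bump_sum2 x) by (symmetry; apply is_derive_unique; auto). ring.
  - intros; apply cmp_b_derive.
  - apply (is_derive_opp (V := R_NormedModule)). apply bump_sum1_derive.
Qed.

Lemma cmp_cont2 : cont2 (fun x y => exp (cmp_a x) * cos (cmp_b x * y)).
Proof.
  apply cont2_mul.
  - apply (cont2_1d exp (fun x _ => cmp_a x)); [intros; apply (ex_derive_continuous (V := R_NormedModule)); auto_derive; auto|].
    apply (cont2_1d cmp_a (fun x _ => x)); [|apply cont2_fst]. intros. apply (ex_derive_continuous (V := R_NormedModule)). eexists; apply cmp_a_derive.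
  - apply (cont2_1d cos (fun x y => cmp_b x * y)); [intros; apply (ex_derive_continuous (V := R_NormedModule)); auto_derive; auto|].
    apply cont2_mul; [|apply cont2_snd].
    apply (cont2_1d cmp_b (fun x _ => x)); [|apply cont2_fst]. intros. apply (ex_derive_continuous (V := R_NormedModule)). eexists; apply cmp_b_derive.
Qed.
End Comparator.

(** Double angle formula: on the half angle the cosine is at least [1 / sqrt 2], which is used once
    for the factor [cos] and once for the slope of [sin]. *)
Lemma sin_ge_half x : 0 <= x <= PI / 2 -> x / 2 <= sin x.
Proof.
  intros Hx. pose proof PI_RGT_0. destruct sqrt2_bounds as [S1 S2].
  assert (i2 : 0 < 1 / sqrt 2) by (apply Rdiv_lt_0_compat; lra).
  assert (e2 : 1 / sqrt 2 * (1 / sqrt 2) = 1 / 2).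
  { replace (1 / sqrt 2 * (1 / sqrt 2)) with (1 / (sqrt 2 * sqrt 2)) by (field; lra). rewrite S2. reflexivity. }
  assert (A : x / 2 * (1 / sqrt 2) <= sin (x / 2)).
  { destruct (MVT_gen sin 0 (x / 2) cos) as [c [Hc E]].
    - intros. auto_derive; auto. ring.
    - intros. apply continuity_sin.
    - rewrite Rmin_left, Rmax_right in Hc by lra. rewrite sin_0 in E.
      destruct (cos_pi4_range c ltac:(lra)) as [Q _]. nra. }
  destruct (cos_pi4_range (x / 2) ltac:(lra)) as [B _].
  replace x with (2 * (x / 2)) at 2 by field. rewrite sin_2a.
  assert (x / 2 * (1 / sqrt 2) * (1 / sqrt 2) <= sin (x / 2) * cos (x / 2)).
  { apply Rmult_le_compat; try lra. apply Rmult_le_pos; lra. }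
  rewrite Rmult_assoc, e2 in H0. lra.
Qed.

Lemma cos_1_ge : 1 / 2 <= cos 1.
Proof.
  rewrite <- cos_PI3. pose proof PI_4. pose proof PI2_3_2. pose proof PI_RGT_0.
  apply cos_decr_1; lra.
Qed.

Lemma cos_ge_half_small z : -1 <= z <= 1 -> 1 / 2 <= cos z.
Proof.
  intros Hz. eapply Rle_trans; [apply cos_1_ge|]. pose proof PI2_3_2.
  destruct (Rle_lt_dec 0 z).
  - apply cos_decr_1; lra.
  - rewrite <- (cos_neg z). apply cos_decr_1; lra.
Qed.

Lemma ln_le_sub1 x : 0 < x -> ln x <= x - 1.
Proof.
  intros Hx. destruct (Req_EM_T (ln x) 0) as [E|N].
  - rewrite E. assert (x = 1). { apply ln_inv; try lra. rewrite ln_1. auto. } lra.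
  - pose proof (exp_ineq1 (ln x) N). rewrite exp_ln in H by auto. lra.
Qed.

Lemma log_le_exp a kap : 0 < kap -> 1 <= a -> forall x, 0 <= x -> ln (a + x) <= (a + / kap) * exp (kap * x).
Proof.
  intros Hk Ha x Hx. pose proof (ln_le_sub1 (a + x) ltac:(lra)).
  assert (E : 1 + kap * x <= exp (kap * x)).
  { destruct Hx as [Hx|<-]; [left; apply exp_ineq1; nra|rewrite Rmult_0_r, exp_0; lra]. }
  assert (ik : 0 < / kap) by (apply Rinv_0_lt_compat; auto).
  assert (x <= / kap * exp (kap * x)).
  { apply Rle_trans with (/ kap * (kap * x)); [right; field; lra|]. apply Rmult_le_compat_l; lra. }
  assert (a * 1 <= a * exp (kap * x)) by (apply Rmult_le_compat_l; [lra|]; assert (0 <= kap * x) by nra; lra).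
  lra.
Qed.

Lemma exp_ge1 x : 0 <= x -> 1 <= exp x.
Proof. intros [H|<-]; [rewrite <- exp_0; left; apply exp_increasing; auto|rewrite exp_0; lra]. Qed.

Lemma exp_le x y : x <= y -> exp x <= exp y.
Proof. intros [H| ->]; [left; apply exp_increasing; auto|lra]. Qed.

Lemma subh_scal u D k : 0 <= k -> subh u D -> subh (fun x y => k * u x y) D.
Proof.
  intros Hk (K & d & K0 & d0 & G). exists (k * K), d. split; [apply Rmult_le_pos; auto|]. split; auto.
  intros x y Dxy h a b Hh Ha Hb. specialize (G x y Dxy h a b Hh Ha Hb).
  replace (stencil (fun x y => k * u x y) x y a b) with (k * stencil u x y a b) by (unfold stencil; ring).
  apply (Rmult_le_compat_l k) in G; auto. lra.
Qed.

Lemma subh_reflect u (D : R -> R -> Prop) : subh u D -> subh (fun x y => u x (- y)) (fun x y => D x (- y)).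
Proof.
  intros (K & d & K0 & d0 & G). exists K, d. split; auto. split; auto.
  intros x y Dxy h a b Hh Ha Hb. specialize (G x (- y) Dxy h a (- b) Hh Ha ltac:(rewrite Rabs_Ropp; auto)).
  eapply Rle_trans; [exact G|]. right. unfold stencil, Rminus.
  rewrite !Ropp_plus_distr, !Ropp_involutive. ring.
Qed.

Lemma subh_weaken u (D D' : R -> R -> Prop) : (forall x y, D' x y -> D x y) -> subh u D -> subh u D'.
Proof.
  intros H (K & d & K0 & d0 & G). exists K, d. split; [auto|]. split; [auto|]. intros x y Hxy. apply G. auto.
Qed.

(** * Phragmén-Lindelöf in a half-strip *)

Section PL.
Variables (rho hw0 : R) (M : R -> R) (u : R -> R -> R) (C1 : R).
Hypothesis Hrho : 0 < rho.
Hypothesis Hhw : 0 < hw0 <= 1.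
Hypothesis HM : forall t, 0 < t -> exp 1 < M t.
Hypothesis Mdec : forall s t, 0 < s -> s <= t -> M t <= M s.
Hypothesis Cu : cont2 u.
Hypothesis Su : forall X, subh u (fun x y => Rabs x <= X /\ Rabs y <= X).
Hypothesis HC1 : 0 < C1.
Hypothesis P1 : forall x y, 0 <= x -> rho < Rabs y <= 2 * rho + 1 -> u x y <= C1 * (ln (2 + x) + ln (M (Rabs y - rho))).
Let beta := PI / (2 * rho).
(** The information at the right end: windows arbitrarily far out with an arbitrarily small factor
    [eps], but still with the factor [ln (M d)] that is singular at the lines [|y| = rho]. *)
Hypothesis P2 : forall eps T, 0 < eps -> exists t, T <= t /\
  forall x y, Rabs (x - t) <= hw0 -> Rabs y <= 2 * rho + 1 -> Rabs y <> rho ->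
  u x y <= eps * exp (beta * t) * ln (M (Rabs (Rabs y - rho))).
Variable I : R.
Hypothesis psi_cont : forall t, 0 < t -> continuous (fun t => ln (ln (M t))) t.
Hypothesis psi_int : forall a b, 0 < a <= b -> RInt (fun t => ln (ln (M t))) a b <= I.

Let lnM1 t : 0 < t -> 1 < ln (M t).
Proof. intros Ht. rewrite <- (ln_exp 1). apply ln_increasing; [apply exp_pos|auto]. Qed.

Let lnMdec s t : 0 < s -> s <= t -> ln (M t) <= ln (M s).
Proof. intros Hs Hst. apply ln_le; [|auto]. specialize (HM t ltac:(lra)). pose proof (exp_pos 1). lra. Qed.

Let psi_pos t : 0 < t -> 0 < ln (ln (M t)).
Proof. intros Ht. rewrite <- ln_1. apply ln_increasing; [lra|auto]. Qed.

Let psi_dec s t : 0 < s -> s <= t -> ln (ln (M t)) <= ln (ln (M s)).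
Proof. intros Hs Hst. apply ln_le; [specialize (lnM1 t ltac:(lra)); lra|auto]. Qed.

Let beta0 : 0 < beta.
Proof. unfold beta. pose proof PI_RGT_0. apply Rdiv_lt_0_compat; lra. Qed.

Let beta_rho : beta * rho = PI / 2.
Proof. unfold beta. field. lra. Qed.

(* The logarithmic integral enters here, through the log-log theorem on both boundary lines. *)
Lemma window_uniform : exists K, 0 < K /\ forall eps T, 0 < eps -> exists t, T <= t /\
  forall x y, Rabs (x - t) <= hw0 / 2 -> Rabs y <= 2 * rho + 1 -> u x y <= K * (eps * exp (beta * t)).
Proof.
  assert (l4 : 0 < ln 4) by (rewrite <- ln_1; apply ln_increasing; lra).
  destruct (level_widths (fun t => ln (ln (M t))) (ln 4) I l4 psi_pos psi_dec psi_cont psi_int)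
    as (lam & B & Lp & Ld & Lpsi & LB).
  (* The bands of half-width [c0] about [y = rho] and [y = - rho] stay disjoint and inside
     [|y| <= 2 * rho + 1]. *)
  set (c0 := Rmin (rho / 2) 1).
  assert (c0p : 0 < c0) by (unfold c0; apply Rmin_case; lra).
  assert (c0r : c0 <= rho / 2) by apply Rmin_l. assert (c01 : c0 <= 1) by apply Rmin_r.
  destruct (psum_tail lam B (fun j => Rlt_le _ _ (Lp j)) LB (Rmin (hw0 / 8) c0)) as [k0 Hk0].
  { apply Rmin_case; lra. }
  assert (tl : forall k, (k0 <= k)%nat -> psum lam k - psum lam k0 <= hw0 / 8).
  { intros k Hk. eapply Rle_trans; [apply Hk0; auto|apply Rmin_l]. }
  assert (mono : forall k, (k0 <= k)%nat -> psum lam k0 <= psum lam k).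
  { intros k Hk. induction Hk as [|k Hk IH]; [lra|]. simpl. specialize (Lp k). lra. }
  assert (lc : forall j, (k0 <= j)%nat -> lam j <= c0).
  { intros j Hj. pose proof (Hk0 (S j) ltac:(lia)) as Q. simpl in Q. specialize (mono j Hj).
    pose proof (Rmin_r (hw0 / 8) c0). lra. }
  set (K := 4 ^ (k0 + 2) + ln (M c0)).
  assert (P4 : 0 < 4 ^ (k0 + 2)) by (apply pow_lt; lra).
  pose proof (lnM1 c0 c0p) as LMc.
  exists K. split; [unfold K; lra|]. intros eps T He. destruct (P2 eps T He) as (t & Ht & W). exists t. split; auto.
  set (m := eps * exp (beta * t)) in *.
  assert (m0 : 0 < m) by (apply Rmult_lt_0_compat; [auto|apply exp_pos]).
  intros x y Hx Hy.
  assert (Far : c0 <= Rabs (Rabs y - rho) -> u x y <= K * m).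
  { intros Hfar. assert (Ny : Rabs y <> rho) by (intros E; rewrite E, Rminus_diag, Rabs_R0 in Hfar; lra).
    eapply Rle_trans; [apply W; auto; lra|]. rewrite (Rmult_comm K). apply Rmult_le_compat_l; [lra|].
    unfold K. specialize (lnMdec c0 _ c0p Hfar). lra. }
  assert (Near : forall y0, y0 = rho \/ y0 = - rho -> Rabs (y - y0) <= c0 -> u x y <= K * m).
  { intros y0 Hy0 Hn.
    assert (D : forall z, Rabs (z - y0) <= c0 -> Rabs (Rabs z - rho) = Rabs (z - y0) /\ Rabs z <= 2 * rho + 1).
    { intros z Hz. apply Rabs_le_between in Hz. destruct Hy0 as [-> | ->].
      - rewrite (Rabs_right z) by lra. split; [auto|lra].
      - rewrite (Rabs_left z) by lra. split; [|lra]. rewrite <- Rabs_Ropp. f_equal. ring. }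
    assert (LL : / m * u x y <= 4 ^ (k0 + 2)).
    (* With [psi = log log M], [exp psi] is the factor [log M] of [P2]; division by [m] removes the
       size of the window bound. *)
    { apply (loglog_bound (fun x y => / m * u x y) (fun t => ln (ln (M t))) lam k0 t y0 hw0 c0); auto; try lra.
      - intros a b. apply continuity_2d_pt_mult; [apply continuity_2d_pt_const|apply Cu].
      - apply subh_scal; [left; apply Rinv_0_lt_compat; auto|].
        apply (subh_weaken u (fun x y => Rabs x <= (Rabs t + hw0 + 2 * rho + 1) /\ Rabs y <= Rabs t + hw0 + 2 * rho + 1)); [|apply Su].
        intros a b [Ha Hb]. destruct (D b Hb) as [_ D2]. pose proof (Rabs_pos t).
        assert (Rabs a <= Rabs t + hw0). { replace a with (t + (a - t)) by ring. eapply Rle_trans; [apply Rabs_triang|lra]. }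
        lra.
      - intros a b Ha [Hb0 Hb]. destruct (D b Hb) as [D1 D2].
        assert (Nb : Rabs b <> rho) by (intros E; rewrite E, Rminus_diag, Rabs_R0 in D1; lra).
        specialize (W a b Ha D2 Nb). rewrite D1 in W.
        rewrite exp_ln by (specialize (lnM1 (Rabs (b - y0)) Hb0); lra).
        apply Rmult_le_reg_l with m; auto. rewrite <- Rmult_assoc, Rinv_r, Rmult_1_l by lra. exact W. }
    apply (Rmult_le_compat_l m) in LL; [|lra]. rewrite <- Rmult_assoc, Rinv_r, Rmult_1_l in LL by lra.
    eapply Rle_trans; [exact LL|]. rewrite Rmult_comm. apply Rmult_le_compat_r; [lra|]. unfold K. lra. }
  destruct (Rle_lt_dec c0 (Rabs (Rabs y - rho))) as [G|G]; [auto|].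
  apply Rabs_lt_between in G.
  destruct (Rle_lt_dec 0 y) as [S|S].
  - rewrite Rabs_right in G by lra. apply (Near rho); auto. apply Rabs_le; lra.
  - rewrite Rabs_left in G by lra. apply (Near (- rho)); auto. apply Rabs_le; lra.
Qed.

(** On [|y| <= 2 * rho + 1] one has [|kq y| <= 1], hence [cos (kq y) >= 1 / 2]; since [kap < kq],
    the function [exp (kap x) * cos (kq y)] is strictly superharmonic there. *)
Let kq := / (2 * rho + 1).
Let kap := kq / 4.

Let kq0 : 0 < kq.
Proof. unfold kq. apply Rinv_0_lt_compat; lra. Qed.

Let kqy y : Rabs y <= 2 * rho + 1 -> 1 / 2 <= cos (kq * y).
Proof.
  intros Hy. apply cos_ge_half_small. apply Rabs_le_between. rewrite Rabs_mult, (Rabs_right kq) by lra.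
  apply Rle_trans with (kq * (2 * rho + 1)); [apply Rmult_le_compat_l; lra|]. right. unfold kq. apply Rinv_l. lra.
Qed.

Lemma exp_cos_cont2 k l : cont2 (fun x y => exp (k * x) * cos (l * y)).
Proof.
  apply cont2_mul.
  - apply (cont2_1d (fun x => exp (k * x)) (fun x _ => x)); [|apply cont2_fst].
    intros; apply (ex_derive_continuous (V := R_NormedModule)); auto_derive; auto.
  - apply (cont2_1d (fun y => cos (l * y)) (fun _ y => y)); [|apply cont2_snd].
    intros; apply (ex_derive_continuous (V := R_NormedModule)); auto_derive; auto.
Qed.

Lemma exp_cos_Lap_const k l x y :
  Lap (fun x y => exp (k * x) * cos (l * y)) x y (k ^ 2 * (exp (k * x) * cos (l * y)) + - (l ^ 2 * (exp (k * x) * cos (l * y)))).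
Proof.
  apply (Lap_intro _ (fun u => k * (exp (k * u) * cos (l * y))) (fun v => - (l * (exp (k * x) * sin (l * v))))).
  - apply filter_forall. intros. auto_derive; auto. ring.
  - auto_derive; auto. ring.
  - apply filter_forall. intros. auto_derive; auto. ring.
  - auto_derive; auto. ring.
Qed.

(** The comparison function is [eps K3 exp (a x) cos (b x y) + C4 exp (kap x) cos (kq y)]. Its
    second term dominates [u] on the curved sides and at the left end; at the right end, inside a
    window of [window_uniform], the first term takes what the second leaves. Then [eps] tends to 0
    with [x] fixed. *)
Lemma exp_growth : exists C, 0 < C /\ forall x y, 0 <= x -> Rabs y <= 2 * rho + 1 -> u x y <= C * exp (kap * x).
Proof.
  assert (kap0 : 0 < kap) by (unfold kap; lra).
  pose proof PI_RGT_0 as Hpi.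
  destruct (level_widths (fun t => ln (ln (M t))) kap I kap0 psi_pos psi_dec psi_cont psi_int)
    as (lam & B & Lp & Ld & Lpsi & LB).
  assert (ldec : forall j i, (j <= i)%nat -> lam i <= lam j).
  { intros j i Hji. induction Hji as [|i Hji IH]; [lra|]. specialize (Ld i). lra. }
  (* Dropping the first [j0] levels makes the remaining widths at most [rho / 32], so that the
     frequency stays above [7 / 8 * beta]; the price is the starting point [x0 = j0]. *)
  destruct (psum_tail lam B (fun j => Rlt_le _ _ (Lp j)) LB (rho / 32) ltac:(lra)) as [j0 Hj0].
  set (L := fun j => lam (j0 + j)%nat).
  assert (Lpos : forall j, 0 < L j) by (intros; apply Lp).
  assert (Ldec : forall j, L (S j) <= L j) by (intros; unfold L; apply ldec; lia).
  assert (L0 : L O <= rho / 32).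
  { pose proof (Hj0 (S j0) ltac:(lia)) as Q. simpl in Q. unfold L. rewrite Nat.add_0_r. lra. }
  assert (Lle : forall j, L j <= rho / 32).
  { intros j. eapply Rle_trans; [|exact L0]. unfold L. apply ldec. lia. }
  assert (LS : forall n, psum L n <= B).
  { intros n. assert (E : psum lam (j0 + n) = psum lam j0 + psum L n).
    { induction n as [|n IH]; [rewrite Nat.add_0_r; simpl; ring|]. rewrite Nat.add_succ_r. simpl. rewrite IH. unfold L. ring. }
    specialize (LB (j0 + n)%nat). rewrite E in LB.
    assert (0 <= psum lam j0) by (apply psum_ge0; intros; left; auto). lra. }
  set (x0 := INR j0). assert (x00 : 0 <= x0) by apply pos_INR.
  (* Chosen so that the width [s x] below is at least [L j] on the [j]-th unit interval. *)
  set (c := 4 * beta / rho). assert (Hc : 0 < c) by (apply Rdiv_lt_0_compat; lra).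
  assert (Lsmall : c * L O <= beta / 8).
  { apply Rle_trans with (c * (rho / 32)); [apply Rmult_le_compat_l; lra|]. unfold c. right. field. lra. }
  assert (LM : forall j s x, x0 + INR j <= x -> L j <= s -> ln (M s) <= exp (kap * (x + 1))).
  { intros j s x Hx Hs. specialize (Lpos j). 
    assert (X : ln (ln (M s)) <= kap * (x + 1)).
    { eapply Rle_trans; [apply (Lpsi (j0 + j)%nat); exact Hs|]. rewrite plus_INR. apply Rmult_le_compat_l; [lra|]. unfold x0 in Hx. lra. }
    specialize (lnM1 s ltac:(lra)). rewrite <- (exp_ln (ln (M s))) by lra. apply exp_le; auto. }
  set (D1 := C1 * ((3 + / kap) + exp (2 * kap))).
  assert (ik : 0 < / kap) by (apply Rinv_0_lt_compat; auto).
  assert (D1p : 0 < D1) by (apply Rmult_lt_0_compat; auto; pose proof (exp_pos (2 * kap)); lra).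
  (* A bound at distance at least [L j] outside the strip. The slack in [x + 1] serves the points of
     a window about [t] that lie left of [t]. *)
  assert (Out : forall j x y s, 0 <= x -> x0 + INR j <= x + 1 -> L j <= s -> s = Rabs y - rho -> Rabs y <= 2 * rho + 1 ->
     u x y <= D1 * exp (kap * x)).
  { intros j x y s Hx Hj Hs Es Hy. specialize (Lpos j).
    eapply Rle_trans; [apply P1; auto; lra|]. rewrite <- Es. unfold D1. rewrite Rmult_assoc. apply Rmult_le_compat_l; [lra|].
    pose proof (log_le_exp 2 kap kap0 ltac:(lra) x Hx) as G. pose proof (LM j s (x + 1) Hj Hs) as G2.
    replace (kap * (x + 1 + 1)) with (2 * kap + kap * x) in G2 by ring. rewrite exp_plus in G2.
    pose proof (exp_pos (kap * x)). lra. }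
  destruct (cont_bounded u 0 x0 (- (2 * rho + 1)) (2 * rho + 1) (fun x y _ _ => Cu x y)) as (C0 & C00 & HC0).
  destruct window_uniform as (K2 & K20 & HW).
  set (q := hw0 / 2). assert (q0 : 0 < q <= 1/2) by (unfold q; lra).
  set (C5 := 2 * (2 * rho) / (q * q) + 1 / rho).
  assert (C50 : 0 < C5).
  { unfold C5. assert (0 < 2 * (2 * rho) / (q * q)) by (apply Rdiv_lt_0_compat; nra).
    assert (0 < 1 / rho) by (apply Rdiv_lt_0_compat; lra). lra. }
  set (D2 := D1 * exp (kap * 1)).
  assert (D2p : D1 <= D2).
  { unfold D2. rewrite <- (Rmult_1_r D1) at 1. apply Rmult_le_compat_l; [lra|]. apply exp_ge1. nra. }
  set (C4 := 2 * (D2 + C0)).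
  (* The factors are the window bound, the slope of the boundary layer, the passage from distance to
     cosine, and the loss [beta x - a x <= 9 + c B]. *)
  set (K3 := K2 * C5 * (8 / beta) * exp (9 + c * B)).
  assert (K30 : 0 < K3).
  { unfold K3. apply Rmult_lt_0_compat; [|apply exp_pos]. apply Rmult_lt_0_compat; [apply Rmult_lt_0_compat; auto|]. apply Rdiv_lt_0_compat; lra. }
  assert (Main : forall eps x y, 0 < eps -> x0 <= x -> Rabs y <= 2 * rho + 1 -> 
     u x y <= eps * K3 * exp (beta * x) + C4 * exp (kap * x)).
  { intros eps x y He Hx Hy.
    destruct (HW eps (x + 1) He) as (t & Ht & W'). fold q in W'.
    (* The [n] unit intervals cover [[x0, t]]; the constants fixed so far do not depend on [n]. *)
    destruct (nfloor_ex (t - x0) ltac:(lra)) as [jt Hjt].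
    set (n := S jt). assert (Hn : (0 < n)%nat) by (unfold n; lia).
    set (b := cmp_b beta c x0 L n). set (a := cmp_a beta c x0 L n).
    assert (bR : forall z, 7 / 8 * beta <= b z <= beta) by (intros; apply cmp_b_range; auto).
    (* With this factor [b (rho + s) <= PI / 2], so the cosine is nonnegative up to the curved
       side. *)
    set (s := fun z => rho / (2 * beta) * (beta - b z)).
    assert (rb : 0 < rho / (2 * beta)) by (apply Rdiv_lt_0_compat; lra).
    assert (sR : forall z, 0 <= s z <= rho / 16).
    { intros z. specialize (bR z). unfold s. split; [apply Rmult_le_pos; lra|].
      apply Rle_trans with (rho / (2 * beta) * (beta / 8)); [apply Rmult_le_compat_l; lra|]. right. field. lra. }
    assert (sig : forall j z, (j < n)%nat -> z <= x0 + INR j + 1 -> 2 * beta / rho * L j <= beta - b z).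
    { intros j z Hj Hz. eapply Rle_trans; [|apply (cmp_b_gap beta c x0 L n) with (j := j); auto].
      right. unfold c. field. lra. }
    assert (fl : forall z, x0 <= z <= t -> exists j, (j < n)%nat /\ x0 + INR j <= z /\ L j <= s z).
    { intros z Hz. destruct (nfloor_ex (z - x0) ltac:(lra)) as [j Hj]. exists j.
      assert (Hjn : (j < n)%nat). { unfold n. apply INR_lt. rewrite S_INR. lra. }
      split; auto. split; [lra|]. specialize (sig j z Hjn ltac:(lra)).
      unfold s. apply (Rmult_le_compat_l (rho / (2 * beta))) in sig; [|lra].
      replace (rho / (2 * beta) * (2 * beta / rho * L j)) with (L j) in sig by (field; lra). exact sig. }
    assert (C4h : D2 + C0 = C4 / 2) by (unfold C4; field).
    assert (eK : 0 < eps * K3) by (apply Rmult_lt_0_compat; auto).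
    assert (Ep : forall z, 0 < exp z) by apply exp_pos.
    destruct (Rlt_le_dec (rho + s x) (Rabs y)) as [Far|Near].
    { destruct (fl x ltac:(lra)) as (j & _ & Hj1 & Hj2).
      pose proof (Out j x y (Rabs y - rho) ltac:(lra) ltac:(lra) ltac:(lra) eq_refl Hy).
      assert (D1 * exp (kap * x) <= C4 * exp (kap * x)) by (apply Rmult_le_compat_r; [left; auto|lra]).
      assert (0 < eps * K3 * exp (beta * x)) by (apply Rmult_lt_0_compat; auto). lra. }
    set (W := fun x y => eps * K3 * (exp (a x) * cos (b x * y)) + C4 * (exp (kap * x) * cos (kq * y))).
    assert (sc : forall z, continuous s z).
    { intros z. apply (ex_derive_continuous (V := R_NormedModule)). unfold s.
      assert (ex_derive b z) by (eexists; apply cmp_b_derive). auto_derive. auto. }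
    assert (bw : forall z w, Rabs w <= rho + s z -> b z * Rabs w <= PI / 2).
    { intros z w Hw. specialize (bR z).
      apply Rle_trans with (b z * (rho + s z)); [apply Rmult_le_compat_l; lra|].
      rewrite <- beta_rho. unfold s. set (g := beta - b z). replace (b z) with (beta - g) by (unfold g; ring).
      replace ((beta - g) * (rho + rho / (2 * beta) * g)) with (beta * rho - (rho * g / 2 + rho / (2 * beta) * (g * g))) by (field; lra).
      assert (g0 : 0 <= g) by (unfold g; lra).
      assert (0 <= rho * g) by (apply Rmult_le_pos; lra).
      assert (0 <= rho / (2 * beta) * (g * g)) by (apply Rmult_le_pos; nra). lra. }
    assert (cosb : forall z w, Rabs w <= rho + s z -> 0 <= cos (b z * w)).
    { intros z w Hw. specialize (bw z w Hw). specialize (bR z).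
      assert (Q : - (PI / 2) <= b z * w <= PI / 2) by (apply Rabs_le_between; rewrite Rabs_mult, (Rabs_right (b z)) by lra; auto).
      apply cos_ge_0; lra. }
    assert (MP : u x y <= W x y).
    { apply (max_principle (fun x y => Rabs y - rho - s x) u W x0 t (- (2 * rho)) (2 * rho)); try lra.
      - intros; apply Cu.
      - intros z w _ _. apply cont2_add.
        + apply (cont2_mul (fun _ _ => eps * K3)); [apply cont2_const|]. apply cmp_cont2; auto.
        + apply (cont2_mul (fun _ _ => C4)); [apply cont2_const|apply exp_cos_cont2].
      - intros z w _ _. apply (cont2_sub (fun x y => Rabs y - rho) (fun x _ => s x)).
        + apply (cont2_sub (fun _ y => Rabs y) (fun _ _ => rho)); [|apply cont2_const].
          apply (cont2_1d Rabs (fun _ y => y)); [|apply cont2_snd]. intros v. apply continuous_Rabs.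
        + apply (cont2_1d s (fun x _ => x)); [auto|apply cont2_fst].
      - apply (subh_weaken u (fun x y => Rabs x <= t + 2 * rho /\ Rabs y <= t + 2 * rho)); [|apply Su].
        intros z w (Hz & Hw & _). split; apply Rabs_le; lra.
      - intros z w Hz Hw Hk. assert (Hw' : Rabs w <= rho + s z) by lra.
        destruct (cmp_superharmonic beta c x0 L n beta0 Hc Lpos Ldec Lsmall Hn z w (bw z w Hw')) as (l & l0 & Hl).
        exists (eps * K3 * l + C4 * (kap ^ 2 * (exp (kap * z) * cos (kq * w)) + - (kq ^ 2 * (exp (kap * z) * cos (kq * w))))).
        split.
        + assert (eps * K3 * l <= 0) by nra.
          assert (e1 : 0 < exp (kap * z) * cos (kq * w)).
          { apply Rmult_lt_0_compat; auto. specialize (sR z). pose proof (kqy w ltac:(lra)). lra. }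
          assert (e2 : 0 < kq ^ 2 - kap ^ 2) by (unfold kap; assert (0 < kq ^ 2) by (apply pow_lt; auto); lra).
          assert (0 < C4 * ((kq ^ 2 - kap ^ 2) * (exp (kap * z) * cos (kq * w)))) by (apply Rmult_lt_0_compat; [lra|apply Rmult_lt_0_compat; auto]).
          lra.
        + apply (Lap_plus (fun x y => eps * K3 * (exp (a x) * cos (b x * y))) (fun x y => C4 * (exp (kap * x) * cos (kq * y)))).
          * apply (Lap_scal (fun x y => exp (a x) * cos (b x * y))). exact Hl.
          * apply (Lap_scal (fun x y => exp (kap * x) * cos (kq * y))). apply exp_cos_Lap_const.
      - intros z w Hz Hw Hk HB. cbv beta in HB, Hk.
        assert (Hw' : Rabs w <= rho + s z) by lra. specialize (sR z).
        assert (z0 : 0 <= z) by lra.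
        assert (F1 : 0 <= eps * K3 * (exp (a z) * cos (b z * w))).
        { apply Rmult_le_pos; [lra|]. apply Rmult_le_pos; [left; auto|auto]. }
        assert (F2 : (D2 + C0) * exp (kap * z) <= C4 * (exp (kap * z) * cos (kq * w))).
        { rewrite C4h. replace (C4 / 2 * exp (kap * z)) with (C4 * (exp (kap * z) * (1 / 2))) by field.
          apply Rmult_le_compat_l; [lra|]. apply Rmult_le_compat_l; [left; auto|]. apply kqy. lra. }
        pose proof (exp_ge1 (kap * z) ltac:(apply Rmult_le_pos; lra)) as E1.
        assert (F3 : D2 * exp (kap * z) + C0 <= (D2 + C0) * exp (kap * z)) by nra.
        assert (F4 : D1 * exp (kap * z) <= D2 * exp (kap * z)) by (apply Rmult_le_compat_r; lra).
        assert (Wz : D2 * exp (kap * z) <= W z w) by (unfold W; lra).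
        destruct HB as [Ez|[Ez|[Ew|[Ew|Ek]]]].
        + assert (Q : u z w <= C0).
          { subst z. apply Rabs_le_between in Hw'. specialize (HC0 x0 w ltac:(lra) ltac:(lra)). apply Rabs_le_between in HC0. lra. }
          unfold W. assert (0 < D2 * exp (kap * z)) by (apply Rmult_lt_0_compat; [lra|auto]). lra.
        (* At the right end the cosine may vanish linearly towards the curved side, so the constant
           bound of the window does not suffice; the barrier with top [|y| = rho + sb] improves it
           to a linear one. *)
        + subst z. set (sb := L jt). assert (sb0 : 0 < sb) by apply Lpos. pose proof (Lle jt) as sb1. fold sb in sb1.
          destruct (Rle_lt_dec (rho + sb) (Rabs w)) as [G|G].
          { pose proof (Out jt t w (Rabs w - rho) ltac:(lra) ltac:(lra) ltac:(fold sb; lra) eq_refl ltac:(lra)). lra. }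
          set (A := K2 * (eps * exp (beta * t))).
          assert (A0 : 0 < A) by (unfold A; apply Rmult_lt_0_compat; auto; apply Rmult_lt_0_compat; auto).
          set (Y := rho + sb).
          assert (BL : u t w <= D2 * exp (kap * t) + A * (2 * Y / (q * q) + 1 / Y) * (Y - Rabs w)).
          { assert (Edge : forall x' y', Rabs (x' - t) <= q -> Rabs y' = Y -> u x' y' <= D2 * exp (kap * t)).
            { intros x' y' Hx' Hy'. apply Rabs_le_between in Hx'.
              eapply Rle_trans; [apply (Out jt x' y' sb); unfold Y in *; first [lra | apply Rle_refl]|].
              unfold D2. rewrite Rmult_assoc, <- exp_plus. apply Rmult_le_compat_l; [lra|]. apply exp_le. nra. }
            assert (D20 : 0 <= D2 * exp (kap * t)) by (apply Rmult_le_pos; [lra|left; auto]).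
            assert (Sub : subh u (fun x y => Rabs x <= t + 1 + 2 * rho /\ Rabs y <= t + 1 + 2 * rho)) by apply Su.
            destruct (Rle_lt_dec 0 w) as [Sg|Sg].
            - rewrite (Rabs_right w) in * by lra.
              apply (boundary_layer u t q Y A (D2 * exp (kap * t))); auto; try (unfold Y; lra).
              + revert Sub. apply subh_weaken. intros x' y' [H1 H2]. apply Rabs_le_between in H1. unfold Y in H2. split; apply Rabs_le; lra.
              + intros x' y' H1 H2. apply W'; auto. apply Rabs_le. unfold Y in H2. lra.
              + intros x' H1. apply Edge; auto. apply Rabs_right. unfold Y; lra.
            - rewrite (Rabs_left w) in * by lra.
              replace (u t w) with (u t (- - w)) by (f_equal; ring).
              apply (boundary_layer (fun x y => u x (- y)) t q Y A (D2 * exp (kap * t))); auto; try (unfold Y; lra).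
              + apply (cont2_comp2 u (fun x _ => x) (fun _ y => - y)); auto; [apply cont2_fst|].
                intros p1 p2. apply continuity_2d_pt_opp, continuity_2d_pt_id2.
              + apply subh_reflect in Sub. revert Sub. apply subh_weaken. intros x' y' [H1 H2]. apply Rabs_le_between in H1. unfold Y in H2. split; apply Rabs_le; lra.
              + intros x' y' H1 H2. apply W'; auto. apply Rabs_le. unfold Y in H2. lra.
              + intros x' H1. apply Edge; auto. rewrite Rabs_Ropp. apply Rabs_right. unfold Y; lra. }
          assert (C5b : 2 * Y / (q * q) + 1 / Y <= C5).
          { unfold C5, Y. apply Rplus_le_compat.
            - apply Rmult_le_compat_r; [left; apply Rinv_0_lt_compat; nra|lra].
            - apply Rmult_le_compat_l; [lra|]. apply Rinv_le_contravar; lra. }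
          set (g := beta - b t). assert (gb : 2 * beta / rho * sb <= g) by (apply sig; [unfold n; lia|lra]).
          assert (gb' : beta * sb <= g * (rho / 2)).
          { apply (Rmult_le_compat_r (rho / 2)) in gb; [|lra]. replace (2 * beta / rho * sb * (rho / 2)) with (beta * sb) in gb by (field; lra). exact gb. }
          assert (g0 : 0 <= g) by (specialize (bR t); unfold g; lra).
          pose proof (bw t w Hw') as bwt. pose proof (Rabs_pos w) as w0.
          assert (Cw : (PI / 2 - b t * Rabs w) / 2 <= cos (b t * w)).
          { assert (Ec : cos (b t * w) = sin (PI / 2 - b t * Rabs w)).
            { rewrite sin_shift. unfold Rabs. destruct Rcase_abs; [|reflexivity]. rewrite <- cos_neg. f_equal. ring. }
            rewrite Ec. apply sin_ge_half. specialize (bR t). split; [lra|]. assert (0 <= b t * Rabs w) by (apply Rmult_le_pos; lra). lra. }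
          assert (Id : PI / 2 - b t * Rabs w = beta * (rho - Rabs w) + g * Rabs w) by (rewrite <- beta_rho; unfold g; ring).
          (* For small [|w|] the term [beta (rho - |w|)] dominates the distance; otherwise the
             frequency gap [g], which exceeds a multiple of [sb], does. *)
          assert (Yw : Y - Rabs w <= 4 / beta * (PI / 2 - b t * Rabs w)).
          { rewrite Id. apply Rmult_le_reg_l with beta; auto.
            replace (beta * (4 / beta * (beta * (rho - Rabs w) + g * Rabs w))) with (4 * (beta * (rho - Rabs w) + g * Rabs w)) by (field; lra).
            unfold Y in *. assert (gw : 0 <= g * Rabs w) by (apply Rmult_le_pos; auto).
            destruct (Rle_lt_dec (Rabs w) (rho / 2)) as [Sm|Lg].
            - assert (beta * sb <= beta * rho) by (apply Rmult_le_compat_l; lra).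
              assert (beta * (rho / 2) <= beta * (rho - Rabs w)) by (apply Rmult_le_compat_l; lra).
              assert (0 <= beta * Rabs w) by (apply Rmult_le_pos; lra). lra.
            - assert (g * (rho / 2) <= g * Rabs w) by (apply Rmult_le_compat_l; lra).
              assert (0 <= beta * (rho + sb - Rabs w)) by (apply Rmult_le_pos; lra). lra. }
          assert (Fin : A * (2 * Y / (q * q) + 1 / Y) * (Y - Rabs w) <= eps * K3 * (exp (a t) * cos (b t * w))).
          { apply Rle_trans with (A * C5 * (8 / beta * cos (b t * w))).
            - apply Rmult_le_compat.
              + apply Rmult_le_pos; [lra|]. unfold Y.
                assert (0 < 2 * (rho + sb) / (q * q)) by (apply Rdiv_lt_0_compat; nra).
                assert (0 < 1 / (rho + sb)) by (apply Rdiv_lt_0_compat; lra). lra.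
              + unfold Y; lra.
              + apply Rmult_le_compat_l; lra.
              + eapply Rle_trans; [exact Yw|]. replace (8 / beta * cos (b t * w)) with (4 / beta * (2 * cos (b t * w))) by (field; lra).
                apply Rmult_le_compat_l; [left; apply Rdiv_lt_0_compat; lra|lra].
            - replace (A * C5 * (8 / beta * cos (b t * w))) with (eps * (K2 * C5 * (8 / beta)) * (exp (beta * t) * cos (b t * w))) by (unfold A; ring).
              unfold K3. replace (eps * (K2 * C5 * (8 / beta) * exp (9 + c * B)) * (exp (a t) * cos (b t * w))) with
                (eps * (K2 * C5 * (8 / beta)) * (exp (9 + c * B) * exp (a t) * cos (b t * w))) by ring.
              apply Rmult_le_compat_l.
              + apply Rmult_le_pos; [lra|]. apply Rmult_le_pos; [apply Rmult_le_pos; lra|]. left; apply Rdiv_lt_0_compat; lra.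
              + apply Rmult_le_compat_r; [auto|]. rewrite <- exp_plus. apply exp_le.
                pose proof (cmp_a_lower beta c x0 L n beta0 Hc Lpos Ldec Lsmall Hn t) as AL. fold a in AL.
                assert (c * psum L n <= c * B) by (apply Rmult_le_compat_l; [lra|auto]). lra. }
          unfold W. lra.
        + subst w. rewrite Rabs_Ropp, Rabs_right in Hw'; lra.
        + subst w. rewrite Rabs_right in Hw'; lra.
        + destruct (fl z ltac:(lra)) as (j & _ & Hj1 & Hj2).
          pose proof (Out j z w (s z) ltac:(lra) ltac:(lra) Hj2 ltac:(lra) ltac:(lra)). lra.
      - apply Rabs_le_between. specialize (sR x). lra. }
    eapply Rle_trans; [exact MP|]. unfold W. specialize (sR x).
    assert (V1 : exp (a x) * cos (b x * y) <= exp (beta * x)).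
    { pose proof (cmp_a_upper beta c x0 L n beta0 Hc Lpos Ldec Lsmall Hn x Hx) as AU. fold a in AU.
      apply exp_le in AU. pose proof (COS_bound (b x * y)). pose proof (Ep (a x)). nra. }
    assert (V2 : exp (kap * x) * cos (kq * y) <= exp (kap * x)).
    { pose proof (COS_bound (kq * y)). pose proof (Ep (kap * x)). nra. }
    apply (Rmult_le_compat_l (eps * K3)) in V1; [|lra]. apply (Rmult_le_compat_l C4) in V2; [|lra]. lra. }
  exists C4. split; [unfold C4; lra|]. intros x y Hx Hy.
  destruct (Rle_lt_dec x0 x) as [G|G].
  (* [x] is fixed, and [eps] is chosen so that the first term becomes [e]. *)
  - apply le_epsilon. intros e He.
    assert (Q : 0 < K3 * exp (beta * x)) by (apply Rmult_lt_0_compat; [auto|apply exp_pos]).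
    pose proof (Main (e / (K3 * exp (beta * x))) x y ltac:(apply Rdiv_lt_0_compat; auto) G Hy) as F.
    replace (e / (K3 * exp (beta * x)) * K3 * exp (beta * x)) with e in F by (field; split; [apply Rgt_not_eq, exp_pos|lra]). lra.
  - apply Rabs_le_between in Hy. specialize (HC0 x y ltac:(lra) ltac:(lra)). apply Rabs_le_between in HC0.
    pose proof (exp_ge1 (kap * x) ltac:(apply Rmult_le_pos; lra)). unfold C4. nra.
Qed.
End PL.

(** * From exponential to logarithmic growth *)

(** The gauge [d exp (kq x / 2) cos (kq y)] has an exponent between the growth rate [kq / 4] and the
    frequency [kq]. The function [ln (2 + x)] is itself superharmonic, hence admissible as part of
    the bound. *)
Lemma log_growth rho u C A : 0 < rho -> 0 < C -> 0 < A -> cont2 u ->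
  (forall X, subh u (fun x y => Rabs x <= X /\ Rabs y <= X)) ->
  (forall x y, 0 <= x -> Rabs y <= 2 * rho + 1 -> u x y <= C * exp (/ (2 * rho + 1) / 4 * x)) ->
  (forall x y, 0 <= x -> Rabs y = rho + 1 -> u x y <= A * (1 + ln (2 + x))) ->
  exists K, 0 < K /\ forall x y, 0 <= x -> Rabs y <= rho + 1 -> u x y <= K * (1 + ln (2 + x)).
Proof.
  intros Hrho HC HA Cu Su G E. set (kq := / (2 * rho + 1)) in *.
  assert (kq0 : 0 < kq) by (apply Rinv_0_lt_compat; lra).
  assert (kqy : forall y, Rabs y <= rho + 1 -> 1 / 2 <= cos (kq * y)).
  { intros y Hy. apply cos_ge_half_small. apply Rabs_le_between. rewrite Rabs_mult, (Rabs_right kq) by lra.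
    apply Rle_trans with (kq * (2 * rho + 1)); [apply Rmult_le_compat_l; lra|]. right. unfold kq. apply Rinv_l. lra. }
  destruct (cont_bounded u 0 0 (- (rho + 1)) (rho + 1) (fun x y _ _ => Cu x y)) as (C0 & C00 & HC0).
  assert (lp : forall x, 0 <= x -> 0 <= ln (2 + x)).
  { intros x Hx. rewrite <- ln_1. apply ln_le; lra. }
  exists (A + C0). split; [lra|]. intros x y Hx Hy. apply le_epsilon. intros e He.
  set (d := e / exp (kq / 2 * x)).
  assert (d0 : 0 < d) by (apply Rdiv_lt_0_compat; [auto|apply exp_pos]).
  (* Far enough to the right for the gauge, with the cosine replaced by [1 / 2], to exceed the
     growth bound. *)
  assert (Rt : exists X, x < X /\ C * exp (kq / 4 * X) <= d / 2 * exp (kq / 2 * X)).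
  { set (X := x + 1 + 4 / kq * (2 * C / d)). exists X.
    assert (p1 : 0 < 2 * C / d) by (apply Rdiv_lt_0_compat; lra).
    assert (p2 : 0 < 4 / kq * (2 * C / d)) by (apply Rmult_lt_0_compat; [apply Rdiv_lt_0_compat; lra|auto]).
    split; [unfold X; lra|].
    replace (kq / 2 * X) with (kq / 4 * X + kq / 4 * X) by field. rewrite exp_plus, <- Rmult_assoc.
    apply Rmult_le_compat_r; [left; apply exp_pos|].
    assert (Q : 2 * C / d <= kq / 4 * X).
    { unfold X. replace (2 * C / d) with (kq / 4 * (4 / kq * (2 * C / d))) at 1 by (field; lra). apply Rmult_le_compat_l; lra. }
    assert (Q2 : 2 * C / d <= exp (kq / 4 * X)).
    { pose proof (exp_ineq1 (kq / 4 * X) ltac:(lra)). lra. }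
    apply (Rmult_le_compat_l (d / 2)) in Q2; [|lra]. replace (d / 2 * (2 * C / d)) with C in Q2 by (field; lra). exact Q2. }
  destruct Rt as (X & HX & RX).
  set (W := fun x y => d * (exp (kq / 2 * x) * cos (kq * y)) + (A + C0) * (1 + ln (2 + x))).
  assert (MP : u x y <= W x y).
  { apply (max_principle (fun _ _ => -1) u W 0 X (- (rho + 1)) (rho + 1)); try lra.
    - intros; apply Cu.
    - intros z w Hz _. apply (continuity_2d_pt_plus (fun x y => d * (exp (kq / 2 * x) * cos (kq * y))) (fun x y => (A + C0) * (1 + ln (2 + x)))).
      + apply (cont2_mul (fun _ _ => d)); [apply cont2_const|apply exp_cos_cont2].
      + apply (continuity_1d_2d_pt_comp (fun t => (A + C0) * (1 + ln (2 + t))) (fun x _ => x)); [|apply continuity_2d_pt_id1].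
        apply continuity_pt_filterlim. apply (ex_derive_continuous (V := R_NormedModule) (fun t => (A + C0) * (1 + ln (2 + t)))). auto_derive. lra.
    - intros; apply cont2_const.
    - apply (subh_weaken u (fun x y => Rabs x <= X + (rho + 1) /\ Rabs y <= X + (rho + 1))); [|apply Su].
      intros z w (Hz & Hw & _). split; apply Rabs_le; lra.
    - intros z w Hz Hw _.
      exists (d * ((kq / 2) ^ 2 * (exp (kq / 2 * z) * cos (kq * w)) + - (kq ^ 2 * (exp (kq / 2 * z) * cos (kq * w)))) + (- ((A + C0) * / (2 + z) ^ 2) + 0)).
      split.
      + assert (e1 : 0 < exp (kq / 2 * z) * cos (kq * w)).
        { apply Rmult_lt_0_compat; [apply exp_pos|]. pose proof (kqy w ltac:(apply Rabs_le; lra)). lra. }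
        assert (e2 : 0 < 3 / 4 * kq ^ 2) by (assert (0 < kq ^ 2) by (apply pow_lt; auto); lra).
        assert (0 < d * (3 / 4 * kq ^ 2 * (exp (kq / 2 * z) * cos (kq * w)))) by (apply Rmult_lt_0_compat; auto; apply Rmult_lt_0_compat; auto).
        assert (0 < (A + C0) * / (2 + z) ^ 2) by (apply Rmult_lt_0_compat; [lra|apply Rinv_0_lt_compat, pow_lt; lra]).
        lra.
      + apply (Lap_plus (fun x y => d * (exp (kq / 2 * x) * cos (kq * y))) (fun x y => (A + C0) * (1 + ln (2 + x)))).
        * apply (Lap_scal (fun x y => exp (kq / 2 * x) * cos (kq * y))). apply exp_cos_Lap_const.
        * apply (Lap_intro _ (fun z => (A + C0) * / (2 + z)) (fun _ => 0)).
          -- assert (P : 0 < z) by lra. exists (mkposreal z P). intros v Hv. cbn in Hv. unfold ball in Hv; cbn in Hv; unfold AbsRing_ball, abs, minus, plus, opp in Hv; cbn in Hv.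
             apply Rabs_lt_between in Hv. auto_derive; [lra|]. field. lra.
          -- auto_derive; [lra|]. field. lra.
          -- apply filter_forall. intros. auto_derive; auto.
          -- auto_derive; auto.
    - intros z w Hz Hw _ HB. cbv beta in HB. unfold W.
      assert (Hw' : Rabs w <= rho + 1) by (apply Rabs_le; lra).
      pose proof (kqy w Hw') as cw. pose proof (lp z (proj1 Hz)) as lz.
      assert (e1 : d * exp (kq / 2 * z) * / 2 <= d * (exp (kq / 2 * z) * cos (kq * w))).
      { rewrite Rmult_assoc. apply Rmult_le_compat_l; [lra|]. apply Rmult_le_compat_l; [left; apply exp_pos|lra]. }
      assert (e2 : 0 < d * exp (kq / 2 * z)) by (apply Rmult_lt_0_compat; [auto|apply exp_pos]).
      assert (S : Rabs w = rho + 1 -> u z w <= d * (exp (kq / 2 * z) * cos (kq * w)) + (A + C0) * (1 + ln (2 + z))).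
      { intros Ew. specialize (E z w ltac:(lra) Ew). nra. }
      destruct HB as [Ez|[Ez|[Ew|[Ew|Ek]]]].
      + specialize (HC0 z w ltac:(lra) ltac:(lra)). apply Rabs_le_between in HC0. nra.
      + subst z. specialize (G X w ltac:(lra) ltac:(lra)). nra.
      + apply S. subst w. rewrite Rabs_Ropp. apply Rabs_right; lra.
      + apply S. subst w. apply Rabs_right; lra.
      + lra.
    - apply Rabs_le_between. auto. }
  eapply Rle_trans; [exact MP|]. unfold W.
  assert (d * (exp (kq / 2 * x) * cos (kq * y)) <= e).
  { replace e with (d * (exp (kq / 2 * x) * 1)) by (unfold d; field; apply Rgt_not_eq, exp_pos).
    apply Rmult_le_compat_l; [lra|]. apply Rmult_le_compat_l; [left; apply exp_pos|]. apply COS_bound. }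
  lra.
Qed.

Lemma log_eventually_exp a b c beta eps : 0 <= a -> 0 <= b -> 1 <= c -> 0 < beta -> 0 < eps ->
  exists T, 0 <= T /\ forall t, T <= t -> a + b * ln (c + t) <= eps * exp (beta * t).
Proof.
  intros Ha Hb Hc Hbeta He. set (k := beta / 2). assert (k0 : 0 < k) by (unfold k; lra).
  assert (ik : 0 < / k) by (apply Rinv_0_lt_compat; auto).
  set (Q := a + b * (c + / k)). assert (Q0 : 0 <= Q) by (unfold Q; assert (0 <= b * (c + / k)) by (apply Rmult_le_pos; lra); lra).
  assert (T0 : 0 <= / k * (Q / eps)) by (apply Rmult_le_pos; [lra|apply Rdiv_le_0_compat; auto]).
  exists (/ k * (Q / eps)). split; [auto|]. intros t Ht. assert (t0 : 0 <= t) by lra.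
  pose proof (log_le_exp c k k0 Hc t t0) as L.
  assert (kt : Q / eps <= k * t).
  { apply Rmult_le_reg_l with (/ k); auto. rewrite <- (Rmult_assoc (/ k) k), Rinv_l, Rmult_1_l by lra. auto. }
  pose proof (exp_ge1 (k * t) ltac:(apply Rmult_le_pos; lra)) as E1.
  assert (E2 : Q / eps <= exp (k * t)).
  { destruct (Req_EM_T (k * t) 0) as [Z|Z]; [lra|]. pose proof (exp_ineq1 (k * t) Z). lra. }
  replace (beta * t) with (k * t + k * t) by (unfold k; field). rewrite exp_plus.
  apply Rle_trans with (Q * exp (k * t)).
  - unfold Q. apply (Rmult_le_compat_l b) in L; auto.
    assert (a * 1 <= a * exp (k * t)) by (apply Rmult_le_compat_l; auto). lra.
  - rewrite <- Rmult_assoc. apply Rmult_le_compat_r; [lra|].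
    apply (Rmult_le_compat_l eps) in E2; [|lra]. replace (eps * (Q / eps)) with Q in E2 by (field; lra). exact E2.
Qed.

(** * Application to the segment means of [log |H|] in a half-strip *)

Section HalfStrip.
Variables (rho : R) (M : R -> R) (H : C -> C) (N : nat) (I : R).
Hypothesis Hrho : 0 < rho.
Hypothesis HM : forall t, 0 < t -> exp 1 < M t.
Hypothesis Mdec : forall s t, 0 < s -> s <= t -> M t <= M s.
Hypothesis psi_cont : forall t, 0 < t -> continuous (fun t => ln (ln (M t))) t.
Hypothesis psi_int : forall a b, 0 < a <= b -> RInt (fun t => ln (ln (M t))) a b <= I.
Hypothesis HH : forall z, cdiffble H z.
Hypothesis Hout : forall x y, rho < Rabs y -> Cmod (H (x, y)) <= (1 + Cmod (x, y)) ^ N * M (Rabs y - rho).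

(** What the right end needs from the given collection: for each [eps] a single [F], good at
    arbitrarily large [t]. The collection itself is not mentioned, so that the property can also be
    stated for functions reflected at the origin. *)
Definition multiplier_family : Prop :=
  forall eps, 0 < eps -> exists F B,
    (forall x y, Rabs y < rho -> cdiffble F (x, y)) /\
    (forall x y, Rabs y < rho -> Cmod (F (x, y)) <= B) /\
    (forall x y, Rabs y < rho -> Cmod (F (x, y) * H (x, y)) <= (1 + Cmod (x, y)) ^ N * M (rho - Rabs y)) /\
    forall T, exists t, T <= t /\ 0 < Cmod (F (t, 0)) /\ - ln (Cmod (F (t, 0))) <= eps * exp (PI / (2 * rho) * t).

Lemma avgH_half_strip : multiplier_family ->
  exists K, 0 < K /\ forall x y, 0 <= x -> Rabs y <= rho + 1 -> avgH rho H x y <= K * (1 + ln (2 + x)).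
Proof.
  intros HF. set (w := hw rho). assert (w0 : 0 < w) by (unfold w, hw; lra).
  pose proof PI_RGT_0 as Hpi.
  set (beta := PI / (2 * rho)). assert (beta0 : 0 < beta) by (apply Rdiv_lt_0_compat; lra).
  pose proof (pos_INR N) as N0.
  assert (lnM1 : forall t, 0 < t -> 1 < ln (M t)).
  { intros t Ht. rewrite <- (ln_exp 1). apply ln_increasing; [apply exp_pos|auto]. }
  assert (lp : forall x, 0 <= x -> 0 <= ln (2 + x)).
  { intros x Hx. rewrite <- ln_1. apply ln_le; lra. }
  (* For [|y| <= 2 * rho + 1] one has [1 + x + w + |y| <= (2 + x) * D], and the logarithm of the
     product splits. *)
  set (D := 2 + 2 * rho + w). assert (lD : 0 <= ln D) by (rewrite <- ln_1; apply ln_le; unfold D; lra).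
  set (C1 := 2 * w * (INR N + INR N * ln D + 1)).
  assert (ND : 0 <= INR N * ln D) by (apply Rmult_le_pos; auto).
  assert (C10 : 0 < C1) by (unfold C1; apply Rmult_lt_0_compat; lra).
  assert (P1 : forall x y, 0 <= x -> rho < Rabs y <= 2 * rho + 1 -> avgH rho H x y <= C1 * (ln (2 + x) + ln (M (Rabs y - rho)))).
  { intros x y Hx Hy. specialize (lp x Hx). specialize (lnM1 (Rabs y - rho) ltac:(lra)).
    eapply Rle_trans; [apply (avgH_outside rho M H N Hrho HM HH Hout x y ((2 + x) * D)); [lra|]|].
    - rewrite (Rabs_right x) by lra. fold w. unfold D. nra.
    - fold w. unfold C1. rewrite (Rmult_assoc (2 * w)). apply Rmult_le_compat_l; [lra|].
      rewrite ln_mult by (unfold D; lra). set (l1 := ln (2 + x)) in *. set (l2 := ln (M (Rabs y - rho))) in *.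
      assert (0 <= INR N * l2) by (apply Rmult_le_pos; lra). assert (0 <= INR N * ln D * l1) by (apply Rmult_le_pos; lra).
      assert (INR N * ln D * 1 <= INR N * ln D * l2) by (apply Rmult_le_compat_l; lra). lra. }
  set (K0 := 20 * exp (16 * PI) * rho).
  assert (K00 : 0 < K0) by (unfold K0; pose proof (exp_pos (16 * PI)); apply Rmult_lt_0_compat; lra).
  (* [exp_growth] takes windows of half-width at most 1. *)
  set (w1 := Rmin w 1). assert (w1w : w1 <= w) by apply Rmin_l. assert (w11 : w1 <= 1) by apply Rmin_r.
  assert (w10 : 0 < w1) by (apply Rmin_case; lra).
  set (c := 4 + 2 * rho + 2 * w).
  assert (P2 : forall eps T, 0 < eps -> exists t, T <= t /\ forall x y, Rabs (x - t) <= w1 -> Rabs y <= 2 * rho + 1 -> Rabs y <> rho ->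
    avgH rho H x y <= eps * exp (beta * t) * ln (M (Rabs (Rabs y - rho)))).
  { intros eps T He.
    (* A quarter of [eps] is spent on [- log |F t|], whose coefficient is [K0]; half of it absorbs
       constants and logarithms once [t] is large. *)
    destruct (HF (eps / (4 * K0)) ltac:(apply Rdiv_lt_0_compat; lra)) as (F & B & F1 & F2 & F3 & F4).
    set (B' := Rmax B 1). assert (B1 : 1 <= B') by apply Rmax_r.
    assert (lB : 0 <= ln B') by (rewrite <- ln_1; apply ln_le; lra).
    destruct (log_eventually_exp (K0 * ln B' + 2 * w) (2 * w * INR N) c beta (eps / 2)) as (T1 & T10 & HT1); try lra.
    { assert (0 <= K0 * ln B') by (apply Rmult_le_pos; lra). lra. }
    { apply Rmult_le_pos; lra. }
    { unfold c; lra. }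
    destruct (F4 (Rmax T T1)) as (t & Ht & Ft0 & Ft). fold beta in Ft. exists t.
    pose proof (Rmax_l T T1). pose proof (Rmax_r T T1). split; [lra|]. specialize (HT1 t ltac:(lra)).
    set (E := exp (beta * t)) in *. assert (E0 : 0 < E) by apply exp_pos. set (lZ := ln (c + t)) in *.
    assert (lZ0 : 0 <= lZ) by (unfold lZ; rewrite <- ln_1; apply ln_le; unfold c; lra).
    assert (nz : 0 <= 2 * w * INR N * lZ) by (apply Rmult_le_pos; [apply Rmult_le_pos; lra|auto]).
    assert (kb : 0 <= K0 * ln B') by (apply Rmult_le_pos; lra).
    assert (Kt : K0 * - ln (Cmod (F (t, 0))) <= eps / 4 * E).
    { apply (Rmult_le_compat_l K0) in Ft; [|lra]. replace (K0 * (eps / (4 * K0) * E)) with (eps / 4 * E) in Ft by (field; lra). exact Ft. }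
    assert (Fin : forall l m, 1 < l -> 2 * w * (INR N * lZ + l) + K0 * m <= 2 * w * (INR N * lZ + l) + (K0 * ln B' + eps / 4 * E) ->
      2 * w * (INR N * lZ + l) + K0 * m <= eps * E * l).
    { intros l m Hl Hm. eapply Rle_trans; [exact Hm|].
      assert (e0 : 0 < eps * E) by (apply Rmult_lt_0_compat; auto).
      assert (a1 : (2 * w * INR N * lZ) * 1 <= (2 * w * INR N * lZ) * l) by (apply Rmult_le_compat_l; lra).
      assert (a2 : (K0 * ln B') * 1 <= (K0 * ln B') * l) by (apply Rmult_le_compat_l; lra).
      assert (a3 : eps * E * 1 <= eps * E * l) by (apply Rmult_le_compat_l; lra).
      apply (Rmult_le_compat_r l) in HT1; [|lra]. lra. }
    intros x y Hx Hy Ny. apply Rabs_le_between in Hx. destruct (Rlt_le_dec (Rabs y) rho) as [G|G].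
    - rewrite (Rabs_left (Rabs y - rho)) by lra. replace (- (Rabs y - rho)) with (rho - Rabs y) by ring.
      eapply Rle_trans; [apply (avgH_inside rho M H N Hrho HM HH F B' F1) with (t := t) (Z := c + t); auto|].
      + intros x' y' Hy'. eapply Rle_trans; [apply F2; auto|apply Rmax_l].
      + apply Rabs_le. fold w. lra.
      + rewrite Rabs_right by lra. unfold c. lra.
      + fold K0 w lZ. rewrite Rplus_comm. apply Fin; [apply lnM1; lra|]. lra.
    - rewrite (Rabs_right (Rabs y - rho)) by lra.
      eapply Rle_trans; [apply (avgH_outside rho M H N Hrho HM HH Hout x y (c + t)); [lra|]|].
      + assert (Rabs x <= t + w) by (apply Rabs_le; lra). fold w. unfold c. lra.
      + fold w lZ. pose proof (Fin (ln (M (Rabs y - rho))) 0 ltac:(apply lnM1; lra)) as Q.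
        assert (0 < eps / 4 * E) by (apply Rmult_lt_0_compat; lra). lra. }
  destruct (exp_growth rho w1 M (avgH rho H) C1 Hrho (conj w10 w11) HM Mdec (avgH_cont rho H Hrho HH) (avgH_subh rho H Hrho HH) C10 P1 P2 I psi_cont psi_int)
    as (C & C0 & G).
  assert (l1 : 1 < ln (M 1)) by (apply lnM1; lra).
  apply (log_growth rho (avgH rho H) C (C1 * ln (M 1))); auto.
  - apply Rmult_lt_0_compat; lra.
  - apply avgH_cont; auto.
  - apply avgH_subh; auto.
  - intros x y Hx Hy. eapply Rle_trans; [apply P1; lra|]. rewrite Hy. replace (rho + 1 - rho) with 1 by ring.
    rewrite Rmult_assoc. apply Rmult_le_compat_l; [lra|]. specialize (lp x Hx).
    assert (1 * ln (2 + x) <= ln (M 1) * ln (2 + x)) by (apply Rmult_le_compat_r; lra). lra.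
Qed.
End HalfStrip.

Lemma cdiffble_opp z : cdiffble (fun w => - w)%C z.
Proof.
  exists (- 1)%C. intros eps He. exists 1. split; [lra|]. intros w _.
  replace (- w - - z - - 1 * (w - z))%C with (RtoC 0) by ring. rewrite Cmod_0.
  apply Rmult_le_pos; [lra|apply Cmod_ge_0].
Qed.

(** * Polynomial growth of [H] in the plane *)

Section PolynomialGrowth.
Variables (rho : R) (M : R -> R) (N : nat) (I : R).
Hypothesis Hrho : 0 < rho.
Hypothesis HM : forall t, 0 < t -> exp 1 < M t.
Hypothesis Mdec : forall s t, 0 < s -> s <= t -> M t <= M s.
Hypothesis psi_cont : forall t, 0 < t -> continuous (fun t => ln (ln (M t))) t.
Hypothesis psi_int : forall a b, 0 < a <= b -> RInt (fun t => ln (ln (M t))) a b <= I.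

Let bounded_outside (H : C -> C) :=
  forall x y, rho < Rabs y -> Cmod (H (x, y)) <= (1 + Cmod (x, y)) ^ N * M (Rabs y - rho).

Let lnM1 t : 0 < t -> 1 < ln (M t).
Proof. intros Ht. rewrite <- (ln_exp 1). apply ln_increasing; [apply exp_pos|auto]. Qed.

Let lnMdec s t : 0 < s -> s <= t -> ln (M t) <= ln (M s).
Proof. intros Hs Hst. apply ln_le; [|auto]. specialize (HM t ltac:(lra)). pose proof (exp_pos 1). lra. Qed.

(** [line_to_point] leads back from segments to points: over the horizontal segment of half-width
    [w] centred at [x], the integral of [logH] is [avgH]. Heights up to [rho + 1 + w] occur, and
    those above [rho + 1] are covered by the bound outside the strip. *)
Lemma logH_half_strip H : (forall z, cdiffble H z) -> bounded_outside H -> multiplier_family rho M H N ->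
  exists K, 0 < K /\ forall x y, 0 <= x -> Rabs y <= rho + 1 -> logH H x y <= K * (1 + ln (2 + x)).
Proof.
  intros HH Hout HF.
  destruct (avgH_half_strip rho M H N I Hrho HM Mdec psi_cont psi_int HH Hout HF) as (K & K0 & G).
  set (w := hw rho). assert (w0 : 0 < w) by (unfold w, hw; lra). pose proof (pos_INR N) as N0.
  set (D := 3 + 2 * rho + 2 * w). assert (lD : 0 <= ln D) by (rewrite <- ln_1; apply ln_le; unfold D; lra).
  specialize (lnM1 1 ltac:(lra)) as l1.
  assert (lp : forall x, 0 <= x -> 0 <= ln (2 + x)).
  { intros x Hx. rewrite <- ln_1. apply ln_le; lra. }
  set (K' := K + 2 * w * (INR N + INR N * ln D + ln (M 1))).
  assert (ND : 0 <= INR N * ln D) by (apply Rmult_le_pos; auto).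
  assert (Q0 : 0 < 2 * w * (INR N + INR N * ln D + ln (M 1))) by (apply Rmult_lt_0_compat; lra).
  assert (G' : forall x y, 0 <= x -> Rabs y <= rho + 1 + w -> avgH rho H x y <= K' * (1 + ln (2 + x))).
  { intros x y Hx Hy. specialize (lp x Hx). destruct (Rle_lt_dec (Rabs y) (rho + 1)) as [S|S].
    - eapply Rle_trans; [apply G; auto|]. apply Rmult_le_compat_r; unfold K'; lra.
    - eapply Rle_trans; [apply (avgH_outside rho M H N Hrho HM HH Hout x y ((2 + x) * D)); [lra|]|].
      + rewrite (Rabs_right x) by lra. fold w. unfold D. nra.
      + fold w. rewrite ln_mult by (unfold D; lra). set (l2 := ln (2 + x)) in *.
        assert (l3 : ln (M (Rabs y - rho)) <= ln (M 1)) by (apply lnMdec; lra).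
        apply Rle_trans with (2 * w * (INR N + INR N * ln D + ln (M 1)) * (1 + l2)).
        * rewrite (Rmult_assoc (2 * w)). apply Rmult_le_compat_l; [lra|].
          assert (0 <= INR N * ln D * l2) by (apply Rmult_le_pos; lra).
          assert (0 <= ln (M 1) * l2) by (apply Rmult_le_pos; lra). lra.
        * apply Rmult_le_compat_r; unfold K'; lra. }
  exists (2 * K' / (w / 2)). split; [apply Rdiv_lt_0_compat; unfold K'; lra|]. intros x y Hx Hy.
  eapply Rle_trans; [apply (line_to_point (logH H) x y (w / 2) (K' * (1 + ln (2 + x))))|].
  - apply logH_cont; auto.
  - apply logH_ge0; auto.
  - lra.
  - apply (subh_weaken _ (fun a b => Rabs a <= (x + rho + 1 + w) /\ Rabs b <= (x + rho + 1 + w))); [|apply lnmax_entire_subh; auto; lra].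
    intros a b Hab. replace (2 * (w / 2)) with w in Hab by field. apply Rabs_le_between in Hy.
    assert (sq : forall v, v ^ 2 <= w ^ 2 -> - w <= v <= w) by (intros; split; nra).
    cbv beta in Hab. pose proof (pow2_ge_0 (a - x)). pose proof (pow2_ge_0 (b - y)).
    pose proof (sq (a - x) ltac:(lra)). pose proof (sq (b - y) ltac:(lra)). split; apply Rabs_le; lra.
  - intros y' Hy'. replace (2 * (w / 2)) with w in * by field. apply (G' x y' Hx).
    replace y' with (y + (y' - y)) by ring. eapply Rle_trans; [apply Rabs_triang|lra].
  - right. field. lra.
Qed.

(* The left half-plane is the right half-plane of [z |-> H (- z)]. *)
Theorem polynomial_growth H : (forall z, cdiffble H z) -> bounded_outside H ->
  multiplier_family rho M H N -> multiplier_family rho M (fun z => H (- z)%C) N ->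
  exists (A : R) (k : nat), 0 < A /\ forall z, Cmod (H z) <= A * (1 + Cmod z) ^ k.
Proof.
  intros HH Hout Fp Fm. set (Hm := fun z => H (- z)%C) in *.
  assert (HHm : forall z, cdiffble Hm z).
  { intros z. apply (cdiffble_comp H (fun z => (- z)%C)); auto. apply cdiffble_opp. }
  assert (Om : bounded_outside Hm).
  { intros x y Hy. unfold Hm. assert (E : (- (x, y))%C = (- x, - y)) by reflexivity. rewrite E.
    rewrite <- (Cmod_opp (x, y)), E, <- (Rabs_Ropp y). apply Hout. rewrite Rabs_Ropp; auto. }
  destruct (logH_half_strip H HH Hout Fp) as (K1 & K10 & G1).
  destruct (logH_half_strip Hm HHm Om Fm) as (K2 & K20 & G2).
  specialize (lnM1 1 ltac:(lra)) as l1. pose proof (pos_INR N) as N0.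
  set (K := K1 + K2 + INR N + ln (M 1)).
  assert (lp : forall x, 0 <= x -> 0 <= ln (2 + x)).
  { intros x Hx. rewrite <- ln_1. apply ln_le; lra. }
  assert (G : forall x y, logH H x y <= K * (1 + ln (2 + (Rabs x + Rabs y)))).
  { intros x y. pose proof (Rabs_pos x) as X0. pose proof (Rabs_pos y) as Y0.
    pose proof (lp (Rabs x + Rabs y) ltac:(lra)) as L0.
    assert (Lx : ln (2 + Rabs x) <= ln (2 + (Rabs x + Rabs y))) by (apply ln_le; lra).
    pose proof (lp (Rabs x) X0) as Lx0. set (lx := ln (2 + Rabs x)) in *. set (l := ln (2 + (Rabs x + Rabs y))) in *.
    assert (Up : forall k, 0 <= k <= K -> k * (1 + lx) <= K * (1 + l)) by (intros; apply Rmult_le_compat; lra).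
    destruct (Rle_lt_dec (Rabs y) (rho + 1)) as [S|S].
    - destruct (Rle_lt_dec 0 x) as [P|P].
      + eapply Rle_trans; [apply G1; auto|]. rewrite <- (Rabs_right x) at 1 by lra. apply Up. unfold K; lra.
      + assert (E : logH H x y = logH Hm (- x) (- y)).
        { unfold logH, lnmax, Hm. do 4 f_equal. unfold Copp; cbn. rewrite !Ropp_involutive. reflexivity. }
        rewrite E. eapply Rle_trans; [apply G2; [lra|rewrite Rabs_Ropp; auto]|].
        rewrite <- (Rabs_left x) at 1 by lra. apply Up. unfold K; lra.
    - eapply Rle_trans; [apply (logH_outside rho M H N Hrho HM Hout x y (2 + (Rabs x + Rabs y))); lra|]. fold l.
      assert (ln (M (Rabs y - rho)) <= ln (M 1)) by (apply lnMdec; lra).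
      assert (INR N * l <= K * l) by (apply Rmult_le_compat_r; unfold K; lra). unfold K in *. lra. }
  (* The real exponent [K] is rounded up to the integer [k + 1]. *)
  destruct (nfloor_ex K ltac:(unfold K; lra)) as [k Hk].
  exists (exp K * 2 ^ S k), (S k). split; [apply Rmult_lt_0_compat; [apply exp_pos|apply pow_lt; lra]|].
  intros [x y]. specialize (G x y). pose proof (Cmod_ge_0 (x, y)) as Z0.
  assert (X : Rabs x <= Cmod (x, y)) by (eapply Rle_trans; [|apply (Rmax_Cmod (x, y))]; apply Rmax_l).
  assert (Y : Rabs y <= Cmod (x, y)) by apply (Rabs_Im_le (x, y)).
  pose proof (Rabs_pos x) as X0. pose proof (Rabs_pos y) as Y0.
  set (m := Cmod (x, y)) in *.
  assert (L : ln (2 + (Rabs x + Rabs y)) <= ln (2 * (1 + m))) by (apply ln_le; lra).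
  assert (L0 : 0 <= ln (2 * (1 + m))) by (rewrite <- ln_1; apply ln_le; lra).
  apply Rle_trans with (exp (logH H x y)).
  { unfold logH, lnmax. rewrite exp_ln; [apply Rmax_r|]. pose proof (Rmax_l 1 (Cmod (H (x, y)))). lra. }
  apply Rle_trans with (exp (K + INR (S k) * ln (2 * (1 + m)))).
  - apply exp_le. eapply Rle_trans; [exact G|]. rewrite S_INR.
    assert (K * ln (2 + (Rabs x + Rabs y)) <= K * ln (2 * (1 + m))) by (apply Rmult_le_compat_l; [unfold K; lra|auto]).
    assert (K * ln (2 * (1 + m)) <= (INR k + 1) * ln (2 * (1 + m))) by (apply Rmult_le_compat_r; lra). lra.
  - right. rewrite exp_plus, Rmult_assoc, <- Rpow_mult_distr. f_equal.
    rewrite <- ln_pow by lra. apply exp_ln. apply pow_lt. lra.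
Qed.
End PolynomialGrowth.

(** * Entire functions of polynomial growth *)

Lemma ccont_pow f t n : ccont f t -> ccont (fun v => f v ^ n)%C t.
Proof.
  intros Hf. induction n as [|n IH]; [apply ccont_const|].
  apply (ccont_mul f (fun v => f v ^ n)%C); auto.
Qed.

Lemma horner_snoc l a z : horner (l ++ a :: nil) z = (horner l z + z ^ length l * a)%C.
Proof.
  induction l as [|b l IH]; unfold horner in *; simpl; [|rewrite IH]; ring.
Qed.

Lemma horner_scal c l z : horner (map (fun a => c * a)%C l) z = (c * horner l z)%C.
Proof.
  induction l as [|b l IH]; unfold horner in *; simpl; [|rewrite IH]; ring.
Qed.

Lemma RtoC_nz x : x <> 0 -> RtoC x <> 0%C.
Proof. intros Hx E. apply Hx, RtoC_inj. exact E. Qed.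

Section Liouville.
Variable H : C -> C.
Hypothesis HH : forall z, cdiffble H z.

(** This is [2 PI] times the [n]-th Taylor coefficient at 0, read off the circle of radius [r]; the
    conjugate encodes [1 / (r e^{it})]. *)
Definition taylor_coef (r : R) (n : nat) : C :=
  CInt (fun t => H (RtoC 0 + r * eit t) * (/ r * Cconj (eit t)) ^ n)%C 0 (2 * PI).

Let cker r t : ccont (fun t => / r * Cconj (eit t))%C t.
Proof. apply (ccont_mul (fun _ => / r)%C (fun t => Cconj (eit t))); [apply ccont_const|apply ccont_conj, ccont_eit]. Qed.

(** [H z / z^n] is holomorphic off 0, so [ray_invariance] about 0 applies between the two radii. *)
Lemma taylor_coef_const r s n : 0 < r <= s -> taylor_coef r n = taylor_coef s n.
Proof.
  intros Hrs.
  assert (Hi : forall s t, 0 < s -> (/ (RtoC 0 + s * arc 0 1 t) = / s * Cconj (eit t))%C).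
  { intros s' t Hs. unfold arc. assert (RtoC s' <> 0%C) by (apply RtoC_nz; lra). pose proof (eit_neq0 t) as E0.
    replace (Cconj (eit t)) with (/ eit t)%C.
    - field. split; auto.
    - rewrite <- (Cmult_1_r (/ eit t)), <- (eit_conj t). field. auto. }
  assert (Nz : forall s t, 0 < s -> (RtoC 0 + s * arc 0 1 t <> 0)%C).
  { intros s' t Hs. unfold arc. replace (RtoC 0 + s' * (0 + 1 * eit t))%C with (s' * eit t)%C by ring.
    apply Cmult_neq_0; [apply RtoC_nz; lra|apply eit_neq0]. }
  assert (Form : forall s, 0 < s -> CInt (fun t => ((H (RtoC 0 + s * arc 0 1 t) * (/ (RtoC 0 + s * arc 0 1 t)) ^ n) * arc_dlog 0 1 t)%C) 0 (2 * PI) = (Ci * taylor_coef s n)%C).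
  { intros s' Hs. unfold taylor_coef. rewrite <- CInt_mul.
    - apply CInt_ext. intros t. rewrite Hi by auto. unfold arc_dlog, arc.
      replace (RtoC 0 + 1 * eit t)%C with (eit t) by ring. field. apply eit_neq0.
    - pose proof PI_RGT_0. lra.
    - intros t _. apply (ccont_mul (fun t => H (RtoC 0 + s' * eit t))%C).
      + apply ccont_circle; auto.
      + apply ccont_pow, cker. }
  assert (E : (Ci * taylor_coef r n = Ci * taylor_coef s n)%C).
  { rewrite <- !Form by lra.
    apply (ray_invariance (fun z => H z * (/ z) ^ n)%C 0 0 1); try lra.
    - rewrite Cmod_0. lra.
    - intros s' t Hs. apply cdiffble_mult; auto. apply (cdiffble_pow (fun z => / z)%C), cdiffble_inv; [apply cdiffble_id|].
      apply Nz. lra. }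
  assert (I0 : Ci <> 0%C) by (intros Q; injection Q; lra).
  replace (taylor_coef r n) with (/ Ci * (Ci * taylor_coef r n))%C by (field; auto).
  rewrite E. field. auto.
Qed.

(** Induction by [ckernel = 1 + q * ckernel] with [q = h / (r e^{it})], the geometric series of the
    kernel with its remainder. *)
Lemma taylor_expansion r h k : 0 < r -> Cmod h < r ->
  (RtoC (2 * PI) * H h = horner (map (taylor_coef r) (seq 0 k)) h +
   CInt (fun t => H (RtoC 0 + r * eit t) * ((h * (/ r * Cconj (eit t))) ^ k * ckernel r h t))%C 0 (2 * PI))%C.
Proof.
  intros Hr Hh. pose proof PI_RGT_0 as Hpi. assert (r0 : RtoC r <> 0%C) by (apply RtoC_nz; lra).
  assert (cH : forall t, ccont (fun t => H (RtoC 0 + r * eit t))%C t) by (intros; apply ccont_circle; auto).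
  assert (cq : forall t, ccont (fun t => h * (/ r * Cconj (eit t)))%C t).
  { intros t. apply (ccont_mul (fun _ => h) (fun t => / r * Cconj (eit t))%C); [apply ccont_const|apply cker]. }
  induction k as [|k IH].
  - unfold horner. simpl. rewrite Cplus_0_l. rewrite <- (Cplus_0_l h) at 1.
    rewrite (cauchy_formula H 0 r Hr) by auto. apply CInt_ext. intros t. ring.
  - rewrite IH, seq_S, map_app. cbn [map]. rewrite horner_snoc, length_map, length_seq, <- Cplus_assoc. f_equal.
    unfold taylor_coef at 1. rewrite Nat.add_0_l, <- CInt_mul; [|lra|].
    + rewrite <- CInt_add; [|lra| |].
      * apply CInt_ext. intros t. destruct (ckernel_small r Hr h Hh t) as [_ Q].
        replace (ckernel r h t) with (1 + (h * (/ r * Cconj (eit t))) * ckernel r h t)%C at 1.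
        -- rewrite Cpow_S, !Cpow_mult_l. ring.
        -- unfold ckernel. unfold Cdiv in Q. field. split; [auto|]. intros Z. apply Q. rewrite <- (Cmult_0_r (/ r)%C), <- Z. field. auto.
      * intros t _. apply (ccont_mul (fun _ => (h ^ k)%C)); [apply ccont_const|].
        apply (ccont_mul (fun t => H (RtoC 0 + r * eit t))%C); auto. apply ccont_pow, cker.
      * intros t _. apply (ccont_mul (fun t => H (RtoC 0 + r * eit t))%C); auto.
        apply (ccont_mul (fun t => (h * (/ r * Cconj (eit t))) ^ S k)%C); [apply (ccont_pow (fun t => h * (/ r * Cconj (eit t)))%C); auto|apply ccont_ckernel; auto].
    + intros t _. apply (ccont_mul (fun t => H (RtoC 0 + r * eit t))%C); auto. apply ccont_pow, cker.
Qed.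

(** The remainder after [n + 1] terms is [O((1 + r)^n / r^{n+1})] as [r] grows, while the
    coefficients do not depend on [r]. *)
Theorem polynomial_growth_is_polynomial A n : 0 < A -> (forall z, Cmod (H z) <= A * (1 + Cmod z) ^ n) -> is_polynomial H.
Proof.
  intros HA Hb. pose proof PI_RGT_0 as Hpi. assert (pi0 : RtoC (2 * PI) <> 0%C) by (apply RtoC_nz; lra).
  exists (map (fun a => / RtoC (2 * PI) * a)%C (map (taylor_coef 1) (seq 0 (S n)))). intros h.
  rewrite horner_scal.
  set (P := horner (map (taylor_coef 1) (seq 0 (S n))) h).
  assert (E : (RtoC (2 * PI) * H h - P = 0)%C).
  2: { replace P with (RtoC (2 * PI) * H h)%C; [field; auto|]. replace (RtoC (2 * PI) * H h)%C with (P + (RtoC (2 * PI) * H h - P))%C by ring. rewrite E. ring. }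
  apply Cmod_eq_0. apply Rle_antisym; [|apply Cmod_ge_0]. apply le_epsilon. intros e He. rewrite Rplus_0_l.
  pose proof (Cmod_ge_0 h) as h0.
  set (Q := 2 * (2 * PI) * (A * 2 ^ n * (Cmod h ^ S n * 2))).
  assert (Q0 : 0 <= Q).
  { unfold Q. apply Rmult_le_pos; [lra|]. apply Rmult_le_pos; [apply Rmult_le_pos; [lra|apply pow_le; lra]|]. apply Rmult_le_pos; [apply pow_le; auto|lra]. }
  (* Large enough for [|h| <= r / 2] and for the remainder bound [Q / r] to be at most [e]. *)
  set (r := 1 + 2 * Cmod h + Q / e). assert (Qe : 0 <= Q / e) by (apply Rdiv_le_0_compat; auto).
  assert (r1 : 1 <= r) by (unfold r; lra). assert (hr : Cmod h <= r / 2) by (unfold r; lra).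
  replace P with (horner (map (taylor_coef r) (seq 0 (S n))) h).
  2: { unfold P. f_equal. apply map_ext. intros i. symmetry. apply taylor_coef_const. lra. }
  rewrite (taylor_expansion r h (S n)) by lra. 
  match goal with |- Cmod (?a + ?b - ?a) <= _ => replace (a + b - a)%C with b by ring end.
  assert (ir : 0 < / r) by (apply Rinv_0_lt_compat; lra).
  eapply Rle_trans; [apply (circle_pairing_bound H 0 r ltac:(lra)) with (B := A * (1 + r) ^ n) (M := (Cmod h * / r) ^ S n * 2)|].
  - auto.
  - intros z Hz. replace (z - 0)%C with z in Hz by ring. eapply Rle_trans; [apply Hb|]. apply Rmult_le_compat_l; [lra|].
    apply pow_incr. pose proof (Cmod_ge_0 z). lra.
  - intros t. apply (ccont_mul (fun t => (h * (/ r * Cconj (eit t))) ^ S n)%C); [|apply ccont_ckernel; lra].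
    apply (ccont_pow (fun t => h * (/ r * Cconj (eit t)))%C). apply (ccont_mul (fun _ => h) (fun t => / r * Cconj (eit t))%C); [apply ccont_const|apply cker].
  - intros t. rewrite Cmod_mult, Cmod_pow. apply Rmult_le_compat; try apply pow_le; try apply Cmod_ge_0.
    + right. f_equal. destruct (ckernel_small r ltac:(lra) h ltac:(lra) t) as [E _].
      rewrite Cmult_assoc. exact E.
    + destruct (ckernel_small r ltac:(lra) h ltac:(lra) t) as [E N0]. unfold ckernel. rewrite Cmod_inv by auto.
      rewrite <- (Rinv_inv 2). apply Rinv_le_contravar; [lra|].
      pose proof (Cmod_triangle (1 - h / r * Cconj (eit t)) (h / r * Cconj (eit t))) as T.
      replace (1 - h / r * Cconj (eit t) + h / r * Cconj (eit t))%C with (RtoC 1) in T by ring.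
      rewrite Cmod_1, E in T. assert (Cmod h / r <= / 2); [|lra].
      apply Rmult_le_reg_r with r; [lra|]. unfold Rdiv. rewrite Rmult_assoc, Rinv_l by lra. lra.
  - apply Rle_trans with (Q * / r).
    + unfold Q. apply Rle_trans with (2 * (2 * PI) * (A * (2 * r) ^ n * ((Cmod h * / r) ^ S n * 2))).
      * apply Rmult_le_compat_l; [lra|]. apply Rmult_le_compat_r.
        -- apply Rmult_le_pos; [apply pow_le, Rmult_le_pos; lra|lra].
        -- apply Rmult_le_compat_l; [lra|]. apply pow_incr. lra.
      * right. rewrite !Rpow_mult_distr. simpl. rewrite !pow_inv. field. split; [lra|]. apply pow_nonzero. lra.
    + apply Rmult_le_reg_r with r; [lra|]. rewrite Rmult_assoc, Rinv_l, Rmult_1_r by lra.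
      replace Q with (e * (Q / e)) by (field; lra). apply Rmult_le_compat_l; [lra|]. unfold r. lra.
Qed.
End Liouville.

(** * Consequences of the hypotheses on [delta] and on the integral of [log log M] *)

Lemma Rbar_glb_is_glb E : Rbar_is_glb E (Rbar_glb E).
Proof. unfold Rbar_glb. destruct (Rbar_ex_glb E); auto. Qed.

Lemma Rbar_lub_is_lub E : Rbar_is_lub E (Rbar_lub E).
Proof. unfold Rbar_lub. destruct (Rbar_ex_lub E); auto. Qed.

(** Otherwise the supremum over the tail from [T] on, and with it the limsup, would be at most
    [a]. *)
Lemma limsup_pinfty_frequently g (a : R) : Rbar_lt a (limsup_pinfty g) ->
  forall T, exists t, T <= t /\ Rbar_lt a (g t).
Proof.
  intros Ha T. apply NNPP. intros Hn. apply Rbar_lt_not_le in Ha. apply Ha.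
  set (s := Rbar_lub (fun v => exists t, T <= t /\ v = g t)).
  apply Rbar_le_trans with s.
  - apply (proj1 (Rbar_glb_is_glb _)). exists T. reflexivity.
  - apply (proj2 (Rbar_lub_is_lub _)). intros v (t & Ht & ->). apply Rbar_not_lt_le. intros Q. apply Hn. eauto.
Qed.

(** An infimum 0 below [eps] singles out one [F] whose limsup exceeds [- eps]. The value [m_infty]
    at zeros of [F] forces [F] to be nonzero at the points found. *)
Lemma inf_delta_frequently rho Omega s :
  inf_over Omega (fun F => Rbar_opp (limsup_pinfty (wlog rho F s))) = 0 ->
  forall eps, 0 < eps -> exists F, Omega F /\
  forall T, exists t, T <= t /\ 0 < Cmod (F (RtoC (s * t))) /\
    - ln (Cmod (F (RtoC (s * t)))) <= eps * exp (PI / (2 * rho) * t).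
Proof.
  intros Hinf eps He. apply NNPP. intros Hn.
  assert (Q : Rbar_le eps (inf_over Omega (fun F => Rbar_opp (limsup_pinfty (wlog rho F s))))).
  { apply (proj2 (Rbar_glb_is_glb _)). intros v (F & HF & ->). apply Rbar_not_lt_le. intros L. apply Hn.
    exists F. split; auto. intros T.
    assert (L' : Rbar_lt (- eps)%R (limsup_pinfty (wlog rho F s))).
    { destruct (limsup_pinfty (wlog rho F s)); simpl in *; auto; lra. }
    destruct (limsup_pinfty_frequently _ _ L' T) as (t & Ht & Lt). exists t. split; auto.
    unfold wlog in Lt. destruct Req_EM_T as [Z|Z]; simpl in Lt; [contradiction|].
    pose proof (Cmod_ge_0 (F (RtoC (s * t)))). split; [lra|].
    set (l := ln _) in *. set (b := PI / (2 * rho)) in *.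
    assert (E : exp (b * t) * exp (- b * t) = 1) by (rewrite <- exp_plus; replace (b * t + - b * t) with 0 by ring; apply exp_0).
    assert (P : 0 < exp (b * t)) by apply exp_pos.
    apply (Rmult_lt_compat_l (exp (b * t))) in Lt; auto. rewrite <- Rmult_assoc, E in Lt. lra. }
  rewrite Hinf in Q. simpl in Q. lra.
Qed.

(** [[a, b]] is enlarged to an interval whose integral is within 1 of the limit; nonnegativity of
    [f] gives the comparison. *)
Lemma RInt_gen_bounded (f : R -> R) :
  (forall t, 0 < t -> continuous f t) -> (forall t, 0 < t -> 0 <= f t) ->
  ex_RInt_gen f (at_right 0) (Rbar_locally p_infty) ->
  exists I, forall a b, 0 < a <= b -> RInt f a b <= I.
Proof.
  intros Cf Pf [l Hl].
  destruct (Hl (fun y => Rabs (y - l) < 1)) as [Q S [d Hd] [X HX] HP].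
  { exists (mkposreal 1 Rlt_0_1). intros y Hy. exact Hy. }
  exists (l + 1). intros a b Hab.
  set (a' := Rmin a (d / 2)). set (b' := Rmax b (X + 1)). pose proof (cond_pos d) as d0.
  assert (a'a : a' <= a) by apply Rmin_l. assert (b'b : b <= b') by apply Rmax_l.
  assert (a'0 : 0 < a') by (apply Rmin_case; lra).
  assert (Qa : Q a').
  { apply Hd; auto. unfold ball; simpl; unfold AbsRing_ball, abs, minus, plus, opp; simpl.
    assert (a' <= d / 2) by apply Rmin_r. rewrite Rabs_right; lra. }
  assert (Sb : S b') by (apply HX; assert (X + 1 <= b') by apply Rmax_r; lra).
  destruct (HP a' b' Qa Sb) as (v & Hv & Hvl). cbn in Hv. apply (is_RInt_unique (V := R_CompleteNormedModule)) in Hv. apply Rabs_lt_between in Hvl.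
  assert (E : forall p q, 0 < p <= q -> ex_RInt f p q) by (intros; apply ex_RInt_cont; [lra|]; intros; apply Cf; lra).
  assert (G : forall p q, 0 < p <= q -> 0 <= RInt f p q) by (intros; apply RInt_ge_0; [lra|auto|intros; apply Pf; lra]).
  pose proof (G a' a ltac:(lra)). pose proof (G b b' ltac:(lra)).
  assert (Hs : RInt f a' a + (RInt f a b + RInt f b b') = v).
  { rewrite (RInt_ChaslesR f a b b'), (RInt_ChaslesR f a' a b') by (apply E; lra). exact Hv. }
  lra.
Qed.

Theorem theorem6p3 (rho : R) (M : R -> R) (Omega : (C -> C) -> Prop) (H : C -> C) (N : nat) :
  0 < rho ->
  (* M : (0,oo) -> (e,oo), continuously differentiable, decreasing *)
  (forall t, 0 < t -> exp 1 < M t) ->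
  (forall t, 0 < t -> ex_derive M t) ->
  (forall t, 0 < t -> continuous (Derive M) t) ->
  (forall s t, 0 < s -> s <= t -> M t <= M s) ->
  (* lim_{t->0+} t log log M(t) < oo *)
  (exists l : R, filterlim (fun t => t * ln (ln (M t))) (at_right 0) (locally l)) ->
  (* int_0^oo log log M(t) dt < oo *)
  ex_RInt_gen (fun t => ln (ln (M t))) (at_right 0) (Rbar_locally p_infty) ->
  (* Omega : bounded holomorphic functions on the open strip *)
  (forall F, Omega F ->
     (forall z, in_open_strip rho z -> C_differentiable F z) /\
     (exists B : R, forall z, in_open_strip rho z -> Cmod (F z) <= B)) ->
  inf_over Omega (delta_plus rho) = Finite 0 ->
  inf_over Omega (delta_minus rho) = Finite 0 ->
  entire H ->
  (forall z, ~ in_closed_strip rho z ->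
     Cmod (H z) <= (1 + Cmod z) ^ N * M (dist_boundary rho z)) ->
  (forall F, Omega F -> forall z, in_open_strip rho z ->
     Cmod (F z * H z) <= (1 + Cmod z) ^ N * M (dist_boundary rho z)) ->
  is_polynomial H.
Proof.
  intros Hrho HM dM _ Mdec _ Int HO Ip Im Ent Hout Hin.
  assert (lnM1 : forall t, 0 < t -> 1 < ln (M t)).
  { intros t Ht. rewrite <- (ln_exp 1). apply ln_increasing; [apply exp_pos|auto]. }
  assert (psi_cont : forall t, 0 < t -> continuous (fun t => ln (ln (M t))) t).
  { intros t Ht. apply (ex_derive_continuous (V := R_NormedModule) (fun t => ln (ln (M t)))).
    specialize (HM t Ht). specialize (lnM1 t Ht). pose proof (exp_pos 1). auto_derive. repeat split; auto; lra. }
  destruct (RInt_gen_bounded _ psi_cont) as [I HI]; [|exact Int|].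
  { intros t Ht. rewrite <- ln_1. apply ln_le; [lra|]. specialize (lnM1 t Ht). lra. }
  assert (HH : forall z, cdiffble H z) by (intros; apply C_differentiable_cdiffble, Ent).
  assert (Hout' : forall x y, rho < Rabs y -> Cmod (H (x, y)) <= (1 + Cmod (x, y)) ^ N * M (Rabs y - rho)).
  { intros x y Hy. rewrite <- (Rabs_right (Rabs y - rho)) by lra. apply (Hout (x, y)).
    unfold in_closed_strip. simpl. lra. }
  assert (Hin' : forall F, Omega F -> forall x y, Rabs y < rho -> Cmod (F (x, y) * H (x, y)) <= (1 + Cmod (x, y)) ^ N * M (rho - Rabs y)).
  { intros F HF x y Hy. replace (rho - Rabs y) with (Rabs (Rabs y - rho)) by (rewrite Rabs_left; lra). apply (Hin F HF (x, y) Hy). }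
  assert (Neg : forall x y, (- (x, y))%C = (- x, - y)) by reflexivity.
  assert (Fp : multiplier_family rho M H N).
  { intros eps He. destruct (inf_delta_frequently rho Omega 1 Ip eps He) as (F & HF & HT).
    destruct (HO F HF) as [dF [B FB]]. exists F, B. split; [|split; [|split]].
    - intros x y Hy. apply C_differentiable_cdiffble, dF. exact Hy.
    - intros x y Hy. apply FB. exact Hy.
    - apply Hin'; auto.
    - intros T. destruct (HT T) as (t & Ht). rewrite Rmult_1_l in Ht. exists t. exact Ht. }
  (* Reflection at the origin turns the condition at the left end into one at the right end, for the
     functions [F (- z)] and [H (- z)]. *)
  assert (Fm : multiplier_family rho M (fun z => H (- z)%C) N).
  { intros eps He. destruct (inf_delta_frequently rho Omega (-1) Im eps He) as (F & HF & HT).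
    destruct (HO F HF) as [dF [B FB]]. exists (fun z => F (- z)%C), B. split; [|split; [|split]].
    - intros x y Hy. apply (cdiffble_comp F (fun z => - z)%C); [apply cdiffble_opp|].
      apply C_differentiable_cdiffble, dF. unfold in_open_strip. simpl. rewrite Rabs_Ropp. exact Hy.
    - intros x y Hy. apply FB. unfold in_open_strip. simpl. rewrite Rabs_Ropp. exact Hy.
    - intros x y Hy. rewrite <- (Cmod_opp (x, y)), Neg, <- (Rabs_Ropp y). apply Hin'; auto. rewrite Rabs_Ropp; auto.
    - intros T. destruct (HT T) as (t & Ht). exists t.
      replace (- (t, 0))%C with (RtoC (-1 * t)) by (rewrite Neg; unfold RtoC; f_equal; ring). exact Ht. }
  destruct (polynomial_growth rho M N I Hrho HM Mdec psi_cont HI H HH Hout' Fp Fm) as (A & k & A0 & HA).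
  exact (polynomial_growth_is_polynomial H HH A k A0 HA).
Qed.
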